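(* Let $s=\frac56$ and let $u$ be a weak solution of the stationary fractional Navier--Stokes equations $$(-\Delta)^su+u\cdot\nabla u+\nabla P=0,\qquad\nabla\cdot u=0\qquad\text{in }\mathbb{R}^3,$$ with $\int_{\mathbb{R}^3}|(-\Delta)^{\frac s2}u|^2dx<\infty$. Then $u\equiv0$.
   Context: Fourier transform on $\mathcal{S}'(\mathbb{R}^3)$: $\hat f(\xi)=(2\pi)^{-3/2}\int_{\mathbb{R}^3} e^{-ix\cdot\xi}f(x)\,dx$, with inverse $\mathcal{F}^{-1}$; $(-\Delta)^{\sigma}f=\mathcal{F}^{-1}(|\xi|^{2\sigma}\hat f)$; $\|f\|_{\dot H^\sigma}=(\int_{\mathbb{R}^3}|\xi|^{2\sigma}|\hat f(\xi)|^2d\xi)^{1/2}$. Weak solution: a vector field $u\in\dot H^s(\mathbb{R}^3)$ is a weak solution of the stationary fractional Navier--Stokes equations $(-\Delta)^su+u\cdot\nabla u+\nabla P=0$, $\nabla\cdot u=0$ in $\mathbb{R}^3$ if $u$ is weakly divergence free and, for some $P\in\mathcal{S}'(\mathbb{R}^3)$ and all $\phi\in(C_0^\infty(\mathbb{R}^3))^3$, $$\int_{\mathbb{R}^3}(-\Delta)^{\frac s2}u\cdot(-\Delta)^{\frac s2}\phi\,dx=\int_{\mathbb{R}^3}(u\otimes u):\nabla\phi\,dx+\int_{\mathbb{R}^3}P\,\nabla\cdot\phi\,dx,$$ where $(\nabla\phi)_{i,j}=\partial_j\phi_i$ and the last integral is a duality pairing. *)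

(* Defs.v *)
From HB Require Import structures.
From mathcomp Require Import all_boot all_order all_algebra.
From mathcomp Require Import all_classical all_reals all_analysis.
From mathcomp Require Export complex.

Set Implicit Arguments.
Unset Strict Implicit.
Unset Printing Implicit Defensive.

Import Order.TTheory GRing.Theory Num.Theory.
Import numFieldNormedType.Exports.

Local Open Scope classical_set_scope.
Local Open Scope ring_scope.
Local Open Scope complex_scope.

(* R^3 is the iterated product R * R * R: the library provides on it both the
   normed-space structure (hence derivatives) and the product of Lebesgue
   measures.  The library norm on it is the sup norm, so |x| is [enorm]. *)
Notation R3 R := (R * R * R)%type.

(* [measurableTypeR R] is convertible to R; it is the carrier on which the
   library defines the Lebesgue measure. *)
Notation R3meas R :=
  (measurableTypeR R * measurableTypeR R * measurableTypeR R)%type.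

Section EuclideanSpace.
Variable R : realType.
Implicit Types (x y : R3 R) (i : 'I_3).

Definition coord3 i x : R :=
  match val i with 0%N => x.1.1 | 1%N => x.1.2 | _ => x.2 end.

Definition basis3 i : R3 R :=
  ((i == 0%N :> nat)%:R, (i == 1%N :> nat)%:R, (i == 2%N :> nat)%:R).

Definition dot x y : R := \sum_(i < 3) coord3 i x * coord3 i y.

Definition enorm x : R := Num.sqrt (dot x x).

Definition leb3 : {measure set (R3meas R) -> \bar R} :=
  ((@lebesgue_measure R \x @lebesgue_measure R) \x @lebesgue_measure R)%E.

End EuclideanSpace.

Section ComplexIntegral.
Variable R : realType.
Implicit Type f : R3 R -> R[i].

Definition cabs (z : R[i]) : R := ComplexField.Normc.normc z.

Definition cexpi (t : R) : R[i] := cos t +i* sin t.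

Definition cmeasurable f : Prop :=
  measurable_fun [set: R3meas R] (fun x => complex.Re (f x)) /\
  measurable_fun [set: R3meas R] (fun x => complex.Im (f x)).

Definition cintegrable f : Prop :=
  (@leb3 R).-integrable setT (EFin \o (fun x => complex.Re (f x))) /\
  (@leb3 R).-integrable setT (EFin \o (fun x => complex.Im (f x))).

Definition cint f : R[i] :=
  (\int[@leb3 R]_x complex.Re (f x)) +i* (\int[@leb3 R]_x complex.Im (f x)).

End ComplexIntegral.

Section TestFunctions.
Variable R : realType.

Definition partial (i : 'I_3) (f : R3 R -> R) : R3 R -> R :=
  fun x => 'D_(basis3 R i) f x.

(* [partials [:: i1; ...; ik] f] is the iterated derivative of f along the
   coordinates i1, ..., ik. *)
Definition partials (s : seq 'I_3) (f : R3 R -> R) : R3 R -> R :=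
  foldr partial f s.

Definition smooth (f : R3 R -> R) : Prop :=
  forall s : seq 'I_3, continuous (partials s f) /\
    forall (i : 'I_3) (x : R3 R), derivable (partials s f) x (basis3 R i).

Definition test_function (f : R3 R -> R) : Prop :=
  smooth f /\ compact (closure [set x | f x != 0]).

Definition cpartials (s : seq 'I_3) (f : R3 R -> R[i]) : R3 R -> R[i] :=
  fun x => partials s (fun y => complex.Re (f y)) x +i* partials s (fun y => complex.Im (f y)) x.

Definition csmooth (f : R3 R -> R[i]) : Prop :=
  smooth (fun x => complex.Re (f x)) /\ smooth (fun x => complex.Im (f x)).

Definition schwartz (f : R3 R -> R[i]) : Prop :=
  csmooth f /\
  forall (k : nat) (s : seq 'I_3), exists M : R,
    forall x, enorm x ^+ k * cabs (cpartials s f x) <= M.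

Definition of_real (f : R3 R -> R) : R3 R -> R[i] := fun x => (f x)%:C.

End TestFunctions.

Section Distributions.
Variable R : realType.

(* A distribution is a functional defined on all complex functions, of which
   only the values on Schwartz functions are meaningful. *)
Definition distr : Type := (R3 R -> R[i]) -> R[i].

(* The continuity clause says that |T f| is at most M times the largest of the
   seminorms sup |x|^k |d^s f| with k <= N and |s| <= N. *)
Definition tempered (T : distr) : Prop :=
  (forall (a : R[i]) (f g : R3 R -> R[i]), schwartz f -> schwartz g ->
     T (fun x => a * f x + g x) = a * T f + T g) /\
  (exists (N : nat) (M : R), forall (f : R3 R -> R[i]) (K : R), schwartz f ->
     (forall (k : nat) (s : seq 'I_3), (k <= N)%N -> (size s <= N)%N ->
        forall x, enorm x ^+ k * cabs (cpartials s f x) <= K) ->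
     cabs (T f) <= M * K).

Definition distr_of (f : R3 R -> R[i]) : distr :=
  fun g => cint (fun x => f x * g x).

(* T is the function f; testing on functions that are positive on a given ball
   shows that such an f is locally integrable. *)
Definition represents (T : distr) (f : R3 R -> R[i]) : Prop :=
  cmeasurable f /\
  forall g, schwartz g ->
    cintegrable (fun x => f x * g x) /\ T g = distr_of f g.

Definition is_function (T : distr) : Prop := exists f, represents T f.

(* The function (unique up to a null set) that T is, when there is one; the
   zero function otherwise. *)
Definition fun_of (T : distr) : R3 R -> R[i] :=
  match pselect (is_function T) with
  | left h => projT1 (cid h)
  | right _ => fun=> 0
  end.

Definition fourier (f : R3 R -> R[i]) : R3 R -> R[i] := fun xi =>
  ((2 * pi) `^ (- (3 / 2)))%:C * cint (fun x => cexpi (- dot x xi) * f x).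

Definition inv_fourier (f : R3 R -> R[i]) : R3 R -> R[i] := fun x =>
  ((2 * pi) `^ (- (3 / 2)))%:C * cint (fun xi => cexpi (dot x xi) * f xi).

Definition distr_fourier (T : distr) : distr := fun g => T (fourier g).

Definition distr_inv_fourier (T : distr) : distr := fun g => T (inv_fourier g).

(* (- Delta)^sigma T = F^-1 (|xi|^(2 sigma) F T) needs F T to be a function:
   |xi|^(2 sigma) is not smooth at the origin and does not multiply general
   distributions. *)
Definition hat (T : distr) : R3 R -> R[i] := fun_of (distr_fourier T).

Definition fracLap (sigma : R) (T : distr) : distr :=
  distr_inv_fourier
    (distr_of (fun xi => (enorm xi `^ (2 * sigma))%:C * hat T xi)).

Definition Hdot_norm (sigma : R) (T : distr) : \bar R :=
  ((\int[@leb3 R]_xi (enorm xi `^ (2 * sigma) * cabs (hat T xi) ^+ 2)%:E)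
     `^ (1 / 2))%E.

Definition in_Hdot (sigma : R) (T : distr) : Prop :=
  [/\ tempered T, is_function (distr_fourier T) & (Hdot_norm sigma T < +oo)%E].

End Distributions.

Section NavierStokes.
Variable R : realType.
Implicit Types (u : 'I_3 -> R3 R -> R) (s : R).

Definition cmp_distr u (i : 'I_3) : distr R := distr_of (of_real (u i)).

(* The first conjunct says that u i is measurable and has an absolutely
   convergent integral against every Schwartz function. *)
Definition vector_in_Hdot s u : Prop :=
  forall i, represents (cmp_distr u i) (of_real (u i)) /\
            in_Hdot s (cmp_distr u i).

Definition weakly_divergence_free u : Prop :=
  forall psi : R3 R -> R, test_function psi ->
    \int[@leb3 R]_x (\sum_(i < 3) u i x * partial i psi x) = 0.

Definition divergence (phi : 'I_3 -> R3 R -> R) : R3 R -> R :=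
  fun x => \sum_(i < 3) partial i (phi i) x.

Definition weak_momentum s u (P : distr R) : Prop :=
  forall phi : 'I_3 -> R3 R -> R, (forall i, test_function (phi i)) ->
    cint (fun x => \sum_(i < 3) fun_of (fracLap (s / 2) (cmp_distr u i)) x *
                                fun_of (fracLap (s / 2) (cmp_distr phi i)) x)
    = (\int[@leb3 R]_x
         (\sum_(i < 3) \sum_(j < 3) u i x * u j x * partial j (phi i) x))%:C
      + P (of_real (divergence phi)).

Definition weak_solution s u : Prop :=
  [/\ vector_in_Hdot s u, weakly_divergence_free u &
      exists2 P : distr R, tempered P & weak_momentum s u P].

(* (- Delta)^(s/2) u is a function and is square integrable. *)
Definition finite_energy s u : Prop :=
  (forall i, is_function (fracLap (s / 2) (cmp_distr u i))) /\
  (\int[@leb3 R]_x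
     (\sum_(i < 3) cabs (fun_of (fracLap (s / 2) (cmp_distr u i)) x) ^+ 2)%:E
   < +oo)%E.

End NavierStokes.

(* Main.v *)
(* Write [v_i] for the Fourier transform of [u_i]; the energy is
   [int |xi|^(5/3) |v|^2].  Testing the equation against the curl fields
   [d_b psi e_a - d_a psi e_b] removes the pressure and gives, almost
   everywhere, [xi_b l_a = xi_a l_b] for
     [l_i = |xi|^(5/3) v_i + i c sum_j xi_j (v_i * v_j)].
   Since [xi . v = 0], multiplying by the conjugate of [v_a] and summing over
   [a] gives [conj v . l = 0], so the energy is [- i c] times a trilinear
   integral in [v].  The substitution [(x, y) -> (x + y, - y)], together with
   [v (- x) = conj (v x)] and [xi . v = 0], turns that integral into its own
   conjugate: it is real, the energy is both real and imaginary, and [v = 0].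
   The trilinear integral must converge absolutely, and here the exponent
   enters: [|xi|^(5/6) v] is in [L^2], so Cauchy-Schwarz reduces the matter to
   the Riesz kernel bound [|x|^(-5/3) * |x|^(-5/3) <= C |x|^(-1/3)].

   The transform of a product is identified with a convolution by mollifying
   both factors with Gaussians; only test functions built from products of
   affine bumps are needed, since they already separate functions. *)
From HB Require Import structures.
Require Import Defs.
From mathcomp Require Import all_boot all_order all_algebra.
From mathcomp Require Import all_classical all_reals all_analysis.
From mathcomp Require Import measurable_realfun ring lra.
Set Implicit Arguments.
Unset Strict Implicit.
Unset Printing Implicit Defensive.
Import Order.TTheory GRing.Theory Num.Theory.
Import numFieldNormedType.Exports.
Local Open Scope classical_set_scope.
Local Open Scope ring_scope.
Local Open Scope complex_scope.

(** * Real and complex integrable functions *)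

(** The exponent comes from a scaling balance. If two of the three factors of the trilinear integral
    carry the weights |x|^(-2s) and |y|^(-2s), the Riesz convolution leaves |z|^(3 - 4s) on the
    square of the third, which is z_j conj (v_i z) and contributes |z|^2. Now 5 - 4s = 2s exactly
    when s = 5/6, and then the third factor costs the energy once more.

    The obstacle is that the energy places v only in a weighted L2 space: neither u nor v need be
    integrable or square integrable, and |xi|^(5/3) is not smooth at the origin. Identities are
    therefore proved weakly, as int u h = int v (F^-1 h) for real test functions h, whose transforms
    decay faster than any power, and are brought back to almost everywhere statements by a
    uniqueness theorem on the Fourier side. The product u_i u_j is the hard case: weak convergence
    of two mollified factors says nothing about their product, so a subsequence is chosen that
    converges almost everywhere, under a majorant square integrable against a Gaussian. *)

Notation igr mu f := (mu.-integrable setT (EFin \o f)).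

Section RealIntegrable.
Context d (T : measurableType d) (R : realType) (mu : {measure set T -> \bar R}).
Implicit Types f g : T -> R.

Lemma igr_meas f : igr mu f -> measurable_fun setT f.
Proof. by move=> /measurable_int /measurable_EFinP. Qed.

Lemma igr_le f g : measurable_fun setT f -> (forall x, `|f x| <= g x) ->
  igr mu g -> igr mu f.
Proof.
move=> mf fg; apply: le_integrable => //; first exact/measurable_EFinP.
move=> x _ /=; rewrite lee_fin (le_trans (fg x))//; exact: ler_norm.
Qed.

Lemma igr_norm f : igr mu f -> igr mu (fun x => `|f x|).
Proof. exact: integrable_norm. Qed.

Lemma igrD f g : igr mu f -> igr mu g -> igr mu (fun x => f x + g x).
Proof. by move=> fi gi; have := integrableD measurableT fi gi. Qed.

Lemma igrZ (k : R) f : igr mu f -> igr mu (fun x => k * f x).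
Proof. by move=> fi; have := integrableZl measurableT k fi. Qed.

Lemma igrN f : igr mu f -> igr mu (fun x => - f x).
Proof. by move=> fi; have := integrableN fi. Qed.

Lemma igrB f g : igr mu f -> igr mu g -> igr mu (fun x => f x - g x).
Proof. by move=> fi gi; apply: igrD => //; exact: igrN. Qed.

Lemma igr_ge0P f : measurable_fun setT f -> (forall x, 0 <= f x) ->
  igr mu f <-> (\int[mu]_x (f x)%:E < +oo)%E.
Proof.
move=> mf f0; split.
  case/integrableP => _; under eq_integral do rewrite /= ger0_norm//.
  by [].
move=> fi; apply/integrableP; split; first exact/measurable_EFinP.
by under eq_integral do rewrite /= ger0_norm//.
Qed.

Lemma Rint_EFin f : igr mu f -> (\int[mu]_x f x)%:E = (\int[mu]_x (f x)%:E)%E.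
Proof. by move=> fi; rewrite /Rintegral fineK//; exact: integrable_fin_num. Qed.

Lemma Rint_ae f g : measurable_fun setT f -> measurable_fun setT g ->
  {ae mu, forall x, f x = g x} -> \int[mu]_x f x = \int[mu]_x g x.
Proof.
move=> mf mg fg; rewrite /Rintegral; congr fine; apply: ae_eq_integral => //.
- exact/measurable_EFinP.
- exact/measurable_EFinP.
by apply: filterS fg => x /= ->.
Qed.

Lemma igr_ae f g : measurable_fun setT g ->
  {ae mu, forall x, f x = g x} -> igr mu f -> igr mu g.
Proof.
move=> mg fg fi; have mf := igr_meas fi; apply/integrableP; split; first exact/measurable_EFinP.
have /integrableP[_] := fi; congr (_ < _)%E.
apply: ae_eq_integral => //.
- by apply/measurable_EFinP => /=; exact: measurableT_comp.
- by apply/measurable_EFinP => /=; exact: measurableT_comp.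
by apply: filterS fg => x /= ->.
Qed.

Lemma Rint_eq0 f : igr mu f -> (forall x, 0 <= f x) -> \int[mu]_x f x = 0 ->
  {ae mu, forall x, f x = 0}.
Proof.
move=> fi f0 H.
have mf := igr_meas fi.
have : (\int[mu]_x `| (f x)%:E | = 0)%E.
  under eq_integral do rewrite /= ger0_norm//.
  by rewrite -Rint_EFin// H.
have mE : measurable_fun setT (EFin \o f) by exact/measurable_EFinP.
move/(@ae_eq_integral_abs _ _ _ mu setT measurableT _ mE).
by apply: filterS => x /= /(_ I) [].
Qed.

Lemma Rdct (f_ : (T -> R)^nat) f g : (forall n, measurable_fun setT (f_ n)) ->
  measurable_fun setT f -> {ae mu, forall x, f_ ^~ x @ \oo --> f x} -> igr mu g ->
  (forall n x, `|f_ n x| <= g x) ->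
  igr mu f /\ (fun n => \int[mu]_x f_ n x) @ \oo --> \int[mu]_x f x.
Proof.
move=> mf_ mf ff gi fg.
have /= [|||/= |h1 h2 h3] := @dominated_convergence _ _ _ mu _ measurableT
   (fun n => EFin \o f_ n) (EFin \o f) (EFin \o g) _ _ _ gi _.
- by move=> n; exact/measurable_EFinP.
- exact/measurable_EFinP.
- apply: filterS ff => x H _; apply: cvg_comp; [exact: H | by []].
- by apply: aeW => x n _ /=; rewrite lee_fin.
split => //.
rewrite /Rintegral; apply: fine_cvg; rewrite fineK//.
exact: integrable_fin_num.
Qed.

Lemma int_le f g : measurable_fun setT f -> measurable_fun setT g ->
  (forall x, 0 <= f x) -> (forall x, f x <= g x) ->
  (\int[mu]_x (f x)%:E <= \int[mu]_x (g x)%:E)%E.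
Proof.
move=> mf mg f0 fg; apply: ge0_le_integral.
- exact: measurableT.
- by move=> x _; rewrite lee_fin.
- exact/measurable_EFinP.
- exact/measurable_EFinP.
- by move=> x _; rewrite lee_fin.
Qed.

Lemma int_add f g : measurable_fun setT f -> measurable_fun setT g ->
  (forall x, 0 <= f x) -> (forall x, 0 <= g x) ->
  (\int[mu]_x (f x + g x)%:E = \int[mu]_x (f x)%:E + \int[mu]_x (g x)%:E)%E.
Proof.
move=> mf mg f0 g0; under eq_integral do rewrite EFinD.
apply: ge0_integralD.
- exact: measurableT.
- by move=> x _; rewrite lee_fin.
- exact/measurable_EFinP.
- by move=> x _; rewrite lee_fin.
- exact/measurable_EFinP.
Qed.

Lemma int_scale (k : R) f : measurable_fun setT f -> (forall x, 0 <= f x) -> 0 <= k ->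
  (\int[mu]_x (k * f x)%:E = k%:E * \int[mu]_x (f x)%:E)%E.
Proof.
move=> mf f0 k0; under eq_integral do rewrite EFinM.
apply: ge0_integralZl.
- exact: measurableT.
- exact/measurable_EFinP.
- by move=> x _; rewrite lee_fin.
- by rewrite lee_fin.
Qed.
End RealIntegrable.

Section ComplexNumbers.
Variable R : realType.
Implicit Types z w : R[i].

Lemma complex_ext z w : complex.Re z = complex.Re w ->
  complex.Im z = complex.Im w -> z = w.
Proof. by case: z w => a b [c d] /= -> ->. Qed.

Lemma ReD z w : complex.Re (z + w) = complex.Re z + complex.Re w.
Proof. by case: z => a b; case: w. Qed.

Lemma ImD z w : complex.Im (z + w) = complex.Im z + complex.Im w.
Proof. by case: z => a b; case: w. Qed.

Lemma ReN z : complex.Re (- z) = - complex.Re z.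
Proof. by case: z. Qed.

Lemma ImN z : complex.Im (- z) = - complex.Im z.
Proof. by case: z. Qed.

Lemma ReM z w : complex.Re (z * w) =
  complex.Re z * complex.Re w - complex.Im z * complex.Im w.
Proof. by case: z => a b; case: w. Qed.

Lemma ImM z w : complex.Im (z * w) =
  complex.Re z * complex.Im w + complex.Im z * complex.Re w.
Proof. by case: z => a b; case: w => c d /=; rewrite addrC. Qed.

Lemma Re_conj z : complex.Re (conjc z) = complex.Re z. Proof. by case: z. Qed.

Lemma Im_conj z : complex.Im (conjc z) = - complex.Im z. Proof. by case: z. Qed.

Lemma conjcM z w : conjc (z * w) = conjc z * conjc w.
Proof. exact: rmorphM. Qed.

Lemma conjc_realE (x : R) : conjc x%:C = x%:C :> R[i].
Proof. by apply: complex_ext => /=; rewrite ?oppr0. Qed.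

Lemma cabsE z : cabs z = Num.sqrt (complex.Re z ^+ 2 + complex.Im z ^+ 2).
Proof. by case: z. Qed.

Lemma cabs_ge0 z : 0 <= cabs z. Proof. by rewrite cabsE sqrtr_ge0. Qed.

Lemma cabs_sqr z : cabs z ^+ 2 = complex.Re z ^+ 2 + complex.Im z ^+ 2.
Proof. by rewrite cabsE sqr_sqrtr// addr_ge0// sqr_ge0. Qed.

Lemma cabsM z w : cabs (z * w) = cabs z * cabs w.
Proof. exact: ComplexField.Normc.normcM. Qed.

Lemma cabs_conj z : cabs (conjc z) = cabs z.
Proof. by rewrite !cabsE Re_conj Im_conj sqrrN. Qed.

Lemma cabs_real (x : R) : cabs x%:C = `|x|.
Proof. by rewrite cabsE /= expr0n addr0 sqrtr_sqr. Qed.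

Lemma cabs_expi t : cabs (cexpi t : R[i]) = 1.
Proof. by rewrite cabsE /= cos2Dsin2 sqrtr1. Qed.

Lemma cabs_eq0 z : cabs z = 0 -> z = 0.
Proof. exact: ComplexField.Normc.eq0_normc. Qed.

Lemma Re_le_cabs z : `|complex.Re z| <= cabs z.
Proof. by rewrite -sqrtr_sqr cabsE ler_wsqrtr// lerDl sqr_ge0. Qed.

Lemma Im_le_cabs z : `|complex.Im z| <= cabs z.
Proof. by rewrite -sqrtr_sqr cabsE ler_wsqrtr// lerDr sqr_ge0. Qed.

Lemma cabs_le_ReIm z : cabs z <= `|complex.Re z| + `|complex.Im z|.
Proof.
rewrite -(@ger0_norm _ (_ + _)) ?addr_ge0// -sqrtr_sqr cabsE ler_wsqrtr// sqrrD.
by rewrite !real_normK ?num_real// lerD2r lerDl mulrn_wge0// mulr_ge0.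
Qed.

Lemma mulJ_cabs z : z * conjc z = (cabs z ^+ 2)%:C.
Proof. by apply: complex_ext; rewrite ?ReM ?ImM Re_conj Im_conj ?cabs_sqr /=; ring. Qed.

Lemma expiD (s t : R) : cexpi (s + t) = cexpi s * cexpi t.
Proof. by apply: complex_ext; rewrite ?ReM ?ImM /= ?cosD ?sinD//; ring. Qed.

Lemma expi_conj (t : R) : conjc (cexpi t) = cexpi (- t).
Proof. by rewrite /cexpi /= cosN sinN. Qed.

Lemma realcM (x y : R) : (x * y)%:C = x%:C * y%:C.
Proof. by apply: complex_ext; rewrite ?ReM ?ImM /=; ring. Qed.

Lemma realcD (x y : R) : (x + y)%:C = x%:C + y%:C.
Proof. by apply: complex_ext; rewrite ?ReD ?ImD /=; ring. Qed.

(** Componentwise, so that dominated convergence for complex functions amounts to two real instances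
    of it. *)
Definition ccvg (u : nat -> R[i]) (l : R[i]) :=
  (fun n => complex.Re (u n)) @ \oo --> complex.Re l /\
  (fun n => complex.Im (u n)) @ \oo --> complex.Im l.

Lemma ccvg_unique u l l' : ccvg u l -> ccvg u l' -> l = l'.
Proof.
move=> [h1 h2] [h3 h4]; apply: complex_ext.
  exact: (cvg_unique (@Rhausdorff R) h1 h3).
exact: (cvg_unique (@Rhausdorff R) h2 h4).
Qed.

Lemma ccvgM u v l m : ccvg u l -> ccvg v m -> ccvg (fun n => u n * v n) (l * m).
Proof.
move=> [h1 h2] [h3 h4]; split.
  under eq_fun do rewrite ReM; rewrite ReM; apply: cvgB; exact: cvgM.
under eq_fun do rewrite ImM; rewrite ImM; apply: cvgD; exact: cvgM.
Qed.

Lemma ccvg_cst l : ccvg (fun=> l) l.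
Proof. by split; exact: cvg_cst. Qed.

Lemma ccvg_real (u : nat -> R) (l : R) : u @ \oo --> l ->
  ccvg (fun n => (u n)%:C) l%:C.
Proof. by move=> ul; split => //=; exact: cvg_cst. Qed.
End ComplexNumbers.

(** [cmeas], [cigr] and [ci] restate [cmeasurable], [cintegrable] and [cint] over an arbitrary
    measure space, because integrals over the line and over R^3 x R^3 occur as well. On R^3 the two
    versions are convertible. *)
Definition cmeas d (T : measurableType d) (R : realType) (f : T -> R[i]) :=
  measurable_fun setT (fun x => complex.Re (f x)) /\
  measurable_fun setT (fun x => complex.Im (f x)).

Section ComplexMeasurable.
Context d (T : measurableType d) (R : realType).
Implicit Types f g : T -> R[i].

Lemma cmeasD f g : cmeas f -> cmeas g -> cmeas (fun x => f x + g x).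
Proof.
move=> [f1 f2] [g1 g2]; split.
  by under eq_fun do rewrite ReD; exact: measurable_funD.
by under eq_fun do rewrite ImD; exact: measurable_funD.
Qed.

Lemma cmeasN f : cmeas f -> cmeas (fun x => - f x).
Proof.
move=> [f1 f2]; split.
  by under eq_fun do rewrite ReN; exact: measurable_funN.
by under eq_fun do rewrite ImN; exact: measurable_funN.
Qed.

Lemma cmeasB f g : cmeas f -> cmeas g -> cmeas (fun x => f x - g x).
Proof. by move=> mf mg; apply: cmeasD => //; exact: cmeasN. Qed.

Lemma cmeasM f g : cmeas f -> cmeas g -> cmeas (fun x => f x * g x).
Proof.
move=> [f1 f2] [g1 g2]; split.
  by under eq_fun do rewrite ReM; apply: measurable_funB; exact: measurable_funM.
by under eq_fun do rewrite ImM; apply: measurable_funD; exact: measurable_funM.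
Qed.

Lemma cmeas_cst (c : R[i]) : cmeas (fun _ : T => c).
Proof. by split; exact: measurable_cst. Qed.

Lemma cmeas_conj f : cmeas f -> cmeas (fun x => conjc (f x)).
Proof.
move=> [f1 f2]; split; first by under eq_fun do rewrite Re_conj.
by under eq_fun do rewrite Im_conj; exact: measurable_funN.
Qed.

Lemma cmeas_real (f : T -> R) : measurable_fun setT f -> cmeas (fun x => (f x)%:C).
Proof. by move=> mf; split => //=; exact: measurable_cst. Qed.

Lemma cmeas_cabs f : cmeas f -> measurable_fun setT (fun x => cabs (f x)).
Proof.
move=> [f1 f2].
have -> : (fun x => cabs (f x)) =
    (fun x => (complex.Re (f x) ^+ 2 + complex.Im (f x) ^+ 2) `^ (1/2)).
  apply/funext => x; rewrite cabsE; set a := _ + _.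
  by rewrite -powR12_sqrt ?div1r// addr_ge0// sqr_ge0.
apply: (measurableT_comp (measurable_powR _)).
by apply: measurable_funD; exact: measurable_funX.
Qed.

Lemma cmeas_expi (f : T -> R) : measurable_fun setT f -> cmeas (fun x => cexpi (f x) : R[i]).
Proof.
move=> mf; split => /=.
  by apply: (measurableT_comp _ mf); apply: continuous_measurable_fun; exact: continuous_cos.
by apply: (measurableT_comp _ mf); apply: continuous_measurable_fun; exact: continuous_sin.
Qed.
End ComplexMeasurable.

Lemma cmeas_comp d1 d2 (T1 : measurableType d1) (T2 : measurableType d2)
  (R : realType) (f : T2 -> R[i]) (h : T1 -> T2) :
  cmeas f -> measurable_fun setT h -> cmeas (f \o h).
Proof.
move=> [f1 f2] mh; split.
  exact: (measurableT_comp f1 mh).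
exact: (measurableT_comp f2 mh).
Qed.

Definition cigr d (T : measurableType d) (R : realType)
    (mu : {measure set T -> \bar R}) (f : T -> R[i]) :=
  igr mu (fun x => complex.Re (f x)) /\ igr mu (fun x => complex.Im (f x)).

Definition ci d (T : measurableType d) (R : realType)
    (mu : {measure set T -> \bar R}) (f : T -> R[i]) : R[i] :=
  (\int[mu]_x complex.Re (f x)) +i* (\int[mu]_x complex.Im (f x)).

Section ComplexIntegration.
Context d (T : measurableType d) (R : realType) (mu : {measure set T -> \bar R}).
Implicit Types f g : T -> R[i].

Lemma cigr_meas f : cigr mu f -> cmeas f.
Proof. by move=> [/igr_meas ? /igr_meas]. Qed.

Lemma cigr_le f (g : T -> R) : cmeas f -> (forall x, cabs (f x) <= g x) ->
  igr mu g -> cigr mu f.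
Proof.
move=> [f1 f2] fg gi; split; apply: igr_le gi => // x.
  exact: le_trans (Re_le_cabs _) (fg x).
exact: le_trans (Im_le_cabs _) (fg x).
Qed.

Lemma cigr_cabs f : cigr mu f -> igr mu (fun x => cabs (f x)).
Proof.
move=> fi; have mf := cigr_meas fi; case: fi => f1 f2.
apply: igr_le (igrD (igr_norm f1) (igr_norm f2)); first exact: cmeas_cabs.
by move=> x; rewrite ger0_norm ?cabs_ge0//; exact: cabs_le_ReIm.
Qed.

Lemma cigr_cabsP f : cmeas f -> cigr mu f <-> igr mu (fun x => cabs (f x)).
Proof. by move=> mf; split; [exact: cigr_cabs | exact: cigr_le]. Qed.

Lemma cigrD f g : cigr mu f -> cigr mu g -> cigr mu (fun x => f x + g x).
Proof.
move=> [f1 f2] [g1 g2]; split.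
  by under eq_fun do rewrite ReD; exact: igrD.
by under eq_fun do rewrite ImD; exact: igrD.
Qed.

Lemma cigrN f : cigr mu f -> cigr mu (fun x => - f x).
Proof.
move=> [f1 f2]; split.
  by under eq_fun do rewrite ReN; exact: igrN.
by under eq_fun do rewrite ImN; exact: igrN.
Qed.

Lemma cigrB f g : cigr mu f -> cigr mu g -> cigr mu (fun x => f x - g x).
Proof. by move=> fi gi; apply: cigrD => //; exact: cigrN. Qed.

Lemma cigrZ (a : R[i]) f : cigr mu f -> cigr mu (fun x => a * f x).
Proof.
move=> [f1 f2]; split.
  by under eq_fun do rewrite ReM; apply: igrB; exact: igrZ.
by under eq_fun do rewrite ImM; apply: igrD; exact: igrZ.
Qed.

Lemma cigr_real (f : T -> R) : igr mu f -> cigr mu (fun x => (f x)%:C).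
Proof.
by move=> fi; split => //=; apply: integrable0.
Qed.

Lemma cigr0 : cigr mu (fun=> 0).
Proof. by split; apply: integrable0. Qed.

Lemma cigr_sum (I : Type) (s : seq I) (F : I -> T -> R[i]) :
  (forall i, cigr mu (F i)) -> cigr mu (fun x => \sum_(i <- s) F i x).
Proof.
move=> Fi; elim: s => [|i s ih]; first by under eq_fun do rewrite big_nil; exact: cigr0.
by under eq_fun do rewrite big_cons; exact: cigrD.
Qed.

Lemma cigr_conj f : cigr mu f -> cigr mu (fun x => conjc (f x)).
Proof.
move=> [f1 f2]; split; first by under eq_fun do rewrite Re_conj.
by under eq_fun do rewrite Im_conj; exact: igrN.
Qed.

Lemma cigrM_bounded f g (M : R) : cigr mu f -> cmeas g ->
  (forall x, cabs (g x) <= M) -> cigr mu (fun x => f x * g x).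
Proof.
move=> fi mg gM; apply: (@cigr_le _ (fun x => M * cabs (f x))).
- by apply: cmeasM => //; exact: cigr_meas fi.
- by move=> x; rewrite cabsM mulrC ler_wpM2r// cabs_ge0.
by apply: igrZ; exact: cigr_cabs.
Qed.

Lemma ciD f g : cigr mu f -> cigr mu g ->
  ci mu (fun x => f x + g x) = ci mu f + ci mu g.
Proof.
move=> [f1 f2] [g1 g2]; apply: complex_ext; rewrite ?ReD ?ImD /ci/=.
  by under eq_Rintegral do rewrite ReD; rewrite RintegralD.
by under eq_Rintegral do rewrite ImD; rewrite RintegralD.
Qed.

Lemma ciZ (a : R[i]) f : cigr mu f -> ci mu (fun x => a * f x) = a * ci mu f.
Proof.
move=> [f1 f2]; apply: complex_ext; rewrite ?ReM ?ImM /ci/=.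
  under eq_Rintegral do rewrite ReM.
  by rewrite RintegralB//; [rewrite !RintegralZl | exact: igrZ | exact: igrZ].
under eq_Rintegral do rewrite ImM.
by rewrite RintegralD//; [rewrite !RintegralZl | exact: igrZ | exact: igrZ].
Qed.

Lemma ciZr (a : R[i]) f : cigr mu f -> ci mu (fun x => f x * a) = ci mu f * a.
Proof. by move=> fi; under eq_fun do rewrite mulrC; rewrite ciZ// mulrC. Qed.

Lemma ciN f : cigr mu f -> ci mu (fun x => - f x) = - ci mu f.
Proof. by move=> fi; under eq_fun do rewrite -mulN1r; rewrite ciZ// mulN1r. Qed.

Lemma ciB f g : cigr mu f -> cigr mu g ->
  ci mu (fun x => f x - g x) = ci mu f - ci mu g.
Proof. by move=> fi gi; rewrite ciD ?ciN//; exact: cigrN. Qed.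

Lemma ci0 : ci mu (fun=> 0) = 0.
Proof. by rewrite /ci /= /Rintegral integral0. Qed.

Lemma ci_sum (I : Type) (s : seq I) (F : I -> T -> R[i]) :
  (forall i, cigr mu (F i)) ->
  ci mu (fun x => \sum_(i <- s) F i x) = \sum_(i <- s) ci mu (F i).
Proof.
move=> Fi; elim: s => [|i s ih].
  by under eq_fun do rewrite big_nil; rewrite big_nil ci0.
by under eq_fun do rewrite big_cons; rewrite big_cons ciD ?ih//; exact: cigr_sum.
Qed.

Lemma ci_real (f : T -> R) : ci mu (fun x => (f x)%:C) = (\int[mu]_x f x)%:C.
Proof. by apply: complex_ext => //=; rewrite /Rintegral integral0. Qed.

Lemma ci_conj f : cigr mu f -> ci mu (fun x => conjc (f x)) = conjc (ci mu f).
Proof.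
move=> [f1 f2]; apply: complex_ext; rewrite ?Re_conj ?Im_conj /ci/=.
  by under eq_Rintegral do rewrite Re_conj.
under eq_Rintegral do rewrite Im_conj -mulN1r.
by rewrite RintegralZl// mulN1r.
Qed.

Lemma ci_ae f g : cmeas f -> cmeas g -> {ae mu, forall x, f x = g x} ->
  ci mu f = ci mu g.
Proof.
move=> [f1 f2] [g1 g2] fg; apply: complex_ext; rewrite /ci/=.
  by apply: Rint_ae => //; apply: filterS fg => x ->.
by apply: Rint_ae => //; apply: filterS fg => x ->.
Qed.

Lemma cigr_ae f g : cmeas g -> {ae mu, forall x, f x = g x} ->
  cigr mu f -> cigr mu g.
Proof.
move=> [g1 g2] fg [f1 f2]; split.
  by apply: (igr_ae _ _ f1) => //; apply: filterS fg => x ->.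
by apply: (igr_ae _ _ f2) => //; apply: filterS fg => x ->.
Qed.

(** The factor 2 comes from bounding real and imaginary parts separately; the lemma serves
    boundedness and domination, where a constant is harmless. *)
Lemma cabs_ci_le f : cigr mu f -> cabs (ci mu f) <= 2 * \int[mu]_x cabs (f x).
Proof.
move=> fi; have ai := cigr_cabs fi; case: fi => f1 f2.
apply: le_trans (cabs_le_ReIm _) _; rewrite mulrDl mul1r /ci/=; apply: lerD.
  apply: le_trans (le_normr_Rintegral _ _) _ => //; apply: le_Rintegral => //.
    exact: igr_norm.
  by move=> x _; exact: Re_le_cabs.
apply: le_trans (le_normr_Rintegral _ _) _ => //; apply: le_Rintegral => //.
  exact: igr_norm.
by move=> x _; exact: Im_le_cabs.
Qed.

Lemma cdct (f_ : nat -> T -> R[i]) f (g : T -> R) : (forall n, cmeas (f_ n)) ->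
  cmeas f -> {ae mu, forall x, ccvg (f_ ^~ x) (f x)} -> igr mu g ->
  (forall n x, cabs (f_ n x) <= g x) ->
  cigr mu f /\ ccvg (fun n => ci mu (f_ n)) (ci mu f).
Proof.
move=> mf_ [m1 m2] ff gi fg.
have [|||||h1 h2] := @Rdct _ _ _ mu (fun n x => complex.Re (f_ n x)) (fun x => complex.Re (f x)) g.
- by move=> n; have [] := mf_ n.
- by [].
- by apply: filterS ff => x [].
- exact: gi.
- by move=> n x; exact: le_trans (Re_le_cabs _) (fg _ _).
have [|||||h3 h4] := @Rdct _ _ _ mu (fun n x => complex.Im (f_ n x)) (fun x => complex.Im (f x)) g.
- by move=> n; have [] := mf_ n.
- by [].
- by apply: filterS ff => x [].
- exact: gi.
- by move=> n x; exact: le_trans (Im_le_cabs _) (fg _ _).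
by [].
Qed.
End ComplexIntegration.

(** * Product measures and Fubini *)

(** A named copy of the product measure that carries a sigma-finite structure: Fubini asks it of
    each factor, and the factors here are themselves products, R^3 being built in two steps. *)
Definition sfprod d1 d2 (T1 : measurableType d1) (T2 : measurableType d2) (R : realType)
  (m1 : {sigma_finite_measure set T1 -> \bar R})
  (m2 : {sigma_finite_measure set T2 -> \bar R}) : set (T1 * T2)%type -> \bar R := (m1 \x m2)%E.
Section SigmaFiniteProduct.
Context d1 d2 (T1 : measurableType d1) (T2 : measurableType d2) (R : realType)
  (m1 : {sigma_finite_measure set T1 -> \bar R})
  (m2 : {sigma_finite_measure set T2 -> \bar R}).
HB.instance Definition _ := Measure.copy (sfprod m1 m2) (m1 \x m2)%E.
Lemma sfprod_sigma_finite : sigma_finite setT (sfprod m1 m2).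
Proof.
have /sigma_finiteP[F [TF ndF Foo]] := sigma_finiteT m1.
have /sigma_finiteP[G [TG ndG Goo]] := sigma_finiteT m2.
(* Both exhaustions are monotone, so a point of F_n x G_k lies in the rectangle of index max n k. *)
exists (fun n => F n `*` G n).
  apply/seteqP; split => // -[x y] _.
  have [n _ Fx] : (\bigcup_n F n) x by rewrite -TF.
  have [k _ Gy] : (\bigcup_n G n) y by rewrite -TG.
  exists (maxn n k) => //; split => /=.
    exact: (subsetPset _ _ (ndF _ _ (leq_maxl n k))).
  exact: (subsetPset _ _ (ndG _ _ (leq_maxr n k))).
move=> k; have [mF Fk] := Foo k; have [mG Gk] := Goo k; split.
  exact: measurableX.
by rewrite /sfprod product_measure1E// lte_mul_pinfty// ge0_fin_numE.
Qed.
HB.instance Definition _ := Measure_isSigmaFinite.Build _ _ _ (sfprod m1 m2)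
  sfprod_sigma_finite.
End SigmaFiniteProduct.

Section RealFubini.
Context d1 d2 (T1 : measurableType d1) (T2 : measurableType d2) (R : realType)
  (m1 : {sigma_finite_measure set T1 -> \bar R})
  (m2 : {sigma_finite_measure set T2 -> \bar R}).

(** No integrability is assumed: the integrals of the positive and negative parts are measurable by
    Tonelli, and so is [fine] of their difference, whatever value it takes. *)
Lemma measurable_inner (f : T1 * T2 -> R) : measurable_fun setT f ->
  measurable_fun setT (fun x => \int[m2]_y f (x, y)).
Proof.
move=> mf; apply: (measurableT_comp (fine_measurable measurableT)).
under eq_fun do rewrite integralE.
apply: emeasurable_funB.
  rewrite [X in measurable_fun _ X](_ : _ = fubini_F m2 (EFin \o f)^\+%E); last first.
    by apply/funext => x; apply: eq_integral => y _; rewrite !funeposE.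
  apply: measurable_fun_fubini_tonelli_F; first exact/measurable_funepos/measurable_EFinP.
  by move=> x; exact: funepos_ge0.
rewrite [X in measurable_fun _ X](_ : _ = fubini_F m2 (EFin \o f)^\-%E); last first.
    by apply/funext => x; apply: eq_integral => y _; rewrite !funenegE.
apply: measurable_fun_fubini_tonelli_F; first exact/measurable_funeneg/measurable_EFinP.
by move=> x; exact: funeneg_ge0.
Qed.

Lemma measurable_inner_sym (f : T1 * T2 -> R) : measurable_fun setT f ->
  measurable_fun setT (fun y => \int[m1]_x f (x, y)).
Proof.
move=> mf; apply: (measurableT_comp (fine_measurable measurableT)).
under eq_fun do rewrite integralE.
apply: emeasurable_funB.
  rewrite [X in measurable_fun _ X](_ : _ = fubini_G m1 (EFin \o f)^\+%E); last first.
    by apply/funext => x; apply: eq_integral => y _; rewrite !funeposE.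
  apply: measurable_fun_fubini_tonelli_G; first exact/measurable_funepos/measurable_EFinP.
  by move=> x; exact: funepos_ge0.
rewrite [X in measurable_fun _ X](_ : _ = fubini_G m1 (EFin \o f)^\-%E); last first.
    by apply/funext => x; apply: eq_integral => y _; rewrite !funenegE.
apply: measurable_fun_fubini_tonelli_G; first exact/measurable_funeneg/measurable_EFinP.
by move=> x; exact: funeneg_ge0.
Qed.

(** Fubini for extended inner integrals, transferred to inner integrals taken through [fine]: the
    two can differ only where the section is not integrable, which is a null set. *)
Lemma igr_inner (f : T1 * T2 -> R) : igr (sfprod m1 m2) f ->
  [/\ {ae m1, forall x, igr m2 (fun y => f (x, y))},
      igr m1 (fun x => \int[m2]_y f (x, y)) &
      \int[m1]_x \int[m2]_y f (x, y) = \int[(sfprod m1 m2)]_z f z].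
Proof.
move=> fi.
have h1 := ae_integrable1 fi.
have h2 := integrable_fubini_F fi.
have mf := igr_meas fi.
have h3 : igr m1 (fun x => \int[m2]_y f (x, y)).
  apply/integrableP; split; first exact/measurable_EFinP/measurable_inner.
  have /integrableP[mF] := h2; congr (_ < _)%E; apply: ae_eq_integral => //.
  - exact: measurableT_comp.
  - apply: measurableT_comp => //; exact/measurable_EFinP/measurable_inner.
  by apply: filterS h1 => x hx _; congr abse; rewrite /= Rint_EFin.
split => //; apply: EFin_inj; rewrite !Rint_EFin// -(integral12_prod_meas1 fi).
apply: ae_eq_integral => //.
- exact/measurable_EFinP/measurable_inner.
- exact: measurable_int h2.
by apply: filterS h1 => x hx _ /=; rewrite Rint_EFin.
Qed.

Lemma igr_inner_sym (f : T1 * T2 -> R) : igr (sfprod m1 m2) f ->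
  [/\ {ae m2, forall y, igr m1 (fun x => f (x, y))},
      igr m2 (fun y => \int[m1]_x f (x, y)) &
      \int[m2]_y \int[m1]_x f (x, y) = \int[(sfprod m1 m2)]_z f z].
Proof.
move=> fi.
have h1 := ae_integrable2 fi.
have mf := igr_meas fi.
have mEf : measurable_fun setT (EFin \o f) by exact/measurable_EFinP.
(* The marginal is dominated by the integral of |f| over the section, which is integrable by
   Tonelli. *)
have h2 : m2.-integrable setT (fubini_G m1 (EFin \o f)).
  apply/integrableP; split; first exact: (measurable_fubini_G fi).
  apply: le_lt_trans ((integrable21ltyP m1 m2 mEf).1 fi).
  apply: ge0_le_integral => //.
  - by apply: measurableT_comp => //; exact: (measurable_fubini_G fi).
  - have -> : (fun y => \int[m1]_x `|(EFin \o f) (x, y)|)%E = fubini_G m1 (abse \o (EFin \o f)) by [].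
    apply: measurable_fun_fubini_tonelli_G => //.
      exact: measurableT_comp.
    by move=> z; exact: abse_ge0.
  move=> y _; apply: le_abse_integral => //.
  apply: measurableT_comp => //; exact: measurable_fun_pair1.
have h3 : igr m2 (fun y => \int[m1]_x f (x, y)).
  apply/integrableP; split; first exact/measurable_EFinP/measurable_inner_sym.
  have /integrableP[mF] := h2; congr (_ < _)%E; apply: ae_eq_integral => //.
  - exact: measurableT_comp.
  - apply: measurableT_comp => //; exact/measurable_EFinP/measurable_inner_sym.
  by apply: filterS h1 => x hx _; congr abse; rewrite /= Rint_EFin.
split => //; apply: EFin_inj; rewrite !Rint_EFin// -(integral21_prod_meas1 fi).
apply: ae_eq_integral => //.
- exact/measurable_EFinP/measurable_inner_sym.
- exact: measurable_int h2.
by apply: filterS h1 => x hx _ /=; rewrite Rint_EFin.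
Qed.
End RealFubini.

Section ComplexFubini.
Context d1 d2 (T1 : measurableType d1) (T2 : measurableType d2) (R : realType)
  (m1 : {sigma_finite_measure set T1 -> \bar R})
  (m2 : {sigma_finite_measure set T2 -> \bar R}).
Implicit Types f : T1 * T2 -> R[i].

Lemma cmeas_inner f : cmeas f -> cmeas (fun x => ci m2 (fun y => f (x, y))).
Proof.
move=> [f1 f2]; split; rewrite /ci /=.
  exact: (measurable_inner _ f1).
exact: (measurable_inner _ f2).
Qed.

Lemma cmeas_inner_sym f : cmeas f -> cmeas (fun y => ci m1 (fun x => f (x, y))).
Proof.
move=> [f1 f2]; split; rewrite /ci /=.
  exact: (measurable_inner_sym _ f1).
exact: (measurable_inner_sym _ f2).
Qed.

Lemma cfubini f : cigr (sfprod m1 m2) f ->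
  [/\ {ae m1, forall x, cigr m2 (fun y => f (x, y))},
      cigr m1 (fun x => ci m2 (fun y => f (x, y))) &
      ci m1 (fun x => ci m2 (fun y => f (x, y))) = ci (sfprod m1 m2) f].
Proof.
move=> [/igr_inner[a1 b1 c1] /igr_inner[a2 b2 c2]]; split.
- by apply: filterS2 a1 a2.
- by [].
- by apply: complex_ext.
Qed.

Lemma cfubini_sym f : cigr (sfprod m1 m2) f ->
  [/\ {ae m2, forall y, cigr m1 (fun x => f (x, y))},
      cigr m2 (fun y => ci m1 (fun x => f (x, y))) &
      ci m2 (fun y => ci m1 (fun x => f (x, y))) = ci (sfprod m1 m2) f].
Proof.
move=> [/igr_inner_sym[a1 b1 c1] /igr_inner_sym[a2 b2 c2]]; split.
- by apply: filterS2 a1 a2.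
- by [].
- by apply: complex_ext.
Qed.

Lemma cfubini_swap f : cigr (sfprod m1 m2) f ->
  ci m1 (fun x => ci m2 (fun y => f (x, y))) =
  ci m2 (fun y => ci m1 (fun x => f (x, y))).
Proof. by move=> fi; have [_ _ ->] := cfubini fi; have [_ _ ->] := cfubini_sym fi. Qed.

Lemma measurable_fst_comp d (T : measurableType d) (f : T1 -> T) :
  measurable_fun setT f -> measurable_fun setT (fun z : T1 * T2 => f z.1).
Proof. by move=> mf; exact: (measurableT_comp mf measurable_fst). Qed.

Lemma measurable_snd_comp d (T : measurableType d) (f : T2 -> T) :
  measurable_fun setT f -> measurable_fun setT (fun z : T1 * T2 => f z.2).
Proof. by move=> mf; exact: (measurableT_comp mf measurable_snd). Qed.

Lemma tonelliP (f : T1 * T2 -> R) : measurable_fun setT f -> (forall z, 0 <= f z) ->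
  igr (sfprod m1 m2) f <-> (\int[m1]_x \int[m2]_y (f (x, y))%:E < +oo)%E.
Proof.
move=> mf f0; rewrite integrable12ltyP; last exact/measurable_EFinP.
by under eq_integral do under eq_integral do rewrite /= ger0_norm//.
Qed.

Lemma igr_prod_ge0 (f : T1 -> R) (g : T2 -> R) : (forall x, 0 <= f x) ->
  (forall y, 0 <= g y) -> igr m1 f -> igr m2 g ->
  igr (sfprod m1 m2) (fun z => f z.1 * g z.2).
Proof.
move=> f0 g0 fi gi; have mf := igr_meas fi; have mg := igr_meas gi.
apply/tonelliP => /=.
- by apply: measurable_funM; [exact: measurable_fst_comp|exact: measurable_snd_comp].
- by move=> z; exact: mulr_ge0.
under eq_integral do under eq_integral do rewrite EFinM.
under eq_integral => x _.
  rewrite ge0_integralZl//; last 3 first.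
    exact/measurable_EFinP.
    by move=> y _; rewrite lee_fin.
    by rewrite lee_fin.
  rewrite -Rint_EFin// -EFinM mulrC.
  over.
have := igrZ (\int[m2]_y g y) fi.
move/igr_ge0P; apply.
  by apply: measurable_funM.
by move=> x; apply: mulr_ge0 => //; exact: Rintegral_ge0.
Qed.

Lemma cigr_prod (f : T1 -> R[i]) (g : T2 -> R[i]) : cigr m1 f -> cigr m2 g ->
  cigr (sfprod m1 m2) (fun z => f z.1 * g z.2).
Proof.
move=> fi gi; apply: (cigr_le _ _ (igr_prod_ge0 _ _ (cigr_cabs fi) (cigr_cabs gi))).
- have mf := cigr_meas fi; have mg := cigr_meas gi.
  apply: cmeasM; first exact: (cmeas_comp mf measurable_fst).
  exact: (cmeas_comp mg measurable_snd).
- by move=> z; rewrite cabsM.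
- by move=> x; exact: cabs_ge0.
- by move=> x; exact: cabs_ge0.
Qed.
End ComplexFubini.

(** * Changes of variables *)

Definition leb3s (R : realType) : {sigma_finite_measure set (R3meas R) -> \bar R} :=
  sfprod (sfprod (@lebesgue_measure R) (@lebesgue_measure R)) (@lebesgue_measure R).

(** [m] is [c] times its image under [h]. Stating this for nonnegative extended functions makes it
    stable under products by Tonelli; the real and complex formulas follow by splitting into
    parts. *)
Definition scales d (T : measurableType d) (R : realType)
    (m : {measure set T -> \bar R}) (h : T -> T) (c : R) :=
  measurable_fun setT h /\
  forall f : T -> \bar R, measurable_fun setT f -> (forall x, 0 <= f x)%E ->
    (c%:E * \int[m]_x f (h x) = \int[m]_x f x)%E.

Section Scales.
Context d (T : measurableType d) (R : realType) (m : {measure set T -> \bar R}).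
Variables (h : T -> T) (c : R).
Hypotheses (hc : scales m h c) (c0 : 0 < c).

Lemma scales_igr (f : T -> R) : measurable_fun setT f ->
  igr m f <-> igr m (f \o h).
Proof.
move=> mf; have [mh H] := hc.
have E := H (fun x => `|f x|%:E).
have {}E := E _ _.
have {}E : (c%:E * \int[m]_x `|f (h x)|%:E = \int[m]_x `|f x|%:E)%E.
  apply: E; last by move=> x; rewrite lee_fin.
  by apply/measurable_EFinP; exact: measurableT_comp.
have mfh : measurable_fun setT (f \o h) by exact: measurableT_comp.
split=> /integrableP[_ fi]; apply/integrableP; split; try exact/measurable_EFinP.
  have I0 : (0 <= \int[m]_x `|f (h x)|%:E)%E by apply: integral_ge0 => x _; rewrite lee_fin.
  move: fi; rewrite /= -E; move: I0; case: (\int[m]_x `|f (h x)|%:E)%E => //= [r _ _|_].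
    by rewrite ltry.
  by rewrite mulry gtr0_sg// mul1e.
by rewrite /= -E lte_mul_pinfty// ?lee_fin ltW.
Qed.

Lemma scales_Rint (f : T -> R) : igr m f -> c * \int[m]_x f (h x) = \int[m]_x f x.
Proof.
move=> fi; have mf := igr_meas fi.
have fhi := (scales_igr mf).1 fi.
have [mh H] := hc.
rewrite /Rintegral -[c * _]/(fine c%:E * fine _) -fineM//; last first.
  exact: integrable_fin_num.
congr fine; rewrite integralE [RHS]integralE.
have mE : measurable_fun setT (EFin \o f) by exact/measurable_EFinP.
have e1 := integrable_pos_fin_num measurableT fhi.
have e2 := integrable_neg_fin_num measurableT fhi.
rewrite muleBr//; last by apply: fin_num_adde_defr.
congr (_ - _)%E.
  rewrite -(H _ (measurable_funepos mE) (funepos_ge0 _)); congr (_ * _)%E.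
  by apply: eq_integral => x _; rewrite !funeposE.
rewrite -(H _ (measurable_funeneg mE) (funeneg_ge0 _)); congr (_ * _)%E.
by apply: eq_integral => x _; rewrite !funenegE.
Qed.

Lemma scales_cigr (f : T -> R[i]) : cmeas f -> cigr m f <-> cigr m (f \o h).
Proof. by move=> [f1 f2]; rewrite /cigr (scales_igr f1) (scales_igr f2). Qed.

Lemma scales_ci (f : T -> R[i]) : cigr m f -> c%:C * ci m (f \o h) = ci m f.
Proof.
move=> [f1 f2]; apply: complex_ext; rewrite ?ReM ?ImM /= mul0r.
  by rewrite subr0 (scales_Rint f1).
by rewrite addr0 (scales_Rint f2).
Qed.
End Scales.

Lemma scales_prod d1 d2 (T1 : measurableType d1) (T2 : measurableType d2)
    (R : realType) (m1 : {sigma_finite_measure set T1 -> \bar R})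
    (m2 : {sigma_finite_measure set T2 -> \bar R}) h1 h2 (c1 c2 : R) :
  0 <= c1 -> 0 <= c2 -> scales m1 h1 c1 -> scales m2 h2 c2 ->
  scales (sfprod m1 m2) (fun z => (h1 z.1, h2 z.2)) (c1 * c2).
Proof.
move=> c10 c20 [mh1 H1] [mh2 H2]; split.
  by apply: measurable_fun_pair; [exact: measurable_fst_comp|exact: measurable_snd_comp].
move=> f mf f0.
have mh : measurable_fun setT (fun z : T1 * T2 => (h1 z.1, h2 z.2)).
  by apply: measurable_fun_pair; [exact: measurable_fst_comp|exact: measurable_snd_comp].
have mfh : measurable_fun setT (fun z : T1 * T2 => f (h1 z.1, h2 z.2)).
  exact: (measurableT_comp mf mh).
rewrite fubini_tonelli1// fubini_tonelli1// /fubini_F/=.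
have mF := @measurable_fun_fubini_tonelli_F _ _ _ _ _ m2 f mf f0.
rewrite -[RHS](H1 _ mF); last by move=> x; apply: integral_ge0 => y _.
rewrite EFinM -muleA; congr (_ * _)%E.
rewrite -ge0_integralZl//; last 2 first.
- exact: (@measurable_fun_fubini_tonelli_F _ _ _ _ _ m2 _ mfh (fun _ => f0 _)).
- by move=> x _; apply: integral_ge0 => y _.
apply: eq_integral => x _; rewrite (H2 (fun y => f (h1 x, y)))//.
exact: measurable_fun_pair2.
Qed.

(** The rescaled image measure agrees with Lebesgue measure on half-open intervals, hence everywhere
    by uniqueness. For a < 0 the preimage of []c, d]] is closed on the left instead, with the same
    length. *)
Lemma scales_lebesgue (R : realType) (a b : R) : a != 0 ->
  scales (@lebesgue_measure R) (fun x => b + a * x) `|a|.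
Proof.
move=> a0.
pose h (x : measurableTypeR R) : measurableTypeR R := b + a * x.
have mh : measurable_fun setT h.
  by apply: measurable_funD => //; exact: mulrl_measurable.
split => // f mf f0.
have ap : 0 <= `|a| by [].
pose mu0 := mscale (NngNum ap) (pushforward (@lebesgue_measure R) h)
  : {measure set (measurableTypeR R) -> \bar R}.
pose mu' := mu0 mh.
transitivity (\int[mu']_x f x)%E.
  rewrite ge0_integral_mscale//= ge0_integral_pushforward//.
apply: eq_measure_integral => A mA _; apply/esym; apply: lebesgue_measure_unique => // X.
case=> -[c d] _ <-; change (lebesgue_measure `]c, d]%classic = (`|a|%:E * lebesgue_measure (h @^-1` `]c, d]))%E).
move: a0; rewrite neq_lt => /orP[a0|a0].
  have -> : h @^-1` `]c, d] = `[(d - b) / a, (c - b) / a[%classic.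
    apply/seteqP; split=> x /=; rewrite !in_itv/= /h.
      by rewrite ler_ndivrMr// ltr_ndivlMr// => /andP[? ?]; apply/andP; split; lra.
    by rewrite ler_ndivrMr// ltr_ndivlMr// => /andP[? ?]; apply/andP; split; lra.
  rewrite !lebesgue_measure_itv/= !lte_fin ltr_nM2r ?invr_lt0// ltrD2r ltr0_norm//.
  case: ifP => cd; last by rewrite mule0.
  rewrite -!EFinD -EFinM; congr EFin; field; lra.
have -> : h @^-1` `]c, d] = `](c - b) / a, (d - b) / a]%classic.
  apply/seteqP; split=> x /=; rewrite !in_itv/= /h.
    by rewrite ler_pdivlMr// ltr_pdivrMr// => /andP[? ?]; apply/andP; split; lra.
  by rewrite ler_pdivlMr// ltr_pdivrMr// => /andP[? ?]; apply/andP; split; lra.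
rewrite !lebesgue_measure_itv/= !lte_fin ltr_pM2r ?invr_gt0// ltrD2r gtr0_norm//.
case: ifP => cd; last by rewrite mule0.
rewrite -!EFinD -EFinM; congr EFin; field; lra.
Qed.

Lemma sfprodE d1 d2 (T1 : measurableType d1) (T2 : measurableType d2)
    (R : realType) (m1 : {sigma_finite_measure set T1 -> \bar R})
    (m2 : {sigma_finite_measure set T2 -> \bar R}) (A : set T1) (B : set T2) :
  measurable A -> measurable B -> (sfprod m1 m2 (A `*` B) = m1 A * m2 B)%E.
Proof. exact: product_measure1E. Qed.

Section Affine.
Variable R : realType.

(** Carries most of the vector arithmetic: [affine3 x 1 y] is x + y, [affine3 x (-1) y] is x - y and
    [affine3 0 t x] is t x, so that one change of variables covers translations, reflections and
    dilations. *)
Definition affine3 (b : R3 R) (a : R) (x : R3 R) : R3 R :=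
  ((b.1.1 + a * x.1.1, b.1.2 + a * x.1.2), b.2 + a * x.2).

Lemma scales_leb3 (b : R3 R) (a : R) : a != 0 ->
  scales (leb3s R) (affine3 b a) (`|a| ^+ 3).
Proof.
move=> a0; rewrite exprSr expr2.
have ap : 0 <= `|a| by [].
have H2 := scales_prod ap ap (scales_lebesgue b.1.1 a0) (scales_lebesgue b.1.2 a0).
exact: (scales_prod (mulr_ge0 ap ap) ap H2 (scales_lebesgue b.2 a0)).
Qed.

Lemma leb3s_box (A B C : set (measurableTypeR R)) : measurable A -> measurable B ->
  measurable C -> (leb3s R ((A `*` B) `*` C) =
    @lebesgue_measure R A * @lebesgue_measure R B * @lebesgue_measure R C)%E.
Proof.
move=> mA mB mC.
apply: etrans (sfprodE _ (@lebesgue_measure R) (measurableX mA mB) mC) _.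
congr (_ * _)%E; exact: sfprodE.
Qed.

Lemma ae_coord_neq0 : {ae leb3s R, forall x : R3meas R,
  [/\ x.1.1 != 0 :> R, x.1.2 != 0 :> R & x.2 != 0 :> R]}.
Proof.
have m0 : measurable ([set 0] : set (measurableTypeR R)) by exact: measurable_set1.
pose A1 : set (R3meas R) := ([set 0] `*` setT) `*` setT.
pose A2 : set (R3meas R) := (setT `*` [set 0]) `*` setT.
pose A3 : set (R3meas R) := (setT `*` setT) `*` [set 0].
have mA1 : measurable A1 by apply: measurableX => //; exact: measurableX.
have mA2 : measurable A2 by apply: measurableX => //; exact: measurableX.
have mA3 : measurable A3 by apply: measurableX => //; exact: measurableX.
have n1 : leb3s R A1 = 0%E.
  by rewrite leb3s_box// [X in (X * _ * _)%E]lebesgue_measure_set1 mul0e mul0e.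
have n2 : leb3s R A2 = 0%E.
  by rewrite leb3s_box// [X in (_ * X * _)%E]lebesgue_measure_set1 mule0 mul0e.
have n3 : leb3s R A3 = 0%E.
  by rewrite leb3s_box// [X in (_ * X)%E]lebesgue_measure_set1 mule0.
have n1' : (leb3s R).-negligible A1 by exists A1; split.
have n2' : (leb3s R).-negligible A2 by exists A2; split.
have n3' : (leb3s R).-negligible A3 by exists A3; split.
apply: negligibleS (negligibleU (negligibleU n1' n2') n3') => x /= H.
have [x1|x1] := eqVneq (x.1.1 : R) 0; first by left; left.
have [x2|x2] := eqVneq (x.1.2 : R) 0; first by left; right.
have [x3|x3] := eqVneq (x.2 : R) 0; first by right.
by exfalso; apply: H.
Qed.
End Affine.

(** * The Gaussian on the line *)

Section RealLine.
Variable R : realType.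
Notation leb := (@lebesgue_measure R).

(* Integrating [F'] over [[-n, n]] and letting [n] go to infinity. *)
Lemma Rint_derive_eq0 (F f : R -> R) : (forall x : R, is_derive x (1 : R) F (f x)) ->
  continuous f -> igr leb f ->
  (fun n : nat => F n%:R) @ \oo --> 0 -> (fun n : nat => F (- n%:R)) @ \oo --> 0 ->
  \int[leb]_x f x = 0.
Proof.
move=> dF cf fi Fp Fm.
have cF : continuous F.
  by move=> x; apply/differentiable_continuous/derivable1_diffP; have [] := dF x.
pose I n : set R := `[- n.+1%:R, n.+1%:R]%classic.
have mI n : measurable (I n : set (measurableTypeR R)) by exact: measurable_itv.
have FTC n : \int[leb]_x (f x * \1_(I n) x) = F n.+1%:R - F (- n.+1%:R).
  apply: EFin_inj; rewrite EFinB -(@continuous_FTC2 R f F).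
  - rewrite Rint_EFin.
      rewrite [RHS]integral_mkcond; apply: eq_integral => x _.
      by rewrite patchE indicE /I; case: ifPn => xI; rewrite ?mulr1 ?mulr0//.
    apply: igr_le (igr_norm fi).
      by apply: measurable_funM; [exact: igr_meas fi|apply: measurable_indic; exact: mI].
    by move=> x; rewrite normrM ler_piMr// indicE; case: (_ \in _); rewrite ?normr1 ?normr0.
  - by rewrite -subr_gt0 opprK addr_gt0.
  - exact: continuous_subspaceT.
  - split.
    + by move=> x _; have [] := dF x.
    + exact/cvg_at_right_filter/cF.
    + exact/cvg_at_left_filter/cF.
  - by move=> x _; rewrite derive1E; have [_ ->] := dF x.
have [||| | |_ L] := @Rdct _ _ _ leb (fun n x => f x * \1_(I n) x) f (fun x => `|f x|).
- by move=> n; apply: measurable_funM; [exact: igr_meas fi|apply: measurable_indic; exact: mI].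
- exact: igr_meas fi.
- apply: aeW => x; apply: cvg_near_cst.
  near=> n; rewrite indicE mem_set ?mulr1// /I /= in_itv/= -ler_norml.
  near: n; exists (Num.truncn `|x|) => // n /= hn.
  apply: ltW; apply: lt_le_trans (truncnS_gt _) _; rewrite ler_nat ltnS//.
- exact: igr_norm.
- by move=> n x; rewrite normrM ler_piMr// indicE; case: (_ \in _); rewrite ?normr1 ?normr0.
have L2 : (fun n : nat => F n.+1%:R - F (- n.+1%:R)) @ \oo --> 0.
  rewrite -[X in _ --> X](subr0 0); apply: cvgB.
    by have := cvg_shiftS (fun n => F n%:R); rewrite /= => ->.
  by have := cvg_shiftS (fun n => F (- n%:R)); rewrite /= => ->.
apply: (cvg_unique (@Rhausdorff R)) L2.
by move: L; under eq_fun do rewrite FTC.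
Unshelve. all: end_near.
Qed.

Lemma expR_pow_bound (n : nat) : exists2 C : R, 0 <= C & forall x : R, 0 <= x -> x ^+ n <= C * expR x.
Proof.
(* Raise x / n <= 1 + x / n <= exp (x / n) to the power n; for n = 0 the constant is 0^0 = 1. *)
exists (n%:R ^+ n) => [|x x0]; first exact: exprn_ge0.
case: n => [|n]; first by rewrite !expr0 mul1r (le_trans _ (expR_ge1Dx x))// lerDl.
have -> : x = n.+1%:R * (x / n.+1%:R) by field; rewrite nat1r.
rewrite expRM_natl exprMn ler_wpM2l ?exprn_ge0//.
rewrite lerXn2r ?nnegrE ?expR_ge0// ?divr_ge0//.
apply: le_trans (expR_ge1Dx _); rewrite lerDr//.
Qed.

Lemma igr_gauss (a : R) : 0 < a -> igr leb (fun x => expR (- (a * x ^+ 2))).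
Proof.
move=> a0; have s0 : Num.sqrt a != 0 by rewrite gt_eqF// sqrtr_gt0.
have H := (@scales_igr _ _ _ _ _ _ (scales_lebesgue 0 s0) _ gauss_fun measurable_gauss_fun).1 integrableT_gauss.
have -> : (fun x => expR (- (a * x ^+ 2))) = gauss_fun \o (fun x => 0 + Num.sqrt a * x).
  by apply/funext => x /=; rewrite /gauss_fun add0r exprMn sqr_sqrtr// ltW.
by apply: H; rewrite normr_gt0.
Qed.

Lemma Rint_gauss : \int[leb]_x expR (- (x ^+ 2 / 2)) = Num.sqrt (2 * pi).
Proof.
have s2 : Num.sqrt (2 : R) != 0 by rewrite gt_eqF// sqrtr_gt0.
have s20 : 0 < `|(Num.sqrt (2 : R))^-1| by rewrite normr_gt0 invr_eq0.
have s2' : (Num.sqrt (2 : R))^-1 != 0 by rewrite invr_eq0.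
have := scales_Rint (scales_lebesgue 0 s2') s20 integrableT_gauss.
have -> : \int[leb]_x gauss_fun x = Num.sqrt pi.
  by apply: EFin_inj; rewrite Rint_EFin ?integralT_gauss//; exact: integrableT_gauss.
have e x : gauss_fun (0 + (Num.sqrt 2)^-1 * x) = expR (- (x ^+ 2 / 2)).
  by rewrite /gauss_fun add0r exprMn exprVn sqr_sqrtr// mulrC.
under eq_Rintegral do rewrite e.
by move=> H; rewrite sqrtrM// -H ger0_norm ?invr_ge0 ?sqrtr_ge0// mulrA mulfV// mul1r.
Qed.

Lemma igr_powgauss (n : nat) (a : R) : 0 < a ->
  igr leb (fun x => `|x| ^+ n * expR (- (a * x ^+ 2))).
Proof.
move=> a0; have [C C0 HC] := expR_pow_bound n.
have ha : 0 < a / 2 by rewrite divr_gt0.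
(* Completing the square, t - a t^2 <= 1 / (2 a) - a t^2 / 2: half of the Gaussian pays for the
   exponential that dominates the power. *)
have h := igrZ (C * expR (1 / (2 * a))) (igr_gauss ha).
apply: igr_le h.
  apply: measurable_funM.
    by apply: measurable_funX; exact: normr_measurable.
  exact: igr_meas (igr_gauss a0).
move=> x; rewrite ger0_norm; last by rewrite mulr_ge0 ?expR_ge0 ?exprn_ge0.
apply: (@le_trans _ _ (C * expR `|x| * expR (- (a * x ^+ 2)))).
  by rewrite ler_wpM2r ?expR_ge0//; exact: HC.
rewrite -!mulrA ler_wpM2l// -!expRD ler_expR -(real_normK (num_real x)).
set t := `|x|.
rewrite -subr_ge0.
have -> : 1 / (2 * a) - a * (2^-1 * t ^+ 2) - (t - a * t ^+ 2) = (a * t - 1) ^+ 2 / (2 * a).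
  by field; rewrite gt_eqF.
by rewrite divr_ge0 ?sqr_ge0// mulr_ge0// ltW.
Qed.

Definition gw (x : R) : R := expR (- (x ^+ 2 / 2)).

Lemma gwE x : gw x = expR (- (2^-1 * x ^+ 2)). Proof. by rewrite /gw mulrC. Qed.

Lemma igr_gw : igr leb gw.
Proof. by have := @igr_gauss 2^-1; under eq_fun do rewrite -gwE; apply; rewrite invr_gt0. Qed.

Lemma igr_absgw : igr leb (fun x => `|x| * gw x).
Proof.
have := @igr_powgauss 1 2^-1; under eq_fun do rewrite -gwE expr1.
by apply; rewrite invr_gt0.
Qed.

Lemma is_derive_gw (x : R) : is_derive x (1 : R) gw (- x * gw x).
Proof.
rewrite /gw; apply: is_derive_eq.
by rewrite /GRing.scale/=; field.
Qed.

Lemma continuous_gw : continuous gw.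
Proof.
by move=> x; apply/differentiable_continuous/derivable1_diffP; have [] := is_derive_gw x.
Qed.

Lemma gw_ge0 x : 0 <= gw x. Proof. exact: expR_ge0. Qed.

Lemma cvg_bounded_harmonic (F : nat -> R) (C : R) :
  (forall n, `|F n| <= C * n.+1%:R^-1) -> F @ \oo --> 0.
Proof.
move=> H; have h : (fun n => C * n.+1%:R^-1) @ \oo --> C * 0.
  by apply: cvgM; [exact: cvg_cst|exact: cvg_harmonic].
rewrite mulr0 in h.
apply: (@squeeze_cvgr _ _ _ _ (fun n => - (C * n.+1%:R^-1)) (fun n => C * n.+1%:R^-1)) => //.
  by apply: nearW => n; rewrite -ler_norml.
by rewrite -oppr0; exact: cvgN.
Qed.

Lemma gw_nat_le (n : nat) : gw n%:R <= 2 * n.+1%:R^-1.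
Proof.
rewrite /gw expRN; apply: (@le_trans _ _ (1 + n%:R ^+ 2 / 2)^-1).
  by rewrite lef_pV2 ?posrE ?expR_gt0 ?expR_ge1Dx// ltr_wpDr// divr_ge0// sqr_ge0.
rewrite -[2 in leRHS]invrK -invfM lef_pV2 ?posrE ?mulr_gt0 ?invr_gt0//.
rewrite -subr_ge0 -[n.+1%:R]natr1.
have -> : 1 + n%:R ^+ 2 / 2 - 2^-1 * (n%:R + 1) = ((n%:R - 2^-1) ^+ 2 + 3/4) / 2 :> R by field.
by rewrite divr_ge0// addr_ge0// ?sqr_ge0// divr_ge0.
Qed.

(** The cosine transform of the Gaussian, to be computed from the equation cgw' = - t cgw, which
    comes from differentiation under the integral followed by integration by parts. *)
Definition cgw (t : R) : R := \int[leb]_x (cos (t * x) * gw x).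

Lemma measurable_cosM (t : R) : measurable_fun setT (fun x : measurableTypeR R => cos (t * x)).
Proof.
apply: (measurableT_comp (continuous_measurable_fun (@continuous_cos R))).
exact: mulrl_measurable.
Qed.

Lemma measurable_sinM (t : R) : measurable_fun setT (fun x : measurableTypeR R => sin (t * x)).
Proof.
apply: (measurableT_comp (continuous_measurable_fun (@continuous_sin R))).
exact: mulrl_measurable.
Qed.

Lemma norm_cos_le1 (x : R) : `|cos x| <= 1.
Proof. by rewrite ler_norml cos_geN1 cos_le1. Qed.

Lemma norm_sin_le1 (x : R) : `|sin x| <= 1.
Proof. by rewrite ler_norml sin_geN1 sin_le1. Qed.

Lemma igr_cosgw t : igr leb (fun x => cos (t * x) * gw x).
Proof.
apply: igr_le igr_gw.
  by apply: measurable_funM; [exact: measurable_cosM|exact: igr_meas igr_gw].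
by move=> x; rewrite normrM (ger0_norm (gw_ge0 x)) ler_piMl ?gw_ge0// norm_cos_le1.
Qed.

Lemma igr_xsingw t : igr leb (fun x => x * sin (t * x) * gw x).
Proof.
apply: igr_le igr_absgw.
  apply: measurable_funM; last exact: igr_meas igr_gw.
  by apply: measurable_funM => //; exact: measurable_sinM.
move=> x; rewrite !normrM (ger0_norm (gw_ge0 x)) ler_wpM2r ?gw_ge0// ler_piMr//.
exact: norm_sin_le1.
Qed.

Lemma derive_cgw (t : R) : is_derive t (1 : R) cgw (- \int[leb]_x (x * sin (t * x) * gw x)).
Proof.
have dF (s x : R) : is_derive s (1 : R) (fun s => cos (s * x) * gw x) (- (x * sin (s * x) * gw x)).
  apply: is_derive_eq.
  rewrite /GRing.scale/=; ring.
have tI : (`]t - 1, t + 1[%classic : set R) t by rewrite /= in_itv/=; apply/andP; split; lra.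
have h1 (s : R) : (`]t - 1, t + 1[%classic : set R) s -> igr leb (fun x => cos (s * x) * gw x).
  by move=> _; exact: igr_cosgw.
have h2 (s : R) (x : measurableTypeR R) : (`]t - 1, t + 1[%classic : set R) s -> setT x ->
  derivable (fun s : R => cos (s * x) * gw x) s (1 : R) by move=> _ _; have [] := dF s x.
have h3 (x : measurableTypeR R) : 0 <= `|x| * gw x by rewrite mulr_ge0 ?gw_ge0.
have e (s : R) (x : measurableTypeR R) : partial1of2 (fun (s : R) (x : measurableTypeR R) => cos (s * x) * gw x) s x = - (x * sin (s * x) * gw x).
  by rewrite partial1of2E; have [_ ->] := dF s x.
have h4 (s : R) (x : measurableTypeR R) : (`]t - 1, t + 1[%classic : set R) s -> setT x ->
  `|partial1of2 (fun (s : R) (x : measurableTypeR R) => cos (s * x) * gw x) s x| <= `|x| * gw x.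
  move=> _ _; rewrite e normrN !normrM (ger0_norm (gw_ge0 x)) ler_wpM2r ?gw_ge0// ler_piMr//.
  exact: norm_sin_le1.
have A := derivable_under_integral measurableT tI h1 h2 h3 igr_absgw h4.
have B := differentiation_under_integral measurableT tI h1 h2 h3 igr_absgw h4.
apply: DeriveDef => //; rewrite -derive1E B.
under eq_Rintegral do rewrite e -mulN1r.
by rewrite RintegralZl// ?mulN1r//; exact: igr_xsingw.
Qed.

Lemma parts_cgw (t : R) : \int[leb]_x (x * sin (t * x) * gw x) = t * cgw t.
Proof.
have igrD' : igr leb (fun x => t * (cos (t * x) * gw x) - x * sin (t * x) * gw x).
  by apply: igrB; [apply: igrZ; exact: igr_cosgw|exact: igr_xsingw].
have : \int[leb]_x (t * (cos (t * x) * gw x) - x * sin (t * x) * gw x) = 0.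
  apply: (@Rint_derive_eq0 (fun x : R => sin (t * x) * gw x)) => //.
  - move=> x; have ? := is_derive_gw x; apply: is_derive_eq.
    rewrite /GRing.scale/=; ring.
  - move=> x; apply: cvgB; apply: cvgM.
    + exact: cvg_cst.
    + apply: cvgM; last exact: continuous_gw.
      by apply: continuous_comp; [exact: mulrl_continuous|exact: continuous_cos].
    + apply: cvgM; first exact: cvg_id.
      by apply: continuous_comp; [exact: mulrl_continuous|exact: continuous_sin].
    + exact: continuous_gw.
  - apply: (@cvg_bounded_harmonic _ 2) => n; apply: le_trans (gw_nat_le n).
    by rewrite normrM (ger0_norm (gw_ge0 _)) ler_piMl ?gw_ge0// norm_sin_le1.
  - apply: (@cvg_bounded_harmonic _ 2) => n; apply: le_trans (gw_nat_le n).
    have -> : gw n%:R = gw (- n%:R) by rewrite /gw sqrrN.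
    by rewrite normrM (ger0_norm (gw_ge0 _)) ler_piMl ?gw_ge0// norm_sin_le1.
rewrite RintegralB//; [|by apply: igrZ; exact: igr_cosgw|exact: igr_xsingw].
rewrite RintegralZl//; last exact: igr_cosgw.
by move/eqP; rewrite subr_eq0 => /eqP <-.
Qed.

(* [t |-> cgw t * expR (t^2/2)] has derivative zero. *)
Lemma cgwE (t : R) : cgw t = Num.sqrt (2 * pi) * gw t.
Proof.
have H (s : R) : is_derive s (1 : R) (fun s : R => cgw s * expR (s ^+ 2 / 2)) 0.
  have K := derive_cgw s; rewrite parts_cgw in K.
  apply: is_derive_eq.
  by rewrite /GRing.scale/=; field.
have := is_derive_0_is_cst t 0 H.
rewrite expr0n/= mul0r expR0 mulr1 {2}/cgw.
under eq_Rintegral do rewrite mul0r cos0 mul1r.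
rewrite Rint_gauss => <-.
by rewrite -mulrA /gw -expRD subrr expR0 mulr1.
Qed.

Lemma cigr_expigw t : cigr leb (fun x : measurableTypeR R => cexpi (t * x) * (gw x)%:C).
Proof.
apply: (@cigr_le _ _ _ leb _ gw).
- apply: cmeasM; last by apply: cmeas_real; exact: igr_meas igr_gw.
  by apply: cmeas_expi; exact: mulrl_measurable.
- by move=> x; rewrite cabsM cabs_expi mul1r cabs_real ger0_norm ?gw_ge0.
- exact: igr_gw.
Qed.

(** The reflection x -> - x conjugates the integrand, so the integral is real and equals its cosine
    part. *)
Lemma gwcE (t : R) : ci leb (fun x : measurableTypeR R => cexpi (t * x) * (gw x)%:C) =
  (Num.sqrt (2 * pi) * gw t)%:C.
Proof.
have n1 : (-1 : R) != 0 by rewrite oppr_eq0.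
have p1 : 0 < `|-1 : R| by rewrite normrN1.
have := scales_ci (scales_lebesgue 0 n1) p1 (cigr_expigw t).
have -> : (fun x : measurableTypeR R => cexpi (t * x) * (gw x)%:C) \o (fun x => 0 + -1 * x) =
   fun x : measurableTypeR R => conjc (cexpi (t * x) * (gw x)%:C).
  apply/funext => x; rewrite conjcM conjc_realE expi_conj; congr (cexpi _ * _%:C).
    by ring.
  by rewrite /gw add0r mulN1r sqrrN.
rewrite normrN1 mul1r ci_conj; last exact: cigr_expigw.
set z := ci _ _ => zz; apply: complex_ext.
  rewrite /z /ci -[RHS]cgwE; apply: eq_Rintegral => x _; rewrite ReM /= mulr0 subr0//.
by have := congr1 (@complex.Im R) zz; rewrite Im_conj /=; lra.
Qed.
End RealLine.

(** * The Riesz kernel and the trilinear integral *)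

Section PowerIntegrals.
Variable R : realType.
Notation leb := (@lebesgue_measure R).

Lemma continuous_powR_gt0 (p x : R) : 0 < x -> {for x, continuous (@powR R ^~ p)}.
Proof.
move=> x0; apply/differentiable_continuous/derivable1_diffP.
by have [] := is_derive1_powR p x0.
Qed.

Lemma integral_powR (p a b : R) : 0 < a -> a < b -> p != 0 ->
  (\int[leb]_(x in `[a, b]) (x `^ (p - 1))%:E = ((b `^ p - a `^ p) / p)%:E)%E.
Proof.
move=> a0 ab p0.
have dF (x : R) : 0 < x -> is_derive x (1 : R) (fun x => p^-1 * x `^ p) (x `^ (p - 1)).
  move=> x0; have K := is_derive1_powR p x0.
  have -> : x `^ (p - 1) = p^-1 *: (p * x `^ (p - 1)).
    by rewrite /GRing.scale/= mulrA mulVf// mul1r.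
  exact: is_deriveZ.
rewrite (@continuous_FTC2 R (fun x => x `^ (p - 1)) (fun x => p^-1 * x `^ p)) //.
- by rewrite -EFinB -mulrBr mulrC.
- have cp x : a <= x -> {for x, continuous (@powR R ^~ (p - 1))}.
    by move=> ax; apply: continuous_powR_gt0; exact: lt_le_trans ax.
  apply/(continuous_within_itvP _ ab); split.
  + by move=> x; rewrite in_itv/= => /andP[/ltW ax _]; exact: cp.
  + exact/cvg_at_right_filter/cp.
  + exact/cvg_at_left_filter/cp/ltW.
- have cp x : a <= x -> {for x, continuous (fun x => p^-1 * x `^ p)}.
    move=> ax; apply: cvgM; first exact: cvg_cst.
    by apply: continuous_powR_gt0; exact: lt_le_trans ax.
  split.
  + move=> x; rewrite in_itv/= => /andP[ax _].
    by have [] := dF _ (lt_trans a0 ax).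
  + exact/cvg_at_right_filter/cp.
  + exact/cvg_at_left_filter/cp/ltW.
- move=> x; rewrite in_itv/= => /andP[ax _].
  by rewrite derive1E; have [_ ->] := dF _ (lt_trans a0 ax).
Qed.

(** Exhaustion by growing compact intervals treats the singular endpoint 0 and the endpoint at
    infinity in one statement. *)
Lemma integral_powR_bigcup (p C : R) (a b : nat -> R) :
  (forall n, 0 < a n) -> (forall n, a n < b n) -> p != 0 ->
  (forall m n, (m <= n)%N -> a n <= a m) -> (forall m n, (m <= n)%N -> b m <= b n) ->
  (forall n, (b n `^ p - a n `^ p) / p <= C) ->
  (\int[leb]_(x in \bigcup_n `[a n, b n]%classic) (x `^ (p - 1))%:E < +oo)%E.
Proof.
move=> a0 ab p0 an bn H.
have mp (D : set (measurableTypeR R)) : measurable_fun D (fun x : measurableTypeR R => (x `^ (p - 1))%:E).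
  by apply/measurable_EFinP; apply: (@measurable_funS _ _ _ _ setT) => //; exact: measurable_powR.
pose I n : set (measurableTypeR R) := `[a n, b n]%classic.
have hI : {homo I : n m / (n <= m)%N >-> (n <= m)%O}.
  move=> m n mn; apply/subsetPset => x; rewrite /I /= !in_itv/= => /andP[ax xb].
  by rewrite (le_trans (an _ _ mn) ax) (le_trans xb (bn _ _ mn)).
have mI n : measurable (I n) by exact: measurable_itv.
have L := @ge0_nondecreasing_set_cvg_integral _ _ R I (fun x => (x `^ (p - 1))%:E) leb hI mI
  (fun n => mp (I n)) (fun n x _ => powR_ge0 _ _).
apply: (@le_lt_trans _ _ C%:E); last by rewrite ltry.
rewrite -(cvg_lim _ L)//; apply: lime_le.
  by apply/cvg_ex; eexists; exact: L.
by apply: nearW => n; rewrite integral_powR// lee_fin.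
Qed.

(** The exponents are a third of those of the kernel in R^3: -5/9 > -1 is integrable at 0, and -10/9
    < -1 at infinity. *)
Definition sing (x : R) : R := (x `^ (- (5 / 9))) * \1_(`]0, 1]%classic) x.
Definition tail (x : R) : R := (x `^ (- (10 / 9))) * \1_(`[1, +oo[%classic) x.

Lemma igr_restr (f : R -> R) (D : set (measurableTypeR R)) : measurable D ->
  measurable_fun setT (f : measurableTypeR R -> R) -> (forall x, 0 <= f x) ->
  (\int[leb]_(x in D) (f x)%:E < +oo)%E -> igr leb (fun x => f x * \1_D x).
Proof.
move=> mD mf f0 fi; apply/igr_ge0P.
- by apply: measurable_funM => //; exact: measurable_indic.
- by move=> x; rewrite mulr_ge0 ?f0.
suff <- : (\int[leb]_(x in D) (f x)%:E = \int[leb]_x (f x * \1_D x)%:E)%E by [].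
rewrite [LHS]integral_mkcond; apply: eq_integral => x _.
by rewrite patchE indicE; case: ifPn => _; rewrite ?mulr1 ?mulr0.
Qed.

Lemma igr_sing : igr leb sing.
Proof.
apply: igr_restr; [exact: measurable_itv|exact: measurable_powR|by move=> x; exact: powR_ge0|].
have e : - (5 / 9) = 4 / 9 - 1 :> R by field.
rewrite e.
have -> : `]0, 1]%classic = \bigcup_n `[n.+2%:R^-1, 1]%classic :> set R.
  apply/seteqP; split => x.
    rewrite /= in_itv/= => /andP[x0 x1].
    exists (Num.truncn x^-1) => //=; rewrite in_itv/= x1 andbT.
    rewrite -[leRHS]invrK lef_pV2 ?posrE ?invr_gt0//.
    by apply: ltW; apply: lt_trans (truncnS_gt _) _; rewrite ltr_nat.
  case=> n _; rewrite /= !in_itv/= => /andP[nx ->]; rewrite andbT.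
  by apply: lt_le_trans nx; rewrite invr_gt0.
apply: (@integral_powR_bigcup _ (9 / 4)) => //.
- by move=> n; rewrite invf_lt1// ltr1n.
- by move=> m n mn; rewrite lef_pV2 ?posrE// ler_nat ltnS.
- move=> n; rewrite powR1 ler_pdivrMr//.
  have := powR_ge0 (n.+2%:R^-1 : R) (4 / 9); lra.
Qed.

Lemma igr_tail : igr leb tail.
Proof.
apply: igr_restr; [exact: measurable_itv|exact: measurable_powR|by move=> x; exact: powR_ge0|].
have e : - (10 / 9) = - (1 / 9) - 1 :> R by field.
rewrite e.
have -> : `[1, +oo[%classic = \bigcup_n `[1, n.+2%:R]%classic :> set R.
  apply/seteqP; split => x.
    rewrite /= in_itv/= andbT => x1.
    exists (Num.truncn x) => //=; rewrite in_itv/= x1/=.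
    by apply: ltW; apply: lt_trans (truncnS_gt _) _; rewrite ltr_nat.
  by case=> n _; rewrite /= !in_itv/= andbT => /andP[].
apply: (@integral_powR_bigcup _ 9) => //.
- by move=> n; rewrite ltr1n.
- by move=> m n mn; rewrite ler_nat.
- move=> n; rewrite powR1 ler_ndivrMr ?oppr_lt0 ?divr_gt0//.
  have := powR_ge0 (n.+2%:R : R) (- (1 / 9)); lra.
Qed.

(** The one-dimensional factor whose product over the three coordinates dominates the kernel
    [wker 1] below. *)
Definition J1 (x : R) : R := `|x| `^ (- (5 / 9)) * Num.max `|x| 1 `^ (- (5 / 9)).

Lemma measurable_J1 : measurable_fun setT (J1 : measurableTypeR R -> R).
Proof.
have mn : measurable_fun setT (fun x : measurableTypeR R => `|x|) by exact: normr_measurable.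
apply: measurable_funM; apply: (measurableT_comp (measurable_powR _)) => //.
by apply: measurable_maxr.
Qed.

Lemma igr_J1 : igr leb J1.
Proof.
have n1 : (-1 : R) != 0 by rewrite oppr_eq0.
have p1 : 0 < `|-1 : R| by rewrite normrN1.
have igN f : igr leb f -> igr leb (fun x => f (- x)).
  move=> fi; have := (scales_igr (scales_lebesgue 0 n1) p1 (igr_meas fi)).1 fi.
  by congr (_.-integrable _ _); apply/funext => x /=; rewrite add0r mulN1r.
apply: igr_le (igrD (igrD igr_sing (igN _ igr_sing)) (igrD igr_tail (igN _ igr_tail))).
  exact: measurable_J1.
have J0 x : 0 <= J1 x by rewrite mulr_ge0 ?powR_ge0.
have s0 x : 0 <= sing x by rewrite mulr_ge0 ?powR_ge0.
have t0 x : 0 <= tail x by rewrite mulr_ge0 ?powR_ge0.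
have key x : 0 < x -> J1 x <= sing x + tail x.
  move=> x0; rewrite /J1 gtr0_norm//; have [x1|x1] := leP x 1.
    apply: ler_wpDr => //; rewrite /sing indicE mem_set ?mulr1/=; last by rewrite in_itv/= x0.
    by rewrite powR1 mulr1.
  apply: ler_wpDl => //; rewrite /tail indicE mem_set ?mulr1/=; last by rewrite in_itv/= ltW.
  rewrite -powRD; last by rewrite (gt_eqF x0) implybT.
  by have -> : - (5 / 9) - (5 / 9) = - (10 / 9) :> R by field.
suff H (x : R) : J1 x <= sing x + sing (- x) + (tail x + tail (- x)).
  by move=> x; rewrite ger0_norm//; exact: H.
have [x0|x0|<-] := ltgtP 0 x.
- apply: le_trans (key _ x0) _; have := s0 (- x); have := t0 (- x); lra.
- have -> : J1 x = J1 (- x) by rewrite /J1 normrN.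
  have nx : 0 < - x by rewrite oppr_gt0.
  apply: le_trans (key _ nx) _; have := s0 x; have := t0 x; lra.
(* By convention 0 to a nonzero power is 0, so J1 vanishes at the origin. *)
- rewrite /J1 normr0 powR0 ?mul0r; last by rewrite oppr_eq0 gt_eqF.
  by rewrite !addr_ge0.
Qed.
End PowerIntegrals.

Section AlmostEverywhere.
Context d1 d2 (T1 : measurableType d1) (T2 : measurableType d2) (R : realType)
  (m1 : {sigma_finite_measure set T1 -> \bar R})
  (m2 : {sigma_finite_measure set T2 -> \bar R}).

Lemma ae_fst (P : T1 -> Prop) : {ae m1, forall x, P x} ->
  {ae sfprod m1 m2, forall z, P z.1}.
Proof.
move=> [N [mN N0 PN]]; exists (N `*` setT); split.
- exact: measurableX.
- by rewrite sfprodE// N0 mul0e.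
- by move=> z /= Pz; split => //; exact: PN.
Qed.

Lemma ae_snd (P : T2 -> Prop) : {ae m2, forall x, P x} ->
  {ae sfprod m1 m2, forall z, P z.2}.
Proof.
move=> [N [mN N0 PN]]; exists (setT `*` N); split.
- exact: measurableX.
- by rewrite sfprodE// N0 mule0.
- by move=> z /= Pz; split => //; exact: PN.
Qed.
End AlmostEverywhere.

Lemma igr_le_ae d (T : measurableType d) (R : realType)
    (mu : {measure set T -> \bar R}) (f g : T -> R) : measurable_fun setT f ->
  {ae mu, forall x, `|f x| <= g x} -> igr mu g -> igr mu f.
Proof.
move=> mf fg gi; apply/integrableP; split; first exact/measurable_EFinP.
have /integrableP[_] := gi; apply: le_lt_trans.
apply: ae_ge0_le_integral => //.
- by apply: measurableT_comp => //; exact/measurable_EFinP.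
- by apply: measurableT_comp => //; exact/measurable_EFinP/(igr_meas gi).
by apply: filterS fg => x H _ /=; rewrite lee_fin (le_trans H)// ler_norm.
Qed.

(** * The Euclidean norm and the Riesz kernel bound *)

Section Norm3.
Variable R : realType.
Implicit Types x y z : R3 R.

Lemma dotE x y : dot x y = x.1.1 * y.1.1 + x.1.2 * y.1.2 + x.2 * y.2.
Proof. by rewrite /dot !big_ord_recr big_ord0 /= add0r. Qed.

Lemma dot_ge0 x : 0 <= dot x x.
Proof. by rewrite dotE !addr_ge0// -expr2 sqr_ge0. Qed.

Lemma enorm_ge0 x : 0 <= enorm x. Proof. exact: sqrtr_ge0. Qed.

Lemma enorm_sqr x : enorm x ^+ 2 = dot x x.
Proof. by rewrite sqr_sqrtr// dot_ge0. Qed.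

Lemma le_enorm x y : (enorm x <= enorm y) = (dot x x <= dot y y).
Proof. by rewrite -!enorm_sqr ler_sqr ?nnegrE ?enorm_ge0. Qed.

Lemma coord_le_enorm x : [/\ `|x.1.1| <= enorm x, `|x.1.2| <= enorm x & `|x.2| <= enorm x].
Proof.
by split; rewrite -sqrtr_sqr ler_wsqrtr// dotE;
  have := sqr_ge0 x.1.1; have := sqr_ge0 x.1.2; have := sqr_ge0 x.2; rewrite !expr2; lra.
Qed.

Lemma enorm_scale (a : R) x : enorm (affine3 0 a x) = `|a| * enorm x.
Proof.
rewrite /enorm -sqrtr_sqr -sqrtrM ?sqr_ge0//; congr Num.sqrt.
by rewrite !dotE /=; ring.
Qed.

Lemma enorm_eq0 x : enorm x = 0 -> x = 0.
Proof.
move=> x0; have [] := coord_le_enorm x; rewrite x0 !normr_le0.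
by case: x {x0} => [[a b] c] /= /eqP -> /eqP -> /eqP ->.
Qed.

Lemma measurable_dot (d : measure_display) (T : measurableType d) (f g : T -> R3meas R) :
  measurable_fun setT f -> measurable_fun setT g ->
  measurable_fun setT (fun t => dot (f t) (g t)).
Proof.
move=> mf mg; under eq_fun do rewrite dotE.
have m1 (h : T -> R3meas R) : measurable_fun setT h -> measurable_fun setT (fun t => (h t).1.1 : measurableTypeR R).
  by move=> mh; apply: (measurableT_comp measurable_fst); exact: (measurableT_comp measurable_fst).
have m2 (h : T -> R3meas R) : measurable_fun setT h -> measurable_fun setT (fun t => (h t).1.2 : measurableTypeR R).
  by move=> mh; apply: (measurableT_comp measurable_snd); exact: (measurableT_comp measurable_fst).
have m3 (h : T -> R3meas R) : measurable_fun setT h -> measurable_fun setT (fun t => (h t).2 : measurableTypeR R).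
  by move=> mh; exact: (measurableT_comp measurable_snd).
apply: measurable_funD; first apply: measurable_funD; apply: measurable_funM.
- exact: m1.
- exact: m1.
- exact: m2.
- exact: m2.
- exact: m3.
- exact: m3.
Qed.

Lemma measurable_affine3 (d : measure_display) (T : measurableType d) (f g : T -> R3meas R) (a : R) :
  measurable_fun setT f -> measurable_fun setT g ->
  measurable_fun setT (fun t => affine3 (f t) a (g t) : R3meas R).
Proof.
move=> mf mg.
have m1 (h : T -> R3meas R) : measurable_fun setT h -> measurable_fun setT (fun t => (h t).1.1 : measurableTypeR R).
  by move=> mh; apply: (measurableT_comp measurable_fst); exact: (measurableT_comp measurable_fst).
have m2 (h : T -> R3meas R) : measurable_fun setT h -> measurable_fun setT (fun t => (h t).1.2 : measurableTypeR R).
  by move=> mh; apply: (measurableT_comp measurable_snd); exact: (measurableT_comp measurable_fst).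
have m3 (h : T -> R3meas R) : measurable_fun setT h -> measurable_fun setT (fun t => (h t).2 : measurableTypeR R).
  by move=> mh; exact: (measurableT_comp measurable_snd).
have ma (p q : T -> measurableTypeR R) : measurable_fun setT p -> measurable_fun setT q ->
    measurable_fun setT (fun t => p t + a * q t : measurableTypeR R).
  by move=> mp mq; apply: measurable_funD => //; apply: measurable_funM.
apply: measurable_fun_pair; first apply: measurable_fun_pair.
- exact: ma (m1 _ mf) (m1 _ mg).
- exact: ma (m2 _ mf) (m2 _ mg).
- exact: ma (m3 _ mf) (m3 _ mg).
Qed.

Lemma measurable_enorm : measurable_fun setT (@enorm R : R3meas R -> R).
Proof.
have -> : @enorm R = fun x => dot x x `^ 2^-1.
  by apply/funext => x; rewrite powR12_sqrt// dot_ge0.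
apply: (measurableT_comp (measurable_powR _)).
exact: (@measurable_dot _ (R3meas R) id id).
Qed.

Lemma measurable_enorm_powR (p : R) :
  measurable_fun setT (fun x : R3meas R => enorm x `^ p).
Proof. exact: (measurableT_comp (measurable_powR _) measurable_enorm). Qed.

Lemma ae_neq0 : {ae leb3s R, forall x : R3meas R, x != 0 :> R3 R}.
Proof.
have := @ae_coord_neq0 R; apply: filterS => x [x1 _ _].
by apply: contra_neq x1 => ->.
Qed.

Lemma enorm_gt0 x : x != 0 -> 0 < enorm x.
Proof.
by move=> x0; rewrite lt_neqAle enorm_ge0 andbT; apply: contra_neq x0 => /esym /enorm_eq0.
Qed.

(* Integrable for [r > 0]: the exponents are [-5/3] at the origin and [-10/3] at infinity. *)
Definition wker (r : R) x : R := enorm x `^ (- (5 / 3)) * Num.max (enorm x) r `^ (- (5 / 3)).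

Lemma measurable_wker r : measurable_fun setT (wker r : R3meas R -> R).
Proof.
apply: measurable_funM; first exact: measurable_enorm_powR.
apply: (measurableT_comp (measurable_powR _)); apply: measurable_maxr => //.
exact: measurable_enorm.
Qed.

Lemma wker_ge0 r x : 0 <= wker r x. Proof. by rewrite mulr_ge0// powR_ge0. Qed.

Lemma powRN_le (p a b : R) : 0 <= p -> 0 < a -> a <= b -> b `^ (- p) <= a `^ (- p).
Proof.
move=> p0 a0 ab; rewrite !powRN lef_pV2 ?posrE ?powR_gt0//; last exact: lt_le_trans ab.
by rewrite ge0_ler_powR// nnegrE ltW// (lt_le_trans a0).
Qed.

(** Each |x_i| is at most |x|, so a negative power of |x| split into three equal factors is bounded
    by the product of the corresponding powers of the |x_i|. The bound fails where a coordinate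
    vanishes, by the convention for powers of 0; that set is null. *)
Lemma igr_wker1 : igr (leb3s R) (wker 1).
Proof.
have J0 (x : measurableTypeR R) : 0 <= J1 x by rewrite mulr_ge0 ?powR_ge0.
have I2 : igr (sfprod (@lebesgue_measure R) (@lebesgue_measure R)) (fun p : measurableTypeR R * measurableTypeR R => J1 p.1 * J1 p.2).
  by apply: igr_prod_ge0 => //; exact: igr_J1.
have I3 : igr (leb3s R) (fun p : R3meas R => (J1 p.1.1 * J1 p.1.2) * J1 p.2).
  have J2 (p : measurableTypeR R * measurableTypeR R) : 0 <= J1 p.1 * J1 p.2 by exact: mulr_ge0.
  exact: (igr_prod_ge0 J2 J0 I2 (@igr_J1 R)).
apply: igr_le_ae I3; first exact: measurable_wker.
apply: filterS (@ae_coord_neq0 R) => x [x1 x2 x3].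
rewrite ger0_norm ?wker_ge0//.
have [c1 c2 c3] := coord_le_enorm x.
have e0 : 0 < enorm x by apply: lt_le_trans c1; rewrite normr_gt0.
have split3 (y : R) : 0 < y -> y `^ (- (5 / 3)) = y `^ (- (5 / 9)) * y `^ (- (5 / 9)) * y `^ (- (5 / 9)).
  by move=> y0; rewrite -!powRD ?(gt_eqF y0) ?implybT//; congr (_ `^ _); field.
have m0 : 0 < Num.max (enorm x) 1 by rewrite lt_max e0.
rewrite /wker !split3// /J1.
have p59 : 0 <= 5 / 9 :> R by [].
have q (y : R) : y != 0 -> `|y| <= enorm x ->
    enorm x `^ (- (5 / 9)) * Num.max (enorm x) 1 `^ (- (5 / 9)) <=
    `|y| `^ (- (5 / 9)) * Num.max `|y| 1 `^ (- (5 / 9)).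
  move=> y0 yx; apply: ler_pM; rewrite ?powR_ge0//.
    by apply: powRN_le => //; rewrite normr_gt0.
  apply: powRN_le; rewrite ?lt_max ?ltr01 ?orbT//.
  by rewrite ge_max !le_max yx lexx/= orbT.
set a := enorm x `^ _; set b := Num.max _ _ `^ _.
have -> : a * a * a * (b * b * b) = (a * b) * (a * b) * (a * b) by ring.
have ab0 : 0 <= a * b by rewrite mulr_ge0// powR_ge0.
apply: ler_pM; [exact: mulr_ge0|by []| |exact: q].
by apply: ler_pM => //; exact: q.
Qed.

(** Homogeneity: x -> r x multiplies the kernel by r^(-10/3) and the measure by r^3, which leaves
    r^(-1/3). *)
Lemma int_wker (r : R) : 0 < r ->
  (\int[leb3s R]_x (wker r x)%:E = (r `^ (- (1 / 3)))%:E * \int[leb3s R]_x (wker 1 x)%:E)%E.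
Proof.
move=> r0; have rn0 : r != 0 by rewrite gt_eqF.
have [_ H] := scales_leb3 0 rn0.
rewrite -H; last 2 first.
- by apply/measurable_EFinP; exact: measurable_wker.
- by move=> x; rewrite lee_fin wker_ge0.
have e x : wker r (affine3 0 r x) = r `^ (- (10 / 3)) * wker 1 x.
  rewrite /wker enorm_scale gtr0_norm//.
  have -> : Num.max (r * enorm x) r = r * Num.max (enorm x) 1 by rewrite maxr_pMr ?mulr1// ltW.
  rewrite !powRM ?enorm_ge0 ?(ltW r0)//; last by rewrite le_max enorm_ge0.
  have -> : r `^ (- (10 / 3)) = r `^ (- (5 / 3)) * r `^ (- (5 / 3)).
    by rewrite -powRD ?rn0 ?implybT//; congr (_ `^ _); field.
  by ring.
under eq_integral do rewrite e.
rewrite int_scale; last 3 first.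
- exact: measurable_wker.
- exact: wker_ge0.
- exact: powR_ge0.
rewrite muleA -EFinM; congr (_%:E * _)%E.
rewrite gtr0_norm// -powR_mulrn ?ltW// -powRD ?rn0 ?implybT//.
by congr (_ `^ _); field.
Qed.

Definition riesz_conv (z : R3 R) : \bar R :=
  (\int[leb3s R]_x (enorm (affine3 z (-1) x) `^ (- (5 / 3)) * enorm x `^ (- (5 / 3)))%:E)%E.

(** The larger of |x| and |z - x| is at least |z| / 2 as well as at least the smaller one. With r =
    |z| / 2 the integrand is thus at most [wker r] at the shorter of the two vectors, and [int_wker]
    applies to both cases. *)
Lemma riesz_conv_le : exists C : R, forall z, z != 0 ->
  (riesz_conv z <= (C * enorm z `^ (- (1 / 3)))%:E)%E.
Proof.
have [W HW] : exists W : R, (\int[leb3s R]_x (wker 1 x)%:E = W%:E)%E.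
  by exists (\int[leb3s R]_x (wker 1 x)); rewrite Rint_EFin//; exact: igr_wker1.
exists (2 * (2^-1) `^ (- (1 / 3)) * W) => z z0.
pose r := enorm z / 2.
have r0 : 0 < r by rewrite divr_gt0// enorm_gt0.
have n1 : (-1 : R) != 0 by rewrite oppr_eq0.
have [mh H] := scales_leb3 z n1.
have mw := measurable_wker r.
have mwh : measurable_fun setT (fun x : R3meas R => wker r (affine3 z (-1) x)).
  exact: (measurableT_comp mw mh).
have {H} := H (fun x => (wker r x)%:E) _ (fun x => wker_ge0 r x).
rewrite normrN1 expr1n mul1e => H.
have {}H : (\int[leb3s R]_x (wker r (affine3 z (-1) x))%:E = \int[leb3s R]_x (wker r x)%:E)%E.
  apply: H; apply/measurable_EFinP; exact: mw.
apply: (@le_trans _ _ (\int[leb3s R]_x (wker r x + wker r (affine3 z (-1) x))%:E)%E).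
  apply: int_le.
  - apply: measurable_funM; last exact: measurable_enorm_powR.
    exact: (measurableT_comp (measurable_enorm_powR _) mh).
  - exact: measurable_funD mw mwh.
  - by move=> x; apply: mulr_ge0; exact: powR_ge0.
  move=> x {mw mwh H mh}; set y := affine3 z (-1) x.
  have zxy : dot z z <= 2 * dot x x + 2 * dot y y.
    rewrite !dotE /y /= -subr_ge0.
    set e := (X in 0 <= X).
    have -> : e = (2 * x.1.1 - z.1.1) ^+ 2 + (2 * x.1.2 - z.1.2) ^+ 2 + (2 * x.2 - z.2) ^+ 2.
      by rewrite /e; ring.
    by rewrite !addr_ge0 ?sqr_ge0.
  have key (p q : R3 R) : enorm p <= enorm q -> dot z z <= 2 * dot p p + 2 * dot q q ->
      enorm q `^ (- (5 / 3)) * enorm p `^ (- (5 / 3)) <= wker r p.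
    move=> pq zpq; rewrite /wker mulrC ler_wpM2l ?powR_ge0//.
    apply: powRN_le; rewrite ?lt_max ?r0 ?orbT//.
    rewrite ge_max pq/= /r ler_pdivrMr// -ler_sqr ?nnegrE ?mulr_ge0 ?enorm_ge0//.
    by rewrite exprMn !enorm_sqr; move: pq; rewrite le_enorm; lra.
  have [xy|yx] := leP (enorm x) (enorm y).
    by apply: ler_wpDr; [exact: wker_ge0|exact: key].
  apply: ler_wpDl; first exact: wker_ge0.
  by rewrite mulrC; apply: key; [exact: ltW|rewrite addrC].
rewrite (int_add (leb3s R) mw mwh (wker_ge0 r) (fun x => wker_ge0 r _)) H {mw mwh H mh}.
rewrite int_wker// HW -EFinM -EFinD lee_fin /r powRM ?enorm_ge0// ?invr_ge0//.
by rewrite le_eqVlt; apply/orP; left; apply/eqP; ring.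
Qed.
End Norm3.

(** * Absolute convergence of the trilinear integral *)

Section Trilinear.
Variable R : realType.
Notation m := (leb3s R).
Implicit Types x y z : R3 R.

Definition opp3 x : R3 R := affine3 0 (-1) x.

Lemma affine3K x y : affine3 (affine3 x (-1) y) 1 y = x.
Proof. by case: x => [[? ?] ?]; rewrite /affine3/= !mul1r !mulN1r !subrK. Qed.

Lemma scales_translate (a : R) y : scales m (fun x => affine3 x a y) 1.
Proof.
have -> : (fun x : R3 R => affine3 x a y) = affine3 (affine3 0 a y) 1.
  by apply/funext => x; rewrite /affine3/= !add0r !mul1r; congr (_, _, _); rewrite addrC.
by have := scales_leb3 (affine3 0 a y) (oner_neq0 R); rewrite normr1 expr1n.
Qed.

Lemma scales_reflect y : scales m (affine3 y (-1)) 1.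
Proof.
have n1 : (-1 : R) != 0 by rewrite oppr_eq0.
by have := scales_leb3 y n1; rewrite normrN1 expr1n.
Qed.

Lemma scales_shear (a : R) : scales (sfprod m m) (fun p => (affine3 p.1 a p.2, p.2)) 1.
Proof.
have mh : measurable_fun setT (fun p : R3meas R * R3meas R => (affine3 p.1 a p.2, p.2) : R3meas R * R3meas R).
  apply: measurable_fun_pair => //.
  by apply: measurable_affine3; [exact: measurable_fst|exact: measurable_snd].
split; first exact: mh.
move=> f mf f0; rewrite mul1e.
have mfh := measurableT_comp mf mh.
apply: etrans (@fubini_tonelli2 _ _ _ _ R m m _ mfh (fun p => f0 _)) _.
apply: etrans (esym (@fubini_tonelli2 _ _ _ _ R m m f mf f0)).
apply: eq_integral => y _; rewrite /fubini_G.
have [_ H] := scales_translate a y.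
have := H (fun x => f (x, y)) (measurable_fun_pair1 y mf) (fun x => f0 _).
by rewrite mul1e.
Qed.

(** A pointwise substitute for Cauchy-Schwarz, by r s t = (a r b s) (t / (a b)); it is used with a =
    |x|^(5/6) and b = |y|^(5/6). *)
Lemma young_weighted (a b r s t : R) : 0 < a -> 0 < b ->
  r * s * t <= a ^+ 2 * r ^+ 2 * (b ^+ 2 * s ^+ 2) + a^-1 ^+ 2 * b^-1 ^+ 2 * t ^+ 2.
Proof.
move=> a0 b0; rewrite -subr_ge0.
have -> : a ^+ 2 * r ^+ 2 * (b ^+ 2 * s ^+ 2) + a^-1 ^+ 2 * b^-1 ^+ 2 * t ^+ 2 - r * s * t =
  ((a * r * b * s - a^-1 * b^-1 * t) ^+ 2 + (a * r * b * s) ^+ 2 + (a^-1 * b^-1 * t) ^+ 2) / 2.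
  by field; rewrite !gt_eqF.
by rewrite divr_ge0 // !addr_ge0 // sqr_ge0.
Qed.

(** The first term of the weighted Young inequality is a product of two energies; the second is the
    kernel [F] below, in which A and B no longer occur. *)
Lemma trilinear_igr (A B C : R3meas R -> R) :
  measurable_fun setT A -> measurable_fun setT B -> measurable_fun setT C ->
  (forall x, 0 <= A x) -> (forall x, 0 <= B x) -> (forall x, 0 <= C x) ->
  igr m (fun x => enorm x `^ (5 / 3) * A x ^+ 2) ->
  igr m (fun x => enorm x `^ (5 / 3) * B x ^+ 2) ->
  igr m (fun x => enorm x `^ (- (1 / 3)) * C x ^+ 2) ->
  igr (sfprod m m) (fun p => A p.1 * B p.2 * C (affine3 p.1 1 p.2)).
Proof.
move=> mA mB mC A0 B0 C0 iA iB iC.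
have mpw (p : R) := measurable_enorm_powR p.
have madd : measurable_fun setT (fun p : R3meas R * R3meas R => affine3 p.1 1 p.2 : R3meas R).
  by apply: measurable_affine3; [exact: measurable_fst|exact: measurable_snd].
have madd' : measurable_fun setT (fun p : R3meas R * R3meas R => affine3 p.1 (-1) p.2 : R3meas R).
  by apply: measurable_affine3; [exact: measurable_fst|exact: measurable_snd].
pose F (p : R3meas R * R3meas R) :=
  enorm p.1 `^ (- (5 / 3)) * enorm p.2 `^ (- (5 / 3)) * C (affine3 p.1 1 p.2) ^+ 2.
have mF : measurable_fun setT F.
  apply: measurable_funM.
    by apply: measurable_funM; [exact: (measurable_fst_comp (mpw _))|exact: (measurable_snd_comp (mpw _))].
  by apply: measurable_funX; exact: (measurableT_comp mC madd).
have F0 p : 0 <= F p.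
  by apply: mulr_ge0; [apply: mulr_ge0; exact: powR_ge0|exact: sqr_ge0].
(* After the shear, Tonelli in y leaves C(x)^2 times the Riesz convolution at x, which is at most a
   multiple of |x|^(-1/3) for x <> 0. *)
have iF : igr (sfprod m m) F.
  apply/(scales_igr (scales_shear (-1)) ltr01 mF).
  apply/tonelliP.
  - exact: (measurableT_comp mF (scales_shear (-1)).1).
  - by move=> p; exact: F0.
  have [K HK] := riesz_conv_le R.
  have e (x y : R3meas R) : F (affine3 x (-1) y, y) =
      C x ^+ 2 * (enorm (affine3 x (-1) y) `^ (- (5 / 3)) * enorm y `^ (- (5 / 3))).
    by rewrite /F/= affine3K; ring.
  have mr (x : R3meas R) : measurable_fun setT (fun y : R3meas R => enorm (affine3 x (-1) y) `^ (- (5 / 3)) * enorm y `^ (- (5 / 3))).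
    by apply: measurable_funM; [exact: (measurableT_comp (mpw _) (scales_reflect x).1)|exact: mpw].
  have r0 (x y : R3meas R) : 0 <= enorm (affine3 x (-1) y) `^ (- (5 / 3)) * enorm y `^ (- (5 / 3)).
    by apply: mulr_ge0; exact: powR_ge0.
  have iK := igrZ K iC.
  have /integrableP[mK] := iK; apply: le_lt_trans.
  apply: ae_ge0_le_integral.
  - exact: measurableT.
  - move=> x _; apply: integral_ge0 => y _; rewrite lee_fin; exact: F0.
  - have := @measurable_fun_fubini_tonelli_F _ _ _ _ _ m (fun p => (F (affine3 p.1 (-1) p.2, p.2))%:E).
    apply.
      by apply/measurable_EFinP; exact: (measurableT_comp mF (scales_shear (-1)).1).
    by move=> p; rewrite lee_fin; exact: F0.
  - by move=> x _; exact: abse_ge0.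
  - exact: measurableT_comp.
  apply: filterS (@ae_neq0 R) => x x0 _.
  under eq_integral do rewrite /= e.
  rewrite (int_scale _ (mr x) (r0 x) (sqr_ge0 _)).
  apply: (@le_trans _ _ ((C x ^+ 2)%:E * (K * enorm x `^ (- (1 / 3)))%:E)%E).
    by apply: lee_wpmul2l; [rewrite lee_fin sqr_ge0|exact: HK].
  rewrite -EFinM /= lee_fin; apply: le_trans (ler_norm _).
  by rewrite le_eqVlt; apply/orP; left; apply/eqP; ring.
have iAB : igr (sfprod m m) (fun p => (enorm p.1 `^ (5 / 3) * A p.1 ^+ 2) * (enorm p.2 `^ (5 / 3) * B p.2 ^+ 2)).
  apply: igr_prod_ge0 iA iB => x.
    by apply: mulr_ge0; [exact: powR_ge0|exact: sqr_ge0].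
  by apply: mulr_ge0; [exact: powR_ge0|exact: sqr_ge0].
apply: igr_le_ae (igrD iAB iF).
  apply: measurable_funM; last exact: (measurableT_comp mC madd).
  by apply: measurable_funM; [exact: (measurable_fst_comp mA)|exact: (measurable_snd_comp mB)].
have a1 := ae_fst m (@ae_neq0 R); have a2 := ae_snd m (@ae_neq0 R).
apply: filterS2 a1 a2 => -[x y] /= x0 y0.
rewrite ger0_norm; last by apply: mulr_ge0; [apply: mulr_ge0|].
rewrite /F/= {mF iF iAB F0 F iA iB iC mA mB mC mpw madd madd'}.
set c := C _; have c0 : 0 <= c by exact: C0.
have sq (t : R3 R) : t != 0 -> enorm t `^ (5 / 3) = (enorm t `^ (5 / 6)) ^+ 2.
  by move=> t0; rewrite -powR_mulrn ?powR_ge0// -powRrM; congr (_ `^ _); field.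
have sq' (t : R3 R) : t != 0 -> enorm t `^ (- (5 / 3)) = ((enorm t `^ (5 / 6))^-1) ^+ 2.
  by move=> t0; rewrite powRN sq// exprVn.
rewrite !sq// !sq'//.
have p0 (t : R3 R) : t != 0 -> 0 < enorm t `^ (5 / 6) by move=> t0; rewrite powR_gt0// enorm_gt0.
have := p0 _ x0; have := p0 _ y0.
set a := enorm x `^ _; set b := enorm y `^ _ => b0 a0.
exact: (young_weighted _ _ _ a0 b0).
Qed.
End Trilinear.

(** * Test functions *)

Section DirectionalCalculus.
Variable R : realType.
Implicit Types (x v a : R3 R) (f g : R3 R -> R).

(** Brings the one-variable chain rule and derivative computations to directional derivatives. *)
Lemma is_derive_line f x v (df : R) :
  is_derive x v f df <-> is_derive (0 : R) (1 : R) (fun h : R => f (h *: v + x)) df.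
Proof.
have E : 'D_v f x = 'D_(1 : R) (fun h : R => f (h *: v + x)) (0 : R).
  apply: (congr1 (fun F : R -> R => lim (F @ 0^'))); apply/funext => h /=.
  by rewrite addr0 scale0r add0r /GRing.scale/= mulr1.
split=> -[d e]; split.
- exact: (derivable1P f x v).1.
- by rewrite -E.
- exact: (derivable1P f x v).2.
- by rewrite E.
Qed.

Lemma is_derive_lin a (b : R) x v : is_derive x v (fun x => dot a x + b) (dot a v).
Proof.
apply/is_derive_line.
have -> : (fun h : R => dot a (h *: v + x) + b) = (fun h : R => h * dot a v + (dot a x + b)).
  by apply/funext => h; rewrite !dotE /= /GRing.scale/=; ring.
apply: is_derive_eq; rewrite /GRing.scale/=; ring.
Qed.

Lemma is_derive_comp_lin (f : R -> R) (df : R) a (b : R) x v :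
  is_derive (dot a x + b) (1 : R) f df ->
  is_derive x v (fun x => f (dot a x + b)) (dot a v * df).
Proof.
move=> Hf; apply/is_derive_line.
have /is_derive_line Hl := is_derive_lin a b x v.
rewrite mulrC; apply: (@is_derive1_comp _ f (fun h : R => dot a (h *: v + x) + b)) => //.
by rewrite scale0r add0r.
Qed.

Lemma continuous_coord : [/\ continuous (fun x : R3 R => x.1.1),
  continuous (fun x : R3 R => x.1.2) & continuous (fun x : R3 R => x.2)].
Proof.
have c1 : continuous (fun x : R3 R => x.1) by move=> x; exact: cvg_fst.
split=> x.
- by apply: (continuous_comp (c1 x)); exact: cvg_fst.
- by apply: (continuous_comp (c1 x)); exact: cvg_snd.
- exact: cvg_snd.
Qed.

Lemma continuous_lin a (b : R) : continuous (fun x : R3 R => dot a x + b).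
Proof.
have [c1 c2 c3] := continuous_coord.
move=> x; under eq_fun do rewrite dotE.
by apply: cvgD; [apply: cvgD; [apply: cvgD|]|exact: cvg_cst]; apply: cvgM;
  [exact: cvg_cst|exact: c1|exact: cvg_cst|exact: c2|exact: cvg_cst|exact: c3].
Qed.

(** Smoothness speaks of all iterated partial derivatives at once; it is enough to exhibit a class
    of continuous, derivable functions stable under each partial derivative. *)
Lemma smooth_coind (P : (R3 R -> R) -> Prop) :
  (forall f, P f -> continuous f /\ forall i x, derivable f x (basis3 R i) ) ->
  (forall f i, P f -> P (partial i f)) -> forall f, P f -> smooth f.
Proof.
move=> P1 P2 f Pf s.
suff Ps : P (partials s f) by have [] := P1 _ Ps; split.
by elim: s => [//|i s ih] /=; exact: P2.
Qed.

(** The algebra generated by constants and by functions of B composed with affine forms. It is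
    instantiated twice, with trigonometric functions and the identity for modulated Gaussians, and
    with one-sided bumps for the test functions. Inductive generation gives stability under
    derivatives and their commutation by induction. *)
Inductive ralg (B : (R -> R) -> Prop) : (R3 R -> R) -> Prop :=
| ralg_cst (c : R) : ralg B (fun=> c)
| ralg_base (f : R -> R) (a : R3 R) (b : R) : B f -> ralg B (fun x => f (dot a x + b))
| ralg_add f g : ralg B f -> ralg B g -> ralg B (fun x => f x + g x)
| ralg_mul f g : ralg B f -> ralg B g -> ralg B (fun x => f x * g x).

Section Ralg.
Variable B : (R -> R) -> Prop.
(** The derivative need not lie in B, only its compositions with affine forms in the algebra; the
    differentiability of f' is for the commutation of second derivatives. *)
Hypothesis HB : forall f : R -> R, B f -> exists f' : R -> R, [/\ forall x : R, is_derive x (1 : R) f (f' x),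
  forall x : R, derivable f' x (1 : R) & forall a b, ralg B (fun x => f' (dot a x + b))].

Lemma ralg_derive f v : ralg B f ->
  continuous f /\ exists df, ralg B df /\ forall x, is_derive x v f (df x).
Proof.
elim=> [c|g a b Bg|g h _ [cg [dg [rg Dg]]] _ [ch [dh [rh Dh]]]|g h rrg [cg [dg [rg Dg]]] rrh [ch [dh [rh Dh]]]].
- split; first by move=> x; exact: cvg_cst.
  by exists (fun=> 0); split; [exact: ralg_cst|move=> x; exact: is_derive_cst].
- have [g' [Dg _ rg]] := HB Bg; split.
    move=> x; apply: (continuous_comp (@continuous_lin a b x)).
    by apply/differentiable_continuous/derivable1_diffP; have [] := Dg (dot a x + b).
  exists (fun x => dot a v * g' (dot a x + b)); split.
    by apply: ralg_mul; [exact: ralg_cst|exact: rg].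
  by move=> x; exact: is_derive_comp_lin.
- split; first by move=> x; apply: cvgD; [exact: cg|exact: ch].
  exists (fun x => dg x + dh x); split; first exact: ralg_add.
  by move=> x; have := is_deriveD (Dg x) (Dh x).
- split; first by move=> x; apply: cvgM; [exact: cg|exact: ch].
  exists (fun x => g x * dh x + h x * dg x); split.
    by apply: ralg_add; apply: ralg_mul.
  by move=> x; have := is_deriveM (Dg x) (Dh x).
Qed.

Lemma ralg_smooth f : ralg B f -> smooth f.
Proof.
move: f; apply: smooth_coind => f.
  move=> rf; split; first by have [] := ralg_derive 0 rf.
  by move=> i x; have [_ [df [_ D]]] := ralg_derive (basis3 R i) rf; have [] := D x.
move=> i rf; have [_ [df [rdf D]]] := ralg_derive (basis3 R i) rf.
have -> // : partial i f = df.
by apply/funext => x; rewrite /partial; have [_ ->] := D x.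
Qed.

Lemma ralg_partial f i : ralg B f ->
  ralg B (partial i f) /\ forall x, is_derive x (basis3 R i) f (partial i f x).
Proof.
move=> rf; have [_ [df [rdf D]]] := ralg_derive (basis3 R i) rf.
have -> : partial i f = df.
  by apply/funext => x; rewrite /partial; have [_ ->] := D x.
by [].
Qed.

Lemma partial_eq f i (df : R3 R -> R) :
  (forall x, is_derive x (basis3 R i) f (df x)) -> partial i f = df.
Proof. by move=> D; apply/funext => x; rewrite /partial; have [_ ->] := D x. Qed.

Lemma ralg_partialD f g i : ralg B f -> ralg B g ->
  partial i (fun x => f x + g x) = fun x => partial i f x + partial i g x.
Proof.
move=> /(ralg_partial i)[_ Df] /(ralg_partial i)[_ Dg]; apply: partial_eq => x.
Qed.

Lemma ralg_partialM f g i : ralg B f -> ralg B g ->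
  partial i (fun x => f x * g x) = fun x => f x * partial i g x + g x * partial i f x.
Proof.
move=> /(ralg_partial i)[_ Df] /(ralg_partial i)[_ Dg]; apply: partial_eq => x.
Qed.

Lemma partial_cst (c : R) i : partial i (fun=> c : R) = fun=> 0.
Proof. by apply: partial_eq => x; exact: is_derive_cst. Qed.

(** By induction on the construction. On a generator g (a . x + b) both sides are a_i a_j g'' (a . x
    + b); sums and products follow from the Leibniz rule. *)
Lemma ralg_partialC f i j : ralg B f ->
  partial i (partial j f) = partial j (partial i f).
Proof.
elim=> [c|g a b Bg|g h rg ihg rh ihh|g h rg ihg rh ihh].
- by rewrite !partial_cst.
- have [g' [Dg Dg' rg]] := HB Bg.
  have E k : partial k (fun x => g (dot a x + b)) =
      (fun x => dot a (basis3 R k) * g' (dot a x + b)).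
    by apply: partial_eq => x; exact: is_derive_comp_lin.
  have E' k : partial k (fun x => g' (dot a x + b)) =
      (fun x => dot a (basis3 R k) * 'D_(1 : R) g' (dot a x + b)).
    by apply: partial_eq => x; apply: is_derive_comp_lin; exact: derivableP.
  have rc k := ralg_cst B (dot a (basis3 R k)).
  rewrite !E (ralg_partialM i (rc j) (rg a b)) (ralg_partialM j (rc i) (rg a b)).
  by rewrite !partial_cst !E'; apply/funext => x; ring.
- have [rgi _] := ralg_partial i rg; have [rgj _] := ralg_partial j rg.
  have [rhi _] := ralg_partial i rh; have [rhj _] := ralg_partial j rh.
  by rewrite (ralg_partialD j rg rh) (ralg_partialD i rg rh) (ralg_partialD i rgj rhj)
    (ralg_partialD j rgi rhi) ihg ihh.
- have [rgi _] := ralg_partial i rg; have [rgj _] := ralg_partial j rg.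
  have [rhi _] := ralg_partial i rh; have [rhj _] := ralg_partial j rh.
  rewrite (ralg_partialM j rg rh) (ralg_partialM i rg rh)
    (ralg_partialD i (ralg_mul rg rhj) (ralg_mul rh rgj))
    (ralg_partialD j (ralg_mul rg rhi) (ralg_mul rh rgi))
    (ralg_partialM i rg rhj) (ralg_partialM i rh rgj)
    (ralg_partialM j rg rhi) (ralg_partialM j rh rgi) ihg ihh.
  move: (partial j (partial i g)) (partial j (partial i h)) (partial i g)
    (partial j g) (partial i h) (partial j h) => u1 u2 u3 u4 u5 u6.
  by apply/funext => x; ring.
Qed.
End Ralg.

(** Closed under derivatives thanks to the opposites; the identity supplies the polynomials that
    come out of differentiating a Gaussian. *)
Inductive trig_base : (R -> R) -> Prop :=
| trig_cos : trig_base cos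
| trig_sin : trig_base sin
| trig_ncos : trig_base (fun t => - cos t)
| trig_nsin : trig_base (fun t => - sin t)
| trig_id : trig_base id.

Lemma trig_baseP (f : R -> R) : trig_base f -> exists f' : R -> R,
  [/\ forall x : R, is_derive x (1 : R) f (f' x),
  forall x : R, derivable f' x (1 : R) &
  forall a b, ralg trig_base (fun x => f' (dot a x + b))].
Proof.
have Dc (x : R) := is_derive_cos x; have Ds (x : R) := is_derive_sin x.
case.
- exists (fun t => - sin t); split.
  + by move=> x; exact: Dc.
  + by move=> x; apply: derivableN; have [] := Ds x.
  + by move=> a b; apply: (ralg_base (f := fun t => - sin t)); exact: trig_nsin.
- exists cos; split.
  + by move=> x; exact: Ds.
  + by move=> x; have [] := Dc x.
  + by move=> a b; apply: (ralg_base (f := cos)); exact: trig_cos.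
- exists sin; split.
  + by move=> x; apply: is_derive_eq; rewrite opprK.
  + by move=> x; have [] := Ds x.
  + by move=> a b; apply: (ralg_base (f := sin)); exact: trig_sin.
- exists (fun t => - cos t); split.
  + by move=> x; apply: is_derive_eq.
  + by move=> x; apply: derivableN; have [] := Dc x.
  + by move=> a b; apply: (ralg_base (f := fun t => - cos t)); exact: trig_ncos.
- exists (fun _ : R => 1); split.
  + by move=> x; exact: is_derive_id.
  + by move=> x; exact: derivable_cst.
  + by move=> a b; exact: ralg_cst.
Qed.

Lemma dot_le a x : `|dot a x| <= 3 * enorm a * enorm x.
Proof.
have [a1 a2 a3] := coord_le_enorm a; have [x1 x2 x3] := coord_le_enorm x.
rewrite dotE; apply: le_trans (ler_normD _ _) _.
have -> : 3 * enorm a * enorm x = (enorm a * enorm x + enorm a * enorm x) + enorm a * enorm x by ring.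
apply: lerD; last by rewrite normrM; apply: ler_pM.
by apply: le_trans (ler_normD _ _) _; apply: lerD; rewrite normrM; apply: ler_pM.
Qed.

Lemma trig_poly_bound f : ralg trig_base f -> exists (N : nat) (C : R),
  0 <= C /\ forall x, `|f x| <= C * (1 + enorm x) ^+ N.
Proof.
have e1 x : 1 <= 1 + enorm x by rewrite lerDl enorm_ge0.
elim=> [c|g a b Bg|g h _ [N [C [C0 H]]] _ [N' [C' [C'0 H']]]|g h _ [N [C [C0 H]]] _ [N' [C' [C'0 H']]]].
- by exists 0, `|c|; split => // x; rewrite expr0 mulr1.
- exists 1, (1 + 3 * enorm a + `|b|); split.
    by rewrite !addr_ge0// mulr_ge0// enorm_ge0.
  move=> x; rewrite expr1; set t := dot a x + b.
  have ht : `|t| <= 3 * enorm a * enorm x + `|b|.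
    by apply: le_trans (ler_normD _ _) _; rewrite lerD2r dot_le.
  have hg : `|g t| <= 1 + `|t|.
    case: Bg; rewrite ?normrN.
    + by apply: ler_wpDr => //; exact: norm_cos_le1.
    + by apply: ler_wpDr => //; exact: norm_sin_le1.
    + by apply: ler_wpDr => //; exact: norm_cos_le1.
    + by apply: ler_wpDr => //; exact: norm_sin_le1.
    + by rewrite lerDr.
  have xa : 0 <= enorm a * enorm x by rewrite mulr_ge0 ?enorm_ge0.
  have xb : 0 <= `|b| * enorm x by rewrite mulr_ge0 ?enorm_ge0.
  have := enorm_ge0 a; have := enorm_ge0 x; nra.
- exists (N + N')%N, (C + C'); split; first exact: addr_ge0.
  move=> x; apply: le_trans (ler_normD _ _) _; rewrite mulrDl; apply: lerD.
    by apply: le_trans (H x) _; rewrite ler_wpM2l// ler_weXn2l// leq_addr.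
  by apply: le_trans (H' x) _; rewrite ler_wpM2l// ler_weXn2l// leq_addl.
- exists (N + N')%N, (C * C'); split; first exact: mulr_ge0.
  move=> x; rewrite normrM exprD mulrACA; apply: ler_pM => //.
Qed.

Definition gauss3 (c : R) x : R := expR (- (c * dot x x)).

Lemma is_derive_gauss3 c x v : is_derive x v (gauss3 c) (- (2 * c) * dot v x * gauss3 c x).
Proof.
apply/is_derive_line; rewrite /gauss3.
have -> : (fun h : R => expR (- (c * dot (h *: v + x) (h *: v + x)))) =
    (fun h : R => expR (- (c * (h ^+ 2 * dot v v + (h * (2 * dot v x) + dot x x))))).
  apply/funext => h; congr (expR (- (c * _))); rewrite !dotE /= /GRing.scale/=; ring.
apply: is_derive_eq; rewrite expr0n/= mul0r mul0r !add0r /GRing.scale/=; ring.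
Qed.

Lemma continuous_gauss3 c : continuous (gauss3 c).
Proof.
have [c1 c2 c3] := continuous_coord.
have cd : continuous (fun x : R3 R => - (c * dot x x)).
  move=> x; under eq_fun do rewrite dotE.
  apply: cvgN; apply: cvgM; first exact: cvg_cst.
  by apply: cvgD; [apply: cvgD|]; apply: cvgM; [exact: c1|exact: c1|exact: c2|exact: c2|exact: c3|exact: c3].
by move=> x; apply: (continuous_comp (cd x)); exact: continuous_expR.
Qed.

(** A Gaussian is not a function of an affine form, so it is kept as a common factor:
    differentiation only changes the coefficient q. *)
Definition gauss_alg c f := exists2 q, ralg trig_base q & f = fun x => q x * gauss3 c x.

Lemma gauss_alg_partial c f i : gauss_alg c f -> gauss_alg c (partial i f).
Proof.
move=> [q rq ->]; have [rdq Dq] := ralg_partial trig_baseP i rq.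
exists (fun x => partial i q x + (- (2 * c) * (dot (basis3 R i) x + 0)) * q x).
  apply: ralg_add => //; apply: ralg_mul => //; apply: ralg_mul; first exact: ralg_cst.
  by apply: (ralg_base (f := id)); exact: trig_id.
apply: partial_eq => x.
have := is_deriveM (Dq x) (is_derive_gauss3 c x (basis3 R i)).
set e1 := (X in is_derive _ _ _ X); set e2 := (X in _ -> is_derive _ _ _ X).
by have -> : e1 = e2 by rewrite /e1 /e2 /GRing.scale/= addr0; ring.
Qed.

Lemma gauss_alg_smooth c f : gauss_alg c f -> smooth f.
Proof.
move: f; apply: smooth_coind => [f [q rq ->]|f i]; last exact: gauss_alg_partial.
split.
  move=> x; apply: cvgM; last exact: continuous_gauss3.
  by have [cq _] := ralg_derive trig_baseP 0 rq; exact: cq.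
move=> i x; have [_ Dq] := ralg_partial trig_baseP i rq.
by have [] := is_deriveM (Dq x) (is_derive_gauss3 c x (basis3 R i)).
Qed.

Lemma gauss_alg_decay c f (k : nat) : 0 < c -> gauss_alg c f ->
  exists M : R, forall x, enorm x ^+ k * `|f x| <= M.
Proof.
move=> c0 [q rq ->]; have [N [C [C0 H]]] := trig_poly_bound rq.
have [K K0 HK] := expR_pow_bound R (k + N).
(* (1 + t)^(k + N) is at most K exp (1 + t), and t - c t^2 is at most 1 / (4 c). *)
exists (C * (K * expR (1 + 1 / (4 * c)))) => x.
have e0 := enorm_ge0 x; set t := enorm x in e0 *.
rewrite normrM (ger0_norm (expR_ge0 _)).
apply: (@le_trans _ _ (C * ((1 + t) ^+ (k + N) * gauss3 c x))).
  rewrite exprD -/(gauss3 c x).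
  have -> : C * ((1 + t) ^+ k * (1 + t) ^+ N * gauss3 c x) =
    (1 + t) ^+ k * ((C * (1 + t) ^+ N) * gauss3 c x) by ring.
  apply: ler_pM; rewrite ?exprn_ge0 ?mulr_ge0 ?expR_ge0//.
    by rewrite lerXn2r ?nnegrE ?addr_ge0// lerDr.
  by rewrite ler_wpM2r ?expR_ge0//; exact: H.
rewrite ler_wpM2l//; apply: (@le_trans _ _ (K * expR (1 + t) * gauss3 c x)).
  by rewrite ler_wpM2r ?expR_ge0// HK// addr_ge0.
rewrite -mulrA ler_wpM2l// /gauss3 -expRD ler_expR -enorm_sqr -/t -subr_ge0.
have -> : 1 + 1 / (4 * c) - (1 + t - c * t ^+ 2) = (2 * c * t - 1) ^+ 2 / (4 * c).
  by field; rewrite gt_eqF.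
by rewrite divr_ge0 ?sqr_ge0// mulr_ge0// ltW.
Qed.

Lemma gauss_alg_partials c f s : gauss_alg c f -> gauss_alg c (partials s f).
Proof. by move=> gf; elim: s => [//|i s ih] /=; exact: gauss_alg_partial. Qed.

(** The Schwartz functions on which transforms are tested: the transform of a Gaussian modulated by
    y is a narrow Gaussian centred at y, so these tests are mollifications. *)
Definition mgauss (c : R) (y x : R3 R) : R[i] := cexpi (dot y x) * (gauss3 c x)%:C.

Lemma schwartz_mgauss c y : 0 < c -> schwartz (mgauss c y).
Proof.
move=> c0.
have EC : (fun x => complex.Re (mgauss c y x)) = (fun x => cos (dot y x + 0) * gauss3 c x).
  by apply/funext => x; rewrite ReM /= mulr0 subr0 addr0.
have ES : (fun x => complex.Im (mgauss c y x)) = (fun x => sin (dot y x + 0) * gauss3 c x).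
  by apply/funext => x; rewrite ImM /= mulr0 add0r addr0.
have gC : gauss_alg c (fun x => complex.Re (mgauss c y x)).
  rewrite EC; exists (fun x => cos (dot y x + 0)) => //.
  by apply: (ralg_base (f := cos)); exact: trig_cos.
have gS : gauss_alg c (fun x => complex.Im (mgauss c y x)).
  rewrite ES; exists (fun x => sin (dot y x + 0)) => //.
  by apply: (ralg_base (f := sin)); exact: trig_sin.
split; first by split; [exact: gauss_alg_smooth gC|exact: gauss_alg_smooth gS].
move=> k s.
have [M1 H1] := gauss_alg_decay k c0 (gauss_alg_partials s gC).
have [M2 H2] := gauss_alg_decay k c0 (gauss_alg_partials s gS).
exists (M1 + M2) => x; apply: le_trans (lerD (H1 x) (H2 x)).
rewrite -mulrDr ler_wpM2l ?exprn_ge0 ?enorm_ge0//.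
exact: cabs_le_ReIm.
Qed.
End DirectionalCalculus.

(** * Smooth bumps and the class of test functions *)

Section Bumps.
Variable R : realType.
Implicit Types (x v a : R3 R) (f g : R3 R -> R).

(** The powers t^(-k) are included to make the family stable under differentiation, up to linear
    combinations. *)
Definition ebump (k : nat) (t : R) : R := if 0 < t then (t^-1) ^+ k * expR (- t^-1) else 0.

Lemma is_derive_near (f g : R -> R) (t df : R) : (\near t, f t = g t) ->
  is_derive t (1 : R) f df -> is_derive t (1 : R) g df.
Proof.
move=> fg [d e]; split.
  by apply: near_eq_derivable d.
by rewrite -e; apply: near_eq_derive; apply: filterS fg => z ->.
Qed.

Lemma ebump_ge0 k t : 0 <= ebump k t.
Proof.
by rewrite /ebump; case: ifP => // t0; rewrite mulr_ge0 ?expR_ge0 ?exprn_ge0 ?invr_ge0 ?ltW.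
Qed.

Lemma ebump_gt0 k t : 0 < t -> 0 < ebump k t.
Proof. by move=> t0; rewrite /ebump t0 mulr_gt0 ?expR_gt0 ?exprn_gt0 ?invr_gt0. Qed.

Lemma ebump_le0 k t : t <= 0 -> ebump k t = 0.
Proof. by move=> t0; rewrite /ebump ltNge t0. Qed.

Lemma ebump0_le1 t : ebump 0 t <= 1.
Proof.
rewrite /ebump; case: ifP => // t0; rewrite expr0 mul1r -expR0 ler_expR.
by rewrite oppr_le0 invr_ge0 ltW.
Qed.

(* All the exponents are covered by [s^k exp (- s) -> 0] with [s = 1 / t]. *)
Lemma ebump_small k : exists2 C : R, 0 <= C & forall t, `|ebump k t| <= C * t ^+ 2.
Proof.
have [C C0 HC] := expR_pow_bound R k.+2; exists C => // t.
rewrite ger0_norm ?ebump_ge0//.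
have [t0|t0] := ltP 0 t; last by rewrite ebump_le0// mulr_ge0// sqr_ge0.
have s0 : 0 < t^-1 by rewrite invr_gt0.
rewrite /ebump t0 expRN -ler_pdivlMr ?invr_gt0 ?expR_gt0// invrK.
have -> : t^-1 ^+ k = t^-1 ^+ k.+2 * t ^+ 2.
  by rewrite -addn2 exprD -mulrA -exprMn mulVf ?gt_eqF// expr1n mulr1.
by rewrite (mulrAC C) ler_wpM2r ?sqr_ge0// HC// ltW.
Qed.

Lemma is_derive_pow (k : nat) (s : R) :
  is_derive s (1 : R) (fun s : R => s ^+ k) (k%:R * s ^+ k.-1).
Proof.
elim: k => [|k ih]; first by rewrite mul0r; exact: is_derive_cst.
have := is_deriveM ih (is_derive_id s (1 : R)).
set e1 := (X in is_derive _ _ _ X -> _); set e2 := (X in _ -> is_derive _ _ _ X).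
have -> : e1 = e2.
  rewrite /e1 /e2 /GRing.scale/= mulr1.
  case: k {ih e1 e2} => [|k] /=; first by rewrite mul0r mulr0 addr0 mul1r.
  by rewrite mulrCA -exprS -[k.+2%:R]nat1r mulrDl mul1r.
have -> // : (fun s : R => s ^+ k) * id = (fun s : R => s ^+ k.+1).
by apply/funext => z; rewrite exprSr.
Qed.

Lemma is_derive_ebump k t :
  is_derive t (1 : R) (ebump k) (- k%:R * ebump k.+1 t + ebump k.+2 t).
Proof.
have [t0|t0|<-] := ltgtP 0 t.
- have D : is_derive t (1 : R) (fun t => (t^-1) ^+ k * expR (- t^-1))
      (- k%:R * ebump k.+1 t + ebump k.+2 t).
    have Di : is_derive t (1 : R) (fun t => t^-1) (- t ^- 2).
      apply: is_derive_eq; first by apply: is_deriveV; rewrite gt_eqF.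
      by rewrite /GRing.scale/= mulr1.
    have Dp : is_derive (t^-1) (1 : R) (fun s : R => s ^+ k * expR (- s))
        (k%:R * t^-1 ^+ k.-1 * expR (- t^-1) - t^-1 ^+ k * expR (- t^-1)).
      have De : is_derive (t^-1) (1 : R) (fun s : R => expR (- s)) (- expR (- t^-1)).
        by apply: is_derive_eq; rewrite /GRing.scale/= mulrN1.
      have := is_deriveM (is_derive_pow k t^-1) De.
      set e1 := (X in is_derive _ _ _ X -> _); set e2 := (X in _ -> is_derive _ _ _ X).
      suff -> : e1 = e2 by [].
      by rewrite /e1 /e2 /GRing.scale/=; ring.
    have := is_derive1_comp Dp Di.
    set e1 := (X in is_derive _ _ _ X -> _); set e2 := (X in _ -> is_derive _ _ _ X).
    suff -> : e1 = e2 by [].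
    rewrite /e1 /e2 /ebump t0 -exprVn.
    by case: k {Dp e1 e2} => [|k] /=; rewrite ?mulr0n ?exprS; ring.
  apply: is_derive_near D; near=> s.
  have s0 : 0 < s by near: s; exact: lt_nbhsr.
  by rewrite /ebump s0.
- rewrite !ebump_le0 ?(ltW t0)// mulr0 addr0.
  apply: is_derive_near (is_derive_cst (0 : R) t (1 : R)); near=> s.
  by rewrite ebump_le0// ltW//; near: s; exact: lt_nbhsl.
- rewrite !ebump_le0// mulr0 addr0.
  have [C C0 HC] := ebump_small k.
  (* At the origin [ebump_small] bounds the difference quotient by C |h|; the quantity C + 1 avoids
     a division by zero when C = 0. *)
  have L : h^-1 *: ((ebump k \o shift 0) (h *: (1 : R)) - ebump k 0) @[h --> (0:R)^'] --> (0 : R).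
    apply/cvgr0Pnorm_lt => e e0; near=> h.
    have h0 : h != 0 by near: h; exact: nbhs_dnbhs_neq.
    rewrite (ebump_le0 k (lexx 0)) subr0 /= addr0 /GRing.scale/= mulr1 normrM normfV.
    rewrite ltr_pdivrMl ?normr_gt0//; apply: le_lt_trans (HC h) _.
    rewrite -real_normK ?num_real// expr2 mulrA [ltRHS]mulrC ltr_pM2r ?normr_gt0//.
    have hd : `|h| < e / (C + 1).
      by near: h; apply: dnbhs0_lt; rewrite divr_gt0// ltr_wpDl.
    move: hd; rewrite ltr_pdivlMr ?ltr_wpDl//; apply: le_lt_trans.
    by rewrite mulrDr mulrC lerDl mulr_ge0.
  split; first by apply/cvg_ex; exists 0.
  exact/cvg_lim.
Unshelve. all: end_near.
Qed.

Inductive bump_base : (R -> R) -> Prop := Bump_base k : bump_base (ebump k).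

Lemma bump_baseP (f : R -> R) : bump_base f -> exists f' : R -> R,
  [/\ forall t : R, is_derive t (1 : R) f (f' t),
  forall t : R, derivable f' t (1 : R) &
  forall a b, ralg bump_base (fun x => f' (dot a x + b))].
Proof.
case=> k; exists (fun t => - k%:R * ebump k.+1 t + ebump k.+2 t); split.
- exact: is_derive_ebump.
- move=> t; apply: derivableD; last by have [] := is_derive_ebump k.+2 t.
  by apply: derivableM => //; have [] := is_derive_ebump k.+1 t.
- move=> a b; apply: ralg_add; last exact: ralg_base.
  by apply: ralg_mul; [exact: ralg_cst|exact: ralg_base].
Qed.

Lemma continuous_dot : continuous (fun x : R3 R => dot x x).
Proof.
have [c1 c2 c3] := @continuous_coord R.
move=> x; under eq_fun do rewrite dotE.
by apply: cvgD; [apply: cvgD|]; apply: cvgM; [exact: c1|exact: c1|exact: c2|exact: c2|exact: c3|exact: c3].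
Qed.

Lemma continuous_enorm : continuous (@enorm R).
Proof.
have -> : @enorm R = Num.sqrt \o (fun x => dot x x) by [].
by move=> x; apply: continuous_comp; [exact: continuous_dot|exact: sqrt_continuous].
Qed.

(** A bounded support is expressed by a radius, which passes at once to derivatives, sums and
    products; compactness of the support is deduced afterwards. *)
Definition tf f := ralg bump_base f /\ exists A : R, forall x, A < enorm x -> f x = 0.

Lemma tf_partial f i : tf f -> tf (partial i f).
Proof.
move=> [rf [A HA]]; split; first by have [] := ralg_partial bump_baseP i rf.
exists A => x Ax; rewrite /partial.
have -> : 'D_(basis3 R i) f x = 'D_(basis3 R i) (cst (0 : R)) x.
  apply: near_eq_derive; near=> y; apply: HA; near: y.
  exact: (cvgr_gt (enorm x) (@continuous_enorm x) A Ax).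
exact: derive_cst.
Unshelve. all: end_near.
Qed.

Lemma tf_partials f s : tf f -> tf (partials s f).
Proof. by move=> h; elim: s => //= i s; exact: tf_partial. Qed.

Lemma tf_scale (c : R) f : tf f -> tf (fun x => c * f x).
Proof.
move=> [rf [A HA]]; split; first by apply: ralg_mul => //; exact: ralg_cst.
by exists A => x /HA ->; rewrite mulr0.
Qed.

Lemma tf0 : tf (fun=> 0).
Proof. by split; [exact: ralg_cst|exists 0]. Qed.

Lemma tf_continuous f : tf f -> continuous f.
Proof. by move=> [rf _]; have [] := ralg_derive bump_baseP 0 rf. Qed.

Lemma tf_is_derive f i x : tf f -> is_derive x (basis3 R i) f (partial i f x).
Proof. by move=> [rf _]; have [_ D] := ralg_partial bump_baseP i rf. Qed.

Lemma tf_partialC f i j : tf f -> partial i (partial j f) = partial j (partial i f).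
Proof. by move=> [rf _]; exact: (ralg_partialC bump_baseP). Qed.

Definition box3 (A : R) : set (R3 R) := (`[- A, A] `*` `[- A, A]) `*` `[- A, A].

Lemma compact_box3 A : compact (box3 A).
Proof.
apply: compact_setX; last exact: segment_compact.
by apply: compact_setX; exact: segment_compact.
Qed.

Lemma enorm_box3 A x : enorm x <= A -> box3 A x.
Proof.
have [x1 x2 x3] := coord_le_enorm x => xA.
by rewrite /box3 /= !in_itv/= -!ler_norml !(le_trans _ xA).
Qed.

Lemma tf_bounded f : tf f -> exists M : R, forall x, `|f x| <= M.
Proof.
move=> tff; have [_ [A HA]] := tff.
have cf := tf_continuous tff.
have : compact (f @` box3 A).
  by apply: continuous_compact; [exact: continuous_subspaceT|exact: compact_box3].
move=> /compact_bounded[M [_ HM]].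
exists (`|M| + 1) => x.
have MM : M < `|M| + 1 by rewrite (le_lt_trans (ler_norm _))// ltrDl.
have [Ax|xA] := ltP A (enorm x); first by rewrite HA// normr0 addr_ge0.
by apply: (HM _ MM); exists x => //; exact: enorm_box3.
Qed.

Lemma tf_smooth f : tf f -> smooth f.
Proof. by move=> [rf _]; exact: (ralg_smooth bump_baseP). Qed.

Lemma tf_test_function f : tf f -> test_function f.
Proof.
move=> tff; split; first exact: tf_smooth.
have [_ [A HA]] := tff.
apply: (subclosed_compact (@closed_closure _ _) (@compact_box3 A)).
have /closure_id -> : closed (box3 A).
  apply: compact_closed; last exact: compact_box3.
  exact: norm_hausdorff.
apply: closureS => x /= fx; apply: enorm_box3; rewrite leNgt.
by apply: contra_neqN fx => /HA.
Qed.

Lemma tf_decay f (k : nat) : tf f -> exists M : R, forall x, enorm x ^+ k * `|f x| <= M.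
Proof.
move=> tff; have [M HM] := tf_bounded tff; have [_ [A HA]] := tff.
exists (`|A| ^+ k * `|M|) => x.
have [Ax|xA] := ltP A (enorm x).
  by rewrite HA// normr0 mulr0 mulr_ge0// exprn_ge0.
apply: ler_pM; rewrite ?exprn_ge0 ?enorm_ge0//.
  by rewrite lerXn2r ?nnegrE ?enorm_ge0// (le_trans xA)// ler_norm.
by rewrite (le_trans (HM x))// ler_norm.
Qed.

Lemma partials0 s : partials s (fun=> 0 : R) = fun=> 0.
Proof. by elim: s => //= i s ->; rewrite partial_cst. Qed.

Lemma tf_schwartz f : tf f -> schwartz (of_real f).
Proof.
move=> tff; split.
  split; first exact: tf_smooth.
  exact: tf_smooth tf0.
move=> k s; have [M HM] := tf_decay k (tf_partials s tff).
exists M => x; rewrite /cpartials /= partials0.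
by rewrite expr0n/= addr0 sqrtr_sqr; exact: HM.
Qed.

(** Since exp (- 1 / (n s)) tends to 1 for s > 0, these increase with n to the indicator of the open
    box (a, b); this is how test functions reach sets. *)
Definition boxbump (n : R) (a b x : R3 R) : R :=
  ebump 0 (n * (x.1.1 - a.1.1)) * ebump 0 (n * (b.1.1 - x.1.1)) *
  (ebump 0 (n * (x.1.2 - a.1.2)) * ebump 0 (n * (b.1.2 - x.1.2))) *
  (ebump 0 (n * (x.2 - a.2)) * ebump 0 (n * (b.2 - x.2))).

Lemma enorm_le_sum x : enorm x <= `|x.1.1| + `|x.1.2| + `|x.2|.
Proof.
rewrite -ler_sqr ?nnegrE ?enorm_ge0 ?addr_ge0// enorm_sqr dotE -!expr2.
rewrite -(real_normK (num_real x.1.1)) -(real_normK (num_real x.1.2)) -(real_normK (num_real x.2)).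
move: (normr_ge0 x.1.1) (normr_ge0 x.1.2) (normr_ge0 x.2).
move: `|x.1.1| `|x.1.2| `|x.2| => p q r p0 q0 r0.
have := mulr_ge0 p0 q0; have := mulr_ge0 q0 r0; have := mulr_ge0 p0 r0; nra.
Qed.

Lemma boxbump_neq0 n a b x : 0 < n -> boxbump n a b x != 0 ->
  [/\ a.1.1 < x.1.1 < b.1.1, a.1.2 < x.1.2 < b.1.2 & a.2 < x.2 < b.2].
Proof.
move=> n0; rewrite /boxbump !mulf_eq0 !negb_or.
have e (t s : R) : ebump 0 (n * (t - s)) != 0 -> s < t.
  by move=> H; rewrite ltNge; apply/negP => ts; move/eqP: H; apply;
     rewrite ebump_le0// pmulr_rle0// subr_le0.
by move=> /andP[/andP[/andP[/e -> /e ->] /andP[/e -> /e ->]] /andP[/e -> /e ->]].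
Qed.

Lemma tf_boxbump n a b : 0 < n -> tf (boxbump n a b).
Proof.
move=> n0; split.
  have E (c : R3 R) (d : R) : ralg bump_base (fun x => ebump 0 (dot c x + d)).
    by apply: ralg_base.
  pose e0 : R3 R := ((1, 0), 0); pose e1 : R3 R := ((0, 1), 0); pose e2 : R3 R := ((0, 0), 1).
  have -> : boxbump n a b = fun x =>
    ebump 0 (dot (n *: e0) x + - n * a.1.1) * ebump 0 (dot (- n *: e0) x + n * b.1.1) *
    (ebump 0 (dot (n *: e1) x + - n * a.1.2) * ebump 0 (dot (- n *: e1) x + n * b.1.2)) *
    (ebump 0 (dot (n *: e2) x + - n * a.2) * ebump 0 (dot (- n *: e2) x + n * b.2)).
    apply/funext => x; rewrite /boxbump !dotE /= /GRing.scale/=.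
    by congr (ebump 0 _ * ebump 0 _ * (ebump 0 _ * ebump 0 _) * (ebump 0 _ * ebump 0 _)); ring.
  by repeat (apply: ralg_mul); exact: E.
exists (`|a.1.1| + `|b.1.1| + (`|a.1.2| + `|b.1.2|) + (`|a.2| + `|b.2|)) => x.
apply: contraTeq => /(boxbump_neq0 n0)[/andP[p1 q1] /andP[p2 q2] /andP[p3 q3]].
rewrite -leNgt; apply: le_trans (enorm_le_sum x) _.
have H (s t r : R) : s < t -> t < r -> `|t| <= `|s| + `|r|.
  move=> st tr; rewrite ler_norml; have := ler_norm r; have := ler_norm (- s); rewrite normrN.
  have := normr_ge0 s; have := normr_ge0 r => *; apply/andP; split; lra.
by apply: lerD; [apply: lerD|]; exact: H.
Qed.
End Bumps.

(** * Uniqueness by testing *)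

Section AlmostEverywhereCombinators.
Context d (T : measurableType d) (R : realType) (mu : {measure set T -> \bar R}).
Implicit Types P Q S : T -> Prop.

Lemma ae_imp P Q : {ae mu, forall x, P x} -> (forall x, P x -> Q x) ->
  {ae mu, forall x, Q x}.
Proof. by move=> p h; apply: filterS p. Qed.

Lemma ae_imp2 P Q S : {ae mu, forall x, P x} -> {ae mu, forall x, Q x} ->
  (forall x, P x -> Q x -> S x) -> {ae mu, forall x, S x}.
Proof. by move=> p q h; apply: filterS2 p q. Qed.

Lemma ae_all_nat (P : nat -> T -> Prop) : (forall n, {ae mu, forall x, P n x}) ->
  {ae mu, forall x, forall n, P n x}.
Proof.
move=> h; have := negligible_bigcup h; apply: negligibleS => x /= /existsNP[n hn].
by exists n.
Qed.

End AlmostEverywhereCombinators.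

(** * Boxes, open sets and the product sigma-algebra *)

Section Borel3.
Variable R : realType.
Implicit Types (a b x y : R3 R).

Definition obox a b : set (R3meas R) := [set x : R3 R |
  [/\ a.1.1 < x.1.1 < b.1.1, a.1.2 < x.1.2 < b.1.2 & a.2 < x.2 < b.2]].

Lemma oboxE a b : obox a b =
  ((`]a.1.1, b.1.1[%classic `*` `]a.1.2, b.1.2[%classic) `*` `]a.2, b.2[%classic).
Proof.
apply/seteqP; split => -[[x1 x2] x3] /=; rewrite /= !in_itv /=.
  by case=> *; split; first split.
by case=> -[] *; split.
Qed.

Lemma measurable_obox a b : measurable (obox a b).
Proof.
rewrite oboxE; apply: measurableX; first apply: measurableX.
- exact: measurable_itv.
- exact: measurable_itv.
- exact: measurable_itv.
Qed.

Definition oboxes : set (set (R3meas R)) := [set A | exists a b, A = obox a b].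

Lemma nat_gt_coords x : exists n : nat,
  [/\ `|x.1.1| < n%:R, `|x.1.2| < n%:R & `|x.2| < n%:R].
Proof.
have [n hn] : exists n : nat, `|x.1.1| + `|x.1.2| + `|x.2| < n%:R.
  exists (Num.bound (`|x.1.1| + `|x.1.2| + `|x.2|)).
  by apply: archi_boundP; rewrite !addr_ge0.
have [h1 h2 h3] : [/\ 0 <= `|x.1.1|, 0 <= `|x.1.2| & 0 <= `|x.2|] by [].
by exists n; split; lra.
Qed.

Lemma setI_closed_oboxes : setI_closed oboxes.
Proof.
move=> _ _ [a [b ->]] [c [d ->]].
exists ((Num.max a.1.1 c.1.1, Num.max a.1.2 c.1.2), Num.max a.2 c.2).
exists ((Num.min b.1.1 d.1.1, Num.min b.1.2 d.1.2), Num.min b.2 d.2).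
apply/seteqP; split => x /=; rewrite /obox /= !gt_max !lt_min.
  by move=> [[/andP[-> ->] /andP[-> ->] /andP[-> ->]] [/andP[-> ->] /andP[-> ->] /andP[-> ->]]].
move=> [/andP[/andP[-> ->] /andP[-> ->]] /andP[/andP[-> ->] /andP[-> ->]] /andP[/andP[-> ->] /andP[-> ->]]].
by [].
Qed.

(** The identity is measurable for the sigma-algebra of boxes as soon as its three coordinates are,
    and the half-space x_i > a is the union of growing boxes. *)
Lemma measurable_oboxes : @measurable _ (R3meas R) = <<s oboxes >>.
Proof.
apply/seteqP; split; last first.
  apply: smallest_sub; first exact: sigma_algebra_measurable.
  by move=> _ [a [b ->]]; exact: measurable_obox.
have ray (P : R3 R -> Prop) (lo hi : nat -> R3 R) :
    (forall x, P x <-> exists n, obox (lo n) (hi n) x) -> <<s oboxes >> (P : set (R3meas R)).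
  move=> H; rewrite (_ : (P : set (R3meas R)) = \bigcup_n obox (lo n) (hi n)); last first.
    apply/seteqP; split => x; first by move/H => [n hn]; exists n.
    by move=> [n _ hn]; apply/H; exists n.
  apply: sigma_algebra_bigcup => n; apply: sub_sigma_algebra.
  by exists (lo n), (hi n).
have mid : measurable_fun setT (fun x : g_sigma_algebraType oboxes => x : R3meas R).
  apply/measurable_fun_pairP; split; first apply/measurable_fun_pairP; try split.
  - apply: (measurability _ (RGenOInfty.measurableE R)) => _ [_ [a ->] <-].
    rewrite setTI; apply: (ray (fun x => `]a, +oo[%classic x.1.1)
      (fun n => ((a, - n%:R), - n%:R)) (fun n => ((n%:R, n%:R), n%:R))) => x.
    rewrite /= in_itv /= andbT; split; last by move=> [n [/andP[]]].
    have [n [h1 h2 h3]] := nat_gt_coords x; move: h1 h2 h3; rewrite !ltr_norml => h1 h2 h3 ax.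
    by exists n; split => /=; lra.
  - apply: (measurability _ (RGenOInfty.measurableE R)) => _ [_ [a ->] <-].
    rewrite setTI; apply: (ray (fun x => `]a, +oo[%classic x.1.2)
      (fun n => ((- n%:R, a), - n%:R)) (fun n => ((n%:R, n%:R), n%:R))) => x.
    rewrite /= in_itv /= andbT; split; last by move=> [n [_ /andP[]]].
    have [n [h1 h2 h3]] := nat_gt_coords x; move: h1 h2 h3; rewrite !ltr_norml => h1 h2 h3 ax.
    by exists n; split => /=; lra.
  - apply: (measurability _ (RGenOInfty.measurableE R)) => _ [_ [a ->] <-].
    rewrite setTI; apply: (ray (fun x => `]a, +oo[%classic x.2)
      (fun n => ((- n%:R, - n%:R), a)) (fun n => ((n%:R, n%:R), n%:R))) => x.
    rewrite /= in_itv /= andbT; split; last by move=> [n [_ _ /andP[]]].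
    have [n [h1 h2 h3]] := nat_gt_coords x; move: h1 h2 h3; rewrite !ltr_norml => h1 h2 h3 ax.
    by exists n; split => /=; lra.
move=> A mA; have := mid measurableT A mA.
by rewrite setTI.
Qed.

(** The link between the topology of R^3 and its product sigma-algebra: an open set is the union of
    the rational boxes that it contains. *)
Lemma open_measurable3 (U : set (R3 R)) : open U -> measurable (U : set (R3meas R)).
Proof.
move=> oU.
pose bx (p q r e : rat) := obox ((ratr p - ratr e, ratr q - ratr e), ratr r - ratr e)
   ((ratr p + ratr e, ratr q + ratr e), ratr r + ratr e).
have -> : (U : set (R3meas R)) = \bigcup_p \bigcup_q \bigcup_r \bigcup_e
    (if `[< bx p q r e `<=` U >] then bx p q r e else set0).
  apply/seteqP; split => [x Ux|x]; last first.
    by move=> [p _ [q _ [r _ [e _]]]]; case: ifPn => // /asboolP; exact.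
  have /nbhs_ballP[e /= e0 eU] := open_nbhs_nbhs (conj oU Ux).
  (* The centre is moved to a rational point within e' of x, so points of the box are within 2 e' <
     e of x. *)
  have [e' /itvP ie'] := @rat_in_itvoo R 0 (e / 2) (divr_gt0 e0 (ltr0Sn _ _)).
  have e'0 : 0 < ratr e' :> R by rewrite ie'.
  have e'e : ratr e' < e / 2 by rewrite ie'.
  have rt (t : R) : exists q : rat, `|t - ratr q| < ratr e'.
    have [|q] := @rat_in_itvoo R (t - ratr e') (t + ratr e'); first by lra.
    rewrite in_itv /= => /andP[h1 h2].
    by exists q; rewrite ltr_norml; lra.
  have [p hp] := rt x.1.1; have [q hq] := rt x.1.2; have [r hr] := rt x.2.
  exists p => //; exists q => //; exists r => //; exists e' => //.
  have sub : bx p q r e' `<=` U.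
    move=> y [/= y1 y2 y3]; apply: eU.
    move: hp hq hr; rewrite !ltr_norml => hp hq hr.
    by clear -hp hq hr y1 y2 y3 e'e; split; first split; rewrite /ball /= ltr_norml; lra.
  rewrite asboolT //; move: hp hq hr; rewrite !ltr_norml => hp hq hr.
  by clear -hp hq hr; split => /=; lra.
do 4 (apply: bigcupT_measurable_rat => ?).
by case: ifPn => // _; exact: measurable_obox.
Qed.

Lemma continuous_measurable3 (f : R3 R -> R) : continuous f ->
  measurable_fun setT (f : R3meas R -> R).
Proof.
move=> /continuousP cf; apply: (measurability _ (RGenOpens.measurableE R)).
move=> _ [_ [a [b ->] <-]]; rewrite setTI; apply: open_measurable3.
by apply: cf; exact: interval_open.
Qed.

End Borel3.

Section TestUniqueness.
Variable R : realType.
Notation m := (leb3s R).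
Implicit Types (f : R3meas R -> R) (a b x y : R3 R).

Lemma tf_measurable (h : R3 R -> R) : tf h -> measurable_fun setT (h : R3meas R -> R).
Proof. by move/tf_continuous/continuous_measurable3. Qed.

Lemma tfM (g h : R3 R -> R) : tf g -> tf h -> tf (fun x => g x * h x).
Proof.
move=> [g1 [A hA]] [h1 _]; split; first exact: ralg_mul.
by exists A => x /hA ->; rewrite mul0r.
Qed.

Lemma boxbump_ge0 (n : R) a b x : 0 <= boxbump n a b x.
Proof. by rewrite /boxbump !mulr_ge0 // ebump_ge0. Qed.

Lemma boxbump_le1 (n : R) a b x : boxbump n a b x <= 1.
Proof.
by rewrite /boxbump; do !(apply: mulr_ile1); rewrite ?mulr_ge0 ?ebump_ge0 ?ebump0_le1.
Qed.

Lemma boxbump_gt0 (n : R) a b x : 0 < n -> obox a b x -> 0 < boxbump n a b x.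
Proof.
move=> n0 [/andP[h1 h2] /andP[h3 h4] /andP[h5 h6]].
by rewrite /boxbump !mulr_gt0 //; apply: ebump_gt0; rewrite mulr_gt0 // subr_gt0.
Qed.

Lemma cvg_ebump0 (t : R) : (fun n : nat => ebump 0 (n.+1%:R * t)) @ \oo --> ((0 < t)%R%:R : R).
Proof.
have [t0|t0] := ltP 0 t; last first.
  rewrite (_ : (fun n : nat => _) = fun=> 0); first exact: cvg_cst.
  by apply/funext => n; rewrite ebump_le0 // mulr_ge0_le0.
rewrite (_ : (fun n : nat => _) = fun n : nat => expR (- (n.+1%:R^-1 * t^-1))); last first.
  by apply/funext => n; rewrite /ebump mulr_gt0 // expr0 mul1r invfM.
have h : (fun n : nat => - (n.+1%:R^-1 * t^-1)) @ \oo --> (- (0 * t^-1) : R).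
  by apply: cvgN; apply: cvgMl; exact: cvg_harmonic.
have := continuous_cvg _ (@continuous_expR R _) h.
by rewrite mul0r oppr0 expR0; apply.
Qed.

Lemma cvg_boxbump a b x : (fun n : nat => boxbump n.+1%:R a b x) @ \oo -->
  (\1_(obox a b) x : R).
Proof.
have -> : (\1_(obox a b) x : R) =
  (0 < x.1.1 - a.1.1)%R%:R * (0 < b.1.1 - x.1.1)%R%:R *
  ((0 < x.1.2 - a.1.2)%R%:R * (0 < b.1.2 - x.1.2)%R%:R) *
  ((0 < x.2 - a.2)%R%:R * (0 < b.2 - x.2)%R%:R).
  rewrite indicE -!natrM !mulnb; congr (_%:R); congr (nat_of_bool _); rewrite !subr_gt0.
  apply/idP/idP; first by rewrite inE => -[-> -> ->].
  by move=> /andP[/andP[h1 h2] h3]; rewrite inE.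
apply: cvgM; [apply: cvgM; apply: cvgM|apply: cvgM]; exact: cvg_ebump0.
Qed.

Lemma int_obox_eq0 f a b : igr m f ->
  (forall h, tf h -> \int[m]_x (f x * h x) = 0) ->
  \int[m]_x (f x * \1_(obox a b) x) = 0.
Proof.
move=> fi f0; have mf := igr_meas fi.
have [|||||_ hc] := @Rdct _ _ R m (fun n x => f x * boxbump n.+1%:R a b x)
    (fun x => f x * \1_(obox a b) x) (fun x => `|f x|).
- move=> n; apply: measurable_funM => //; apply: tf_measurable.
  exact: tf_boxbump.
- by apply: measurable_funM => //; apply: measurable_indic; exact: measurable_obox.
- by apply: aeW => x; apply: cvgMr; exact: cvg_boxbump.
- exact: igr_norm.
- move=> n x; rewrite normrM ler_piMr // ger0_norm ?boxbump_ge0 //.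
  exact: boxbump_le1.
apply: (@cvg_unique _ (@Rhausdorff R) _ _ _ _ hc).
rewrite (_ : (fun n : nat => _) = fun=> 0); first exact: cvg_cst.
by apply/funext => n; apply: f0; exact: tf_boxbump.
Qed.

Lemma igr_indic f (S : set (R3meas R)) : measurable S -> igr m f ->
  igr m (fun x => f x * \1_S x).
Proof.
move=> mS fi; apply: (igr_le _ _ (igr_norm fi)).
  by apply: measurable_funM; [exact: igr_meas fi|exact: measurable_indic].
move=> x; rewrite normrM ler_piMr // indicE; case: (_ \in _) => /=;
by rewrite ?normr1 ?normr0.
Qed.

(** Dynkin's theorem: the sets over which f integrates to zero form a lambda-system that contains
    the boxes, which are stable under intersection and generate the measurable sets. *)
Lemma int_set_eq0 f : igr m f ->
  (forall h, tf h -> \int[m]_x (f x * h x) = 0) ->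
  forall S : set (R3meas R), measurable S -> \int[m]_x (f x * \1_S x) = 0.
Proof.
move=> fi f0; have mf := igr_meas fi.
have dct (F : nat -> set (R3meas R)) (S : set (R3meas R)) :
    (forall n, measurable (F n)) -> measurable S ->
    (forall x, (fun n => \1_(F n) x : R) @ \oo --> (\1_S x : R)) ->
    (forall n, \int[m]_x (f x * \1_(F n) x) = 0) -> \int[m]_x (f x * \1_S x) = 0.
  move=> mF mS FS F0.
  have [|||||_ hc] := @Rdct _ _ R m (fun n x => f x * \1_(F n) x)
    (fun x => f x * \1_S x) (fun x => `|f x|).
  - by move=> n; apply: measurable_funM => //; exact: measurable_indic.
  - by apply: measurable_funM => //; exact: measurable_indic.
  - by apply: aeW => x; apply: cvgMr; exact: FS.
  - exact: igr_norm.
  - move=> n x; rewrite normrM ler_piMr // indicE; case: (_ \in _) => /=;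
    by rewrite ?normr1 ?normr0.
  apply: (@cvg_unique _ (@Rhausdorff R) _ _ _ _ hc).
  rewrite (_ : (fun n : nat => _) = fun=> 0); first exact: cvg_cst.
  by apply/funext => n; exact: F0.
have ev (F : nat -> set (R3meas R)) (S : set (R3meas R)) x :
    (exists N, forall n, (N <= n)%N -> (x \in F n) = (x \in S)) ->
    (fun n => \1_(F n) x : R) @ \oo --> (\1_S x : R).
  move=> [N hN]; apply: cvg_near_cst; exists N => // n /= Nn.
  by rewrite !indicE hN.
(* The whole space is not a box, yet complements require it: it is reached by growing boxes. *)
have fT : \int[m]_x f x = 0.
  rewrite (_ : f = fun x => f x * \1_(setT : set (R3meas R)) x); last first.
    by apply/funext => x; rewrite indicT mulr1.
  pose B (n : nat) : set (R3meas R) := obox ((- n%:R, - n%:R), - n%:R) ((n%:R, n%:R), n%:R).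
  apply: (dct B).
  - by move=> n; exact: measurable_obox.
  - exact: measurableT.
  - move=> x; apply: ev.
    have [N [h1 h2 h3]] := nat_gt_coords x; exists N => n Nn; rewrite in_setT.
    have Nn' : N%:R <= n%:R :> R by rewrite ler_nat.
    move: h1 h2 h3; rewrite !ltr_norml => h1 h2 h3.
    by apply/mem_set; clear -h1 h2 h3 Nn'; split => /=; lra.
  - by move=> n; exact: int_obox_eq0.
move=> Z mZ; have : <<s @oboxes R >> Z by rewrite -measurable_oboxes.
apply: (@dynkin_induction _ _ _ (fun S => \int[m]_x (f x * \1_S x) = 0)
  (measurable_oboxes R)).
- exact: setI_closed_oboxes.
- by under eq_Rintegral do rewrite indicT mulr1.
- by move=> _ [a [b ->]]; exact: int_obox_eq0.
- move=> S mS S0.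
  rewrite (_ : (fun x => _) = fun x => f x - f x * \1_S x); last first.
    apply/funext => x; rewrite !indicE in_setC; case: (x \in S) => /=; lra.
  by rewrite RintegralB //; [rewrite fT S0 subr0|exact: igr_indic].
- move=> F mF tF F0.
  have UF0 n : \int[m]_x (f x * \1_(\big[setU/set0]_(i < n) F i) x) = 0.
    elim: n => [|n IH].
      rewrite big_ord0; under eq_Rintegral do rewrite indic0 mulr0.
      by rewrite /Rintegral integral0_eq.
    rewrite big_ord_recr /=.
    rewrite (_ : (fun x => _) = fun x =>
       f x * \1_(\big[setU/set0]_(i < n) F i) x + f x * \1_(F n) x); last first.
      apply/funext => x; rewrite -mulrDr; congr (_ * _); rewrite !indicE in_setU.
      have [xn|_] := boolP (x \in F n); last by rewrite orbF addr0.
      rewrite orbT -bigcup_mkord [in RHS]memNset ?add0r // => -[k /= kn Fk].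
      have := tF k n Logic.I Logic.I; move: xn; rewrite inE => xn.
      by move=> /(_ (ex_intro _ x (conj Fk xn))) kE; rewrite kE ltnn in kn.
    rewrite RintegralD //; first by rewrite IH F0 addr0.
      by apply: igr_indic => //; exact: bigsetU_measurable.
    exact: igr_indic.
  apply: (dct (fun n => \big[setU/set0]_(i < n) F i)) => //.
  - by move=> n; exact: bigsetU_measurable.
  - exact: bigcupT_measurable.
  - move=> x; apply: ev; have [|] := boolP (x \in \bigcup_k F k).
      rewrite inE => -[k _ Fk]; exists k.+1 => n kn; apply/mem_set.
      by rewrite -bigcup_mkord; exists k.
    move=> xF; exists 0%N => n _; apply/negbTE/negP; rewrite inE -bigcup_mkord => -[k _ Fk].
    by move/negP: xF; apply; rewrite inE; exists k.
Qed.

(** f is integrable only against test functions, so it is first multiplied by a bump [chi n] that is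
    positive on a large box. The product is integrable and vanishes almost everywhere for every
    n. *)
Lemma ae_eq0_of_tf f : measurable_fun setT f ->
  (forall h, tf h -> igr m (fun x => f x * h x)) ->
  (forall h, tf h -> \int[m]_x (f x * h x) = 0) ->
  {ae m, forall x, f x = 0}.
Proof.
move=> mf fi f0.
(* The positive part of g is g times the indicator of {g > 0}, whose integral vanishes by
   [int_set_eq0]. *)
have key (g : R3meas R -> R) : igr m g -> (forall h, tf h -> \int[m]_x (g x * h x) = 0) ->
    {ae m, forall x, Num.max (g x) 0 = 0}.
  move=> gi g0; have mg := igr_meas gi.
  pose S : set (R3meas R) := [set x | 0 < g x].
  have mS : measurable S.
    have -> : S = setT `&` g @^-1` `]0, +oo[%classic.
      by rewrite setTI; apply/seteqP; split => x /=; rewrite in_itv /= andbT.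
    exact: mg.
  have E x : Num.max (g x) 0 = g x * \1_S x.
    rewrite indicE; case: (ltP 0 (g x)) => h.
      by rewrite mem_set ?mulr1.
    by rewrite memNset ?mulr0 // /S /=; apply/negP; rewrite -leNgt.
  apply: Rint_eq0.
  - rewrite (_ : (fun x => _) = fun x => g x * \1_S x); last exact/funext.
    exact: igr_indic.
  - by move=> x; rewrite le_max lexx orbT.
  - by under eq_Rintegral do rewrite E; exact: int_set_eq0.
pose chi (n : nat) := boxbump (1 : R) ((- n%:R, - n%:R), - n%:R) ((n%:R, n%:R), n%:R).
have tchi n : tf (chi n) by exact: tf_boxbump.
have pos n : {ae m, forall x, f x * chi n x = 0}.
  have h1 : {ae m, forall x, Num.max (f x * chi n x) 0 = 0}.
    apply: key; first exact: fi.
    move=> h th; under eq_Rintegral do rewrite -mulrA.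
    by apply: f0; exact: tfM.
  have h2 : {ae m, forall x, Num.max (- (f x * chi n x)) 0 = 0}.
    apply: key; first by apply: igrN; exact: fi.
    move=> h th; under eq_Rintegral do rewrite mulNr -mulrN.
    have -> : (fun x => f x * chi n x * - h x) = (fun x => f x * (chi n x * (-1 * h x))).
      by apply/funext => x; ring.
    by apply: f0; apply: tfM => //; exact: tf_scale.
  apply: (ae_imp2 h1 h2) => x.
  move: (f x * chi n x) => t /max_idPr t1 /max_idPr t2.
  by apply/eqP; rewrite eq_le t1 -oppr_le0.
apply: (ae_imp (ae_all_nat pos)) => x H.
have [n [h1 h2 h3]] := nat_gt_coords x.
have : 0 < chi n x.
  apply: boxbump_gt0 => //; move: h1 h2 h3; rewrite !ltr_norml => h1 h2 h3.
  by clear -h1 h2 h3; split => /=; lra.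
by move=> c0; have /eqP := H n; rewrite mulf_eq0 (gt_eqF c0) orbF => /eqP.
Qed.

Lemma ae_eq_of_tf (f g : R3meas R -> R[i]) : cmeas f -> cmeas g ->
  (forall h, tf h -> cigr m (fun x => f x * (h x)%:C)) ->
  (forall h, tf h -> cigr m (fun x => g x * (h x)%:C)) ->
  (forall h, tf h -> ci m (fun x => f x * (h x)%:C) = ci m (fun x => g x * (h x)%:C)) ->
  {ae m, forall x, f x = g x}.
Proof.
move=> mf mg fi gi fg.
have E h : tf h -> cigr m (fun x => (f x - g x) * (h x)%:C) /\
    ci m (fun x => (f x - g x) * (h x)%:C) = 0.
  move=> th; rewrite (_ : (fun x => _) = fun x => f x * (h x)%:C - g x * (h x)%:C); last first.
    by apply/funext => x; rewrite mulrBl.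
  by split; [apply: cigrB; [exact: fi|exact: gi]|rewrite ciB ?fg ?subrr //; [exact: fi|exact: gi]].
have Er z (t : R) : complex.Re (z * t%:C) = complex.Re z * t.
  by rewrite ReM /= mulr0 subr0.
have Ei z (t : R) : complex.Im (z * t%:C) = complex.Im z * t.
  by rewrite ImM /= mulr0 add0r.
have [mr mi] := cmeasB mf mg.
have h1 : {ae m, forall x, complex.Re (f x - g x) = 0}.
  apply: ae_eq0_of_tf => // h th; have [[i1 i2] e] := E h th.
    rewrite (_ : (fun x => _) = fun x => complex.Re ((f x - g x) * (h x)%:C)) //.
    by apply/funext => x; rewrite Er.
  by move: e => /(congr1 (@complex.Re R)) /=; under eq_Rintegral do rewrite Er.
have h2 : {ae m, forall x, complex.Im (f x - g x) = 0}.
  apply: ae_eq0_of_tf => // h th; have [[i1 i2] e] := E h th.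
    rewrite (_ : (fun x => _) = fun x => complex.Im ((f x - g x) * (h x)%:C)) //.
    by apply/funext => x; rewrite Ei.
  by move: e => /(congr1 (@complex.Im R)) /=; under eq_Rintegral do rewrite Ei.
apply: (ae_imp2 h1 h2) => x r i; apply/eqP; rewrite -subr_eq0; apply/eqP.
exact: complex_ext.
Qed.

End TestUniqueness.

(** * Gaussian mollification *)

Lemma ci_prod d1 d2 (T1 : measurableType d1) (T2 : measurableType d2) (R : realType)
    (m1 : {sigma_finite_measure set T1 -> \bar R})
    (m2 : {sigma_finite_measure set T2 -> \bar R}) (f : T1 -> R[i]) (g : T2 -> R[i]) :
  cigr m1 f -> cigr m2 g ->
  ci (sfprod m1 m2) (fun z => f z.1 * g z.2) = ci m1 f * ci m2 g.
Proof.
move=> fi gi; have [_ _ <-] := cfubini (cigr_prod fi gi).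
rewrite -ciZr //; congr (ci m1 _); apply/funext => x /=.
by rewrite ciZ.
Qed.

Section GaussianTransform.
Variable R : realType.
Notation m := (leb3s R).
Notation leb := (@lebesgue_measure R).
Implicit Types (a b x y z : R3 R) (h : R3 R -> R).

Definition cF : R := (2 * pi) `^ (- (3 / 2)).

Lemma pi2_gt0 : 0 < 2 * pi :> R.
Proof. by rewrite mulr_gt0 // pi_gt0. Qed.

Lemma cF_gt0 : 0 < cF. Proof. by rewrite powR_gt0 // pi2_gt0. Qed.

Lemma cFK : cF * Num.sqrt (2 * pi) ^+ 3 = 1.
Proof.
rewrite /cF -powR12_sqrt ?ltW ?pi2_gt0 // -powR_mulrn ?powR_ge0 // -powRrM.
rewrite -powRD; last by rewrite (gt_eqF pi2_gt0) ?implybT.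
by rewrite (_ : _ + _ = 0) ?powRr0 //; lra.
Qed.

Lemma gauss3_split x : gauss3 2^-1 x = gw x.1.1 * gw x.1.2 * gw x.2.
Proof. by rewrite /gauss3 /gw -!expRD dotE; congr expR; rewrite !expr2; ring. Qed.

Lemma gauss3_gt0 (c : R) x : 0 < gauss3 c x. Proof. exact: expR_gt0. Qed.

Lemma gauss3_ge0 (c : R) x : 0 <= gauss3 c x. Proof. exact: expR_ge0. Qed.

Lemma gauss3_le1 (c : R) x : 0 <= c -> gauss3 c x <= 1.
Proof. by move=> c0; rewrite /gauss3 expR_le1 oppr_le0 mulr_ge0 // dot_ge0. Qed.

Lemma measurable_gauss3 (c : R) : measurable_fun setT (gauss3 c : R3meas R -> R).
Proof. apply: continuous_measurable3; exact: continuous_gauss3. Qed.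

Lemma dot_scale (t : R) x y : dot x (affine3 0 t y) = t * dot x y.
Proof. by rewrite !dotE /=; ring. Qed.

Lemma dot_scalel (t : R) x y : dot (affine3 0 t x) y = t * dot x y.
Proof. by rewrite !dotE /=; ring. Qed.

Lemma dotC x y : dot x y = dot y x.
Proof. by rewrite !dotE; ring. Qed.

Lemma gauss3_scale (c t : R) x : gauss3 c (affine3 0 t x) = gauss3 (c * t ^+ 2) x.
Proof. by rewrite /gauss3 dot_scale dot_scalel; congr expR; ring. Qed.

Lemma cigr_ft_gauss t : cigr m (fun x : R3meas R => cexpi (dot t x) * (gauss3 2^-1 x)%:C) /\
  ci m (fun x : R3meas R => cexpi (dot t x) * (gauss3 2^-1 x)%:C) =
  (Num.sqrt (2 * pi) ^+ 3 * gauss3 2^-1 t)%:C.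
Proof.
pose e (s x : measurableTypeR R) : R[i] := cexpi (s * x) * (gw x)%:C.
have ei s : cigr leb (e s) by exact: cigr_expigw.
rewrite (_ : (fun x => _) = fun x : R3meas R => e t.1.1 x.1.1 * e t.1.2 x.1.2 * e t.2 x.2); last first.
  by apply/funext => x; rewrite gauss3_split dotE !expiD !realcM /e; ring.
split.
  exact: (cigr_prod (cigr_prod (ei _) (ei _)) (ei _)).
apply: etrans (ci_prod (cigr_prod (ei t.1.1) (ei t.1.2)) (ei t.2)) _.
rewrite (etrans (ci_prod (ei t.1.1) (ei t.1.2)) erefl) !gwcE -!realcM gauss3_split.
by congr (_%:C); ring.
Qed.

Lemma igr_gauss3 (c : R) : 0 < c -> igr m (gauss3 c : R3meas R -> R).
Proof.
move=> c0; pose t := Num.sqrt (c * 2).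
have t0 : 0 < t by rewrite sqrtr_gt0 mulr_gt0.
have -> : gauss3 c = gauss3 2^-1 \o affine3 0 t.
  apply/funext => x; rewrite /= gauss3_scale sqr_sqrtr ?mulr_ge0 ?ltW //.
  by rewrite [2^-1 * _]mulrC mulfK.
have sc := scales_leb3 (0 : R3 R) (lt0r_neq0 t0).
have tt : 0 < `|t| ^+ 3 by rewrite exprn_gt0 // normr_gt0 gt_eqF.
apply: (scales_igr sc tt (measurable_gauss3 _)).1.
have [H _] := cigr_ft_gauss 0.
have /cigr_cabs := H; congr (igr m _); apply/funext => x.
by rewrite cabsM cabs_expi mul1r cabs_real ger0_norm // gauss3_ge0.
Qed.

Lemma Rint_gauss3 : \int[m]_x gauss3 2^-1 x = cF^-1.
Proof.
have [_] := cigr_ft_gauss 0.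
rewrite (_ : (fun x => _) = fun x : R3meas R => (gauss3 2^-1 x)%:C); last first.
  by apply/funext => x; rewrite dotE /= !mul0r !addr0 /cexpi cos0 sin0 mul1r.
rewrite ci_real => /(congr1 (@complex.Re R)) /= ->.
rewrite /gauss3 dotE /= !mul0r !addr0 mulr0 oppr0 expR0 mulr1.
by apply: (mulfI (lt0r_neq0 cF_gt0)); rewrite cFK mulfV // gt_eqF // cF_gt0.
Qed.

(** The Gaussian approximate identity of width e, with mass 1 / [cF] instead of 1: this is the
    normalization in which it is exactly the transform of a Gaussian with parameter e^2 / 2. *)
Definition pk (e : R) z : R := e ^- 3 * gauss3 2^-1 (affine3 0 e^-1 z).

Lemma measurable_pk (e : R) : measurable_fun setT (pk e : R3meas R -> R).
Proof.
apply: measurable_funM; first exact: measurable_cst.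
apply: (measurableT_comp (measurable_gauss3 2^-1)).
apply: measurable_affine3; [exact: measurable_cst|exact: measurable_id].
Qed.

Lemma pk_ge0 e z : 0 < e -> 0 <= pk e z.
Proof. by move=> e0; rewrite mulr_ge0 ?gauss3_ge0 // invr_ge0 exprn_ge0 // ltW. Qed.

Lemma ft_gauss3 (e : R) z : 0 < e ->
  cF%:C * ci m (fun x : R3meas R => cexpi (dot z x) * (gauss3 (e ^+ 2 / 2) x)%:C) = (pk e z)%:C.
Proof.
move=> e0; have sc := scales_leb3 (0 : R3 R) (lt0r_neq0 e0).
have [H H2] := cigr_ft_gauss (affine3 0 e^-1 z).
have c0 : 0 < `|e| ^+ 3 by rewrite exprn_gt0 // normr_gt0 gt_eqF.
have := scales_ci sc c0 H.
rewrite H2 (_ : _ \o _ = fun x : R3meas R => cexpi (dot z x) * (gauss3 (e ^+ 2 / 2) x)%:C); last first.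
  apply/funext => x /=; rewrite dot_scale dot_scalel gauss3_scale mulVKf ?gt_eqF //.
  by rewrite mulrC [in RHS]mulrC [X in gauss3 X]mulrC.
move: (ci _ _) => I hI.
have -> : I = ((e ^- 3) * (Num.sqrt (2 * pi) ^+ 3 * gauss3 2^-1 (affine3 0 e^-1 z)))%:C.
  rewrite [RHS]realcM -hI mulrA -realcM gtr0_norm // mulVf ?mul1r //.
  by rewrite gt_eqF // exprn_gt0.
rewrite -realcM /pk; congr (_%:C).
by rewrite mulrCA (mulrA cF) cFK mul1r.
Qed.

Lemma dotBl x y z : dot (affine3 x (-1) y) z = dot x z - dot y z.
Proof. by rewrite !dotE /=; ring. Qed.

Lemma dotDl x y z : dot (affine3 x 1 y) z = dot x z + dot y z.
Proof. by rewrite !dotE /=; ring. Qed.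

Lemma fourierE (f : R3 R -> R[i]) x :
  fourier f x = cF%:C * ci m (fun xi => cexpi (- dot xi x) * f xi).
Proof. by []. Qed.

Lemma inv_fourierE (f : R3 R -> R[i]) x :
  inv_fourier f x = cF%:C * ci m (fun xi => cexpi (dot x xi) * f xi).
Proof. by []. Qed.

Lemma fourier_mgauss (e : R) y x : 0 < e ->
  fourier (mgauss (e ^+ 2 / 2) y) x = (pk e (affine3 y (-1) x))%:C.
Proof.
move=> e0; rewrite -(ft_gauss3 _ e0) fourierE.
set f := fun xi => _; set g := fun xi => _; suff -> : f = g by [].
apply/funext => xi; rewrite /f /g /mgauss mulrA -expiD dotBl.
by rewrite addrC (dotC xi x).
Qed.

Lemma inv_fourier_mgauss (e : R) y x : 0 < e ->
  inv_fourier (mgauss (e ^+ 2 / 2) y) x = (pk e (affine3 x 1 y))%:C.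
Proof.
move=> e0; rewrite -(ft_gauss3 _ e0) inv_fourierE.
set f := fun xi => _; set g := fun xi => _; suff -> : f = g by [].
by apply/funext => xi; rewrite /f /g /mgauss mulrA -expiD dotDl.
Qed.

End GaussianTransform.

Section MeasurableProjections.
Context d1 d2 (T1 : measurableType d1) (T2 : measurableType d2) (R : realType).

Lemma cmeas_fst (f : T1 -> R[i]) : cmeas f -> cmeas (fun p : T1 * T2 => f p.1).
Proof. by move=> mf; apply: (cmeas_comp mf); exact: measurable_fst. Qed.

Lemma cmeas_snd (f : T2 -> R[i]) : cmeas f -> cmeas (fun p : T1 * T2 => f p.2).
Proof. by move=> mf; apply: (cmeas_comp mf); exact: measurable_snd. Qed.

End MeasurableProjections.

Section Mollification.
Variable R : realType.
Notation m := (leb3s R).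
Implicit Types (a b x y z : R3 R) (h : R3 R -> R).

(** Lets Gaussians play the role of compact supports in every later majorant. *)
Lemma tf_gauss_bound h (c : R) : 0 <= c -> tf h ->
  exists2 C : R, 0 <= C & forall x, `|h x| <= C * gauss3 c x.
Proof.
move=> c0 th; have [M hM] := tf_bounded th; have [_ [A hA]] := th.
exists (`|M| * expR (c * A ^+ 2)) => [|x]; first by rewrite mulr_ge0 // expR_ge0.
have [Ax|xA] := ltP A (enorm x).
  by rewrite hA // normr0 !mulr_ge0 ?expR_ge0.
apply: (le_trans (hM x)); apply: (le_trans (ler_norm M)).
rewrite -mulrA ler_peMr // /gauss3 -expRD -expR0 ler_expR subr_ge0 ler_wpM2l //.
by rewrite -enorm_sqr ler_pXn2r ?nnegrE ?enorm_ge0 // (le_trans (enorm_ge0 x)).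
Qed.

Lemma gauss3_le_tensor (p q r s : R) x y w : 
  r * dot x x + s * dot y y <= p * dot w w + q * dot y y ->
  gauss3 p w * gauss3 q y <= gauss3 r x * gauss3 s y.
Proof. by move=> H; rewrite /gauss3 -!expRD ler_expR -!opprD lerN2. Qed.

(** From |x|^2 <= 2 |x + e z|^2 + 2 e^2 |z|^2: halving the exponents decouples the two variables,
    uniformly for e <= 1. The next shift lemmas follow the same pattern. *)
Lemma gauss3_shift x z (e : R) : 0 < e <= 1 ->
  gauss3 (1 / 4) (affine3 x e z) * gauss3 2^-1 z <= gauss3 (1 / 8) x * gauss3 (1 / 4) z.
Proof.
move=> /andP[e0 e1]; apply: gauss3_le_tensor.
have ee : e ^+ 2 <= 1 by rewrite expr_le1 // ltW.
have zz := dot_ge0 z; have := dot_ge0 (affine3 x (2 * e) z).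
have : e ^+ 2 * dot z z <= dot z z by rewrite ler_piMl.
rewrite !dotE /=; set A := e ^+ 2 * _ => h1 h2.
have : 0 <= (x.1.1 + 2 * e * z.1.1) ^+ 2 + (x.1.2 + 2 * e * z.1.2) ^+ 2 + (x.2 + 2 * e * z.2) ^+ 2.
  by rewrite !addr_ge0 // sqr_ge0.
move: h1; rewrite /A; clear; nra.
Qed.

Lemma pk_le (e : R) z : 0 < e <= 1 -> pk e z <= e ^- 3 * gauss3 (1 / 8) z.
Proof.
move=> /andP[e0 e1]; have e30 : 0 <= e ^- 3 by rewrite invr_ge0 exprn_ge0 // ltW.
rewrite /pk ler_wpM2l // gauss3_scale /gauss3 ler_expR lerN2 ler_wpM2r ?dot_ge0 //.
have : 1 <= e^-1 ^+ 2 by rewrite exprn_ege1 // invf_ge1.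
lra.
Qed.

Lemma gauss3_shift2 x y : gauss3 (1 / 8) (affine3 y (-1) x) * gauss3 (1 / 4) y <=
  gauss3 (1 / 16) x * gauss3 (1 / 8) y.
Proof.
apply: gauss3_le_tensor; have := dot_ge0 (affine3 (affine3 0 2 y) (-1) x).
by rewrite !dotE /=; clear; nra.
Qed.

Lemma gauss3_shift3 x y : gauss3 (1 / 8) (affine3 y (-1) x) <=
  expR (1 / 8 * dot y y) * gauss3 (1 / 16) x.
Proof.
rewrite /gauss3 -expRD ler_expR; have := dot_ge0 (affine3 (affine3 0 2 y) (-1) x).
by rewrite !dotE /=; clear; nra.
Qed.

Lemma gauss3_le (c d : R) x : d <= c -> gauss3 c x <= gauss3 d x.
Proof. by move=> dc; rewrite /gauss3 ler_expR lerN2 ler_wpM2r // dot_ge0. Qed.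

Lemma norm3_gt0 (e : R) : 0 < e -> 0 < `|e| ^+ 3.
Proof. by move=> e0; rewrite exprn_gt0 // normr_gt0 gt_eqF. Qed.

Lemma pk_scale (e : R) x z : 0 < e ->
  e ^+ 3 * pk e (affine3 (affine3 x e z) (-1) x) = gauss3 2^-1 z.
Proof.
move=> e0; have en : e != 0 by rewrite gt_eqF.
have -> : pk e (affine3 (affine3 x e z) (-1) x) = e ^- 3 * gauss3 2^-1 z.
  rewrite /pk; suff -> : affine3 0 e^-1 (affine3 (affine3 x e z) (-1) x) = z by [].
  by case: x z => [[x1 x2] x3] [[z1 z2] z3]; rewrite /affine3 /=; congr (_, _, _); field.
by rewrite mulrA mulfV ?mul1r // expf_eq0.
Qed.

Lemma cvg_affine3 x z (e : nat -> R) : e @ \oo --> 0 ->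
  (fun n => affine3 x (e n) z) @ \oo --> x.
Proof.
move=> e0; have c (s t : R) : (fun n => s + e n * t) @ \oo --> s.
  by rewrite -[X in _ --> X]addr0; apply: cvgD; [exact: cvg_cst|rewrite -(mul0r t); exact: cvgMl].
case: x z => [[x1 x2] x3] [[z1 z2] z3].
by apply: (cvg_pair (cvg_pair (c x1 z1) (c x2 z2)) (c x3 z3)).
Qed.

Section MollifyOne.
Variables (u : R3meas R -> R[i]) (h : R3 R -> R).
Hypotheses (mu : cmeas u) (th : tf h).
Hypothesis ui : forall c : R, 0 < c -> igr m (fun x => cabs (u x) * gauss3 c x).

Let mh : measurable_fun setT (h : R3meas R -> R).
Proof. exact: tf_measurable. Qed.

Let P1 : cmeas (fun p : R3meas R * R3meas R => u p.1).
Proof. exact: cmeas_fst. Qed.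

Lemma cigr_mollify (e : R) : 0 < e <= 1 -> cigr (sfprod m m)
  (fun p : R3meas R * R3meas R => u p.1 * (pk e (affine3 p.2 (-1) p.1) * h p.2)%:C).
Proof.
move=> e01; have [C C0 hC] : exists2 C : R, 0 <= C & forall x, `|h x| <= C * gauss3 (1 / 4) x.
  by apply: tf_gauss_bound; [lra|].
have /andP[e0 _] := e01.
have i1 : igr (sfprod m m) (fun p : R3meas R * R3meas R =>
   (cabs (u p.1) * gauss3 (1 / 16) p.1) * gauss3 (1 / 8) p.2).
  refine (@igr_prod_ge0 _ _ _ _ R m m (fun x => cabs (u x) * gauss3 (1 / 16) x)
    (gauss3 (1 / 8)) _ _ _ _).
  - by move=> x; rewrite mulr_ge0 ?cabs_ge0 ?gauss3_ge0.
  - by move=> y; exact: gauss3_ge0.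
  - by apply: ui; lra.
  - by apply: igr_gauss3; lra.
apply: (cigr_le _ _ (igrZ (C * e ^- 3) i1)).
  apply: cmeasM => //; apply: cmeas_real; apply: measurable_funM.
    apply: (measurableT_comp (measurable_pk e)).
    by apply: measurable_affine3; [exact: measurable_snd|exact: measurable_fst].
  exact: (measurableT_comp mh measurable_snd).
move=> -[x y] /=; rewrite cabsM cabs_real normrM (ger0_norm (pk_ge0 _ e0)).
have k1 := pk_le (affine3 y (-1) x) e01; have k2 := gauss3_shift2 x y.
have k3 := hC y; have k4 := pk_ge0 (affine3 y (-1) x) e0.
apply: (le_trans (y := cabs (u x) * ((e ^- 3 * gauss3 (1 / 8) (affine3 y (-1) x)) * (C * gauss3 (1 / 4) y)))).
  by apply: ler_wpM2l; [exact: cabs_ge0|exact: ler_pM].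
move: k2 (cabs_ge0 (u x)); have : 0 <= e ^- 3 by rewrite invr_ge0 exprn_ge0 // ltW.
move: (gauss3 _ _) (gauss3 _ y) (gauss3 _ x) (gauss3 _ y) (cabs _) (e ^- 3) => a b c d v w w0 ab v0.
rewrite (_ : v * _ = (v * (C * w)) * (a * d)); last by ring.
rewrite (_ : C * w * _ = (v * (C * w)) * (c * b)); last by ring.
by rewrite ler_wpM2l // !mulr_ge0.
Qed.

Lemma cigr_pk (e : R) y : 0 < e <= 1 ->
  cigr m (fun x => u x * (pk e (affine3 y (-1) x))%:C).
Proof.
move=> e01; have /andP[e0 _] := e01.
have i1 : igr m (fun x => cabs (u x) * gauss3 (1 / 16) x) by apply: ui; lra.
apply: (cigr_le _ _ (igrZ (e ^- 3 * expR (1 / 8 * dot y y)) i1)).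
  apply: cmeasM => //; apply: cmeas_real; apply: (measurableT_comp (measurable_pk e)).
  by apply: measurable_affine3; [exact: measurable_cst|exact: measurable_id].
move=> x; rewrite cabsM cabs_real (ger0_norm (pk_ge0 _ e0)) [leRHS]mulrCA.
apply: ler_wpM2l; first exact: cabs_ge0.
apply: (le_trans (pk_le _ e01)); rewrite -[leRHS]mulrA.
apply: ler_wpM2l; first by rewrite invr_ge0 exprn_ge0 // ltW.
exact: gauss3_shift3.
Qed.

(** The mollification integrand after the substitution y = x + e z. The width now sits in the
    argument of h, not in the kernel, so that one majorant serves all e <= 1. *)
Definition mker (e : R) (p : R3meas R * R3meas R) : R[i] :=
  u p.1 * (gauss3 2^-1 p.2 * h (affine3 p.1 e p.2))%:C.

Lemma cmeas_mker e : cmeas (mker e).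
Proof.
apply: cmeasM => //; apply: cmeas_real; apply: measurable_funM.
  exact: (measurableT_comp (measurable_gauss3 2^-1) measurable_snd).
apply: (measurableT_comp mh).
by apply: measurable_affine3; [exact: measurable_fst|exact: measurable_snd].
Qed.

Lemma mker_le : exists2 D : R3meas R * R3meas R -> R, igr (sfprod m m) D &
  forall e p, 0 < e <= 1 -> cabs (mker e p) <= D p.
Proof.
have [C C0 hC] : exists2 C : R, 0 <= C & forall x, `|h x| <= C * gauss3 (1 / 4) x.
  by apply: tf_gauss_bound; [lra|].
have i1 : igr (sfprod m m) (fun p : R3meas R * R3meas R =>
   (cabs (u p.1) * gauss3 (1 / 8) p.1) * gauss3 (1 / 4) p.2).
  refine (@igr_prod_ge0 _ _ _ _ R m m (fun x => cabs (u x) * gauss3 (1 / 8) x)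
    (gauss3 (1 / 4)) _ _ _ _).
  - by move=> x; rewrite mulr_ge0 ?cabs_ge0 ?gauss3_ge0.
  - by move=> y; exact: gauss3_ge0.
  - by apply: ui; lra.
  - by apply: igr_gauss3; lra.
exists (fun p => C * (cabs (u p.1) * gauss3 (1 / 8) p.1 * gauss3 (1 / 4) p.2)); first exact: igrZ.
move=> e [x z] e01; rewrite /mker /= cabsM cabs_real normrM (ger0_norm (gauss3_ge0 _ _)).
rewrite -[X in _ <= _ * X]mulrA [leRHS]mulrCA; apply: ler_wpM2l; first exact: cabs_ge0.
apply: (le_trans (y := gauss3 2^-1 z * (C * gauss3 (1 / 4) (affine3 x e z)))).
  by apply: ler_wpM2l; [exact: gauss3_ge0|exact: hC].
by rewrite mulrCA; apply: ler_wpM2l => //; rewrite mulrC; exact: gauss3_shift.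
Qed.

Lemma cigr_mker e : 0 < e <= 1 -> cigr (sfprod m m) (mker e).
Proof.
move=> e01; have [D Di hD] := mker_le.
by apply: (cigr_le (cmeas_mker e) _ Di) => p; exact: hD.
Qed.

Lemma mollifyE (e : R) : 0 < e <= 1 ->
  ci m (fun y => ci m (fun x => u x * (pk e (affine3 y (-1) x))%:C) * (h y)%:C) =
  ci (sfprod m m) (mker e).
Proof.
move=> e01; have e0 : 0 < e by case/andP: e01.
have I := cigr_mollify e01; have := cfubini_swap I => /= S.
have -> : (fun y => ci m (fun x => u x * (pk e (affine3 y (-1) x))%:C) * (h y)%:C) =
    (fun y => ci m (fun x => u x * (pk e (affine3 y (-1) x) * h y)%:C)).
  apply/funext => y; rewrite -ciZr; last exact: cigr_pk.
  by congr (ci m _); apply/funext => x; rewrite realcM mulrA.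
have [_ _ <-] := cfubini (cigr_mker e01).
rewrite -S; have [Iae _ _] := cfubini I; apply: ci_ae.
- exact: (@cmeas_inner _ _ _ _ R m _ (cigr_meas I)).
- exact: (@cmeas_inner _ _ _ _ R m _ (cmeas_mker e)).
apply: (ae_imp Iae) => x Ix; have sc := scales_leb3 x (lt0r_neq0 e0).
have c0 := norm3_gt0 e0.
rewrite -(scales_ci sc c0 Ix).
have Ix' := (scales_cigr sc c0 (cigr_meas Ix)).1 Ix.
rewrite -(ciZ _ Ix').
set F := fun y => _; set G := fun y => _; suff -> : F = G by [].
apply/funext => z; rewrite /F /G /mker /= (gtr0_norm e0) mulrCA; congr (u x * _).
rewrite -realcM mulrA (pk_scale _ _ e0); exact: erefl.
Qed.

(** The mollified function converges to u weakly, against tests; the factor 1 / [cF] is the mass of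
    [pk]. *)
Lemma cvg_mollify (e : nat -> R) : (forall n, 0 < e n <= 1) -> e @ \oo --> 0 ->
  ccvg (fun n => ci m (fun y => ci m (fun x => u x * (pk (e n) (affine3 y (-1) x))%:C) * (h y)%:C))
       ((cF R)^-1%:C * ci m (fun x => u x * (h x)%:C)).
Proof.
move=> e01 ecvg; have [D Di hD] := mker_le.
have hi : cigr m (fun x => u x * (h x)%:C).
  have [C C0 hC] := tf_gauss_bound ler01 th.
  apply: (cigr_le _ _ (igrZ C (ui ltr01))).
    by apply: cmeasM => //; exact: cmeas_real.
  move=> x; rewrite cabsM cabs_real [leRHS]mulrCA; apply: ler_wpM2l; first exact: cabs_ge0.
  exact: hC.
have gi : cigr m (fun z : R3meas R => (gauss3 2^-1 z)%:C : R[i]).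
  by apply: cigr_real; apply: igr_gauss3; rewrite invr_gt0.
have -> : (cF R)^-1%:C * ci m (fun x => u x * (h x)%:C) =
    ci (sfprod m m) (fun p => u p.1 * (gauss3 2^-1 p.2 * h p.1)%:C).
  have E : (fun p : R3meas R * R3meas R => u p.1 * (gauss3 2^-1 p.2 * h p.1)%:C) =
      (fun p => (u p.1 * (h p.1)%:C) * (gauss3 2^-1 p.2)%:C).
    by apply/funext => p; rewrite realcM; ring.
  rewrite E (ci_prod hi gi) ci_real Rint_gauss3 mulrC.
  by [].
rewrite (_ : (fun n : nat => _) = fun n => ci (sfprod m m) (mker (e n))); last first.
  by apply/funext => n; rewrite mollifyE.
apply: (cdct _ _ _ Di _).2.
- by move=> n; exact: cmeas_mker.
- apply: cmeasM => //; apply: cmeas_real; apply: measurable_funM.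
    exact: (measurableT_comp (measurable_gauss3 2^-1) measurable_snd).
  exact: (measurableT_comp mh measurable_fst).
- apply: aeW => -[x z]; rewrite /mker /=; apply: ccvgM; first exact: ccvg_cst.
  apply: ccvg_real; apply: cvgMr.
  apply: (@cvg_comp _ _ _ (fun n => affine3 x (e n) z) h _ (nbhs x)).
    exact: cvg_affine3.
  exact: (tf_continuous th).
- by move=> n p; exact: hD.
Qed.

End MollifyOne.
End Mollification.

(** * Transforms of test functions *)

Lemma realcB (R : realType) (x y : R) : (x - y)%:C = x%:C - y%:C :> R[i].
Proof. by apply: complex_ext; rewrite ?ReD ?ImD ?ReN ?ImN /= ?subrr. Qed.

Section Extensionality.
Context d (T : measurableType d) (R : realType) (mu : {measure set T -> \bar R}).

Lemma ci_ext (f g : T -> R[i]) : (forall x, f x = g x) -> ci mu f = ci mu g.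
Proof. by move=> /funext ->. Qed.

Lemma cigr_ext (f g : T -> R[i]) : (forall x, f x = g x) -> cigr mu f -> cigr mu g.
Proof. by move=> /funext ->. Qed.

Lemma igr_ext (f g : T -> R) : (forall x, f x = g x) -> igr mu f -> igr mu g.
Proof. by move=> /funext ->. Qed.

End Extensionality.

Section TransformOfTests.
Variable R : realType.
Notation m := (leb3s R).
Implicit Types (a b x y z xi : R3 R) (h : R3 R -> R).

Definition ift h : R3meas R -> R[i] := inv_fourier (of_real h).

Lemma iftE h xi : ift h xi = (cF R)%:C * ci m (fun x => cexpi (dot xi x) * (h x)%:C).
Proof. by []. Qed.

Lemma cmeas_ft (f : R3meas R -> R[i]) : cmeas f ->
  cmeas (fun p : R3meas R * R3meas R => cexpi (dot p.1 p.2) * f p.2).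
Proof.
move=> mf; apply: cmeasM; last exact: cmeas_snd.
by apply: cmeas_expi; apply: measurable_dot; [exact: measurable_fst|exact: measurable_snd].
Qed.

Lemma cmeas_inv_fourier (f : R3meas R -> R[i]) : cmeas f ->
  cmeas (inv_fourier f : R3meas R -> R[i]).
Proof.
move=> mf; rewrite (_ : inv_fourier f = fun xi => (cF R)%:C * ci m (fun x => cexpi (dot xi x) * f x)); last by [].
apply: cmeasM; first exact: cmeas_cst.
exact: (cmeas_inner m (cmeas_ft mf)).
Qed.

Lemma tf_cmeas h : tf h -> cmeas (fun x : R3meas R => (h x)%:C : R[i]).
Proof. by move=> th; apply: cmeas_real; exact: tf_measurable. Qed.

Lemma tf_igr h : tf h -> igr m (h : R3meas R -> R).
Proof.
move=> th; have [C C0 hC] := tf_gauss_bound ler01 th.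
by apply: (igr_le (tf_measurable th) hC); apply: igrZ; exact: igr_gauss3.
Qed.

Lemma cmeas_ift h : tf h -> cmeas (ift h).
Proof. by move=> th; apply: cmeas_inv_fourier; exact: tf_cmeas. Qed.

Lemma cmeas_expi_dot xi : cmeas (fun x : R3meas R => cexpi (dot xi x) : R[i]).
Proof.
apply: cmeas_expi; apply: measurable_dot; [exact: measurable_cst|exact: measurable_id].
Qed.

Lemma cigr_expi (k : R3meas R -> R[i]) xi : cigr m k ->
  cigr m (fun x => cexpi (dot xi x) * k x).
Proof.
move=> ki; apply: (cigr_le _ _ (cigr_cabs ki)).
  by apply: cmeasM; [exact: cmeas_expi_dot|exact: (cigr_meas ki)].
by move=> x; rewrite cabsM cabs_expi mul1r.
Qed.

Lemma cabs_inv_fourier (k : R3meas R -> R[i]) xi : cigr m k ->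
  cabs (inv_fourier k xi) <= cF R * (2 * \int[m]_x cabs (k x)).
Proof.
move=> ki; rewrite inv_fourierE cabsM cabs_real (ger0_norm (ltW (cF_gt0 R))).
apply: ler_wpM2l; first exact: ltW (cF_gt0 R).
apply: (le_trans (cabs_ci_le (cigr_expi xi ki))).
by under eq_Rintegral do rewrite cabsM cabs_expi mul1r.
Qed.

Lemma ift_bounded h : tf h -> exists2 C : R, 0 <= C & forall xi, cabs (ift h xi) <= C.
Proof.
move=> th; have hi := cigr_real (tf_igr th).
exists (cF R * (2 * \int[m]_x cabs ((h x)%:C : R[i]))); last first.
  by move=> xi; exact: cabs_inv_fourier.
by apply: (le_trans (cabs_ge0 (ift h 0))); exact: cabs_inv_fourier.
Qed.

Definition step3 (t : R) (j : 'I_3) x : R3 R := affine3 x t (basis3 R j).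

Lemma step3E t j x : step3 t j x = t *: basis3 R j + x.
Proof.
case: x => [[x1 x2] x3]; rewrite /step3 /affine3 /=.
by congr (_, _, _); rewrite addrC.
Qed.

Lemma dot_basis3 j x : dot x (basis3 R j) = coord3 j x.
Proof. by rewrite dotE; case: j => [[|[|[|//]]] ?]; rewrite /basis3 /coord3 /=; ring. Qed.

Lemma gauss3_step (s : R) j x : 0 <= s <= 1 ->
  gauss3 (1 / 4) (step3 s j x) <= expR (1 / 4) * gauss3 (1 / 8) x.
Proof.
move=> /andP[s0 s1]; rewrite /gauss3 -expRD ler_expR /step3.
have : dot (basis3 R j) (basis3 R j) = 1.
  by rewrite dot_basis3; case: j => [[|[|[|//]]] ?].
have : 0 <= dot (affine3 x (2 * s) (basis3 R j)) (affine3 x (2 * s) (basis3 R j)) by exact: dot_ge0.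
have : s ^+ 2 <= 1 by rewrite expr_le1.
move: (basis3 R j) => v h1 h2 h3.
have : s ^+ 2 * dot v v <= 1 by rewrite h3 mulr1.
by move: h2 h3; rewrite !dotE /=; move: s0 s1; clear; nra.
Qed.

(** By the mean value theorem the quotient is a partial derivative at a point within distance 1 of
    x; a Gaussian bound there costs a constant and half of the exponent. The bound does not depend
    on t, as dominated convergence asks. *)
Lemma tf_step_bound h j : tf h -> exists2 C : R, 0 <= C &
  forall t x, 0 < t <= 1 -> `|t^-1 * (h (step3 t j x) - h x)| <= C * gauss3 (1 / 8) x.
Proof.
move=> th; have [|C C0 hC] := @tf_gauss_bound R _ (1 / 4) _ (tf_partial j th); first lra.
exists (C * expR (1 / 4)) => [|t x /andP[t0 t1]]; first by rewrite mulr_ge0 ?expR_ge0.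
pose F (s : R) := h (s *: basis3 R j + x).
pose F' (s : R) := partial j h (s *: basis3 R j + x).
have dF s : is_derive s (1 : R) F (F' s).
  have /is_derive_line H := tf_is_derive j (s *: basis3 R j + x) th.
  pose G (r : R) := h (r *: basis3 R j + (s *: basis3 R j + x)).
  have -> : F = G \o (fun r => r - s).
    by apply/funext => r; rewrite /F /G /= addrA -scalerDl subrK.
  have H0 : is_derive (s - s) (1 : R) G (F' s) by rewrite subrr.
  have H1 : is_derive s (1 : R) (fun r : R => r - s) (1 : R).
    by apply: is_derive_eq; rewrite subr0.
  have := @is_derive1_comp R G (fun r => r - s) s (F' s) 1 H0 H1.
  by rewrite mulr1.
have cF : {within `[0, t], continuous F}.
  by apply: derivable_within_continuous => s _; have [] := dF s.
have [s /itvP sI E] := @MVT R F F' 0 t t0 (fun s _ => dF s) cF.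
have F0 : F 0 = h x by rewrite /F scale0r add0r.
rewrite step3E -/(F t) -F0 E subr0 mulrC mulfK ?gt_eqF //.
apply: (le_trans (hC _)); rewrite -mulrA; apply: ler_wpM2l => //.
have s0 : 0 <= s by rewrite ltW // sI.
have s1 : s <= 1 by rewrite (le_trans _ t1) // ltW // sI.
by rewrite -step3E; apply: gauss3_step; rewrite s0.
Qed.

Lemma cvg_difference (f : R -> R) (df : R) (t : nat -> R) : is_derive (0 : R) (1 : R) f df ->
  (forall n, t n != 0) -> t @ \oo --> 0 ->
  (fun n => (t n)^-1 * (f (t n) - f 0)) @ \oo --> df.
Proof.
move=> [+ <-] t0 tc => d.
have E : (fun n => (t n)^-1 * (f (t n) - f 0)) =
    (fun s : R => s^-1 *: (f (s *: (1 : R) + 0) - f 0)) \o t.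
  by apply/funext => n /=; rewrite /GRing.scale /= mulr1 addr0.
rewrite E; have /cvgr_dnbhsP := d; move=> /(_ t (conj t0 tc)).
by [].

Qed.

Lemma cvg_difference_tf h j x (t : nat -> R) : tf h ->
  (forall n, t n != 0) -> t @ \oo --> 0 ->
  (fun n => (t n)^-1 * (h (step3 (t n) j x) - h x)) @ \oo --> partial j h x.
Proof.
move=> th t0 tc; have /is_derive_line H := tf_is_derive j x th.
have := cvg_difference H t0 tc.
by under eq_fun do rewrite scale0r add0r -step3E.
Qed.

Lemma dot_step3 (t : R) j xi x : dot xi (step3 t j x) = dot xi x + t * coord3 j xi.
Proof. by rewrite -dot_basis3 !dotE /=; ring. Qed.

(** Integration by parts in the form of translation invariance: the integral of the difference
    quotient against the character is (exp (- i t xi_j) - 1) / t times the transform, and t tends to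
    0. *)
Lemma ift_partial h j xi : tf h ->
  ift (partial j h) xi = (0 +i* (- coord3 j xi)) * ift h xi.
Proof.
move=> th; pose t (n : nat) : R := n.+1%:R^-1.
have t0 n : t n != 0 by rewrite invr_eq0.
have t01 n : 0 < t n <= 1 by rewrite invr_gt0 ltr0n invf_le1 // ler1n.
have tc : t @ \oo --> 0 by exact: cvg_harmonic.
have [C C0 hC] := tf_step_bound j th.
pose J := ci m (fun x => cexpi (dot xi x) * (h x)%:C).
have hi : cigr m (fun x : R3meas R => cexpi (dot xi x) * (h x)%:C).
  by apply: cigr_expi; apply: cigr_real; exact: tf_igr.
have mstep n : measurable_fun setT (fun x : R3meas R => step3 (t n) j x : R3meas R).
  by apply: measurable_affine3; [exact: measurable_id|exact: measurable_cst].
have [|||||_ lim1] := @cdct _ _ R m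
  (fun n x => cexpi (dot xi x) * ((t n)^-1 * (h (step3 (t n) j x) - h x))%:C)
  (fun x => cexpi (dot xi x) * (partial j h x)%:C) (fun x => C * gauss3 (1 / 8) x).
- move=> n; apply: cmeasM; first exact: cmeas_expi_dot.
  apply: cmeas_real; apply: measurable_funM; first exact: measurable_cst.
  apply: measurable_funB; last exact: tf_measurable.
  exact: (measurableT_comp (tf_measurable th) (mstep n)).
- by apply: cmeasM; [exact: cmeas_expi_dot|exact/tf_cmeas/tf_partial].
- apply: aeW => x; apply: ccvgM; first exact: ccvg_cst.
  by apply: ccvg_real; exact: cvg_difference_tf.
- by apply: igrZ; apply: igr_gauss3; lra.
- by move=> n x; rewrite cabsM cabs_expi mul1r cabs_real; exact: hC.
rewrite !iftE mulrCA; congr (_ * _).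
apply: (ccvg_unique lim1).
have E n : ci m (fun x => cexpi (dot xi x) * ((t n)^-1 * (h (step3 (t n) j x) - h x))%:C) =
    ((t n)^-1)%:C * (cexpi (- (t n * coord3 j xi)) - 1) * J.
  have sc := scales_translate (t n) (basis3 R j).
  have := scales_ci sc ltr01 hi.
  have := (scales_cigr sc ltr01 (cigr_meas hi)).1 hi.
  move=> i1; rewrite mul1r => e1; rewrite -/J in e1.
  rewrite -mulrA mulrBl mul1r -{1}e1 -(ciZ _ i1) -ciB; last exact: hi.
    rewrite -ciZ; last first.
      by apply: cigrB; [exact: cigrZ|exact: hi].
    apply: ci_ext => x; rewrite /= -/(step3 (t n) j x) dot_step3.
    rewrite (mulrA (cexpi _)) -expiD addrCA addNr addr0.
    rewrite realcM realcB; move: (cexpi _) (h _)%:C (h _)%:C (_^-1)%:C => p q r v; ring.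
  exact: cigrZ.
rewrite (_ : (fun n : nat => _) = fun n => ((t n)^-1)%:C * (cexpi (- (t n * coord3 j xi)) - 1) * J); last first.
  by apply/funext => n; exact: E.
apply: ccvgM; last exact: ccvg_cst.
pose c := coord3 j xi.
have d1 : is_derive (0 : R) (1 : R) (fun s => cos (- (s * c))) 0.
  by apply: is_derive_eq; rewrite mul0r oppr0 sin0 oppr0 mul0r.
have d2 : is_derive (0 : R) (1 : R) (fun s => sin (- (s * c))) (- c).
  by apply: is_derive_eq; rewrite mul0r oppr0 cos0 /GRing.scale /=; ring.
have := cvg_difference d1 t0 tc; have := cvg_difference d2 t0 tc.
rewrite mul0r oppr0 cos0 sin0 => e2 e1; split => /=.
  by under eq_fun do rewrite mul0r subr0.
by under eq_fun do rewrite mul0r addr0.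
Qed.
(** The operator 1 - Delta. Its symbol is 1 + |xi|^2, so iterating it on a test function gives
    transforms that decay faster than any power. *)
Definition bessel h : R3 R -> R := fun x => h x + \sum_(j < 3) (-1 * partial j (partial j h) x).

Lemma tfD h k : tf h -> tf k -> tf (fun x => h x + k x).
Proof.
move=> [h1 [A hA]] [k1 [B hB]]; split; first exact: ralg_add.
by exists (Num.max A B) => x; rewrite gt_max => /andP[/hA -> /hB ->]; rewrite addr0.
Qed.

Lemma tf_sum (n : nat) (f : 'I_n -> R3 R -> R) : (forall i, tf (f i)) ->
  tf (fun x => \sum_(i < n) f i x).
Proof.
elim: n f => [|n IH] f tff.
  rewrite (_ : (fun x => _) = fun=> 0); first exact: tf0.
  by apply/funext => x; rewrite big_ord0.
rewrite (_ : (fun x => _) = fun x => (\sum_(i < n) f (widen_ord (leqnSn n) i) x) + f ord_max x).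
  by apply: tfD => //; apply: IH.
by apply/funext => x; rewrite big_ord_recr.
Qed.

Lemma tf_bessel h : tf h -> tf (bessel h).
Proof.
move=> th; apply: tfD => //; apply: tf_sum => j; apply: tf_scale.
by do 2 apply: tf_partial.
Qed.

Lemma iftD h k xi : tf h -> tf k -> ift (fun x => h x + k x) xi = ift h xi + ift k xi.
Proof.
move=> th tk; rewrite !iftE -mulrDr -ciD.
- by congr (_ * _); apply: ci_ext => x; rewrite realcD mulrDr.
- by apply: cigr_expi; apply: cigr_real; exact: tf_igr.
- by apply: cigr_expi; apply: cigr_real; exact: tf_igr.
Qed.

Lemma ift_scale (c : R) h xi : tf h -> ift (fun x => c * h x) xi = c%:C * ift h xi.
Proof.
move=> th; rewrite !iftE [RHS]mulrCA; congr (_ * _); rewrite -ciZ.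
- by apply: ci_ext => x; rewrite realcM mulrCA.
- by apply: cigr_expi; apply: cigr_real; exact: tf_igr.
Qed.

Lemma ift0 xi : ift (fun=> 0) xi = 0.
Proof.
rewrite iftE (ci_ext _ (g := fun=> 0)) ?ci0 ?mulr0 // => x.
by rewrite mulr0.
Qed.

Lemma ift_sum (n : nat) (f : 'I_n -> R3 R -> R) xi : (forall i, tf (f i)) ->
  ift (fun x => \sum_(i < n) f i x) xi = \sum_(i < n) ift (f i) xi.
Proof.
elim: n f => [|n IH] f tff.
  rewrite big_ord0 -(ift0 xi); congr (ift _ xi).
  by apply/funext => x; rewrite big_ord0.
rewrite big_ord_recr /= -IH // -iftD //; last exact: tf_sum.
by congr (ift _ xi); apply/funext => x; rewrite big_ord_recr.
Qed.

Lemma ift_bessel h xi : tf h -> ift (bessel h) xi = (1 + dot xi xi)%:C * ift h xi.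
Proof.
move=> th; have th2 j := tf_partial j (tf_partial j th).
rewrite iftD //; last by apply: tf_sum => j; exact: tf_scale.
rewrite ift_sum; last by move=> j; exact: tf_scale.
rewrite realcD mulrDl mul1r; congr (_ + _).
rewrite /dot -[RHS]mulrC rmorph_sum /= mulr_sumr; apply: eq_bigr => j _.
rewrite ift_scale // ift_partial; last exact: tf_partial.
rewrite ift_partial //; move: (ift h xi) => z.
rewrite (_ : (coord3 j xi * coord3 j xi)%:C =
  (-1)%:C * ((0 +i* (- coord3 j xi)) * (0 +i* (- coord3 j xi)))); first by ring.
by apply: complex_ext; rewrite ?ReM ?ImM /=; ring.
Qed.

Lemma ift_decay (k : nat) h : tf h -> exists2 C : R, 0 <= C &
  forall xi, (1 + dot xi xi) ^+ k * cabs (ift h xi) <= C.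
Proof.
elim: k h => [|k IH] h th.
  by have [C C0 hC] := ift_bounded th; exists C => // xi; rewrite mul1r.
have [C C0 hC] := IH _ (tf_bessel th); exists C => // xi.
apply: le_trans (hC xi); rewrite ift_bessel // cabsM cabs_real ger0_norm.
  by rewrite exprSr mulrA.
by rewrite addr_ge0 ?dot_ge0.
Qed.

End TransformOfTests.

(** * Weak Fourier pairs and injectivity on L1 *)

Section Pairing.
Variable R : realType.
Notation m := (leb3s R).
Implicit Types (a b x y z xi : R3 R) (h : R3 R -> R) (u v k : R3meas R -> R[i]).

(** What mollification requires of a function; it holds for everything that pairs absolutely with
    Schwartz functions, hence for u and for its transform. *)
Definition tame u := cmeas u /\
  forall c : R, 0 < c -> igr m (fun x => cabs (u x) * gauss3 c x).

Lemma tame_cigr u : cigr m u -> tame u.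
Proof.
move=> ui; split; first exact: cigr_meas ui.
move=> c c0; apply: (igr_le _ _ (cigr_cabs ui)).
  by apply: measurable_funM; [exact: (cmeas_cabs (cigr_meas ui))|exact: measurable_gauss3].
move=> x; rewrite ger0_norm ?mulr_ge0 ?cabs_ge0 ?gauss3_ge0 // ler_piMr ?cabs_ge0 //.
exact/gauss3_le1/ltW.
Qed.

Lemma tame0 : tame (fun=> 0).
Proof. exact/tame_cigr/cigr0. Qed.

Lemma cmeas_gauss3 (c : R) : cmeas (fun x : R3meas R => (gauss3 c x)%:C : R[i]).
Proof. exact: (cmeas_real (measurable_gauss3 c)). Qed.

Lemma tame_cigr_gauss u (c : R) : 0 < c -> tame u -> cigr m (fun x => u x * (gauss3 c x)%:C).
Proof.
move=> c0 [mu ui]; apply: (cigr_le _ _ (ui c c0)).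
  by apply: cmeasM => //; exact: cmeas_gauss3.
by move=> x; rewrite cabsM cabs_real ger0_norm ?gauss3_ge0.
Qed.

Lemma tame_cigr_tf u h : tame u -> tf h -> cigr m (fun x => u x * (h x)%:C).
Proof.
move=> [mu ui] th; have [C C0 hC] := tf_gauss_bound ler01 th.
apply: (cigr_le _ _ (igrZ C (ui 1 ltr01))).
  by apply: cmeasM => //; exact: tf_cmeas.
move=> x; rewrite cabsM cabs_real [leRHS]mulrCA; apply: ler_wpM2l; first exact: cabs_ge0.
exact: hC.
Qed.

Lemma tame_ae_eq u v : tame u -> tame v ->
  (forall h, tf h -> ci m (fun x => u x * (h x)%:C) = ci m (fun x => v x * (h x)%:C)) ->
  {ae m, forall x, u x = v x}.
Proof.
move=> tu tv H; apply: ae_eq_of_tf => //; [exact: tu.1|exact: tv.1| |].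
- by move=> h; exact: tame_cigr_tf.
- by move=> h; exact: tame_cigr_tf.
Qed.

Lemma ccvg_cF (z : nat -> R[i]) (l l' : R[i]) :
  ccvg z ((cF R)^-1%:C * l) -> ccvg z ((cF R)^-1%:C * l') -> l = l'.
Proof.
move=> h1 h2; apply: (@mulfI _ ((cF R)^-1%:C)); last exact: ccvg_unique h1 h2.
by rewrite -(rmorph0 (real_complex R)) (inj_eq (@complexI R)) invr_eq0 gt_eqF // cF_gt0.
Qed.

(** Fubini carries h to the frequency side; the Gaussian makes the double integral converge
    absolutely although v need not be integrable. *)
Lemma ft_tensor v h (c : R) : 0 < c -> tame v -> tf h ->
  ci m (fun y => ci m (fun xi => v xi * mgauss c y xi) * (h y)%:C) =
  (cF R)^-1%:C * ci m (fun xi => v xi * ift h xi * (gauss3 c xi)%:C).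
Proof.
move=> c0 tv th; pose vg xi := v xi * (gauss3 c xi)%:C.
have vgi : cigr m vg by exact: tame_cigr_gauss.
have hi : cigr m (fun x => (h x)%:C : R[i]) by exact: (cigr_real (tf_igr th)).
have me : cmeas (fun p : R3meas R * R3meas R => cexpi (dot p.1 p.2) : R[i]).
  by apply: cmeas_expi; apply: measurable_dot; [exact: measurable_fst|exact: measurable_snd].
have I : cigr (sfprod m m) (fun p => (h p.1)%:C * vg p.2 * cexpi (dot p.1 p.2)).
  apply: (cigrM_bounded (cigr_prod hi vgi) me (M := 1)) => p.
  by rewrite cabs_expi.
have -> : ci m (fun y => ci m (fun xi => v xi * mgauss c y xi) * (h y)%:C) =
   ci m (fun y => ci m (fun xi => (h y)%:C * vg xi * cexpi (dot y xi))).
  apply: ci_ext => y; rewrite mulrC -ciZ.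
    by apply: ci_ext => xi; rewrite /vg /mgauss; move: (h y)%:C (cexpi _) => p q; ring.
  by apply: (cigr_ext _ (cigr_expi y vgi)) => xi; rewrite /vg /mgauss mulrCA.
rewrite (cfubini_swap I) /= -ciZ; last first.
  have [C C0 hC] := ift_bounded th.
  have := cigrM_bounded vgi (cmeas_ift th) hC; apply: cigr_ext => xi.
  by rewrite /vg mulrAC.
apply: ci_ext => xi; rewrite iftE -mulrA -/(vg xi).
have -> : ci m (fun x => (h x)%:C * vg xi * cexpi (dot x xi)) =
    vg xi * ci m (fun x => cexpi (dot xi x) * (h x)%:C).
  rewrite -ciZ; last exact: cigr_expi.
  by apply: ci_ext => x; rewrite (dotC x xi); move: (cexpi _) (h _)%:C (vg _) => p q r; ring.
rewrite /vg; move: (ci _ _) (v xi) (gauss3 _ _)%:C => p q r.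
have k : (cF R)^-1%:C * (cF R)%:C = 1 :> R[i].
  by rewrite -realcM mulVf // gt_eqF // cF_gt0.
rewrite (_ : (cF R)^-1%:C * _ = ((cF R)^-1%:C * (cF R)%:C) * (q * p * r)); last by ring.
by rewrite k mul1r; ring.
Qed.

Lemma cvg_gauss3_sqr (e : nat -> R) x : e @ \oo --> 0 ->
  (fun n => gauss3 (e n ^+ 2 / 2) x) @ \oo --> (1 : R).
Proof.
move=> ec; have h : (fun n => - (e n ^+ 2 / 2 * dot x x)) @ \oo --> (- (0 * 0 / 2 * dot x x) : R).
  by apply: cvgN; do 2 apply: cvgMl; rewrite /=; under eq_fun do rewrite expr2; exact: cvgM.
have := continuous_cvg _ (@continuous_expR R _) h.
by rewrite !mul0r oppr0 expR0; apply.
Qed.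

(* Mollifying both sides by a Gaussian: the hypothesis says that v is the
   Fourier transform of u, tested on Gaussians only. *)
Lemma gauss_pairing u v h : tame u -> tame v ->
  (forall (e : R) y, 0 < e <= 1 ->
     ci m (fun x => u x * (pk e (affine3 y (-1) x))%:C) =
     ci m (fun xi => v xi * mgauss (e ^+ 2 / 2) y xi)) ->
  tf h -> cigr m (fun xi => v xi * ift h xi) ->
  ci m (fun x => u x * (h x)%:C) = ci m (fun xi => v xi * ift h xi).
Proof.
move=> tu tv H th vi; pose e (n : nat) : R := n.+1%:R^-1.
have e01 n : 0 < e n <= 1 by rewrite invr_gt0 ltr0n invf_le1 // ler1n.
have ec : e @ \oo --> 0 by exact: cvg_harmonic.
have := cvg_mollify tu.1 th tu.2 e01 ec; move/ccvg_cF; apply.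
rewrite (_ : (fun n : nat => _) = fun n =>
   (cF R)^-1%:C * ci m (fun xi => v xi * ift h xi * (gauss3 (e n ^+ 2 / 2) xi)%:C)); last first.
  apply/funext => n; have /andP[en _] := e01 n.
  have c0 : 0 < e n ^+ 2 / 2 by rewrite divr_gt0 // exprn_gt0.
  rewrite -(ft_tensor c0 tv th); apply: ci_ext => y; rewrite (H _ _ (e01 n)).
  exact: erefl.
apply: ccvgM; first exact: ccvg_cst.
apply: (cdct _ _ _ (cigr_cabs vi) _).2.
- by move=> n; apply: cmeasM; [exact: cigr_meas vi|exact: cmeas_gauss3].
- exact: cigr_meas vi.
- apply: aeW => xi; rewrite -[X in ccvg _ X]mulr1; apply: ccvgM; first exact: ccvg_cst.
  by apply: ccvg_real; exact: cvg_gauss3_sqr.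
- move=> n xi; rewrite cabsM cabs_real ger0_norm ?gauss3_ge0 // ler_piMr ?cabs_ge0 //.
  by rewrite gauss3_le1 // divr_ge0 // sqr_ge0.
Qed.

(** [gauss_pairing] with v = 0: the mollification of k at y is, by Fubini, a Gaussian average of
    values of its transform, all of which vanish. *)
Lemma L1_injective k : cigr m k ->
  (forall y, ci m (fun xi => cexpi (dot y xi) * k xi) = 0) -> {ae m, forall x, k x = 0}.
Proof.
move=> ki k0; have tk := tame_cigr ki.
apply: (tame_ae_eq tk tame0) => h th.
have -> : ci m (fun x => 0 * (h x)%:C) = ci m (fun xi => 0 * ift h xi).
  by apply: ci_ext => x; rewrite !mul0r.
apply: (gauss_pairing tk tame0) => //; last first.
  by apply: (cigr_ext _ (cigr0 _)) => x; rewrite mul0r.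
move=> e y /andP[e0 _]; rewrite [RHS](ci_ext _ (g := fun=> 0)); last by move=> x; rewrite mul0r.
rewrite ci0; pose c := e ^+ 2 / 2.
have c0 : 0 < c by rewrite divr_gt0 // exprn_gt0.
have gi : cigr m (fun xi => (gauss3 c xi)%:C : R[i]) by exact: (cigr_real (igr_gauss3 c0)).
have me : cmeas (fun p : R3meas R * R3meas R => cexpi (dot (affine3 y (-1) p.1) p.2) : R[i]).
  apply: cmeas_expi; apply: measurable_dot; last exact: measurable_snd.
  by apply: measurable_affine3; [exact: measurable_cst|exact: measurable_fst].
have I : cigr (sfprod m m) (fun p => k p.1 * (gauss3 c p.2)%:C * cexpi (dot (affine3 y (-1) p.1) p.2)).
  apply: (cigrM_bounded (cigr_prod ki gi) me (M := 1)) => p.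
  by rewrite cabs_expi.
have -> : ci m (fun x => k x * (pk e (affine3 y (-1) x))%:C) =
   (cF R)%:C * ci m (fun x => ci m (fun xi => k x * (gauss3 c xi)%:C * cexpi (dot (affine3 y (-1) x) xi))).
  rewrite -ciZ; last by have [_ + _] := cfubini I.
  apply: ci_ext => x; rewrite -(ft_gauss3 _ e0) [LHS]mulrCA; congr (_ * _).
  rewrite -ciZ; last exact: (cigr_expi _ gi).
  by apply: ci_ext => xi; rewrite -mulrA (mulrC (cexpi _)).
rewrite (cfubini_swap I) /= (ci_ext _ (g := fun=> 0)) ?ci0 ?mulr0 // => xi.
have -> : ci m (fun x => k x * (gauss3 c xi)%:C * cexpi (dot (affine3 y (-1) x) xi)) =
   (gauss3 c xi)%:C * cexpi (dot y xi) * ci m (fun x => cexpi (dot (affine3 0 (-1) xi) x) * k x).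
  rewrite -ciZ; last exact: cigr_expi.
  apply: ci_ext => x; rewrite dotBl expiD dot_scalel mulN1r (dotC xi x).
  by move: (cexpi _) (cexpi _) (k x) => p q r; ring.
by rewrite k0 mulr0.
Qed.

End Pairing.

(** * Uniqueness from pairings with transforms of test functions *)

Section Dilation.
Variable R : realType.
Notation m := (leb3s R).
Implicit Types (a b x y z xi : R3 R) (h : R3 R -> R) (u v k : R3meas R -> R[i]).

Let one3 : R3 R := (1, 1, 1).

(** A bump on the cube of half-side 1 / l about y. Its transform is the character exp (i y . xi)
    times a function of xi / l independent of y, so varying y produces all characters. *)
Definition dil (l : R) y : R3 R -> R :=
  boxbump l (affine3 y (- l^-1) one3) (affine3 y l^-1 one3).

Lemma tf_dil l y : 0 < l -> tf (dil l y).
Proof. exact: tf_boxbump. Qed.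

Lemma dilE l y z : 0 < l -> dil l y (affine3 y l^-1 z) = dil 1 0 z.
Proof.
move=> l0; have ln : l != 0 by rewrite gt_eqF.
rewrite /dil /boxbump /=.
by congr (ebump 0 _ * ebump 0 _ * (ebump 0 _ * ebump 0 _) * (ebump 0 _ * ebump 0 _)); field.
Qed.

Lemma ift_dil l y xi : 0 < l ->
  ift (dil l y) xi = (l^-1 ^+ 3)%:C * cexpi (dot y xi) * ift (dil 1 0) (affine3 0 l^-1 xi).
Proof.
move=> l0; have l0' : 0 < l^-1 by rewrite invr_gt0.
have sc := scales_leb3 y (lt0r_neq0 l0').
have I : cigr m (fun x => cexpi (dot xi x) * (dil l y x)%:C).
  by apply: cigr_expi; apply: cigr_real; apply: tf_igr; exact: tf_dil.
rewrite !iftE -(scales_ci sc (norm3_gt0 l0') I) (gtr0_norm l0').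
rewrite [LHS]mulrCA -[RHS]mulrA; congr (_ * _); rewrite [RHS]mulrCA; congr (_ * _).
rewrite -ciZ; last first.
  by apply: cigr_expi; apply: cigr_real; apply: tf_igr; exact: tf_dil.
apply: ci_ext => z; rewrite /= (dilE _ _ l0) mulrA -expiD; congr (cexpi _ * _).
by rewrite !dotE /=; ring.
Qed.

Lemma dil_int_gt0 : 0 < \int[m]_x dil 1 0 x.
Proof.
have ge0 x : 0 <= dil 1 0 x by exact: boxbump_ge0.
have tb := @tf_dil 1 0 ltr01.
rewrite lt_neqAle; apply/andP; split; last exact: Rintegral_ge0.
apply/negP => /eqP /esym /(Rint_eq0 (tf_igr tb) ge0) [N [mN N0 sub]].
pose B := obox (affine3 0 (- 1^-1) one3) (affine3 0 1^-1 one3).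
have BN : B `<=` N.
  move=> x Bx; apply: sub => /=; apply/eqP; rewrite gt_eqF //.
  exact: boxbump_gt0.
have : (m B <= 0)%E.
  by rewrite -N0; apply: le_measure => //; rewrite inE //; exact: measurable_obox.
rewrite /B oboxE leb3s_box; [|exact: measurable_itv..].
rewrite !lebesgue_measure_itv /= !lte_fin invr1 !add0r !mul1r mulN1r.
rewrite (_ : (- 1 < 1 :> R) = true); last by apply/idP; lra.
by rewrite -!EFinB -!EFinM lee_fin; lra.
Qed.

(** The transform of the bump tends to a positive multiple of its integral along xi / (n + 1), so it
    cannot vanish for every n. *)
Lemma ift_dil_neq0 xi : exists n : nat, ift (dil 1 0) (affine3 0 n.+1%:R^-1 xi) != 0.
Proof.
have tb := @tf_dil 1 0 ltr01.
apply: contrapT => /forallNP H.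
have lim1 : ccvg (fun n : nat => ci m (fun x => cexpi (n.+1%:R^-1 * dot xi x) * (dil 1 0 x)%:C))
    (ci m (fun x => (dil 1 0 x)%:C)).
  apply: (@cdct _ _ R m _ _ (fun x => `|dil 1 0 x|) _ _ _ _ _).2.
  - move=> n; apply: cmeasM; last exact: tf_cmeas.
    apply: cmeas_expi; apply: measurable_funM; first exact: measurable_cst.
    by apply: measurable_dot; [exact: measurable_cst|exact: measurable_id].
  - exact: tf_cmeas.
  - apply: aeW => x; rewrite -[X in ccvg _ X]mul1r; apply: ccvgM; last exact: ccvg_cst.
    have c0 : (fun n : nat => n.+1%:R^-1 * dot xi x) @ \oo --> (0 * dot xi x : R).
      by apply: cvgMl; exact: cvg_harmonic.
    rewrite mul0r in c0; split => /=.
      by rewrite -[X in _ --> X](@cos0 R); exact: (cvg_comp _ _ c0 (@continuous_cos R 0)).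
    by rewrite -[X in _ --> X](@sin0 R); exact: (cvg_comp _ _ c0 (@continuous_sin R 0)).
  - exact: (igr_norm (tf_igr tb)).
  - by move=> n x; rewrite cabsM cabs_expi mul1r cabs_real.
have E n : ci m (fun x => cexpi (n.+1%:R^-1 * dot xi x) * (dil 1 0 x)%:C) = 0.
  have /negP := H n; rewrite negbK iftE mulf_eq0 => /orP[|/eqP <-]; last first.
    by apply: ci_ext => x; rewrite dot_scalel.
  by rewrite -(rmorph0 (real_complex R)) (inj_eq (@complexI R)) gt_eqF // cF_gt0.
move: lim1; rewrite (_ : (fun n : nat => _) = fun=> 0); last exact/funext.
move=> /ccvg_unique /(_ (ccvg_cst _)) /esym; rewrite ci_real => /(congr1 (@complex.Re R)) /= e0.
by have := dil_int_gt0; rewrite e0 ltxx.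
Qed.

(* Testing against translates of the bump of width [1/(n+1)] gives
   [k * ift bump = 0] by the injectivity of the Fourier transform on L1. *)
Lemma ift_tests_eq0 k : cmeas k ->
  (forall h, tf h -> cigr m (fun x => k x * ift h x) /\ ci m (fun x => k x * ift h x) = 0) ->
  {ae m, forall x, k x = 0}.
Proof.
move=> mk H; pose B n xi := ift (dil 1 0) (affine3 0 n.+1%:R^-1 xi).
have E n y xi : (n.+1%:R ^+ 3)%:C * (k xi * ift (dil n.+1%:R y) xi) =
    cexpi (dot y xi) * (k xi * B n xi).
  rewrite ift_dil // -/(B n xi) exprVn.
  have : (n.+1%:R ^+ 3)%:C * (n.+1%:R ^- 3)%:C = 1 :> R[i].
    by rewrite -realcM mulfV // expf_eq0.
  move: (_%:C) (_%:C) (cexpi _) (k _) (B _ _) => p q r s t pq.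
  by rewrite (_ : q * _ = (q * p) * (r * (s * t))); [rewrite pq mul1r|ring].
have e0 xi : cexpi (dot (0 : R3 R) xi) = 1 :> R[i].
  by rewrite dotE /= !mul0r !addr0 /cexpi cos0 sin0.
have ae n : {ae m, forall xi, k xi * B n xi = 0}.
  apply: L1_injective.
    have [I _] := H _ (@tf_dil n.+1%:R 0 (ltr0Sn _ _)).
    apply: (cigr_ext _ (cigrZ (n.+1%:R ^+ 3)%:C I)) => xi.
    by rewrite E e0 mul1r.
  move=> y; have [I I0] := H _ (@tf_dil n.+1%:R y (ltr0Sn _ _)).
  by apply: (etrans (esym (ci_ext m (E n y)))); rewrite (ciZ _ I) I0 mulr0.
apply: (ae_imp (ae_all_nat ae)) => xi K.
have [n hn] := ift_dil_neq0 xi.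
by have /eqP := K n; rewrite mulf_eq0 (negbTE hn) orbF => /eqP.
Qed.

End Dilation.

(** * The fractional Laplacian and the dissipation term *)

Section Representatives.
Variable R : realType.
Notation m := (leb3s R).
Implicit Types (a b x y z xi : R3 R) (h : R3 R -> R) (u v k f g : R3meas R -> R[i]).

(** The polynomial weight for decay on the frequency side; its square is integrable in dimension
    3. *)
Definition wt x : R := (1 + dot x x)^-1.

Lemma wt_den_gt0 x : 0 < 1 + dot x x.
Proof. by apply: (lt_le_trans ltr01); rewrite lerDl dot_ge0. Qed.

Lemma wt_gt0 x : 0 < wt x.
Proof. by rewrite invr_gt0 wt_den_gt0. Qed.

Lemma wt_le1 x : wt x <= 1.
Proof. by rewrite invf_le1 ?wt_den_gt0 // lerDl dot_ge0. Qed.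

Lemma wtK x : (1 + dot x x) * wt x = 1.
Proof. by rewrite mulfV // gt_eqF // wt_den_gt0. Qed.

Lemma measurable_wt : measurable_fun setT (wt : R3meas R -> R).
Proof.
apply: continuous_measurable3 => x.
apply: cvgV; first by rewrite gt_eqF // wt_den_gt0.
by apply: cvgD; [exact: cvg_cst|exact: continuous_dot].
Qed.

(** Compared with [wker 1], which is at least 1 near the origin and equals |x|^(-10/3) far away,
    where the square of the weight is at most |x|^(-4). *)
Lemma igr_wt2 : igr m (fun x => wt x ^+ 2).
Proof.
apply: (igr_le_ae _ _ (igr_wker1 R)).
  by under eq_fun do rewrite expr2; apply: measurable_funM; exact: measurable_wt.
apply: (ae_imp (ae_neq0 R)) => x /enorm_gt0 x0.
rewrite ger0_norm ?sqr_ge0 // /wt -enorm_sqr /wker; move: (enorm x) x0 => t t0.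
have [t1|t1] := leP t 1.
  have h1 : 1 <= t `^ (- (5 / 3)).
    have := @powRN_le R (5 / 3) t 1 _ t0 t1; rewrite powR1; apply; lra.
  rewrite powR1 mulr1; apply: le_trans h1.
  by rewrite exprn_ile1 // ?invr_ge0 ?invf_le1 //; have := sqr_ge0 t; lra.
have E : t `^ (- (5 / 3)) * t `^ (- (5 / 3)) = t `^ (- (10 / 3)).
  by rewrite -powRD ?(gt_eqF t0) ?implybT //; congr (_ `^ _); lra.
rewrite E; apply: (@le_trans _ _ (t `^ (- 4))).
  rewrite powRN -[4]/(4%:R) powR_mulrn ?(ltW t0) // -exprVn.
  rewrite (_ : t^-1 ^+ 4 = (t ^+ 2)^-1 ^+ 2); last by rewrite !exprVn -exprM.
  rewrite lerXn2r ?nnegrE ?invr_ge0 ?addr_ge0 ?sqr_ge0 // lef_pV2 ?posrE ?exprn_gt0 //.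
    by rewrite lerDr.
  by rewrite ltr_wpDr ?sqr_ge0.
by apply: ler_powR; [exact: ltW|lra].
Qed.

Lemma expr2_wt x : (1 + dot x x) ^+ 2 <= 2 * (1 + enorm x ^+ 4).
Proof.
rewrite (_ : enorm x ^+ 4 = dot x x ^+ 2); last by rewrite -enorm_sqr -exprM.
by have := sqr_ge0 (1 - dot x x); move: (dot x x) => t; nra.
Qed.

Lemma schwartz_cigr g : schwartz g -> cigr m g.
Proof.
move=> [[s1 s2] dec].
have mg : cmeas g.
  by split; apply: continuous_measurable3; [have [] := s1 [::]|have [] := s2 [::]].
(* The seminorms of order 0 and 4 together bound (1 + |x|^2)^2 |g|. *)
have [M0 h0] := dec 0%N [::]; have [M4 h4] := dec 4%N [::].
apply: (cigr_le mg _ (igrZ (2 * (M0 + M4)) igr_wt2)) => x.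
have {h0}h0 := h0 x; have {h4}h4 := h4 x; rewrite expr0 mul1r in h0.
have e : cpartials [::] g x = g x by rewrite /cpartials /=; case: (g x).
rewrite e in h0 h4.
have p0 : 0 < (1 + dot x x) ^+ 2 by rewrite exprn_gt0 // wt_den_gt0.
rewrite -(ler_pM2l p0) mulrCA -exprMn wtK expr1n mulr1.
apply: (le_trans (ler_wpM2r (cabs_ge0 _) (expr2_wt x))).
by rewrite -mulrA ler_pM2l // mulrDl mul1r lerD.
Qed.

Lemma represents_ae (T : distr R) f g : represents T f -> represents T g ->
  {ae m, forall x, f x = g x}.
Proof.
move=> [mf Hf] [mg Hg]; apply: ae_eq_of_tf => // h th.
- by have [] := Hf _ (tf_schwartz th).
- by have [] := Hg _ (tf_schwartz th).
- have [_ e1] := Hf _ (tf_schwartz th); have [_ e2] := Hg _ (tf_schwartz th).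
  exact: (etrans (esym e1) e2).
Qed.

Lemma fun_of_represents (T : distr R) : is_function T -> represents T (fun_of T).
Proof. by rewrite /fun_of; case: pselect => // H _; exact: (projT2 (cid H)). Qed.

Lemma fun_of_ae (T : distr R) f : represents T f -> {ae m, forall x, fun_of T x = f x}.
Proof.
by move=> H; apply: (represents_ae (T := T)) => //; apply: fun_of_represents; exists f.
Qed.

Lemma cigr_fourier_kernel f g (s : R) : cigr m f -> cigr m g ->
  cigr (sfprod m m) (fun p => f p.1 * g p.2 * cexpi (s * dot p.1 p.2)).
Proof.
move=> fi gi; apply: (cigrM_bounded (cigr_prod fi gi) _ (M := 1)); last first.
  by move=> p; rewrite cabs_expi.
apply: cmeas_expi; apply: measurable_funM; first exact: measurable_cst.
by apply: measurable_dot; [exact: measurable_fst|exact: measurable_snd].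
Qed.

(* Covers the Fourier transform [s = -1] and its inverse [s = 1]. *)
Lemma ci_kernel_swap f g (s : R) : cigr m f -> cigr m g ->
  cigr m (fun x => f x * ci m (fun y => cexpi (s * dot x y) * g y)) /\
  ci m (fun x => f x * ci m (fun y => cexpi (s * dot x y) * g y)) =
  ci m (fun y => ci m (fun x => cexpi (s * dot y x) * f x) * g y).
Proof.
move=> fi gi; have I := cigr_fourier_kernel s fi gi.
have ek (k : R3meas R -> R[i]) x : cigr m k -> cigr m (fun y => cexpi (s * dot x y) * k y).
  move=> ki; apply: (cigr_ext _ (cigr_expi (affine3 0 s x) ki)) => y.
  by rewrite dot_scalel.
have E1 x : ci m (fun y => f x * g y * cexpi (s * dot x y)) =
    f x * ci m (fun y => cexpi (s * dot x y) * g y).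
  by rewrite -ciZ; [apply: ci_ext => y; rewrite mulrAC mulrA|exact: ek].
have E2 y : ci m (fun x => f x * g y * cexpi (s * dot x y)) =
    ci m (fun x => cexpi (s * dot y x) * f x) * g y.
  rewrite -ciZr; last exact: ek.
  apply: ci_ext => x; rewrite (dotC x y).
  by move: (f x) (g y) (cexpi _) => p q r; ring.
split.
  by have [_ J _] := cfubini I; apply: (cigr_ext _ J) => x; exact: E1.
rewrite -(ci_ext m E1) -(ci_ext m E2); exact: (cfubini_swap I).
Qed.

Lemma ci_fourier f g : cigr m f -> cigr m g ->
  ci m (fun x => f x * fourier g x) = ci m (fun y => fourier f y * g y).
Proof.
move=> fi gi; have [I E] := ci_kernel_swap (-1) fi gi.
have F k x : fourier k x = (cF R)%:C * ci m (fun y => cexpi (-1 * dot x y) * k y).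
  by rewrite fourierE; congr (_ * _); apply: ci_ext => y; rewrite mulN1r (dotC x y).
transitivity ((cF R)%:C * ci m (fun x => f x * ci m (fun y => cexpi (-1 * dot x y) * g y))).
  by rewrite -(ciZ _ I); apply: ci_ext => x; rewrite F mulrCA.
have [J _] := ci_kernel_swap (-1) gi fi.
rewrite E -ciZ; last by apply: (cigr_ext _ J) => y; rewrite mulrC.
by apply: ci_ext => y; rewrite F mulrA.
Qed.

Lemma ci_inv_fourier f g : cigr m f -> cigr m g ->
  ci m (fun x => f x * inv_fourier g x) = ci m (fun y => inv_fourier f y * g y).
Proof.
move=> fi gi; have [I E] := ci_kernel_swap 1 fi gi.
have F k x : inv_fourier k x = (cF R)%:C * ci m (fun y => cexpi (1 * dot x y) * k y).
  by rewrite inv_fourierE; congr (_ * _); apply: ci_ext => y; rewrite mul1r.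
transitivity ((cF R)%:C * ci m (fun x => f x * ci m (fun y => cexpi (1 * dot x y) * g y))).
  by rewrite -(ciZ _ I); apply: ci_ext => x; rewrite F mulrCA.
have [J _] := ci_kernel_swap 1 gi fi.
rewrite E -ciZ; last by apply: (cigr_ext _ J) => y; rewrite mulrC.
by apply: ci_ext => y; rewrite F mulrA.
Qed.

Lemma fourier_real h xi : tf h -> fourier (of_real h) xi = conjc (ift h xi).
Proof.
move=> th; rewrite fourierE iftE conjcM conjc_realE -ci_conj; last first.
  by apply: cigr_expi; apply: cigr_real; exact: tf_igr.
congr (_ * _); apply: ci_ext => x; rewrite conjcM expi_conj conjc_realE.
by rewrite (dotC x xi).
Qed.

Lemma cigr_bounded_schwartz f g (M : R) : cmeas f -> (forall x, cabs (f x) <= M) ->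
  schwartz g -> cigr m (fun x => f x * g x).
Proof.
move=> mf fM sg; have := cigrM_bounded (schwartz_cigr sg) mf fM.
by apply: cigr_ext => x; rewrite mulrC.
Qed.

Lemma hat_tf h : tf h ->
  {ae m, forall xi, hat (distr_of (of_real h)) xi = conjc (ift h xi)}.
Proof.
move=> th; have hi : cigr m (of_real h) := cigr_real (tf_igr th).
have mc : cmeas (fun xi => conjc (ift h xi)) := cmeas_conj (cmeas_ift th).
have [C C0 hC] := ift_bounded th.
apply: fun_of_ae; split; first exact: mc.
move=> g sg; split.
  by apply: (cigr_bounded_schwartz mc _ sg (M := C)) => x; rewrite cabs_conj.
apply: (etrans (ci_fourier hi (schwartz_cigr sg))).
by apply: ci_ext => y; rewrite fourier_real.
Qed.

Lemma powR_le_wt (p : R) xi : 0 <= p <= 2 -> enorm xi `^ p <= 1 + dot xi xi.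
Proof.
move=> /andP[p0 p2]; rewrite -enorm_sqr; have t0 := enorm_ge0 xi.
move: (enorm xi) t0 => t t0; have [t1|t1] := leP t 1.
  apply: (@le_trans _ _ 1); last by rewrite lerDl sqr_ge0.
  have -> : 1 = 1 `^ p :> R by rewrite powR1.
  by apply: ge0_ler_powR; rewrite ?nnegrE.
apply: (@le_trans _ _ (t `^ 2)); first by apply: ler_powR => //; exact: ltW.
by rewrite -[2]/(2%:R) powR_mulrn // lerDr.
Qed.

(** The symbol |xi|^p times the Fourier transform of h, which for real h is the conjugate of the
    inverse transform. *)
Definition wft (p : R) h xi : R[i] := (enorm xi `^ p)%:C * conjc (ift h xi).

Lemma cmeas_wft p h : tf h -> cmeas (wft p h).
Proof.
move=> th; apply: cmeasM; last by apply: cmeas_conj; exact: cmeas_ift.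
by apply: cmeas_real; exact: measurable_enorm_powR.
Qed.

Lemma wft_decay (n : nat) (p : R) h : 0 <= p <= 2 -> tf h ->
  exists2 C : R, 0 <= C & forall xi, cabs (wft p h xi) <= C * wt xi ^+ n.
Proof.
move=> p02 th; have [C C0 hC] := ift_decay n.+1 th; exists C => // xi.
rewrite cabsM cabs_real cabs_conj ger0_norm ?powR_ge0 //.
have q := wt_den_gt0 xi; have q2 : 0 < (1 + dot xi xi) ^+ n by rewrite exprn_gt0.
rewrite -(ler_pM2l q2) [leRHS]mulrCA -exprMn wtK expr1n mulr1.
apply: le_trans (hC xi); rewrite exprSr -mulrA ler_pM2l //.
by apply: ler_wpM2r; [exact: cabs_ge0|exact: powR_le_wt].
Qed.

Lemma cigr_wft (p : R) h : 0 <= p <= 2 -> tf h -> cigr m (wft p h).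
Proof.
move=> p02 th; have [C C0 hC] := wft_decay 2 p02 th.
apply: (cigr_le _ _ (igrZ C igr_wt2)); [exact: cmeas_wft|exact: hC].
Qed.

(** [fun_of] fixes a function only up to a null set, hence the almost everywhere form. Duality shows
    that the ordinary inverse transform of the integrable symbol [wft] is one representative. *)
Lemma fracLap_tf (s : R) h : 0 <= 2 * s <= 2 -> tf h ->
  {ae m, forall x, fun_of (fracLap s (distr_of (of_real h))) x = inv_fourier (wft (2 * s) h) x}.
Proof.
move=> s02 th; have bi := cigr_wft s02 th.
apply: fun_of_ae; split; first exact: cmeas_inv_fourier (cigr_meas bi).
move=> g sg; have gi := schwartz_cigr sg; split.
  apply: (cigr_bounded_schwartz _ _ sg); first exact: cmeas_inv_fourier (cigr_meas bi).
  by move=> x; exact: cabs_inv_fourier.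
apply: etrans (ci_inv_fourier bi gi).
(* Measurable in either branch of the choice: a representative, or the default zero function. *)
have mhat : cmeas (hat (distr_of (of_real h)) : R3meas R -> R[i]).
  rewrite /hat /fun_of; case: pselect => [H|_]; last exact: cmeas_cst.
  by have [] := projT2 (cid H).
have mp : cmeas (fun xi : R3meas R => (enorm xi `^ (2 * s))%:C : R[i]).
  by apply: cmeas_real; exact: measurable_enorm_powR.
have mg := cmeas_inv_fourier (cigr_meas gi).
apply: (@ci_ae _ _ R m).
- by apply: cmeasM => //; exact: cmeasM.
- by apply: cmeasM => //; exact: cigr_meas bi.
by apply: (ae_imp (hat_tf th)) => xi E; rewrite E.
Qed.

End Representatives.

(** The supremum is finite almost everywhere because its integral is at most K; what is kept of it
    is a finite integrable majorant. *)
Lemma beppo_levi d (T : measurableType d) (R : realType) (mu : {measure set T -> \bar R})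
    (f_ : nat -> T -> R) (K : R) :
  (forall n, igr mu (f_ n)) -> (forall n x, 0 <= f_ n x) ->
  (forall x n k, (n <= k)%N -> f_ n x <= f_ k x) ->
  (forall n, \int[mu]_x f_ n x <= K) ->
  exists f : T -> R, [/\ igr mu f, forall x, 0 <= f x &
    {ae mu, forall x, forall n, f_ n x <= f x}].
Proof.
move=> fi f0 fnd fK.
pose F x := ereal_sup (range (fun n => (f_ n x)%:E)).
have nd x : {homo (fun n => (f_ n x)%:E) : n k / (n <= k)%N >-> (n <= k)%E}.
  by move=> n k nk; rewrite lee_fin fnd.
have cF x : (fun n => (f_ n x)%:E) @ \oo --> F x := ereal_nondecreasing_cvgn (nd x).
have mf_ n : measurable_fun setT (EFin \o f_ n).
  by apply/measurable_EFinP; exact: igr_meas (fi n).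
have mF : measurable_fun setT F.
  exact: (emeasurable_fun_cvg (fun n => EFin \o f_ n) F mf_ (fun x _ => cF x)).
have F0 x : (0 <= F x)%E.
  by apply: (@le_trans _ _ (f_ 0%N x)%:E); [rewrite lee_fin|apply: ereal_sup_ubound; exists 0%N].
have FK : (\int[mu]_x F x <= K%:E)%E.
  have : (fun n => \int[mu]_x (f_ n x)%:E)%E @ \oo -->
      (\int[mu]_x limn (fun n => (f_ n x)%:E))%E.
    apply: (cvg_monotone_convergence measurableT mf_) => [n x _|x _]; last exact: nd.
    by rewrite lee_fin.
  rewrite (eq_integral F); last by move=> x _; exact: (cvg_lim _ (cF x)).
  move=> /[dup] /(cvg_lim (@ereal_hausdorff R)) <- c; apply: lime_le; first by apply/cvg_ex; eexists; exact: c.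
  by apply: nearW => n; rewrite -Rint_EFin // lee_fin.
have Fi : mu.-integrable setT F.
  apply/integrableP; split => //.
  under eq_integral do rewrite gee0_abs //.
  exact: le_lt_trans FK (ltry _).
have Ff : {ae mu, forall x, F x \is a fin_num}.
  by apply: (ae_imp (integrable_ae measurableT Fi)) => x; exact.
exists (fun x => fine (F x)); split.
- have mfF : measurable_fun setT (fun x => fine (F x)) by apply: (measurableT_comp _ mF).
  apply/igr_ge0P => //; first by move=> x; exact: fine_ge0.
  rewrite (_ : \int[mu]_x _ = \int[mu]_x F x)%E; first exact: le_lt_trans FK (ltry _).
  apply: ae_eq_integral => //; first exact/measurable_EFinP.
  by apply: (ae_imp Ff) => x fx _; rewrite /= fineK.
- by move=> x; exact: fine_ge0.
apply: (ae_imp Ff) => x fx n; rewrite -lee_fin fineK //.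
by apply: ereal_sup_ubound; exists n.
Qed.

(** * The Parseval identity for the fractional derivatives *)

Section Parseval.
Variable R : realType.
Notation m := (leb3s R).
Implicit Types (x y z xi : R3 R) (h : R3 R -> R) (u v k f g : R3meas R -> R[i]).

Lemma ift_opp h xi : tf h -> conjc (ift h (opp3 xi)) = ift h xi.
Proof.
move=> th; rewrite !iftE conjcM conjc_realE -ci_conj; last first.
  by apply: cigr_expi; apply: cigr_real; exact: tf_igr.
congr (_ * _); apply: ci_ext => x; rewrite conjcM expi_conj conjc_realE dot_scalel.
by rewrite mulN1r opprK.
Qed.

Lemma enorm_opp xi : enorm (opp3 xi) = enorm xi.
Proof. by rewrite /opp3 enorm_scale normrN1 mul1r. Qed.

Lemma wft_opp (p : R) h xi : tf h -> wft p h (opp3 xi) = (enorm xi `^ p)%:C * ift h xi.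
Proof. by move=> th; rewrite /wft enorm_opp ift_opp. Qed.

Lemma ccvg_expi (s : nat -> R) (l : R) : s @ \oo --> l ->
  ccvg (fun n => cexpi (s n) : R[i]) (cexpi l).
Proof.
move=> sl; split => /=; first exact: (cvg_comp _ _ sl (@continuous_cos R l)).
exact: (cvg_comp _ _ sl (@continuous_sin R l)).
Qed.

Lemma ccvg_conj (s : nat -> R[i]) (l : R[i]) : ccvg s l ->
  ccvg (fun n => conjc (s n)) (conjc l).
Proof.
move=> [h1 h2]; split; first by under eq_fun do rewrite Re_conj; rewrite Re_conj.
by under eq_fun do rewrite Im_conj; rewrite Im_conj; exact: cvgN.
Qed.

Lemma cvg_dot_affine x y z (e : nat -> R) : e @ \oo --> 0 ->
  (fun n => dot (affine3 x (e n) z) y) @ \oo --> dot x y.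
Proof.
move=> e0; have -> : (fun n => dot (affine3 x (e n) z) y) = (fun n => dot x y + e n * dot z y).
  by apply/funext => n; rewrite !dotE /=; ring.
rewrite -[X in _ --> X]addr0; apply: cvgD; first exact: cvg_cst.
by rewrite -(mul0r (dot z y)); exact: cvgMl.
Qed.

Lemma ccvg_ift h x z (e : nat -> R) : tf h -> e @ \oo --> 0 ->
  ccvg (fun n => ift h (affine3 x (e n) z)) (ift h x).
Proof.
move=> th e0; rewrite (_ : (fun n : nat => _) = fun n =>
  (cF R)%:C * ci m (fun y => cexpi (dot (affine3 x (e n) z) y) * (h y)%:C)); last by [].
rewrite iftE; apply: ccvgM; first exact: ccvg_cst.
apply: (@cdct _ _ R m _ _ (fun x => `|h x|) _ _ _ _ _).2.
- by move=> n; apply: cmeasM; [exact: cmeas_expi_dot|exact: tf_cmeas].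
- by apply: cmeasM; [exact: cmeas_expi_dot|exact: tf_cmeas].
- apply: aeW => y; apply: ccvgM; last exact: ccvg_cst.
  by apply: ccvg_expi; exact: cvg_dot_affine.
- exact: (igr_norm (tf_igr th)).
- by move=> n y; rewrite cabsM cabs_expi mul1r cabs_real.
Qed.

Lemma ccvg_wft (p : R) h x z (e : nat -> R) : tf h -> e @ \oo --> 0 -> x != 0 ->
  ccvg (fun n => wft p h (affine3 x (e n) z)) (wft p h x).
Proof.
move=> th e0 x0; apply: ccvgM; last by apply: ccvg_conj; exact: ccvg_ift.
apply: ccvg_real.
have c1 : (fun n => enorm (affine3 x (e n) z)) @ \oo --> enorm x.
  apply: (@cvg_comp _ _ _ (fun n => affine3 x (e n) z) (@enorm R) _ (nbhs x)).
    exact: cvg_affine3.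
  exact: continuous_enorm.
apply: (@cvg_comp _ _ _ (fun n => enorm (affine3 x (e n) z)) (fun t => t `^ p) _ (nbhs (enorm x))).
  exact: c1.
exact: (continuous_powR_gt0 (enorm_gt0 x0)).
Qed.

Lemma dot_affine_le x z (e : R) : 0 < e <= 1 ->
  dot x x <= 2 * dot (affine3 x e z) (affine3 x e z) + 2 * dot z z.
Proof.
move=> /andP[e0 e1]; have ee : e ^+ 2 <= 1 by rewrite expr_le1 // ltW.
have : e ^+ 2 * dot z z <= dot z z by rewrite ler_piMl // dot_ge0.
have := dot_ge0 (affine3 x (2 * e) z).
have -> : dot (affine3 x (2 * e) z) (affine3 x (2 * e) z) =
    2 * dot (affine3 x e z) (affine3 x e z) + 2 * (e ^+ 2 * dot z z) - dot x x.
  by rewrite !dotE /=; ring.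
move: (dot _ _) (dot z z) (dot x x) (e ^+ 2 * _) => p q r s; lra.
Qed.

(** Peetre's inequality 1 + |x|^2 <= 2 (1 + |x + e z|^2) (1 + |z|^2), from the parallelogram bound.
    A shift by e z costs a polynomial in z, which Gaussians absorb. *)
Lemma peetre x z (e : R) : 0 < e <= 1 ->
  wt (affine3 x e z) <= 2 * (1 + dot z z) * wt x.
Proof.
move=> e01; have h := dot_affine_le x z e01.
have h2 := wt_den_gt0 (affine3 x e z); have h3 := wt_den_gt0 x.
have z0 := dot_ge0 z; have w0 := dot_ge0 (affine3 x e z).
rewrite -(ler_pM2l h2) wtK mulrA -(ler_pM2r h3) mul1r.
rewrite -[leRHS]mulrA (mulrC (wt x)) wtK mulr1.
by move: z0 w0 h; move: (dot _ _) (dot z z) (dot x x) => p q r; nra.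
Qed.

Lemma gauss3_le_wt z : gauss3 (1 / 8) z <= 8 * wt z.
Proof.
have h3 := wt_den_gt0 z; rewrite -(ler_pM2l h3) mulrCA wtK mulr1.
have := expR_ge1Dx (1 / 8 * dot z z); have := expR_gt0 (1 / 8 * dot z z).
rewrite /gauss3 expRN; move: (expR _) => t t0 ht.
rewrite ler_pdivrMr //; have := dot_ge0 z; lra.
Qed.

Lemma wt_gauss z : (1 + dot z z) * gauss3 2^-1 z <= 4 * gauss3 (1 / 4) z.
Proof.
rewrite (_ : gauss3 2^-1 z = gauss3 (1 / 4) z * gauss3 (1 / 4) z); last first.
  by rewrite /gauss3 -expRD; congr expR; lra.
rewrite mulrA ler_pM2r ?gauss3_gt0 //.
have := expR_ge1Dx (1 / 4 * dot z z); have := expR_gt0 (1 / 4 * dot z z).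
rewrite /gauss3 expRN; move: (expR _) => t t0 ht.
rewrite ler_pdivrMr //; have := dot_ge0 z; lra.
Qed.

Lemma pk_int (e : R) x : 0 < e ->
  igr m (fun y => pk e (affine3 x (-1) y)) /\
  \int[m]_y pk e (affine3 x (-1) y) = (cF R)^-1.
Proof.
move=> e0; have en : - e != 0 by rewrite oppr_eq0 gt_eqF.
have sc := scales_leb3 x en.
have c0 : 0 < `|- e| ^+ 3 by rewrite normrN norm3_gt0.
have E z : pk e (affine3 x (-1) (affine3 x (- e) z)) = e ^- 3 * gauss3 2^-1 z.
  have e1 : e != 0 by rewrite gt_eqF.
  rewrite /pk; suff -> : affine3 0 e^-1 (affine3 x (-1) (affine3 x (- e) z)) = z by [].
  by case: x z {sc} => [[x1 x2] x3] [[z1 z2] z3]; rewrite /affine3 /=; congr (_, _, _); field.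
have mp : measurable_fun setT (fun y : R3meas R => pk e (affine3 x (-1) y)).
  apply: (measurableT_comp (measurable_pk e)).
  by apply: measurable_affine3; [exact: measurable_cst|exact: measurable_id].
have I : igr m (fun y => pk e (affine3 x (-1) y)).
  apply: (scales_igr sc c0 mp).2.
  have := igrZ (e ^- 3) (igr_gauss3 (c := 2^-1) _); rewrite invr_gt0 => /(_ (ltr0Sn _ _)).
  by apply: igr_ext => z; rewrite /= E.
split; first exact: I.
rewrite -(scales_Rint sc c0 I).
under eq_Rintegral do rewrite E.
rewrite RintegralZl; [|exact: measurableT|by apply: igr_gauss3; rewrite invr_gt0].
by rewrite Rint_gauss3 normrN gtr0_norm // mulrA mulfV ?mul1r // expf_eq0 /= gt_eqF.
Qed.

Definition eps (n : nat) : R := n.+1%:R^-1.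

Lemma eps01 n : 0 < eps n <= 1.
Proof. by rewrite invr_gt0 ltr0n invf_le1 // ler1n. Qed.

Lemma eps_cvg : eps @ \oo --> 0.
Proof. exact: cvg_harmonic. Qed.

Lemma eps2_gt0 n : 0 < eps n ^+ 2 / 2.
Proof. by have /andP[e0 _] := eps01 n; rewrite divr_gt0 // exprn_gt0. Qed.

(** Gaussian cutoffs that increase to 1. The parameter is chosen so that a factor [gn n] on one side
    of the transform is a convolution with [pk (eps n)] on the other. *)
Definition gn n x : R := gauss3 (eps n ^+ 2 / 2) x.

Lemma gn_ge0 n x : 0 <= gn n x. Proof. exact: gauss3_ge0. Qed.

Lemma gn_le1 n x : gn n x <= 1. Proof. exact/gauss3_le1/ltW/eps2_gt0. Qed.

Lemma gn_cvg x : (fun n => gn n x) @ \oo --> (1 : R).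
Proof. exact: cvg_gauss3_sqr eps_cvg. Qed.

Lemma gn_nd x (n k : nat) : (n <= k)%N -> gn n x <= gn k x.
Proof.
move=> nk; apply: gauss3_le; rewrite ler_pM2r // lerXn2r ?nnegrE ?invr_ge0 //.
by rewrite lef_pV2 ?posrE // ler_nat ltnS.
Qed.

Lemma measurable_gn n : measurable_fun setT (gn n : R3meas R -> R).
Proof. exact: measurable_gauss3. Qed.

Lemma igr_gn n : igr m (gn n : R3meas R -> R).
Proof. exact: igr_gauss3 (eps2_gt0 n). Qed.

(* The duality [int (F^-1 f) g = int f (F^-1 g)] with
   [g = conj (F^-1 f) * Gaussian], whose transform is at most [2 sup |f|]. *)
Lemma inv_fourier_L2 f (M : R) : cigr m f -> (forall x, cabs (f x) <= M) ->
  igr m (fun x => cabs (inv_fourier f x) ^+ 2).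
Proof.
move=> fi fM; pose W : R3meas R -> R[i] := inv_fourier f.
have mW : cmeas W by exact: cmeas_inv_fourier (cigr_meas fi).
have [B hB] : exists B : R, forall x, cabs (W x) <= B.
  by eexists => x; exact: cabs_inv_fourier.
have M0 : 0 <= M by apply: le_trans (fM 0); exact: cabs_ge0.
have fci := cigr_conj fi.
have cW x : conjc (W x) = fourier (fun y => conjc (f y)) x.
  rewrite fourierE /W inv_fourierE conjcM conjc_realE -ci_conj; last exact: cigr_expi.
  congr (_ * _); apply: ci_ext => y; rewrite conjcM expi_conj (dotC x y).
  by [].
pose k n x : R[i] := (gn n x)%:C * conjc (W x).
have ki n : cigr m (k n).
  apply: (cigrM_bounded (cigr_real (igr_gn n)) (cmeas_conj mW) (M := B)) => x.
  by rewrite cabs_conj.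
have bound n xi : cabs (inv_fourier (k n) xi) <= 2 * M.
  have /andP[e0 _] := eps01 n; have [pi pI] := pk_int xi e0.
  have mgi : cigr m (mgauss (eps n ^+ 2 / 2) xi) by exact: schwartz_cigr (schwartz_mgauss _ (eps2_gt0 n)).
  have -> : inv_fourier (k n) xi =
      (cF R)%:C * ci m (fun y => (pk (eps n) (affine3 xi (-1) y))%:C * conjc (f y)).
    rewrite inv_fourierE; congr (_ * _).
    transitivity (ci m (fun x => mgauss (eps n ^+ 2 / 2) xi x * fourier (fun y => conjc (f y)) x)).
      by apply: ci_ext => x; rewrite /k -cW mulrA.
    rewrite (ci_fourier mgi fci); apply: ci_ext => y.
    by rewrite (fourier_mgauss _ _ e0).
  rewrite cabsM cabs_real (ger0_norm (ltW (cF_gt0 R))).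
  have I : cigr m (fun y => (pk (eps n) (affine3 xi (-1) y))%:C * conjc (f y)).
    apply: (cigrM_bounded (cigr_real pi) (cmeas_conj (cigr_meas fi)) (M := M)) => y.
    by rewrite cabs_conj.
  have le1 : \int[m]_y cabs ((pk (eps n) (affine3 xi (-1) y))%:C * conjc (f y)) <= M * (cF R)^-1.
    rewrite -pI -RintegralZl //; apply: le_Rintegral => //.
    - exact: cigr_cabs.
    - exact: igrZ.
    - move=> y _; rewrite cabsM cabs_conj cabs_real ger0_norm ?pk_ge0 // mulrC.
      by apply: ler_wpM2r; [exact: pk_ge0|].
  have := le_trans (cabs_ci_le I) (ler_wpM2l (ler0n R 2) le1).
  move/(ler_wpM2l (ltW (cF_gt0 R))) => H; apply: (le_trans H).
  rewrite le_eqVlt; apply/orP; left; apply/eqP; field.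
  by rewrite gt_eqF // cF_gt0.
have iW n : igr m (fun x => cabs (W x) ^+ 2 * gn n x).
  have := cigr_cabs (cigrM_bounded (ki n) mW hB); apply: igr_ext => x.
  rewrite /k; move: (W x) => w.
  by rewrite !cabsM cabs_conj cabs_real (ger0_norm (gn_ge0 n x)) -mulrA mulrC expr2.
have bW n : \int[m]_x (cabs (W x) ^+ 2 * gn n x) <= 2 * (2 * M * \int[m]_x cabs (f x)).
  have ff := cigr_cabs fi.
  have E : ((\int[m]_x (cabs (W x) ^+ 2 * gn n x))%:C : R[i]) =
      ci m (fun x => inv_fourier (k n) x * f x).
    rewrite -(ci_inv_fourier (ki n) fi) -ci_real; apply: ci_ext => x.
    by rewrite /k -/(W x) realcM -mulJ_cabs; move: (W x) (conjc _) (gn n x)%:C => p q r; ring.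
  have mi : cmeas (inv_fourier (k n) : R3meas R -> R[i]) := cmeas_inv_fourier (cigr_meas (ki n)).
  have I : cigr m (fun x => inv_fourier (k n) x * f x).
    by apply: (cigr_ext _ (cigrM_bounded fi mi (bound n))) => x; rewrite mulrC.
  have := cabs_ci_le I; rewrite -E cabs_real => H.
  apply: (le_trans (ler_norm _)); apply: (le_trans H); apply: ler_wpM2l => //.
  rewrite -RintegralZl //; apply: le_Rintegral => //.
  - exact: cigr_cabs.
  - exact: igrZ.
  - by move=> x _; rewrite cabsM; apply: ler_wpM2r; [exact: cabs_ge0|exact: bound].
have [F [Fi F0 FW]] := beppo_levi iW (fun n x => mulr_ge0 (sqr_ge0 _) (gn_ge0 n x))
   (fun x n j nj => ler_wpM2l (sqr_ge0 _) (gn_nd x nj)) bW.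
apply: (igr_le_ae _ _ Fi).
  by under eq_fun do rewrite expr2; apply: measurable_funM; exact: cmeas_cabs.
apply: (ae_imp FW) => x H; rewrite ger0_norm ?sqr_ge0 //.
have c : (fun n => cabs (W x) ^+ 2 * gn n x) @ \oo --> cabs (W x) ^+ 2.
  by rewrite -[X in _ --> X]mulr1; apply: cvgMr; exact: gn_cvg.
by apply: (cvgr_to_le c); exact: nearW.
Qed.

Lemma L2_mul (A B : R3meas R -> R) : measurable_fun setT A -> measurable_fun setT B ->
  igr m (fun x => A x ^+ 2) -> igr m (fun x => B x ^+ 2) -> igr m (fun x => A x * B x).
Proof.
move=> mA mB iA iB; apply: (igr_le _ _ (igrD iA iB)); first exact: measurable_funM.
move=> x; rewrite normrM; have := sqr_ge0 (`|A x| - `|B x|).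
have := real_normK (num_real (A x)); have := real_normK (num_real (B x)).
by move: (normr_ge0 (A x)) (normr_ge0 (B x)); nra.
Qed.

Lemma pk_scale_opp (e : R) x z : 0 < e ->
  e ^+ 3 * pk e (affine3 x 1 (affine3 (opp3 x) e z)) = gauss3 2^-1 z.
Proof.
move=> e0; rewrite -(pk_scale (opp3 x) z e0); congr (_ * pk e _).
by case: x z => [[x1 x2] x3] [[z1 z2] z3]; rewrite /opp3 /affine3 /=; congr (_, _, _); ring.
Qed.

Section PlancherelPairing.
Variables (U a : R3meas R -> R[i]) (p : R) (h : R3 R -> R).
Hypotheses (mU : cmeas U) (iU : igr m (fun x => cabs (U x) ^+ 2)).
Hypotheses (ma : cmeas a) (ia : igr m (fun x => cabs (a x) ^+ 2)).
Hypothesis Ua : forall g, schwartz g -> cigr m (fun x => U x * g x) /\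
  ci m (fun x => U x * g x) = ci m (fun xi => a xi * inv_fourier g xi).
Hypotheses (p02 : 0 <= p <= 2) (th : tf h).

Let b := wft p h.
Let W : R3meas R -> R[i] := inv_fourier b.

Let bi : cigr m b. Proof. exact: cigr_wft. Qed.
Let mW : cmeas W. Proof. exact: cmeas_inv_fourier (cigr_meas bi). Qed.

Lemma cigr_UW : cigr m (fun x => U x * W x).
Proof.
have [C C0 hC] := wft_decay 0 p02 th.
have iW : igr m (fun x => cabs (W x) ^+ 2).
  by apply: (inv_fourier_L2 bi (M := C)) => x; have := hC x; rewrite expr0 mulr1.
apply/cigr_cabsP; first exact: cmeasM.
have := L2_mul (cmeas_cabs mU) (cmeas_cabs mW) iU iW; apply: igr_ext => x.
by rewrite cabsM.
Qed.

(* [a(eta) int b(-eta + e z) G(z) dz], whose limit is [a(eta) b(-eta) / cF]. *)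
Let Bn n eta := ci m (fun z => (gauss3 2^-1 z)%:C * b (affine3 (opp3 eta) (eps n) z)).

Let igw : igr m (fun x => cabs (a x) * wt x).
Proof.
by apply: (@L2_mul (fun x => cabs (a x)) (@wt R));
  [exact: cmeas_cabs|exact: measurable_wt|exact: ia|exact: igr_wt2].
Qed.

Let mb n : cmeas (fun q : R3meas R * R3meas R =>
  (gauss3 2^-1 q.2)%:C * b (affine3 (opp3 q.1) (eps n) q.2)).
Proof.
apply: cmeasM.
  by apply: cmeas_real; exact: (measurableT_comp (measurable_gauss3 _) measurable_snd).
apply: (cmeas_comp (cigr_meas bi)); apply: measurable_affine3; last exact: measurable_snd.
by apply: measurable_affine3; [exact: measurable_cst|exact: measurable_fst].
Qed.

(** One power of [wt] survives the shift by Peetre's inequality, and the polynomial in z is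
    swallowed by half of the Gaussian; 8 C is C times the constants 2 and 4 of these two bounds. *)
Let Bker_le : exists2 K : R, 0 <= K & forall n eta z,
  cabs ((gauss3 2^-1 z)%:C * b (affine3 (opp3 eta) (eps n) z)) <= K * wt eta * gauss3 (1 / 4) z.
Proof.
have [C C0 hC] := wft_decay 1 p02 th; exists (8 * C) => [|n eta z]; first by rewrite mulr_ge0.
rewrite cabsM cabs_real ger0_norm ?gauss3_ge0 //.
have h1 := hC (affine3 (opp3 eta) (eps n) z); rewrite expr1 in h1.
have h2 := peetre (opp3 eta) z (eps01 n).
have h3 := wt_gauss z; have w0 := ltW (wt_gt0 eta).
have e : wt (opp3 eta) = wt eta by rewrite /wt -!enorm_sqr enorm_opp.
rewrite e in h2; have g0 := gauss3_ge0 2^-1 z.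
apply: (le_trans (ler_wpM2l g0 (le_trans h1 (ler_wpM2l C0 h2)))).
rewrite [leLHS](_ : _ = 2 * C * wt eta * ((1 + dot z z) * gauss3 2^-1 z)); last first.
  by move: (gauss3 _ _) (wt _) (dot z z) => r s t; ring.
rewrite [leRHS](_ : _ = 2 * C * wt eta * (4 * gauss3 (1 / 4) z)); last first.
  by move: (gauss3 _ _) (wt _) => r s; ring.
by apply: ler_wpM2l => //; rewrite !mulr_ge0.
Qed.

Let quarter_gt0 : 0 < 1 / 4 :> R. Proof. by lra. Qed.

(** Two nested dominated convergences, in z for fixed eta and then in eta. The inner one needs |.|^p
    to be continuous at - eta, true for eta <> 0; the outer majorant |a| [wt] is a product of two L2
    functions. *)
Let cvg_B : ccvg (fun n => ci m (fun eta => a eta * Bn n eta))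
  ((cF R)^-1%:C * ci m (fun eta => a eta * ((enorm eta `^ p)%:C * ift h eta))).
Proof.
have [K K0 hK] := Bker_le; have gi := igr_gauss3 quarter_gt0.
pose G := \int[m]_z gauss3 (1 / 4) z.
have mker n eta : cmeas (fun z => (gauss3 2^-1 z)%:C * b (affine3 (opp3 eta) (eps n) z)).
  apply: cmeasM; first exact: cmeas_gauss3.
  apply: (cmeas_comp (cigr_meas bi)); apply: measurable_affine3; last exact: measurable_id.
  exact: measurable_cst.
have iker n eta : cigr m (fun z => (gauss3 2^-1 z)%:C * b (affine3 (opp3 eta) (eps n) z)).
  by apply: (cigr_le _ _ (igrZ (K * wt eta) gi)); [exact: mker|exact: hK].
have Ble n eta : cabs (Bn n eta) <= 2 * (K * wt eta * G).
  apply: (le_trans (cabs_ci_le (iker n eta))); apply: ler_wpM2l => //.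
  rewrite /G -RintegralZl //; apply: le_Rintegral => //.
  - exact: cigr_cabs.
  - exact: igrZ.
have cB eta : eta != 0 -> ccvg (fun n => Bn n eta)
    ((cF R)^-1%:C * ((enorm eta `^ p)%:C * ift h eta)).
  move=> eta0; rewrite -(wft_opp _ _ th) -/b.
  have -> : (cF R)^-1%:C * b (opp3 eta) = ci m (fun z => (gauss3 2^-1 z)%:C * b (opp3 eta)).
    rewrite ciZr ?ci_real ?Rint_gauss3 //.
    by apply: cigr_real; apply: igr_gauss3; rewrite invr_gt0.
  apply: (@cdct _ _ R m _ _ (fun z => K * wt eta * gauss3 (1 / 4) z) _ _ _ _ _).2.
  - by move=> n; exact: mker.
  - by apply: cmeasM; [exact: cmeas_gauss3|exact: cmeas_cst].
  - apply: aeW => z; apply: ccvgM; first exact: ccvg_cst.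
    apply: (ccvg_wft _ _ th eps_cvg).
    by apply: contra_neq eta0 => e; apply: enorm_eq0; rewrite -enorm_opp e /enorm dotE /= !mul0r !addr0 sqrtr0.
  - exact: igrZ.
  - by move=> n z; exact: hK.
have mift : cmeas (fun eta : R3meas R => (enorm eta `^ p)%:C * ift h eta).
  by apply: cmeasM; [apply: cmeas_real; exact: measurable_enorm_powR|exact: cmeas_ift].
have -> : (cF R)^-1%:C * ci m (fun eta => a eta * ((enorm eta `^ p)%:C * ift h eta)) =
    ci m (fun eta => a eta * ((cF R)^-1%:C * ((enorm eta `^ p)%:C * ift h eta))).
  rewrite -ciZ; first by apply: ci_ext => eta; rewrite mulrCA.
  have [C C0 hC] := wft_decay 1 p02 th.
  apply: (cigr_le _ _ (igrZ C igw)); first exact: cmeasM.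
  move=> x; rewrite -(wft_opp _ _ th) cabsM [leRHS]mulrCA; apply: ler_wpM2l; first exact: cabs_ge0.
  have := hC (opp3 x); rewrite expr1.
  by rewrite (_ : wt (opp3 x) = wt x) // /wt -!enorm_sqr enorm_opp.
apply: (@cdct _ _ R m _ _ (fun eta => 2 * K * G * (cabs (a eta) * wt eta)) _ _ _ _ _).2.
- move=> n; apply: (cmeasM ma); exact: (cmeas_inner m (mb n)).
- by apply: cmeasM => //; apply: cmeasM => //; exact: cmeas_cst.
- apply: (ae_imp (ae_neq0 R)) => eta eta0; apply: ccvgM; first exact: ccvg_cst.
  exact: cB.
- exact: igrZ.
- move=> n eta; rewrite cabsM; apply: (le_trans (ler_wpM2l (cabs_ge0 _) (Ble n eta))).
  by rewrite le_eqVlt; apply/orP; left; apply/eqP; move: (cabs _) (wt _) => r s; rewrite -/G; move: {Ble}G => t; ring.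
Qed.

(** Transposing the inverse transform from b to U times the cutoff leaves pairings of U with
    modulated Gaussians, where [Ua] applies and produces [pk]. Fubini and the substitution xi = -
    eta + e z finish. *)
Let swapB n : ci m (fun x => U x * W x * (gn n x)%:C) = (cF R)%:C * ci m (fun eta => a eta * Bn n eta).
Proof.
have e01 := eps01 n; have /andP[e0 _] := e01.
have smg xi : schwartz (mgauss (eps n ^+ 2 / 2) xi) := schwartz_mgauss _ (eps2_gt0 n).
have Ugi : cigr m (fun x => U x * (gn n x)%:C).
  have [I _] := Ua (smg 0); apply: (cigr_ext _ I) => x.
  by rewrite /mgauss dotE /= !mul0r !addr0 /cexpi cos0 sin0 mul1r.
have := ci_inv_fourier bi Ugi; rewrite -/W => E0.
transitivity (ci m (fun y => W y * (U y * (gn n y)%:C))).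
  by apply: ci_ext => x; move: (U x) (W x) => r s; ring.
rewrite -E0; have EU xi : inv_fourier (fun x => U x * (gn n x)%:C) xi =
    (cF R)%:C * ci m (fun eta => a eta * (pk (eps n) (affine3 eta 1 xi))%:C).
  rewrite inv_fourierE; congr (_ * _); have [_ E] := Ua (smg xi).
  transitivity (ci m (fun x => U x * mgauss (eps n ^+ 2 / 2) xi x)).
    by apply: ci_ext => x; rewrite mulrCA.
  rewrite E; apply: ci_ext => eta.
  by rewrite (inv_fourier_mgauss _ _ e0).
(* Three powers of [wt]: one is spent on turning decay in xi + eta into decay in eta, two remain for
   integrability in xi. *)
have [C C0 hC] := wft_decay 3 p02 th.
have I : cigr (sfprod m m) (fun q : R3meas R * R3meas R =>
    b q.1 * (a q.2 * (pk (eps n) (affine3 q.2 1 q.1))%:C)).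
  have D : igr (sfprod m m) (fun q : R3meas R * R3meas R => wt q.1 ^+ 2 * (cabs (a q.2) * wt q.2)).
    refine (@igr_prod_ge0 _ _ _ _ R m m (fun x => wt x ^+ 2) (fun x => cabs (a x) * wt x) _ _ (igr_wt2 R) igw).
      by move=> x; exact: sqr_ge0.
    by move=> x; rewrite mulr_ge0 ?cabs_ge0 // ltW // wt_gt0.
  apply: (cigr_le _ _ (igrZ (C * (16 * eps n ^- 3)) D)).
    apply: cmeasM; first by apply: (cmeas_comp (cigr_meas bi)); exact: measurable_fst.
    apply: cmeasM; first by apply: (cmeas_comp ma); exact: measurable_snd.
    apply: cmeas_real; apply: (measurableT_comp (measurable_pk (eps n))).
    by apply: measurable_affine3; [exact: measurable_snd|exact: measurable_fst].
  move=> -[xi eta] /=; rewrite (cabsM (b xi)) (cabsM (a eta)) cabs_real (ger0_norm (pk_ge0 _ e0)).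
  have h1 := hC xi; have h2 := pk_le (affine3 eta 1 xi) e01.
  have h3 := gauss3_le_wt (affine3 eta 1 xi).
  have h4 := peetre eta xi (e := 1); rewrite ltr01 lexx in h4; have {h4}h4 := h4 isT.
  have h5 := wtK xi; have w1 := ltW (wt_gt0 xi); have w2 := ltW (wt_gt0 eta).
  have e30 : 0 <= eps n ^- 3 by rewrite invr_ge0 exprn_ge0 // ltW.
  have a0 := cabs_ge0 (a eta).
  have k1 : wt xi * wt (affine3 eta 1 xi) <= 2 * wt eta.
    apply: (le_trans (ler_wpM2l w1 h4)).
    rewrite [leLHS](_ : _ = 2 * ((1 + dot xi xi) * wt xi) * wt eta); last by ring.
    by rewrite h5 mulr1.
  have k2 : cabs (b xi) * pk (eps n) (affine3 eta 1 xi) <=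
      (C * wt xi ^+ 3) * (eps n ^- 3 * (8 * wt (affine3 eta 1 xi))).
    apply: ler_pM; [exact: cabs_ge0|exact: pk_ge0|exact: h1|].
    by apply: (le_trans h2); apply: ler_wpM2l.
  rewrite mulrCA; apply: (le_trans (ler_wpM2l a0 k2)).
  rewrite [leLHS](_ : _ =
    (cabs (a eta) * C * wt xi ^+ 2 * (8 * eps n ^- 3)) * (wt xi * wt (affine3 eta 1 xi))); last first.
    by move: (cabs _) (wt _) (wt _) (eps n ^- 3) => r s t v; ring.
  rewrite [leRHS](_ : _ =
    (cabs (a eta) * C * wt xi ^+ 2 * (8 * eps n ^- 3)) * (2 * wt eta)); last first.
    by move: (cabs _) (wt _) (wt _) (eps n ^- 3) => r s t v; ring.
  by apply: ler_wpM2l => //; rewrite !mulr_ge0 // sqr_ge0.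
have mapk xi : cmeas (fun eta => a eta * (pk (eps n) (affine3 eta 1 xi))%:C).
  apply: cmeasM => //; apply: cmeas_real; apply: (measurableT_comp (measurable_pk (eps n))).
  by apply: measurable_affine3; [exact: measurable_id|exact: measurable_cst].
have apki xi : cigr m (fun eta => a eta * (pk (eps n) (affine3 eta 1 xi))%:C).
  apply: (cigr_le _ _ (igrZ (eps n ^- 3 * (16 * (1 + dot xi xi))) igw)); first exact: mapk.
  move=> eta; rewrite cabsM cabs_real (ger0_norm (pk_ge0 _ e0)) [leRHS]mulrCA.
  apply: ler_wpM2l; first exact: cabs_ge0.
  have h2 := pk_le (affine3 eta 1 xi) e01; have h3 := gauss3_le_wt (affine3 eta 1 xi).
  have h4 := peetre eta xi (e := 1); rewrite ltr01 lexx in h4; have {h4}h4 := h4 isT.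
  have e30 : 0 <= eps n ^- 3 by rewrite invr_ge0 exprn_ge0 // ltW.
  apply: (le_trans h2); rewrite -mulrA; apply: ler_wpM2l => //.
  apply: (le_trans h3); rewrite [leRHS](_ : _ = 8 * (2 * (1 + dot xi xi) * wt eta)); last by ring.
  exact: ler_wpM2l.
transitivity ((cF R)%:C * ci m (fun xi => ci m (fun eta =>
     b xi * (a eta * (pk (eps n) (affine3 eta 1 xi))%:C)))).
  have [_ Ii _] := cfubini I.
  rewrite -(ciZ _ Ii); apply: ci_ext => xi; rewrite EU mulrCA; congr (_ * _).
  by rewrite -(ciZ _ (apki xi)).
rewrite (cfubini_swap I); congr (_ * _); have [Iae _ _] := cfubini_sym I.
apply: (@ci_ae _ _ R m).
- exact: (cmeas_inner_sym m (cigr_meas I)).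
- by apply: (cmeasM ma); exact: (cmeas_inner m (mb n)).
apply: (ae_imp Iae) => eta Ieta.
have sc := scales_leb3 (opp3 eta) (lt0r_neq0 e0); have c0 := norm3_gt0 e0.
rewrite -(scales_ci sc c0 Ieta) /Bn.
have Iz := (scales_cigr sc c0 (cigr_meas Ieta)).1 Ieta.
rewrite -(ciZ _ Iz) -ciZ; last first.
  have [K K0 hK] := Bker_le.
  apply: (cigr_le _ _ (igrZ (K * wt eta) (igr_gauss3 quarter_gt0))); last exact: hK.
  apply: cmeasM; first exact: cmeas_gauss3.
  apply: (cmeas_comp (cigr_meas bi)); apply: measurable_affine3; last exact: measurable_id.
  exact: measurable_cst.
apply: ci_ext => z; rewrite /= (gtr0_norm e0) -(pk_scale_opp eta z e0).
move: (b _) (a _) (pk _ _) (eps n ^+ 3) => r s t v.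
by rewrite realcM; move: t%:C v%:C => {}t {}v; ring.
Qed.

(** [Ua] does not apply to W itself, which need not be Schwartz since |xi|^p is not smooth at 0.
    Hence the cutoff [gn n], removed here on both sides of [swapB]. *)
Lemma parseval_UW : ci m (fun x => U x * W x) =
  ci m (fun eta => a eta * ((enorm eta `^ p)%:C * ift h eta)).
Proof.
have UWi := cigr_UW.
have l1 : ccvg (fun n => ci m (fun x => U x * W x * (gn n x)%:C)) (ci m (fun x => U x * W x)).
  apply: (@cdct _ _ R m _ _ (fun x => cabs (U x * W x)) _ _ _ _ _).2.
  - by move=> n; apply: cmeasM; [exact: cigr_meas UWi|apply: cmeas_real; exact: measurable_gn].
  - exact: cigr_meas UWi.
  - apply: aeW => x; rewrite -[X in ccvg _ X]mulr1; apply: ccvgM; first exact: ccvg_cst.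
    by apply: ccvg_real; exact: gn_cvg.
  - exact: cigr_cabs.
  - move=> n x; rewrite cabsM cabs_real ger0_norm ?gn_ge0 // ler_piMr ?cabs_ge0 //.
    exact: gn_le1.
apply: (ccvg_unique l1).
rewrite (_ : (fun n : nat => _) = fun n => (cF R)%:C * ci m (fun eta => a eta * Bn n eta)); last first.
  by apply/funext => n; exact: swapB.
have := ccvgM (ccvg_cst (cF R)%:C) cvg_B.
by rewrite mulrA -realcM mulfV ?mul1r // gt_eqF // cF_gt0.
Qed.

End PlancherelPairing.
End Parseval.

(** * The transform of a product *)

Lemma Rdct_ae d (T : measurableType d) (R : realType) (mu : {measure set T -> \bar R})
    (f_ : nat -> T -> R) (f g : T -> R) : (forall n, measurable_fun setT (f_ n)) ->
  measurable_fun setT f -> {ae mu, forall x, f_ ^~ x @ \oo --> f x} -> igr mu g ->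
  {ae mu, forall x, forall n, `|f_ n x| <= g x} ->
  igr mu f /\ (fun n => \int[mu]_x f_ n x) @ \oo --> \int[mu]_x f x.
Proof.
move=> mf_ mf ff gi fg.
have mE n : measurable_fun setT (EFin \o f_ n) by apply/measurable_EFinP; exact: mf_.
have mE' : measurable_fun setT (EFin \o f) by apply/measurable_EFinP.
have [||fi _ c] := @dominated_convergence _ _ _ mu setT measurableT
    (fun n => EFin \o f_ n) (EFin \o f) (EFin \o g) mE mE' _ gi _.
- apply: (ae_imp ff) => x h _; apply: cvg_EFin; last exact: h.
  exact: nearW.
- by apply: (ae_imp fg) => x h n _; rewrite /= lee_fin.
split; first exact: fi.
by apply: fine_cvg; rewrite fineK //; apply: integrable_fin_num.
Qed.

Section FastConvergence.
Variable R : realType.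
Notation m := (leb3s R).
Implicit Types (x y z xi : R3 R) (h : R3 R -> R).

(** Adds one term d of weight t to a Cauchy-Schwarz inequality: A^2 <= c B bounds the cross term 2 A
    d by c t d^2 + B / t. *)
Lemma cauchy_schwarz_step (A B c d t : R) : 0 <= A -> 0 <= B -> 0 < c -> 0 <= d -> 0 < t ->
  A ^+ 2 <= c * B -> (A + d) ^+ 2 <= (c + t^-1) * (B + t * d ^+ 2).
Proof.
move=> A0 B0 c0 d0 t0 AB; pose s := t^-1; have s0 : 0 < s by rewrite invr_gt0.
have st : s * t = 1 by rewrite mulVf // gt_eqF.
have key : 2 * A * d <= c * t * d ^+ 2 + s * B.
  rewrite -(ler_pM2l c0).
  have : 0 <= s * (c * t * d - A) ^+ 2 by rewrite mulr_ge0 ?sqr_ge0 // ltW.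
  have -> : s * (c * t * d - A) ^+ 2 =
     (s * t) * (c ^+ 2 * t * d ^+ 2) - (s * t) * (2 * c * d * A) + s * A ^+ 2 by ring.
  rewrite st !mul1r => h1; have := ler_wpM2l (ltW s0) AB; nra.
rewrite -/s (_ : (c + s) * (B + t * d ^+ 2) = c * B + (c * t * d ^+ 2 + s * B) + (s * t) * d ^+ 2); last by ring.
rewrite st mul1r (_ : (A + d) ^+ 2 = A ^+ 2 + 2 * A * d + d ^+ 2); last by ring.
lra.
Qed.

Lemma weighted_cauchy_schwarz (D : nat -> R) (n : nat) :
  (\sum_(k < n) `|D k|) ^+ 2 <= 2 * \sum_(k < n) (2 ^+ k * D k ^+ 2).
Proof.
(* The factor is the sum of 2^(-k) for k < n, raised to 1 at n = 0. The passage from 0 to 1 is done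
   by hand, as the inductive step wants a positive factor. *)
have H : (\sum_(k < n) `|D k|) ^+ 2 <= (2 - 2 * 2^-1 ^+ n + 2^-1 ^+ n * (n == 0)%:R) * \sum_(k < n) (2 ^+ k * D k ^+ 2).
  elim: n => [|n IH]; first by rewrite !big_ord0 expr0n mulr0.
  rewrite !big_ord_recr /=.
  have S0 k : 0 <= \sum_(i < k) `|D i| by apply: sumr_ge0.
  have B0 k : 0 <= \sum_(i < k) (2 ^+ i * D i ^+ 2).
    by apply: sumr_ge0 => i _; apply: mulr_ge0; [exact: exprn_ge0|exact: sqr_ge0].
  case: n IH => [|n] IH.
    rewrite !big_ord0 !add0r expr0 mul1r expr1 mulr0 addr0 real_normK ?num_real //.
    rewrite (_ : 2 - 2 * 2^-1 = 1 :> R) ?mul1r //; lra.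
  have c0 : 0 < 2 - 2 * 2^-1 ^+ n.+1 :> R.
    have : 2^-1 ^+ n.+1 <= 2^-1 :> R by rewrite exprS ler_piMr // exprn_ile1 //; lra.
    lra.
  rewrite mulr0 addr0 in IH; have t0 : 0 < 2 ^+ n.+1 :> R by rewrite exprn_gt0.
  have := cauchy_schwarz_step (S0 n.+1) (B0 n.+1) c0 (normr_ge0 (D n.+1)) t0 IH.
  rewrite real_normK ?num_real // -exprVn mulr0 addr0.
  rewrite (_ : 2 - 2 * 2^-1 ^+ n.+1 + 2^-1 ^+ n.+1 = 2 - 2 * 2^-1 ^+ n.+2 :> R) //.
  by rewrite [in RHS]exprS; field.
apply: (le_trans H); apply: ler_wpM2r.
  by apply: sumr_ge0 => i _; apply: mulr_ge0; [exact: exprn_ge0|exact: sqr_ge0].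
have p0 : 0 <= 2^-1 ^+ n :> R by rewrite exprn_ge0 // invr_ge0.
by case: (n == 0%N); rewrite ?mulr1 ?mulr0; lra.
Qed.

(** The rate 8^(-k) required of the subsequence beats the weights 2^k of the Cauchy-Schwarz
    inequality. *)
Lemma sum_quarter (n : nat) : \sum_(k < n) (2 ^+ k * 8^-1 ^+ k) <= 2 :> R.
Proof.
have H : \sum_(k < n) (2 ^+ k * 8^-1 ^+ k) <= 4 / 3 - 4 / 3 * 4^-1 ^+ n :> R.
  elim: n => [|n IH]; first by rewrite big_ord0 expr0; lra.
  rewrite big_ord_recr /= -exprMn (_ : 2 * 8^-1 = 4^-1 :> R); last by field.
  have p0 : 0 <= 4^-1 ^+ n :> R by rewrite exprn_ge0 // invr_ge0.
  rewrite [4^-1 ^+ n.+1]exprS; move: IH p0.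
  by move: (\sum_(i < n) _) (4^-1 ^+ n) => s t; lra.
have p0 : 0 <= 4^-1 ^+ n :> R by rewrite exprn_ge0 // invr_ge0.
by lra.
Qed.

(* Fast L2 Cauchy sequences converge almost everywhere with an L2 majorant; the
   limit is identified by its integrals against test functions. *)
Lemma fast_L2_cvg (r_ : nat -> R3meas R -> R) (u G : R3meas R -> R) :
  (forall n, measurable_fun setT (r_ n)) -> measurable_fun setT u ->
  measurable_fun setT G -> measurable_fun setT (fun x => (G x)^-1) -> (forall x, 0 < G x) ->
  (forall h, tf h -> igr m (fun x => u x * h x)) ->
  (forall h, tf h -> exists2 C : R, 0 <= C & forall x, `|h x| <= C * G x) ->
  igr m (fun x => r_ 0%N x ^+ 2 * G x) -> igr m G ->
  (forall k, igr m (fun x => (r_ k.+1 x - r_ k x) ^+ 2 * G x)) ->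
  (forall k, \int[m]_x ((r_ k.+1 x - r_ k x) ^+ 2 * G x) <= 8^-1 ^+ k) ->
  (forall h, tf h -> (fun n => \int[m]_x (r_ n x * h x)) @ \oo --> \int[m]_x (u x * h x)) ->
  exists H : R3meas R -> R, [/\ measurable_fun setT H, (forall x, 0 <= H x),
    igr m (fun x => H x ^+ 2 * G x), {ae m, forall x, forall n, `|r_ n x| <= H x} &
    {ae m, forall x, r_ ^~ x @ \oo --> u x}].
Proof.
move=> mr mu mG mGi G0 ui hG r0i Gi Di DI rc.
pose D k (x : R3meas R) := r_ k.+1 x - r_ k x.
pose f_ n (x : R3meas R) := \sum_(k < n) (2 ^+ k * (D k x ^+ 2 * G x)).
have fi n : igr m (f_ n).
  elim: n => [|n IH].
    by apply: (@igr_ext _ _ R m (fun=> 0)) => [x|]; [rewrite /f_ big_ord0|have [] := @cigr0 _ _ R m].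
  apply: (@igr_ext _ _ R m (fun x => f_ n x + 2 ^+ n * (D n x ^+ 2 * G x))).
    by move=> x; rewrite /f_ big_ord_recr.
  by apply: igrD => //; apply: igrZ; exact: Di.
have t0 k x : 0 <= 2 ^+ k * (D k x ^+ 2 * G x).
  apply: mulr_ge0; first exact: exprn_ge0.
  by apply: mulr_ge0; [exact: sqr_ge0|exact: ltW (G0 x)].
have f0 n x : 0 <= f_ n x by apply: sumr_ge0.
have fnd x n k : (n <= k)%N -> f_ n x <= f_ k x.
  move=> /subnK <-; elim: (k - n)%N => [|j IH] //.
  by rewrite addSn /f_ big_ord_recr /=; apply: (le_trans IH); rewrite lerDl.
have fK n : \int[m]_x f_ n x <= 2.
  apply: le_trans (sum_quarter n); elim: n => [|n IH].
    rewrite big_ord0 /f_; under eq_Rintegral do rewrite big_ord0.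
    by rewrite /Rintegral integral0_eq.
  rewrite /f_; under eq_Rintegral do rewrite big_ord_recr /=.
  rewrite RintegralD //; [|exact: fi|by apply: igrZ; exact: Di].
  rewrite big_ord_recr /=; apply: lerD; first exact: IH.
  rewrite RintegralZl //; last exact: Di.
  by apply: ler_wpM2l; [rewrite exprn_ge0|exact: DI].
have [S [Si S0 fS]] := beppo_levi fi f0 fnd fK.
(* The weighted Cauchy-Schwarz inequality bounds the total variation of the sequence at x by this
   square root, S being the Beppo Levi majorant. *)
pose Q (x : R3meas R) := Num.sqrt (2 * (S x / G x)).
pose H (x : R3meas R) := `|r_ 0%N x| + Q x.
have SG x : 0 <= S x / G x by rewrite divr_ge0 // ltW.
have sumD : {ae m, forall x, forall n, \sum_(k < n) `|D k x| <= Q x}.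
  apply: (ae_imp fS) => x hS n; rewrite -(ger0_norm (sumr_ge0 _ _)); last by move=> *; exact: normr_ge0.
  rewrite -sqrtr_sqr ler_sqrt; last by rewrite mulr_ge0.
  apply: (le_trans (weighted_cauchy_schwarz (D ^~ x) n)); rewrite ler_pM2l //.
  rewrite ler_pdivlMr // mulr_suml; apply: le_trans (hS n).
  by rewrite /f_; apply: ler_sum => k _; rewrite mulrA.
have tele x n : r_ n x = r_ 0%N x + \sum_(k < n) D k x.
  elim: n => [|n IH]; first by rewrite big_ord0 addr0.
  by rewrite big_ord_recr /= addrA -IH /D addrC subrK.
have rH : {ae m, forall x, forall n, `|r_ n x| <= H x}.
  apply: (ae_imp sumD) => x hx n; rewrite tele; apply: (le_trans (ler_normD _ _)).
  by rewrite lerD2l; apply: le_trans (hx n); exact: ler_norm_sum.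
have mS := igr_meas Si.
have mQ : measurable_fun setT Q.
  apply: (measurableT_comp (continuous_measurable_fun (@sqrt_continuous R))).
  apply: measurable_funM; first exact: measurable_cst.
  exact: measurable_funM mS mGi.
have mH : measurable_fun setT H.
  by apply: measurable_funD => //; apply: (measurableT_comp (@normr_measurable R setT)).
have H0 x : 0 <= H x by rewrite addr_ge0 // sqrtr_ge0.
have H2i : igr m (fun x => H x ^+ 2 * G x).
  apply: (@igr_le _ _ R m _ (fun x => 2 * (r_ 0%N x ^+ 2 * G x) + 4 * S x)); last first.
  - by apply: igrD; exact: igrZ.
  - move=> x; rewrite ger0_norm; last by rewrite mulr_ge0 ?sqr_ge0 // ltW.
    have e1 : Q x ^+ 2 = 2 * (S x / G x) by rewrite sqr_sqrtr // mulr_ge0.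
    have e2 : `|r_ 0%N x| ^+ 2 = r_ 0%N x ^+ 2 by rewrite real_normK ?num_real.
    have e3 : S x = (S x / G x) * G x by rewrite divfK // gt_eqF.
    have : H x ^+ 2 <= 2 * r_ 0%N x ^+ 2 + 4 * (S x / G x).
      rewrite /H -e2; have := sqr_ge0 (`|r_ 0%N x| - Q x); move: e1; rewrite !expr2; clear; lra.
    move=> /(ler_wpM2r (ltW (G0 x))); rewrite [in X in _ -> X]e3.
    by move: (H x ^+ 2) (r_ 0%N x ^+ 2) (S x / G x) (G x) => h r s g; clear; lra.
  - by under eq_fun do rewrite expr2; apply: measurable_funM => //; exact: measurable_funM.
(* The limit exists almost everywhere only; the upper limit is measurable and defined everywhere. *)
pose F (x : R3meas R) := fine (limn_esup (fun n => (r_ n x)%:E)).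
have mF : measurable_fun setT F.
  apply: (measurableT_comp (fine_measurable measurableT)).
  by apply: measurable_fun_limn_esup => n; apply/measurable_EFinP.
have rF : {ae m, forall x, r_ ^~ x @ \oo --> F x}.
  apply: (ae_imp sumD) => x hx.
  have cn : cvgn (series (fun k => `|D k x|)).
    apply: nondecreasing_is_cvgn.
      by apply/nondecreasing_seqP => n; rewrite /series /= big_nat_recr //= lerDl.
    by exists (Q x) => _ [n _ <-]; rewrite /series /= big_mkord.
  have /cvg_ex[l cl] := @normed_cvg _ _ _ cn.
  have cr : r_ ^~ x @ \oo --> r_ 0%N x + l.
    rewrite (_ : r_ ^~ x = fun n => r_ 0%N x + series (D ^~ x) n).
      by apply: cvgD; [exact: cvg_cst|exact: cl].
    by apply/funext => n; rewrite tele /series /= big_mkord.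
  suff -> : F x = r_ 0%N x + l by [].
  have cE : (fun n => (r_ n x)%:E) @ \oo --> (r_ 0%N x + l)%:E.
    by apply: cvg_EFin; [exact: nearW|exact: cr].
  by rewrite /F (cvg_limn_einf_sup cE).2.
exists H; split => //.
have FH : {ae m, forall x, `|F x| <= H x}.
  apply: (ae_imp2 rH rF) => x h1 h2; apply: (cvgr_to_le (cvg_norm h2)); exact: nearW.
have Hh h : tf h -> igr m (fun x => H x * `|h x|).
  move=> th; have [C C0 hC] := hG _ th.
  have mh := tf_measurable th.
  apply: (@igr_le _ _ R m _ (fun x => C * (H x ^+ 2 * G x + G x))).
  - by apply: measurable_funM => //; apply: (measurableT_comp (@normr_measurable R setT)).
  - move=> x; rewrite ger0_norm ?mulr_ge0 //; apply: (le_trans (ler_wpM2l (H0 x) (hC x))).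
    rewrite mulrCA; apply: ler_wpM2l => //.
    have := sqr_ge0 (H x - 1); have := G0 x; have := H0 x.
    by move: (H x) (G x) => a b; clear; nra.
  - by apply: igrZ; apply: igrD.
(* Against a test function the sequence has the limit F by domination and the limit u by
   hypothesis. *)
have Fu : {ae m, forall x, F x - u x = 0}.
  have Fh h : tf h -> igr m (fun x => F x * h x) /\
      (fun n => \int[m]_x (r_ n x * h x)) @ \oo --> \int[m]_x (F x * h x).
    move=> th; have mh := tf_measurable th; apply: (Rdct_ae _ _ _ (Hh _ th)).
    - by move=> n; apply: measurable_funM.
    - exact: measurable_funM.
    - by apply: (ae_imp rF) => x hx; apply: cvgMl.
    - by apply: (ae_imp rH) => x hx n; rewrite normrM ler_wpM2r.
  apply: ae_eq0_of_tf.
  - exact: measurable_funB.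
  - move=> h th; apply: (@igr_ext _ _ R m (fun x => F x * h x - u x * h x)).
      by move=> x; rewrite mulrBl.
    by apply: igrB; [have [] := Fh _ th|exact: ui].
  - move=> h th; under eq_Rintegral do rewrite mulrBl.
    have [Fhi Fhc] := Fh _ th; rewrite RintegralB //; last exact: ui.
    by rewrite (cvg_unique _ Fhc (rc _ th)) // subrr.
apply: (ae_imp2 rF Fu) => x h1 /eqP; rewrite subr_eq0 => /eqP <-; exact: h1.
Qed.

End FastConvergence.

(** * Mollifications are Cauchy in a weighted L2 space *)

Section ProductFormula.
Variable R : realType.
Notation m := (leb3s R).
Implicit Types (x y z xi : R3 R) (h : R3 R -> R) (k v : R3meas R -> R[i]).

Definition Hs v := cmeas v /\
  igr m (fun x : R3meas R => enorm x `^ (5 / 3) * cabs (v x) ^+ 2).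

(** Makes any C bounded by a multiple of [wt], such as the transform of a test function, admissible
    as third factor of the trilinear integral. *)
Lemma igr_sing_wt : igr m (fun x : R3meas R => enorm x `^ (- (1 / 3)) * wt x ^+ 2).
Proof.
have mw2 : measurable_fun setT (fun x : R3meas R => wt x ^+ 2).
  by under eq_fun do rewrite expr2; apply: measurable_funM; exact: measurable_wt.
apply: (igr_le_ae _ _ (igrD (igr_wker1 R) (igr_wt2 R))).
  by apply: measurable_funM => //; exact: measurable_enorm_powR.
apply: (ae_imp (ae_neq0 R)) => x /enorm_gt0 x0.
rewrite ger0_norm; last by rewrite mulr_ge0 ?powR_ge0 ?sqr_ge0.
have w1 : wt x ^+ 2 <= 1 by rewrite exprn_ile1 ?wt_le1 // ltW // wt_gt0.
have [t1|t1] := leP (enorm x) 1.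
  apply: (@le_trans _ _ (wker 1 x)); last by rewrite lerDl sqr_ge0.
  rewrite /wker (max_idPr t1) powR1 mulr1.
  apply: (@le_trans _ _ (enorm x `^ (- (1 / 3)))); first by rewrite ler_piMr // powR_ge0.
  have := @powRN_le R (4 / 3) (enorm x) 1 _ x0 t1; rewrite powR1 => h1.
  have {h1}h1 : 1 <= enorm x `^ (- (4 / 3)) by apply: h1; lra.
  have -> : enorm x `^ (- (5 / 3)) = enorm x `^ (- (1 / 3)) * enorm x `^ (- (4 / 3)).
    by rewrite -powRD ?(gt_eqF x0) ?implybT //; congr (_ `^ _); lra.
  by rewrite ler_peMr // powR_ge0.
apply: (@le_trans _ _ (wt x ^+ 2)); last by rewrite lerDr wker_ge0.
rewrite ler_piMl ?sqr_ge0 //.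
have := @powRN_le R (1 / 3) 1 (enorm x) _ ltr01 (ltW t1); rewrite powR1; apply; lra.
Qed.

Lemma cmeas_add3 (C : R3meas R -> R[i]) : cmeas C ->
  cmeas (fun p : R3meas R * R3meas R => C (affine3 p.1 1 p.2)).
Proof.
move=> mC; apply: (cmeas_comp mC).
by apply: measurable_affine3; [exact: measurable_fst|exact: measurable_snd].
Qed.

Lemma tri_cigr v1 v2 (C : R3meas R -> R[i]) : Hs v1 -> Hs v2 -> cmeas C ->
  igr m (fun x : R3meas R => enorm x `^ (- (1 / 3)) * cabs (C x) ^+ 2) ->
  cigr (sfprod m m) (fun p => v1 p.1 * v2 p.2 * C (affine3 p.1 1 p.2)).
Proof.
move=> [m1 i1] [m2 i2] mC iC.
have I := trilinear_igr (cmeas_cabs m1) (cmeas_cabs m2) (cmeas_cabs mC)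
  (fun x => cabs_ge0 _) (fun x => cabs_ge0 _) (fun x => cabs_ge0 _) i1 i2 iC.
apply: (cigr_le _ _ I).
  apply: cmeasM; last exact: cmeas_add3.
  by apply: cmeasM; [exact: (cmeas_comp m1 measurable_fst)|exact: (cmeas_comp m2 measurable_snd)].
by move=> p; rewrite !cabsM.
Qed.

Lemma igr_sing_bound (C : R3meas R -> R[i]) (K : R) : cmeas C -> (forall x, cabs (C x) <= K * wt x) ->
  igr m (fun x : R3meas R => enorm x `^ (- (1 / 3)) * cabs (C x) ^+ 2).
Proof.
move=> mC CK; have mc := cmeas_cabs mC.
apply: (igr_le _ _ (igrZ (K ^+ 2) igr_sing_wt)).
  apply: measurable_funM; first exact: measurable_enorm_powR.
  by under eq_fun do rewrite expr2; apply: measurable_funM.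
have s0 x : 0 <= enorm x `^ (- (1 / 3)) * cabs (C x) ^+ 2 by rewrite mulr_ge0 ?powR_ge0 ?sqr_ge0.
move=> x; rewrite (ger0_norm (s0 x)) [leRHS]mulrCA.
apply: ler_wpM2l; first exact: powR_ge0.
by rewrite -exprMn; apply: lerXn2r (CK x); rewrite nnegrE ?cabs_ge0 // (le_trans _ (CK x)) ?cabs_ge0.
Qed.

Lemma cmeas_opp v : cmeas v -> cmeas (fun x => v (opp3 x)).
Proof. by move=> mv; apply: (cmeas_comp mv); have [] := scales_reflect (0 : R3 R). Qed.

Lemma Hs_opp_conj v : Hs v -> Hs (fun x => conjc (v (opp3 x))).
Proof.
move=> [mv iv]; split; first by apply: cmeas_conj; exact: cmeas_opp.
have := (scales_igr (scales_reflect 0) ltr01 (igr_meas iv)).1 iv; apply: igr_ext => x.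
by rewrite /= enorm_opp cabs_conj.
Qed.

(* The Fourier transform of a product is a convolution, tested on g. *)
Lemma ci_inv_inv k1 k2 (g : R3meas R -> R[i]) : cigr m k1 -> cigr m k2 -> cigr m g ->
  cigr (sfprod m m) (fun p => k1 p.1 * k2 p.2 * inv_fourier g (affine3 p.1 1 p.2)) /\
  ci m (fun x => inv_fourier k1 x * inv_fourier k2 x * g x) =
  (cF R)%:C * ci (sfprod m m) (fun p => k1 p.1 * k2 p.2 * inv_fourier g (affine3 p.1 1 p.2)).
Proof.
move=> i1 i2 gi; have mig := cmeas_inv_fourier (cigr_meas gi).
have I : cigr (sfprod m m) (fun p => k1 p.1 * k2 p.2 * inv_fourier g (affine3 p.1 1 p.2)).
  apply: (cigrM_bounded (cigr_prod i1 i2) (cmeas_add3 mig)) => p; exact: cabs_inv_fourier.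
split; first exact: I.
have g2 : cigr m (fun x => inv_fourier k2 x * g x).
  have := cigrM_bounded gi (cmeas_inv_fourier (cigr_meas i2)) (fun x => cabs_inv_fourier x i2).
  by apply: cigr_ext => x; rewrite mulrC.
transitivity (ci m (fun x => inv_fourier k1 x * (inv_fourier k2 x * g x))).
  by apply: ci_ext => x; rewrite mulrA.
rewrite -(ci_inv_fourier i1 g2).
have [_ Ii <-] := cfubini I; rewrite -(ciZ _ Ii); apply: ci_ext => xi /=.
have ge : cigr m (fun x => cexpi (dot xi x) * g x) := cigr_expi xi gi.
have E : inv_fourier (fun x => inv_fourier k2 x * g x) xi =
   (cF R)%:C * ci m (fun eta => k2 eta * inv_fourier g (affine3 xi 1 eta)).
  rewrite inv_fourierE; congr (_ * _).
  transitivity (ci m (fun x => inv_fourier k2 x * (cexpi (dot xi x) * g x))).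
    by apply: ci_ext => x; rewrite mulrCA.
  rewrite -(ci_inv_fourier i2 ge); apply: ci_ext => eta; congr (_ * _).
  rewrite !inv_fourierE; congr (_ * _); apply: ci_ext => x.
  by rewrite mulrA -expiD dotDl addrC.
have I2 : cigr m (fun eta => k2 eta * inv_fourier g (affine3 xi 1 eta)).
  apply: (cigrM_bounded i2 _ (fun eta => cabs_inv_fourier _ gi)).
  apply: (cmeas_comp mig); apply: measurable_affine3; last exact: measurable_id.
  exact: measurable_cst.
rewrite E mulrCA; congr (_ * _); rewrite -(ciZ _ I2); apply: ci_ext => eta.
by rewrite mulrA.
Qed.

Lemma conj_inv_fourier k x : cigr m k ->
  cigr m (fun xi => conjc (k (opp3 xi))) /\
  conjc (inv_fourier k x) = inv_fourier (fun xi => conjc (k (opp3 xi))) x.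
Proof.
move=> ki; have sc := scales_reflect (0 : R3 R).
have ko : cigr m (fun xi => k (opp3 xi)) := (scales_cigr sc ltr01 (cigr_meas ki)).1 ki.
have kc := cigr_conj ko; split; first exact: kc.
rewrite !inv_fourierE conjcM conjc_realE; congr (_ * _).
have ke := cigr_expi x ki; rewrite -(ci_conj ke).
have := scales_ci sc ltr01 (cigr_conj ke); rewrite mul1r => <-.
apply: ci_ext => xi; rewrite /= conjcM expi_conj -/(opp3 xi); congr (cexpi _ * _).
by rewrite /opp3 dot_scale mulN1r opprK.
Qed.

(** When v is the transform of u, this is [cF] times the convolution of u with [pk (eps n)]. *)
Definition mol v n : R3meas R -> R[i] := inv_fourier (fun xi => v xi * (gn n xi)%:C).

Lemma cigr_gn v n : tame v -> cigr m (fun xi => v xi * (gn n xi)%:C).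
Proof. exact: tame_cigr_gauss (eps2_gt0 R n). Qed.

Lemma inv_fourierB k1 k2 x : cigr m k1 -> cigr m k2 ->
  inv_fourier (fun xi => k1 xi - k2 xi) x = inv_fourier k1 x - inv_fourier k2 x.
Proof.
move=> i1 i2; rewrite !inv_fourierE -mulrBr -ciB; [|exact: cigr_expi|exact: cigr_expi].
by congr (_ * _); apply: ci_ext => y; rewrite mulrBr.
Qed.

(** u need not be square integrable, so L2 distances carry this fixed Gaussian weight; its inverse
    transform is at most a multiple of [wt], as the third factor of the trilinear integral should
    be. *)
Definition Gc : R3meas R -> R[i] := fun x => (gn 0 x)%:C.

Lemma cigr_Gc : cigr m Gc. Proof. exact: cigr_real (igr_gn R 0). Qed.

Lemma inv_Gc_bound : exists K : R, forall x, cabs (inv_fourier Gc x) <= K * wt x.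
Proof.
have e01 := eps01 R 0; have /andP[e0 _] := e01; exists (eps R 0 ^- 3 * 8) => x.
have -> : inv_fourier Gc x = inv_fourier (mgauss (eps R 0 ^+ 2 / 2) 0) x.
  rewrite !inv_fourierE; congr (_ * _); apply: ci_ext => y; congr (_ * _).
  by rewrite /mgauss dotE /= !mul0r !addr0 /cexpi cos0 sin0 mul1r.
rewrite (inv_fourier_mgauss _ _ e0) cabs_real (ger0_norm (pk_ge0 _ e0)).
have -> : affine3 x 1 0 = x by case: x => [[x1 x2] x3]; rewrite /affine3 /= !mulr0 !addr0.
apply: (le_trans (pk_le x e01)); rewrite -mulrA; apply: ler_wpM2l; last exact: gauss3_le_wt.
by rewrite invr_ge0 exprn_ge0 // ltW.
Qed.

(* Bounds the L2 distance of the n-th mollification to all the later ones. *)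
Definition moldist v n : R := 2 * cF R * \int[sfprod m m]_p
  ((1 - gn n p.1) * (1 - gn n p.2) *
   cabs (v p.1 * conjc (v (opp3 p.2)) * inv_fourier Gc (affine3 p.1 1 p.2))).

Lemma cigr_moldist v : Hs v -> cigr (sfprod m m)
  (fun p => v p.1 * conjc (v (opp3 p.2)) * inv_fourier Gc (affine3 p.1 1 p.2)).
Proof.
move=> Hv; have mG := cmeas_inv_fourier (cigr_meas cigr_Gc).
have [K hK] := inv_Gc_bound.
exact: (tri_cigr Hv (Hs_opp_conj Hv) mG (igr_sing_bound mG hK)).
Qed.

Lemma one_sub_gn n x : 0 <= 1 - gn n x <= 1.
Proof. by have := gn_ge0 n x; have := gn_le1 n x; lra. Qed.

Lemma measurable_moldist v n : Hs v -> measurable_fun setT (fun p : R3meas R * R3meas R =>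
  (1 - gn n p.1) * (1 - gn n p.2) *
   cabs (v p.1 * conjc (v (opp3 p.2)) * inv_fourier Gc (affine3 p.1 1 p.2))).
Proof.
move=> Hv; apply: measurable_funM; last exact: cmeas_cabs (cigr_meas (cigr_moldist Hv)).
apply: measurable_funM; apply: measurable_funB; try exact: measurable_cst.
  exact: (measurableT_comp (@measurable_gn R n) measurable_fst).
exact: (measurableT_comp (@measurable_gn R n) measurable_snd).
Qed.

Lemma moldist_le v n p : 0 <= (1 - gn n p.1) * (1 - gn n p.2) *
   cabs (v p.1 * conjc (v (opp3 p.2)) * inv_fourier Gc (affine3 p.1 1 p.2)) <=
   cabs (v p.1 * conjc (v (opp3 p.2)) * inv_fourier Gc (affine3 p.1 1 p.2)).
Proof.
have /andP[a0 a1] := one_sub_gn n p.1; have /andP[b0 b1] := one_sub_gn n p.2.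
have c0 := cabs_ge0 (v p.1 * conjc (v (opp3 p.2)) * inv_fourier Gc (affine3 p.1 1 p.2)).
apply/andP; split; first by rewrite mulr_ge0 // mulr_ge0.
by rewrite ler_piMl // mulr_ile1.
Qed.

Lemma igr_moldist v n : Hs v -> igr (sfprod m m) (fun p =>
  (1 - gn n p.1) * (1 - gn n p.2) *
   cabs (v p.1 * conjc (v (opp3 p.2)) * inv_fourier Gc (affine3 p.1 1 p.2))).
Proof.
move=> Hv; apply: (igr_le (measurable_moldist n Hv) _ (cigr_cabs (cigr_moldist Hv))) => p.
by have /andP[h1 h2] := moldist_le v n p; rewrite ger0_norm.
Qed.

Lemma moldist_cvg v : Hs v -> moldist v @ \oo --> 0.
Proof.
move=> Hv; rewrite -(mulr0 (2 * cF R)); apply: cvgMr.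
have [|||||_ c] := @Rdct _ _ R (sfprod m m) (fun n p => (1 - gn n p.1) * (1 - gn n p.2) *
   cabs (v p.1 * conjc (v (opp3 p.2)) * inv_fourier Gc (affine3 p.1 1 p.2))) (fun=> 0)
   (fun p => cabs (v p.1 * conjc (v (opp3 p.2)) * inv_fourier Gc (affine3 p.1 1 p.2))).
- by move=> n; exact: measurable_moldist.
- exact: measurable_cst.
- apply: aeW => p; set c := cabs _.
  rewrite -[X in _ --> X](_ : (1 - 1) * (1 - 1) * c = 0); last by rewrite subrr !mul0r.
  apply: cvgMl; apply: cvgM; apply: cvgB; try exact: cvg_cst; exact: gn_cvg.
- exact: cigr_cabs (cigr_moldist Hv).
- by move=> n p; have /andP[h1 h2] := moldist_le v n p; rewrite ger0_norm.
have <- : \int[sfprod m m]_(p in setT) (0 : R) = 0 by rewrite /Rintegral integral0_eq.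
exact: c.
Qed.

(** The conjugate of F^-1 k is the inverse transform of conj (k (- xi)), so the weighted square
    integrates, by [ci_inv_inv], to a trilinear expression in k that the energy controls. *)
Lemma mol_cauchy v n j : tame v -> Hs v -> (n <= j)%N ->
  igr m (fun x => cabs (mol v j x - mol v n x) ^+ 2 * gn 0 x) /\
  \int[m]_x (cabs (mol v j x - mol v n x) ^+ 2 * gn 0 x) <= moldist v n.
Proof.
move=> tv Hv nj; pose k xi := v xi * (gn j xi)%:C - v xi * (gn n xi)%:C.
have ki : cigr m k by apply: cigrB; exact: cigr_gn.
have E x : mol v j x - mol v n x = inv_fourier k x.
  by rewrite /mol -inv_fourierB //; exact: cigr_gn.
have [kc _] := conj_inv_fourier 0 ki.
have [I E2] := ci_inv_inv ki kc cigr_Gc.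
have sq x : inv_fourier k x * inv_fourier (fun xi => conjc (k (opp3 xi))) x * Gc x =
    (cabs (mol v j x - mol v n x) ^+ 2 * gn 0 x)%:C.
  by have [_ <-] := conj_inv_fourier x ki; rewrite mulJ_cabs -E realcM.
have mk := cmeas_inv_fourier (cigr_meas ki).
have Ii : igr m (fun x => cabs (mol v j x - mol v n x) ^+ 2 * gn 0 x).
  have b x := cabs_inv_fourier x ki.
  have J := cigrM_bounded (cigrM_bounded cigr_Gc mk b) mk b.
  have := cigr_cabs J; apply: igr_ext => x.
  rewrite E /Gc; move: (inv_fourier k x) => w.
  by rewrite !cabsM cabs_real (ger0_norm (gn_ge0 0 x)) expr2 -mulrA mulrC.
split; first exact: Ii.
have e3 : (\int[m]_x (cabs (mol v j x - mol v n x) ^+ 2 * gn 0 x))%:C =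
   ci m (fun x => inv_fourier k x * inv_fourier (fun xi => conjc (k (opp3 xi))) x * Gc x).
  by rewrite -ci_real; apply: ci_ext => x; rewrite sq.
apply: (le_trans (ler_norm _)); rewrite -cabs_real e3 E2 cabsM cabs_real.
rewrite (ger0_norm (ltW (cF_gt0 R))) /moldist (mulrC 2) -mulrA.
apply: ler_wpM2l; first exact: ltW (cF_gt0 R).
apply: (le_trans (cabs_ci_le I)); apply: ler_wpM2l => //.
(* The cutoffs increase to at most 1, which makes the bound independent of j. *)
have kb xi : cabs (k xi) <= (1 - gn n xi) * cabs (v xi).
  rewrite /k -mulrBr -realcB cabsM cabs_real mulrC; apply: ler_wpM2r; first exact: cabs_ge0.
  rewrite ger0_norm; last by rewrite subr_ge0; exact: gn_nd.
  by rewrite lerD2r gn_le1.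
apply: le_Rintegral => //; [exact: cigr_cabs|exact: igr_moldist|move=> p _].
move: (inv_fourier Gc _) => c.
rewrite (cabsM _ c) (cabsM _ c) (cabsM (k p.1)) (cabsM (v p.1)) !cabs_conj [leRHS]mulrA.
apply: ler_wpM2r; first exact: cabs_ge0.
have := kb (opp3 p.2); have -> : gn n (opp3 p.2) = gn n p.2.
  by rewrite /gn /gauss3 -!enorm_sqr enorm_opp.
move=> h2; apply: (le_trans (ler_pM (cabs_ge0 _) (cabs_ge0 _) (kb p.1) h2)).
by rewrite le_eqVlt; apply/orP; left; apply/eqP; ring.
Qed.

End ProductFormula.

Lemma cdct_ae d (T : measurableType d) (R : realType) (mu : {measure set T -> \bar R})
    (f_ : nat -> T -> R[i]) (f : T -> R[i]) (g : T -> R) : (forall n, cmeas (f_ n)) ->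
  cmeas f -> {ae mu, forall x, ccvg (f_ ^~ x) (f x)} -> igr mu g ->
  {ae mu, forall x, forall n, cabs (f_ n x) <= g x} ->
  cigr mu f /\ ccvg (fun n => ci mu (f_ n)) (ci mu f).
Proof.
move=> mf_ mf ff gi fg.
have [h1 h2] := Rdct_ae (fun n => (mf_ n).1) mf.1 (ae_imp ff (fun x h => h.1)) gi
  (ae_imp fg (fun x h n => le_trans (Re_le_cabs _) (h n))).
have [h3 h4] := Rdct_ae (fun n => (mf_ n).2) mf.2 (ae_imp ff (fun x h => h.2)) gi
  (ae_imp fg (fun x h n => le_trans (Im_le_cabs _) (h n))).
by split; split.
Qed.

Lemma measurable_sqr d (T : measurableType d) (R : realType) (f : T -> R) :
  measurable_fun setT f -> measurable_fun setT (fun x => f x ^+ 2).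
Proof. by move=> mf; under eq_fun do rewrite expr2; exact: measurable_funM. Qed.

Section ProductLimit.
Variable R : realType.
Notation m := (leb3s R).
Implicit Types (x y z xi : R3 R) (h : R3 R -> R) (k v : R3meas R -> R[i]) (u : R3meas R -> R).

(* v is the Fourier transform of the real function u. *)
Definition ftpair u v := [/\ tame (fun x => (u x)%:C), tame v, Hs v &
  forall (e : R) y, 0 < e <= 1 ->
    ci m (fun x => (u x)%:C * (pk e (affine3 y (-1) x))%:C) =
    ci m (fun xi => v xi * mgauss (e ^+ 2 / 2) y xi)].

Lemma mol_bounded v n : tame v -> cmeas (mol v n) /\ exists M : R, forall x, cabs (mol v n x) <= M.
Proof.
move=> tv; have i := cigr_gn n tv; split; first exact: cmeas_inv_fourier (cigr_meas i).
by eexists => x; exact: cabs_inv_fourier.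
Qed.

Lemma molE u v n y : ftpair u v ->
  mol v n y = (cF R)%:C * ci m (fun x => (u x)%:C * (pk (eps R n) (affine3 y (-1) x))%:C).
Proof.
move=> [_ _ _ H]; rewrite (H _ _ (eps01 R n)) /mol inv_fourierE; congr (_ * _).
by apply: ci_ext => xi; rewrite mulrCA.
Qed.

Lemma cFV : (cF R)%:C * (cF R)^-1%:C = 1 :> R[i].
Proof. by rewrite -realcM mulfV // gt_eqF // cF_gt0. Qed.

Lemma mol_weak u v h : ftpair u v -> tf h ->
  (forall n, cigr m (fun x => mol v n x * (h x)%:C)) /\
  ccvg (fun n => ci m (fun x => mol v n x * (h x)%:C)) (ci m (fun x => (u x)%:C * (h x)%:C)).
Proof.
move=> fuv th; have [tu tv _ _] := fuv.
have hi : cigr m (fun x => (h x)%:C : R[i]) := cigr_real (tf_igr th).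
have I n : cigr m (fun x => mol v n x * (h x)%:C).
  have [mm [M hM]] := mol_bounded n tv.
  by apply: (cigr_ext _ (cigrM_bounded hi mm hM)) => x; rewrite mulrC.
split; first exact: I.
have c := cvg_mollify tu.1 th tu.2 (eps01 R) (@eps_cvg R).
have := ccvgM (ccvg_cst (cF R)%:C) c; rewrite mulrA cFV mul1r.
congr (ccvg _ _); apply/funext => n.
have E y : (cF R)^-1%:C * (mol v n y * (h y)%:C) =
    ci m (fun x => (u x)%:C * (pk (eps R n) (affine3 y (-1) x))%:C) * (h y)%:C.
  by rewrite (molE n y fuv) !mulrA (mulrC (_^-1%:C)) cFV mul1r.
by rewrite -(ci_ext m E) (ciZ _ (I n)) mulrA cFV mul1r.
Qed.

Let G : R3meas R -> R := gn 0.

Let c0 : 0 < eps R 0 ^+ 2 / 2. Proof. exact: eps2_gt0. Qed.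

(** [fast_L2_cvg] for the real and the imaginary parts separately; the latter tend to 0 because u is
    real. *)
Lemma mol_fast u v (s : nat -> nat) : ftpair u v -> (forall k : nat, (s k <= s k.+1)%N) ->
  (forall k : nat, (k <= s k)%N) -> (forall k : nat, moldist v (s k) <= 8^-1 ^+ k) ->
  exists H : R3meas R -> R, [/\ measurable_fun setT H, (forall x, 0 <= H x),
    igr m (fun x => H x ^+ 2 * G x), {ae m, forall x, forall k : nat, cabs (mol v (s k) x) <= H x} &
    {ae m, forall x, ccvg (fun k : nat => mol v (s k) x) (u x)%:C}].
Proof.
move=> fuv sm sk sd; have [tu tv Hv _] := fuv.
have mG : measurable_fun setT G := measurable_gn 0.
have mGi : measurable_fun setT (fun x => (G x)^-1).
  have -> : (fun x => (G x)^-1) = gauss3 (- (eps R 0 ^+ 2 / 2)).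
    by apply/funext => x; rewrite /G /gn /gauss3 -expRN !mulNr opprK.
  exact: measurable_gauss3.
have G0 x : 0 < G x by exact: gauss3_gt0.
have hG h : tf h -> exists2 C : R, 0 <= C & forall x, `|h x| <= C * G x.
  by move=> th; apply: tf_gauss_bound => //; exact: ltW.
have Gi : igr m G := igr_gn R 0.
have mm (k : nat) : cmeas (mol v (s k)) by have [] := mol_bounded (s k) tv.
(* P stands for either part; additivity and |P a| <= |a| transfer the Cauchy estimate to it. *)
have key (P : R[i] -> R) (w : R3meas R -> R) :
    (forall a b, P a - P b = P (a - b)) -> (forall a, `|P a| <= cabs a) ->
    (forall k : nat, measurable_fun setT (fun x => P (mol v (s k) x))) -> measurable_fun setT w ->
    (forall h, tf h -> igr m (fun x => w x * h x)) ->
    (forall h, tf h -> (fun n => \int[m]_x (P (mol v (s n) x) * h x)) @ \oo --> \int[m]_x (w x * h x)) ->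
    exists H : R3meas R -> R, [/\ measurable_fun setT H, (forall x, 0 <= H x),
      igr m (fun x => H x ^+ 2 * G x), {ae m, forall x, forall n, `|P (mol v (s n) x)| <= H x} &
      {ae m, forall x, (fun n => P (mol v (s n) x)) @ \oo --> w x}].
  move=> PB Pa mP mw wi wc.
  have P2 a : P a ^+ 2 <= cabs a ^+ 2.
    by rewrite -(real_normK (num_real (P a))); apply: lerXn2r (Pa a); rewrite nnegrE ?cabs_ge0.
  have D (k : nat) : igr m (fun x => (P (mol v (s k.+1) x) - P (mol v (s k) x)) ^+ 2 * G x) /\
      \int[m]_x ((P (mol v (s k.+1) x) - P (mol v (s k) x)) ^+ 2 * G x) <= 8^-1 ^+ k.
    have [i1 b1] := mol_cauchy tv Hv (sm k).
    have i2 : igr m (fun x => (P (mol v (s k.+1) x) - P (mol v (s k) x)) ^+ 2 * G x).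
      apply: (igr_le _ _ i1).
        apply: (measurable_funM _ mG); apply: measurable_sqr.
        exact: measurable_funB (mP _) (mP _).
      move=> x; rewrite ger0_norm; last by apply: mulr_ge0; [exact: sqr_ge0|exact: ltW (G0 x)].
      by rewrite PB; apply: ler_wpM2r; [exact: ltW (G0 x)|exact: P2].
    split; first exact: i2.
    apply: (le_trans _ (sd k)); apply: (le_trans _ b1); apply: le_Rintegral => // x _.
    by rewrite PB; apply: ler_wpM2r; [exact: ltW (G0 x)|exact: P2].
  apply: (fast_L2_cvg mP mw mG mGi G0 wi hG _ Gi (fun k : nat => (D k).1) (fun k : nat => (D k).2) wc).
  have [_ [M hM]] := mol_bounded (s 0%N) tv.
  apply: (igr_le _ _ (igrZ (M ^+ 2) Gi)).
    by apply: (measurable_funM _ mG); apply: measurable_sqr; exact: mP.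
  move=> x; rewrite ger0_norm; last by apply: mulr_ge0; [exact: sqr_ge0|exact: ltW (G0 x)].
  apply: ler_wpM2r; first exact: ltW (G0 x).
  apply: (le_trans (P2 _)); apply: lerXn2r (hM x); rewrite nnegrE ?cabs_ge0 //.
  exact: le_trans (cabs_ge0 _) (hM x).
have sub (a : nat -> R) (l : R) : a @ \oo --> l -> (fun k : nat => a (s k)) @ \oo --> l.
  move=> al; apply: (@cvg_comp _ _ _ s a _ \oo) al => A [N _ hN]; exists N => // k Nk.
  by apply: hN; exact: leq_trans Nk (sk k).
have wk h : tf h -> ccvg (fun n => ci m (fun x => mol v (s n) x * (h x)%:C)) (ci m (fun x => (u x)%:C * (h x)%:C)).
  move=> th; have [_ [h1 h2]] := mol_weak fuv th.
  by split; [exact: (sub _ _ h1)|exact: (sub _ _ h2)].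
have Er (z : R[i]) (t : R) : complex.Re (z * t%:C) = complex.Re z * t.
  by rewrite ReM /= mulr0 subr0.
have Ei (z : R[i]) (t : R) : complex.Im (z * t%:C) = complex.Im z * t.
  by rewrite ImM /= mulr0 add0r.
have uh h : tf h -> igr m (fun x => u x * h x).
  by move=> th; have [i1 _] := tame_cigr_tf tu th; apply: (igr_ext _ i1) => x; rewrite Er.
have [H1 [m1 p1 i1 b1 c1]] : exists H : R3meas R -> R, [/\ measurable_fun setT H, (forall x, 0 <= H x),
      igr m (fun x => H x ^+ 2 * G x), {ae m, forall x, forall n, `|complex.Re (mol v (s n) x)| <= H x} &
      {ae m, forall x, (fun n => complex.Re (mol v (s n) x)) @ \oo --> u x}].
  apply: (key (@complex.Re R) u).
  - by move=> a b; rewrite ReD ReN.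
  - exact: Re_le_cabs.
  - by move=> k; have [] := mm k.
  - exact: tu.1.1.
  - exact: uh.
  - move=> h th; have [h1 _] := wk h th.
    have E2 (f : R3meas R -> R[i]) : complex.Re (ci m (fun x => f x * (h x)%:C)) =
        \int[m]_x (complex.Re (f x) * h x) by apply: eq_Rintegral => x _; rewrite Er.
    by move: h1; rewrite E2; under eq_fun do rewrite E2.
have [H2 [m2 p2 i2 b2 c2]] : exists H : R3meas R -> R, [/\ measurable_fun setT H, (forall x, 0 <= H x),
      igr m (fun x => H x ^+ 2 * G x), {ae m, forall x, forall n, `|complex.Im (mol v (s n) x)| <= H x} &
      {ae m, forall x, (fun n => complex.Im (mol v (s n) x)) @ \oo --> 0}].
  apply: (key (@complex.Im R) (fun=> 0)).
  - by move=> a b; rewrite ImD ImN.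
  - exact: Im_le_cabs.
  - by move=> k; have [] := mm k.
  - exact: measurable_cst.
  - move=> h th; apply: (@igr_ext _ _ R m (fun=> 0)) => [x|]; first by rewrite mul0r.
    by have [] := @cigr0 _ _ R m.
  - move=> h th; have [_ h1] := wk h th.
    have E2 (f : R3meas R -> R[i]) : complex.Im (ci m (fun x => f x * (h x)%:C)) =
        \int[m]_x (complex.Im (f x) * h x) by apply: eq_Rintegral => x _; rewrite Ei.
    by move: h1; rewrite E2; under eq_fun do rewrite E2.
exists (fun x => H1 x + H2 x); split.
- exact: measurable_funD.
- by move=> x; rewrite addr_ge0.
- apply: (igr_le _ _ (igrD (igrZ 2 i1) (igrZ 2 i2))).
    apply: (measurable_funM _ mG); apply: measurable_sqr.
    exact: measurable_funD m1 m2.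
  move=> x; rewrite ger0_norm; last by apply: mulr_ge0; [exact: sqr_ge0|exact: ltW (G0 x)].
  rewrite !mulrA -mulrDl; apply: ler_wpM2r; first exact: ltW (G0 x).
  by have := sqr_ge0 (H1 x - H2 x); rewrite !expr2; lra.
- apply: (ae_imp2 b1 b2) => x h1 h2 k; apply: (le_trans (cabs_le_ReIm _)).
  by apply: lerD; [exact: h1|exact: h2].
- by apply: (ae_imp2 c1 c2) => x h1 h2; split.
Qed.

Lemma fast_subsequence (d : nat -> R) : d @ \oo --> 0 ->
  exists N : nat -> nat, forall k n : nat, (N k <= n)%N -> d n <= 8^-1 ^+ k.
Proof.
move=> dc; have H (k : nat) : exists N, forall n, (N <= n)%N -> d n <= 8^-1 ^+ k.
  have p : 0 < 8^-1 ^+ k :> R by rewrite exprn_gt0 // invr_gt0.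
  have /cvgrPdist_le/(_ _ p)[N _ hN] := dc; exists N => n Nn.
  by have := hN n Nn; rewrite sub0r normrN; apply: le_trans; exact: ler_norm.
by have [N hN] := choice H; exists N.
Qed.

(** Along one subsequence both mollified factors converge almost everywhere under majorants H1 and
    H2, and |H1 H2 g| is at most a multiple of (H1^2 + H2^2) G. On the frequency side the cutoffs
    are at most 1, so the limit integrand is its own majorant. *)
Lemma product_formula u1 v1 u2 v2 g : ftpair u1 v1 -> ftpair u2 v2 -> tf g ->
  [/\ igr m (fun x => u1 x * u2 x * g x),
    cigr (sfprod m m) (fun p => v1 p.1 * v2 p.2 * ift g (affine3 p.1 1 p.2)) &
    (\int[m]_x (u1 x * u2 x * g x))%:C =
    (cF R)%:C * ci (sfprod m m) (fun p => v1 p.1 * v2 p.2 * ift g (affine3 p.1 1 p.2))].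
Proof.
move=> f1 f2 tg; have [tu1 tv1 Hv1 _] := f1; have [tu2 tv2 Hv2 _] := f2.
have dc : (fun n => moldist v1 n + moldist v2 n) @ \oo --> 0.
  by rewrite -[X in _ --> X](addr0 (0 : R)); apply: cvgD; exact: moldist_cvg.
have [N hN] := fast_subsequence dc.
(* Partial sums of N + 1 make s nondecreasing, at least N k and at least k. One s serves both
   factors because N was chosen for the sum of their distances. *)
pose s (k : nat) := (\sum_(l < k.+1) (N l).+1)%N.
have sm (k : nat) : (s k <= s k.+1)%N by rewrite [X in (_ <= X)%N]/s big_ord_recr /= leq_addr.
have Ns (k : nat) : (N k <= s k)%N by rewrite /s big_ord_recr /= (leq_trans (leqnSn _)) // leq_addl.
have sk (k : nat) : (k <= s k)%N.
  elim: k => // k IH; rewrite /s big_ord_recr /= addnS ltnS.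
  exact: leq_trans IH (leq_addr _ _).
have d0 v n : 0 <= moldist v n.
  rewrite /moldist !mulr_ge0 ?(ltW (cF_gt0 R)) //; apply: Rintegral_ge0 => p _.
  by have /andP[] := moldist_le v n p.
have sd1 (k : nat) : moldist v1 (s k) <= 8^-1 ^+ k.
  by apply: le_trans (hN k _ (Ns k)); rewrite lerDl.
have sd2 (k : nat) : moldist v2 (s k) <= 8^-1 ^+ k.
  by apply: le_trans (hN k _ (Ns k)); rewrite lerDr.
have [H1 [m1 p1 i1 b1 c1]] := mol_fast f1 sm sk sd1.
have [H2 [m2 p2 i2 b2 c2]] := mol_fast f2 sm sk sd2.
have [C C0 hC] := tf_gauss_bound (ltW c0) tg.
have gi : cigr m (of_real g) := cigr_real (tf_igr tg).
have mg : cmeas (fun x : R3meas R => (g x)%:C : R[i]) := tf_cmeas tg.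
have [L1 L2] : cigr m (fun x => (u1 x)%:C * (u2 x)%:C * (g x)%:C) /\
    ccvg (fun k : nat => ci m (fun x => mol v1 (s k) x * mol v2 (s k) x * (g x)%:C))
      (ci m (fun x => (u1 x)%:C * (u2 x)%:C * (g x)%:C)).
  apply: (@cdct_ae _ _ R m (fun (k : nat) x => mol v1 (s k) x * mol v2 (s k) x * (g x)%:C) _
    (fun x => C * (H1 x ^+ 2 * G x + H2 x ^+ 2 * G x))).
  - move=> k; apply: cmeasM => //; apply: cmeasM.
      by have [] := mol_bounded (s k) tv1.
    by have [] := mol_bounded (s k) tv2.
  - by apply: cmeasM => //; apply: cmeasM; [exact: tu1.1|exact: tu2.1].
  - apply: (ae_imp2 c1 c2) => x h1 h2; apply: ccvgM; last exact: ccvg_cst.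
    exact: ccvgM.
  - by apply: igrZ; apply: igrD.
  - apply: (ae_imp2 b1 b2) => x h1 h2 k; move: (h1 k) (h2 k).
    move: (mol v1 _ x) (mol v2 _ x) => a b ha hb; rewrite !cabsM cabs_real.
    have g0 : 0 <= G x by exact: gauss3_ge0.
    apply: (le_trans (ler_pM _ (normr_ge0 _) (ler_pM (cabs_ge0 a) (cabs_ge0 b) ha hb) (hC x))).
      by rewrite mulr_ge0 ?cabs_ge0.
    rewrite -/(gn 0 x) -/(G x) mulrCA; apply: ler_wpM2l => //; rewrite -mulrDl.
    apply: ler_wpM2r => //; have := sqr_ge0 (H1 x - H2 x).
    have := p1 x; have := p2 x; move: (H1 x) (H2 x) => r t; clear; nra.
have mi := cmeas_ift tg.
have T : cigr (sfprod m m) (fun p => v1 p.1 * v2 p.2 * ift g (affine3 p.1 1 p.2)).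
  have [K K0 hK] := ift_decay 1 tg.
  apply: (tri_cigr Hv1 Hv2 mi (igr_sing_bound mi (K := K) _)) => x.
  rewrite -(ler_pM2l (wt_den_gt0 x)) [leRHS]mulrCA wtK mulr1.
  by have := hK x; rewrite expr1.
split; [|exact: T|].
  have [i _] := L1; apply: (igr_ext _ i) => x.
  by rewrite -!realcM.
have R1 : ccvg (fun k : nat => (cF R)%:C * ci (sfprod m m) (fun p =>
      (v1 p.1 * (gn (s k) p.1)%:C) * (v2 p.2 * (gn (s k) p.2)%:C) * ift g (affine3 p.1 1 p.2)))
    ((cF R)%:C * ci (sfprod m m) (fun p => v1 p.1 * v2 p.2 * ift g (affine3 p.1 1 p.2))).
  apply: ccvgM; first exact: ccvg_cst.
  apply: (cdct _ (cigr_meas T) _ (cigr_cabs T) _).2.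
  - move=> k; apply: cmeasM; last exact: cmeas_add3.
    by apply: cmeasM; [exact: (cmeas_comp (cigr_meas (cigr_gn (s k) tv1)) measurable_fst)|
      exact: (cmeas_comp (cigr_meas (cigr_gn (s k) tv2)) measurable_snd)].
  - apply: aeW => p; apply: ccvgM; last exact: ccvg_cst.
    have gs x : ccvg (fun k : nat => (gn (s k) x)%:C) (1 : R[i]).
      apply: (@ccvg_real R (fun k : nat => gn (s k) x) 1).
      apply: (@cvg_comp _ _ _ s (fun n => gn n x) _ \oo) (gn_cvg x) => A [M _ hM]; exists M => // k Mk.
      by apply: hM; exact: leq_trans Mk (sk k).
    apply: ccvgM.
      by rewrite -[X in ccvg _ X]mulr1; apply: ccvgM; [exact: ccvg_cst|exact: gs].
    by rewrite -[X in ccvg _ X]mulr1; apply: ccvgM; [exact: ccvg_cst|exact: gs].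
  - move=> k p; move: (ift g _) => c; rewrite !cabsM !cabs_real !(ger0_norm (gn_ge0 _ _)).
    apply: ler_wpM2r; first exact: cabs_ge0.
    apply: ler_pM; rewrite ?mulr_ge0 ?cabs_ge0 ?gn_ge0 //.
      by rewrite ler_piMr ?cabs_ge0 ?gn_le1.
    by rewrite ler_piMr ?cabs_ge0 ?gn_le1.
have E : (\int[m]_x (u1 x * u2 x * g x))%:C = ci m (fun x => (u1 x)%:C * (u2 x)%:C * (g x)%:C).
  by rewrite -ci_real; apply: ci_ext => x; rewrite -!realcM.
rewrite E; apply: (ccvg_unique L2).
move: R1; congr (ccvg _ _); apply/funext => k.
have [_ <-] := ci_inv_inv (cigr_gn (s k) tv1) (cigr_gn (s k) tv2) gi.
exact: erefl.
Qed.

End ProductLimit.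

(** Only the product is assumed integrable: for a = 0 the integral of f may be a default value, but
    both sides vanish. *)
Lemma ciZr_ex d (T : measurableType d) (R : realType) (mu : {measure set T -> \bar R}) (f : T -> R[i]) (a : R[i]) :
  cigr mu (fun x => f x * a) -> ci mu (fun x => f x * a) = ci mu f * a.
Proof.
move=> fa; have [->|a0] := eqVneq a 0.
  by rewrite mulr0 (ci_ext _ (g := fun=> 0)) ?ci0 // => x; rewrite mulr0.
rewrite ciZr //; have := cigrZ a^-1 fa; apply: cigr_ext => x.
by rewrite mulrC mulfK.
Qed.

Lemma scales_comp d (T : measurableType d) (R : realType) (mu : {measure set T -> \bar R}) h1 h2 :
  scales mu h1 (1 : R) -> scales mu h2 (1 : R) -> scales mu (h2 \o h1) (1 : R).
Proof.
move=> [m1 s1] [m2 s2]; split; first exact: measurableT_comp m2 m1.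
move=> f mf f0; rewrite -[RHS](s2 f mf f0) -(s1 (f \o h2)) ?mul1e //.
  exact: measurableT_comp mf m2.
by move=> x; exact: f0.
Qed.

(** * Convolutions of transforms and their pairings *)

Section Convolution.
Variable R : realType.
Notation m := (leb3s R).
Implicit Types (x y z xi : R3 R) (h : R3 R -> R) (v : R3meas R -> R[i]).

Definition conv v1 v2 : R3meas R -> R[i] :=
  fun z => ci m (fun y => v1 (affine3 z (-1) y) * v2 y).

Lemma cmeas_conv_ker v1 v2 : cmeas v1 -> cmeas v2 ->
  cmeas (fun p : R3meas R * R3meas R => v1 (affine3 p.1 (-1) p.2) * v2 p.2).
Proof.
move=> m1 m2; apply: cmeasM; last exact: (cmeas_comp m2 measurable_snd).
apply: (cmeas_comp m1); apply: measurable_affine3; [exact: measurable_fst|exact: measurable_snd].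
Qed.

Lemma cmeas_conv v1 v2 : cmeas v1 -> cmeas v2 -> cmeas (conv v1 v2).
Proof. by move=> m1 m2; exact: (cmeas_inner m (cmeas_conv_ker m1 m2)). Qed.

(** Fubini after the shear (z, y) -> (z - y, y). The inner integrand is known to be integrable only
    once multiplied by C z, which may be zero; [ciZr_ex] allows for that. *)
Lemma conv_pairing v1 v2 (C : R3meas R -> R[i]) : Hs v1 -> Hs v2 -> cmeas C ->
  igr m (fun x : R3meas R => enorm x `^ (- (1 / 3)) * cabs (C x) ^+ 2) ->
  cigr m (fun z => conv v1 v2 z * C z) /\
  ci (sfprod m m) (fun p => v1 p.1 * v2 p.2 * C (affine3 p.1 1 p.2)) =
  ci m (fun z => conv v1 v2 z * C z).
Proof.
move=> H1 H2 mC iC; have I := tri_cigr H1 H2 mC iC.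
have sc := @scales_shear R (-1).
have I2 := (scales_cigr sc ltr01 (cigr_meas I)).1 I.
have := scales_ci sc ltr01 I; rewrite mul1r => E.
have J : cigr (sfprod m m) (fun p => v1 (affine3 p.1 (-1) p.2) * v2 p.2 * C p.1).
  by apply: (cigr_ext _ I2) => p; rewrite /= affine3K.
have [Jae Ji JE] := cfubini J.
have ae : {ae m, forall z, ci m (fun y => v1 (affine3 z (-1) y) * v2 y * C z) = conv v1 v2 z * C z}.
  by apply: (ae_imp Jae) => z Jz; rewrite /conv; apply: ciZr_ex; exact: Jz.
have mK : cmeas (fun z => conv v1 v2 z * C z) := cmeasM (cmeas_conv H1.1 H2.1) mC.
split.
  refine (@cigr_ae _ _ R m (fun z : R3meas R => ci m (fun y => v1 (affine3 z (-1) y) * v2 y * C z))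
    (fun z => conv v1 v2 z * C z) _ _ _); [exact: mK|exact: ae|exact: Ji].
have e4 : ci m (fun z => ci m (fun y => v1 (affine3 z (-1) y) * v2 y * C z)) =
    ci m (fun z => conv v1 v2 z * C z).
  by apply: ci_ae; [exact: cigr_meas Ji|exact: mK|exact: ae].
rewrite -E -e4; apply: (etrans _ (esym JE)).
by apply: ci_ext => p; rewrite /= affine3K.
Qed.

Lemma igr_sing53_wt : igr m (fun x : R3meas R => enorm x `^ (- (5 / 3)) * wt x ^+ 2).
Proof.
apply: (igr_le_ae _ _ (igrD (igr_wker1 R) (igr_wt2 R))).
  apply: measurable_funM; first exact: measurable_enorm_powR.
  by apply: measurable_sqr; exact: measurable_wt.
apply: (ae_imp (ae_neq0 R)) => x /enorm_gt0 x0.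
rewrite ger0_norm; last by rewrite mulr_ge0 ?powR_ge0 ?sqr_ge0.
have w1 : wt x ^+ 2 <= 1 by rewrite exprn_ile1 ?wt_le1 // ltW // wt_gt0.
have [t1|t1] := leP (enorm x) 1.
  apply: (@le_trans _ _ (wker 1 x)); last by rewrite lerDl sqr_ge0.
  by rewrite /wker (max_idPr t1) powR1 mulr1 ler_piMr // powR_ge0.
apply: (@le_trans _ _ (wt x ^+ 2)); last by rewrite lerDr wker_ge0.
rewrite ler_piMl ?sqr_ge0 //.
have := @powRN_le R (5 / 3) 1 (enorm x) _ ltr01 (ltW t1); rewrite powR1; apply; lra.
Qed.

(** |v X| is at most t |v|^2 + |X|^2 / t with t = |x|^(5/3): the energy weight against its inverse,
    still integrable at 0 in dimension 3. *)
Lemma Hs_cigr v (X : R3meas R -> R[i]) (K : R) : Hs v -> cmeas X ->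
  (forall x, cabs (X x) <= K * wt x) -> cigr m (fun x => v x * X x).
Proof.
move=> [mv iv] mX XK; apply/cigr_cabsP; first exact: cmeasM.
apply: (igr_le_ae _ _ (igrD iv (igrZ (K ^+ 2) igr_sing53_wt))).
  by apply: cmeas_cabs; exact: cmeasM.
apply: (ae_imp (ae_neq0 R)) => x /enorm_gt0 x0; rewrite cabsM ger0_norm ?mulr_ge0 ?cabs_ge0 //.
have p0 : 0 < enorm x `^ (5 / 3) by rewrite powR_gt0.
rewrite powRN [K ^+ 2 * _]mulrCA -exprMn; have := XK x; have := cabs_ge0 (X x); have := cabs_ge0 (v x).
move: (cabs _) (cabs _) (K * wt x) (enorm x `^ (5 / 3)) p0 => b a c t t0 a0 b0 bc.
have bc2 : b ^+ 2 <= c ^+ 2 by apply: lerXn2r => //; rewrite nnegrE // (le_trans b0 bc).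
apply: (@le_trans _ _ (t * a ^+ 2 + t^-1 * b ^+ 2)); last first.
  by rewrite lerD2l; apply: ler_wpM2l bc2; rewrite invr_ge0 ltW.
have tt : t * t^-1 = 1 by rewrite mulfV // gt_eqF.
have s0 : 0 < t^-1 by rewrite invr_gt0.
move: (t^-1) tt s0 => s tt s0.
have : 0 <= s * (t * a - b) ^+ 2 by rewrite mulr_ge0 ?sqr_ge0 // ltW.
rewrite (_ : s * (t * a - b) ^+ 2 = (t * s) * (t * a ^+ 2) - (t * s) * (2 * (a * b)) + s * b ^+ 2); last by ring.
rewrite tt !mul1r => h; have : 0 <= a * b by rewrite mulr_ge0.
lra.
Qed.

Lemma coord3_le (j : 'I_3) x : `|coord3 j x| <= enorm x.
Proof.
have [h1 h2 h3] := coord_le_enorm x.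
by case: j => [[|[|[|//]]] ?]; rewrite /coord3.
Qed.

Lemma measurable_coord3 (j : 'I_3) : measurable_fun setT (coord3 j : R3meas R -> R).
Proof.
have [c1 c2 c3] := @continuous_coord R; apply: continuous_measurable3.
by case: j => [[|[|[|//]]] ?].
Qed.

Lemma cmeas_coord3 (j : 'I_3) : cmeas (fun x : R3meas R => (coord3 j x)%:C : R[i]).
Proof. exact: (cmeas_real (measurable_coord3 j)). Qed.

Lemma ift_poly_bound h (X : R3meas R -> R[i]) : tf h ->
  (forall x, cabs (X x) <= (1 + dot x x) ^+ 2) ->
  exists K : R, forall x, cabs (X x * ift h x) <= K * wt x.
Proof.
move=> th hX; have [K K0 hK] := ift_decay 3 th; exists K => x.
rewrite cabsM -(ler_pM2l (wt_den_gt0 x)) [leRHS]mulrCA wtK mulr1.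
apply: le_trans (hK x); rewrite exprS -[leRHS]mulrA ler_pM2l ?wt_den_gt0 //.
by apply: ler_wpM2r; [exact: cabs_ge0|exact: hX].
Qed.

Lemma dot_wt_le2 x : 1 + dot x x <= (1 + dot x x) ^+ 2.
Proof. rewrite expr2; apply: ler_peMr; first exact: ltW (wt_den_gt0 x).
by rewrite lerDl dot_ge0. Qed.

Lemma enorm_le_wt x : enorm x <= 1 + dot x x.
Proof. by rewrite -enorm_sqr; have := sqr_ge0 (enorm x - 1); have := enorm_ge0 x; nra. Qed.

Lemma coord_poly j x : cabs ((coord3 j x)%:C : R[i]) <= (1 + dot x x) ^+ 2.
Proof.
rewrite cabs_real; apply: (le_trans (coord3_le j x)).
exact: le_trans (enorm_le_wt x) (dot_wt_le2 x).
Qed.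

End Convolution.

(** * Vanishing of the energy *)

(** Numbers the pairs of indices, so that the countable intersection of null-set conditions
    [ae_all_nat] covers all of them. *)
Lemma ord3_pair (a b : 'I_3) :
  ((inord ((a * 3 + b) %/ 3) = a) * (inord ((a * 3 + b) %% 3) = b))%type.
Proof.
by rewrite divnMDl // modnMDl divn_small // modn_small // addn0 !inord_val.
Qed.

Section Energy.
Variable R : realType.
Notation m := (leb3s R).
Variable v : 'I_3 -> R3meas R -> R[i].
Hypothesis Hv : forall i, Hs (v i).
Hypothesis v_real : forall i, {ae m, forall x, v i (opp3 x) = conjc (v i x)}.
Hypothesis v_div : {ae m, forall x, \sum_(j < 3) (coord3 j x)%:C * v j x = 0}.

(** The transform of (-Delta)^(5/6) u_i + sum_j d_j (u_i u_j); [cF] is there because the unitary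
    transform takes a product to [cF] times a convolution. *)
Definition ell i (x : R3meas R) : R[i] := (enorm x `^ (5 / 3))%:C * v i x +
  (0 +i* cF R) * \sum_(j < 3) (coord3 j x)%:C * conv (v i) (v j) x.

Hypothesis v_eq : forall a b, {ae m, forall x,
  (coord3 b x)%:C * ell a x = (coord3 a x)%:C * ell b x}.

Let Cij (i j : 'I_3) (x : R3meas R) : R[i] := (coord3 j x)%:C * conjc (v i x).

Let mCij i j : cmeas (Cij i j).
Proof. by apply: cmeasM; [exact: cmeas_coord3|apply: cmeas_conj; have [] := Hv i]. Qed.

(** The critical balance: the coordinate contributes |x|^2, and 2 - 1/3 = 5/3 is the exponent of the
    energy. *)
Let iCij i j : igr m (fun x : R3meas R => enorm x `^ (- (1 / 3)) * cabs (Cij i j x) ^+ 2).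
Proof.
have [mv iv] := Hv i; apply: (igr_le_ae _ _ iv).
  apply: measurable_funM; first exact: measurable_enorm_powR.
  exact: measurable_sqr (cmeas_cabs (mCij i j)).
apply: (ae_imp (ae_neq0 R)) => x /enorm_gt0 x0.
rewrite ger0_norm; last by rewrite mulr_ge0 ?powR_ge0 ?sqr_ge0.
rewrite /Cij cabsM cabs_conj cabs_real exprMn mulrA; apply: ler_wpM2r; first exact: sqr_ge0.
have -> : enorm x `^ (5 / 3) = enorm x `^ (- (1 / 3)) * enorm x ^+ 2.
  rewrite -powR_mulrn ?(ltW x0) // -powRD ?(gt_eqF x0) ?implybT //; congr (_ `^ _); lra.
apply: ler_wpM2l; first exact: powR_ge0.
by apply: lerXn2r (coord3_le j x); rewrite nnegrE ?enorm_ge0.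
Qed.

Let Phi (p : R3meas R * R3meas R) : R[i] := \sum_(i < 3) \sum_(j < 3)
  v i p.1 * v j p.2 * Cij i j (affine3 p.1 1 p.2).

Let iPhi : cigr (sfprod m m) Phi.
Proof.
by do 2 apply: cigr_sum => ?; exact: (tri_cigr (Hv _) (Hv _) (mCij _ _) (iCij _ _)).
Qed.

(** An involution that exchanges the frequency x of v_i with the frequency x + y of its conjugate in
    [Phi]. *)
Let tau (p : R3meas R * R3meas R) : R3meas R * R3meas R := (affine3 p.1 1 p.2, opp3 p.2).

Let sc_tau : scales (sfprod m m) tau (1 : R).
Proof.
have sid : scales m (@idfun (R3meas R)) (1 : R).
  by split => [|f mf f0]; [exact: measurable_id|rewrite mul1e].
have := @scales_prod _ _ _ _ R m m idfun (@opp3 R) 1 1 ler01 ler01 sid (scales_reflect 0).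
rewrite mulr1 => s2; exact: (scales_comp (@scales_shear R 1) s2).
Qed.

(* The trilinear form changes into its conjugate under [(x, y) -> (x + y, - y)]:
   this is where both the reality and the vanishing divergence are used. *)
Let Phi_tau : {ae sfprod m m, forall p, Phi (tau p) = conjc (Phi p)}.
Proof.
have r3 : {ae m, forall y, (forall j : 'I_3, v j (opp3 y) = conjc (v j y)) /\
    \sum_(j < 3) (coord3 j y)%:C * v j y = 0}.
  have a012 := ae_imp2 (v_real (@Ordinal 3 0 isT)) (ae_imp2 (v_real (@Ordinal 3 1 isT))
    (v_real (@Ordinal 3 2 isT)) (fun x h1 h2 => conj h1 h2)) (fun x h0 h12 => conj h0 h12).
  apply: (ae_imp2 a012 v_div) => y [h0 [h1 h2]] hd; split => // j.
  by case: j => [[|[|[|//]]] lj]; [rewrite (_ : Ordinal lj = Ordinal (n := 3) (m := 0) isT)|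
    rewrite (_ : Ordinal lj = Ordinal (n := 3) (m := 1) isT)|
    rewrite (_ : Ordinal lj = Ordinal (n := 3) (m := 2) isT)] => //; exact: val_inj.
(* Both conditions concern y alone: after v_j (- y) = conj (v_j y) the two sides differ by a
   multiple of the conjugate of y . v (y). *)
apply: (ae_imp (ae_snd m r3)) => -[x y] /= [hr hd].
have zx : affine3 (affine3 x 1 y) 1 (opp3 y) = x.
  by case: x y {hr hd} => [[x1 x2] x3] [[y1 y2] y3]; rewrite /opp3 /affine3 /=; congr (_, _, _); ring.
have -> : conjc (Phi (x, y)) = \sum_(i < 3) \sum_(j < 3)
    conjc (v i x * v j y * Cij i j (affine3 x 1 y)).
  by rewrite /Phi rmorph_sum; apply: eq_bigr => i _; rewrite rmorph_sum.
rewrite /Phi /tau /= zx; apply: eq_bigr => i _.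
have c1 j : v i (affine3 x 1 y) * v j (opp3 y) * Cij i j x =
    v i (affine3 x 1 y) * conjc (v i x) * ((coord3 j x)%:C * conjc (v j y)).
  by rewrite /Cij hr; move: (v i _) (conjc _) (conjc _) (_%:C) => p q r s; ring.
have c2 j : conjc (v i x * v j y * Cij i j (affine3 x 1 y)) =
    v i (affine3 x 1 y) * conjc (v i x) *
    ((coord3 j x)%:C * conjc (v j y) + conjc ((coord3 j y)%:C * v j y)).
  rewrite /Cij (_ : coord3 j (affine3 x 1 y) = coord3 j x + coord3 j y); last first.
    by case: j => [[|[|[|//]]] ?]; rewrite /coord3 /= mul1r.
  rewrite !conjcM !conjc_realE conjcK realcD.
  by move: (v i _) (conjc _) (conjc _) (_%:C) (_%:C) => p q r s t; ring.
under eq_bigr do rewrite c1; under [RHS]eq_bigr do rewrite c2.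
rewrite -!mulr_sumr; congr (_ * _); rewrite big_split /=.
by rewrite -(rmorph_sum (@conjc R)) hd rmorph0 addr0.
Qed.

Lemma energy_zero i : {ae m, forall x, v i x = 0}.
Proof.
pose S x := \sum_(i < 3) enorm x `^ (5 / 3) * cabs (v i x) ^+ 2.
have Si : igr m S.
  rewrite /S; under eq_fun do rewrite !big_ord_recl big_ord0 addr0.
  by apply: igrD; [have [] := Hv ord0|apply: igrD; [exact: (Hv _).2|exact: (Hv _).2]].
have S0 x : 0 <= S x by apply: sumr_ge0 => j _; rewrite mulr_ge0 ?powR_ge0 ?sqr_ge0.
pose N x := \sum_(i < 3) \sum_(j < 3) conv (v i) (v j) x * Cij i j x.
have Nij a b := conv_pairing (Hv a) (Hv b) (mCij a b) (iCij a b).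
have Ni : cigr m N by do 2 apply: cigr_sum => ?; exact: (Nij _ _).1.
have NE : ci m N = ci (sfprod m m) Phi.
  rewrite /N /Phi !ci_sum; last first.
  - by move=> a; apply: cigr_sum => b; exact: (Nij _ _).1.
  - by move=> a; apply: cigr_sum => b; exact: (tri_cigr (Hv _) (Hv _) (mCij _ _) (iCij _ _)).
  apply: eq_bigr => a _; rewrite !ci_sum; last first.
  - by move=> b; exact: (Nij _ _).1.
  - by move=> b; exact: (tri_cigr (Hv _) (Hv _) (mCij _ _) (iCij _ _)).
  by apply: eq_bigr => b _; rewrite (Nij a b).2.
have T0 : complex.Im (ci (sfprod m m) Phi) = 0.
  have e1 := scales_ci sc_tau ltr01 iPhi; rewrite mul1r in e1.
  have i2 := (scales_cigr sc_tau ltr01 (cigr_meas iPhi)).1 iPhi.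
  have := ci_ae (cigr_meas i2) (cigr_meas (cigr_conj iPhi)) Phi_tau.
  rewrite e1 ci_conj // => /(congr1 (@complex.Im R)); rewrite Im_conj.
  move: (complex.Im _) => t tE; lra.
have aeE : {ae m, forall x, (S x)%:C = - (0 +i* cF R) * N x}.
  have v3 : {ae m, forall x, forall a b : 'I_3, (coord3 b x)%:C * ell a x = (coord3 a x)%:C * ell b x}.
    pose q (n : nat) : 'I_3 * 'I_3 := (inord (n %/ 3), inord (n %% 3)).
    have := ae_all_nat (fun n => v_eq (q n).1 (q n).2).
    move=> /ae_imp; apply => x H a b; have := H (a * 3 + b)%N.
    by rewrite /q /= !ord3_pair.
  apply: (ae_imp2 (ae_imp2 v3 v_div (fun x h1 h2 => conj h1 h2)) (ae_neq0 R)) => x [h1 h2] x0.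
  have X0 : \sum_(a < 3) conjc (v a x) * ell a x = 0.
    (* The momentum relation moves x_b from l_a to l_b and puts x_a on conj v_a, where the
       divergence condition sums it to zero. As x <> 0, some x_b can be cancelled. *)
    have hb b : (coord3 b x)%:C * \sum_(a < 3) conjc (v a x) * ell a x = 0.
      rewrite mulr_sumr.
      have e a : (coord3 b x)%:C * (conjc (v a x) * ell a x) = conjc ((coord3 a x)%:C * v a x) * ell b x.
        by rewrite mulrCA h1 conjcM conjc_realE mulrA [conjc _ * _]mulrC.
      by under eq_bigr do rewrite e; rewrite -mulr_suml -(rmorph_sum (@conjc R)) h2 rmorph0 mul0r.
    apply/eqP; apply: contraTT (x0) => X0; rewrite negbK; apply/eqP.
    have cz b : coord3 b x = 0.
      have /eqP := hb b; rewrite mulf_eq0 (negbTE X0) orbF => /eqP h.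
      by apply: (@complexI R); rewrite h rmorph0.
    apply: enorm_eq0; rewrite /enorm /dot; under eq_bigr do rewrite cz mul0r.
    by rewrite big1 // sqrtr0.
  have e a : conjc (v a x) * ell a x = (enorm x `^ (5 / 3) * cabs (v a x) ^+ 2)%:C +
      (0 +i* cF R) * \sum_(j < 3) conv (v a) (v j) x * Cij a j x.
    rewrite /ell mulrDr realcM -mulJ_cabs; congr (_ + _).
      by move: (v a x) (conjc _) (_%:C) => r s t; ring.
    rewrite mulrCA mulr_sumr; congr (_ * _); apply: eq_bigr => j _.
    by rewrite /Cij; move: (conjc _) (_%:C) (conv _ _ _) => r s t; ring.
  move: X0; under eq_bigr do rewrite e; rewrite big_split /= -mulr_sumr -/(N x).
  rewrite -(rmorph_sum (real_complex R)) -/(S x) => /eqP.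
  by rewrite addr_eq0 => /eqP ->; rewrite mulNr.
have SE : (\int[m]_x S x)%:C = - (0 +i* cF R) * ci (sfprod m m) Phi.
  rewrite -NE -(ciZ _ Ni) -ci_real; apply: ci_ae => //.
  - exact: cigr_meas (cigr_real Si).
  - exact: cigr_meas (cigrZ _ Ni).
have Sz : \int[m]_x S x = 0.
  by have := congr1 (@complex.Re R) SE; rewrite ReM ReN ImN T0 mulr0 subr0 oppr0 mul0r.
apply: (ae_imp2 (Rint_eq0 Si S0 Sz) (ae_neq0 R)) => x Sx /enorm_gt0 x0.
have t0 a : 0 <= enorm x `^ (5 / 3) * cabs (v a x) ^+ 2 by rewrite mulr_ge0 ?powR_ge0 ?sqr_ge0.
move/eqP: Sx; rewrite /S psumr_eq0 // => /allP /(_ i (mem_index_enum i)) /=.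
rewrite mulf_eq0 powR_eq0 (gt_eqF x0) /= expf_eq0 /= => /eqP; exact: cabs_eq0.
Qed.

End Energy.

(** * The momentum equation *)

Section MeasurableSums.
Context d (T : measurableType d) (R : realType) (I : Type) (s : seq I).

Lemma cmeas_sum (F : I -> T -> R[i]) : (forall i, cmeas (F i)) ->
  cmeas (fun x => \sum_(i <- s) F i x).
Proof.
move=> mF; elim: s => [|a r IH].
  rewrite (_ : (fun x => _) = fun=> 0); first exact: cmeas_cst.
  by apply/funext => x; rewrite big_nil.
rewrite (_ : (fun x => _) = fun x => F a x + \sum_(i <- r) F i x); first exact: cmeasD.
by apply/funext => x; rewrite big_cons.
Qed.

End MeasurableSums.

Section WeakSolution.
Variable R : realType.
Notation m := (leb3s R).
Implicit Types (x y z xi : R3 R) (h psi : R3 R -> R).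

Lemma tame_of_schwartz (f : R3meas R -> R[i]) : cmeas f ->
  (forall g, schwartz g -> cigr m (fun x => f x * g x)) -> tame f.
Proof.
move=> mf H; split=> // c c0; have := cigr_cabs (H _ (schwartz_mgauss 0 c0)).
apply: igr_ext => x; rewrite /mgauss dotE /= !mul0r !addr0 /cexpi cos0 sin0 mul1r cabsM.
by rewrite cabs_real ger0_norm // gauss3_ge0.
Qed.

Lemma cmeas_fun_of (T : distr R) : cmeas (fun_of T : R3meas R -> R[i]).
Proof.
rewrite /fun_of; case: pselect => [H|_]; last exact: cmeas_cst.
by have [] := projT2 (cid H).
Qed.

Lemma ift_bound h : tf h -> exists K : R, forall x, cabs (ift h x) <= K * wt x.
Proof.
move=> th; have [K K0 hK] := ift_decay 1 th; exists K => x.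
rewrite -(ler_pM2l (wt_den_gt0 x)) [leRHS]mulrCA wtK mulr1.
by have := hK x; rewrite expr1.
Qed.

(** Minus the imaginary unit: a derivative moved onto the character exp (i x . xi) comes out as - i
    xi_j. *)
Definition mI : R[i] := 0 +i* (-1).

Lemma mIE (c : R) : (0 +i* (- c)) = mI * c%:C.
Proof. by apply: complex_ext; rewrite ?ReM ?ImM /=; ring. Qed.

Lemma mI_neq0 : mI != 0.
Proof.
by apply/negP => /eqP /(congr1 (@complex.Im R)) /= /eqP; rewrite oppr_eq0 oner_eq0.
Qed.

Lemma ift_partialE h j xi : tf h -> ift (partial j h) xi = mI * (coord3 j xi)%:C * ift h xi.
Proof. by move=> th; rewrite ift_partial // mIE. Qed.

Lemma sum_delta (a : 'I_3) (F : 'I_3 -> R[i]) : \sum_(i < 3) (i == a)%:R%:C * F i = F a.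
Proof.
rewrite (bigD1 a) //= eqxx mul1r big1 ?addr0 // => i /negbTE ->.
by rewrite mul0r.
Qed.

Lemma sum_deltaR (a : 'I_3) (F : 'I_3 -> R) : \sum_(i < 3) (i == a)%:R * F i = F a.
Proof.
rewrite (bigD1 a) //= eqxx mul1r big1 ?addr0 // => i /negbTE ->.
by rewrite mul0r.
Qed.

Lemma sum_curl (a b : 'I_3) (F G : 'I_3 -> R) :
  \sum_(i < 3) ((i == a)%:R * F i + - (i == b)%:R * G i) = F a - G b.
Proof. by under eq_bigr do rewrite mulNr; rewrite sumrB !sum_deltaR. Qed.

Variable u : 'I_3 -> R3 R -> R.
Hypothesis ws : weak_solution (5 / 6) u.
Hypothesis fe : finite_energy (5 / 6) u.

Let v i : R3meas R -> R[i] := hat (cmp_distr u i).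

(** Tested on a modulated Gaussian, the definition of the distributional transform is already the
    mollification identity of [ftpair]. *)
Lemma ftpair_u i : ftpair (u i) (v i).
Proof.
have [V _ _] := ws; have [[mu Hu] [_ iF Hn]] := V i.
have [mv Hv] := fun_of_represents iF.
split.
- by apply: tame_of_schwartz => // g sg; have [] := Hu _ sg.
- by apply: tame_of_schwartz => // g sg; have [] := Hv _ sg.
- split; first exact: mv.
  apply/igr_ge0P.
  + apply: measurable_funM; first exact: measurable_enorm_powR.
    by apply: measurable_sqr; exact: cmeas_cabs.
  + by move=> x; rewrite mulr_ge0 ?powR_ge0 ?sqr_ge0.
  (* The norm is a square root of the energy integral, so its finiteness gives that of the
     integral. *)
  have r0 : 1 / 2 != 0 :> R by rewrite gt_eqF // divr_gt0.
  by have := lty_poweRy r0 Hn; rewrite (_ : 2 * (5 / 6) = 5 / 3 :> R) //; field.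
move=> e y /andP[e0 _]; have c0 : 0 < e ^+ 2 / 2 by rewrite divr_gt0 // exprn_gt0.
have [_ E] := Hv _ (schwartz_mgauss y c0).
transitivity (ci m (fun x => (u i x)%:C * fourier (mgauss (e ^+ 2 / 2) y) x)); last exact: E.
by apply: ci_ext => x; rewrite (fourier_mgauss _ _ e0).
Qed.

Let tu i : tame (fun x => (u i x)%:C). Proof. by have [] := ftpair_u i. Qed.
Let Hv i : Hs (v i). Proof. by have [] := ftpair_u i. Qed.

Lemma u_pairing i h : tf h -> cigr m (fun xi => v i xi * ift h xi) /\
  ci m (fun x => (u i x)%:C * (h x)%:C) = ci m (fun xi => v i xi * ift h xi).
Proof.
move=> th; have [t1 t2 _ H] := ftpair_u i; have [K hK] := ift_bound th.
have I := Hs_cigr (Hv i) (cmeas_ift th) hK.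
by split; [exact: I|exact: gauss_pairing].
Qed.

Lemma cigr_v_poly i h (X : R3meas R -> R[i]) : tf h -> cmeas X ->
  (forall x, cabs (X x) <= (1 + dot x x) ^+ 2) -> cigr m (fun x => v i x * (X x * ift h x)).
Proof.
move=> th mX hX; have [K hK] := ift_poly_bound th hX.
by apply: (Hs_cigr (Hv i) _ hK); apply: cmeasM => //; exact: cmeas_ift.
Qed.

(** Paired with [ift h], the sum of the xi_j v_j becomes, up to - i, the integral of u against the
    gradient of h; uniqueness on the Fourier side concludes. *)
Lemma v_divergence : {ae m, forall x, \sum_(j < 3) (coord3 j x)%:C * v j x = 0}.
Proof.
have [_ D _] := ws; apply: ift_tests_eq0.
  apply: cmeas_sum => j.
  by apply: cmeasM; [exact: cmeas_coord3|exact: (Hv j).1].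
move=> h th; have I j := cigr_v_poly j th (cmeas_coord3 R j) (coord_poly j).
have E x : \sum_(j < 3) v j x * ((coord3 j x)%:C * ift h x) =
    (\sum_(j < 3) (coord3 j x)%:C * v j x) * ift h x.
  by rewrite mulr_suml; apply: eq_bigr => j _; rewrite mulrCA mulrA.
split; first by apply: (cigr_ext _ (cigr_sum _ I)) => x; exact: E.
rewrite -(ci_ext m E) ci_sum //; apply: (mulfI mI_neq0); rewrite mulr0 mulr_sumr.
have p j := u_pairing j (tf_partial j th).
have Ej j : mI * ci m (fun x => v j x * ((coord3 j x)%:C * ift h x)) =
    ci m (fun x => (u j x)%:C * (partial j h x)%:C).
  rewrite (p j).2 -(ciZ _ (I j)); apply: ci_ext => x; rewrite ift_partialE //.
  by move: (v j x) (ift h x) (_%:C) => r s t; ring.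
under eq_bigr do rewrite Ej.
have J j : cigr m (fun x => (u j x)%:C * (partial j h x)%:C).
  by apply: tame_cigr_tf => //; exact: tf_partial.
rewrite -ci_sum //; have D0 := D h (tf_test_function th).
transitivity ((\int[m]_x (\sum_(j < 3) u j x * partial j h x))%:C : R[i]); last first.
  by apply: (etrans _ (rmorph0 (real_complex R))); congr (_%:C); exact: D0.
rewrite -ci_real; apply: ci_ext => x; rewrite (rmorph_sum (real_complex R)).
by apply: eq_bigr => j _; rewrite -realcM.
Qed.

(** Pairings of u with real tests are real, so conjugating and reflecting v leaves every pairing
    with [ift h] unchanged, and uniqueness applies. *)
Lemma v_hermitian i : {ae m, forall x, v i (opp3 x) = conjc (v i x)}.
Proof.
have [mv _] := Hv i; have mo := cmeas_opp mv.
have mk : cmeas (fun x => v i (opp3 x) - conjc (v i x)) by apply: cmeasB => //; exact: cmeas_conj.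
suff : {ae m, forall x, v i (opp3 x) - conjc (v i x) = 0}.
  by move=> /ae_imp; apply => x /eqP; rewrite subr_eq0 => /eqP.
have sc := scales_reflect (0 : R3 R).
have H0 h : tf h -> cigr m (fun x => conjc (v i (opp3 x)) * ift h x) /\
    ci m (fun x => conjc (v i (opp3 x)) * ift h x) = ci m (fun x => v i x * ift h x).
  move=> th; have [I E] := u_pairing i th.
  have Ic := cigr_conj I; have Io := (scales_cigr sc ltr01 (cigr_meas Ic)).1 Ic.
  have e x : conjc (v i (opp3 x) * ift h (opp3 x)) = conjc (v i (opp3 x)) * ift h x.
    by rewrite conjcM ift_opp.
  split; first by apply: (cigr_ext _ Io) => x; exact: e.
  have e2 := scales_ci sc ltr01 Ic; rewrite mul1r in e2.
  apply: (etrans (esym (ci_ext m e))); apply: (etrans e2).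
  have Er : ci m (fun x => (u i x)%:C * (h x)%:C) = (\int[m]_x (u i x * h x))%:C.
    by rewrite -ci_real; apply: ci_ext => x; rewrite realcM.
  by rewrite (ci_conj I) -E Er; exact: conjc_realE.
have mk2 : cmeas (fun x => v i x - conjc (v i (opp3 x))) by apply: cmeasB => //; exact: cmeas_conj.
have ae0 : {ae m, forall x, v i x - conjc (v i (opp3 x)) = 0}.
  apply: ift_tests_eq0 => // h th; have [I1 E1] := H0 h th; have [I2 E2] := u_pairing i th.
  have e x : v i x * ift h x - conjc (v i (opp3 x)) * ift h x =
      (v i x - conjc (v i (opp3 x))) * ift h x by rewrite mulrBl.
  split; first by apply: (cigr_ext _ (cigrB I2 I1)) => x; exact: e.
  by apply: (etrans (esym (ci_ext m e))); rewrite (ciB I2 I1) E1 -E2 subrr.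
apply: (ae_imp ae0) => x /eqP; rewrite subr_eq0 => /eqP ->.
by rewrite conjcK subrr.
Qed.

Let p : R := 2 * (5 / 6 / 2).

Let p02 : 0 <= p <= 2. Proof. by rewrite /p; apply/andP; split; lra. Qed.

Let powpp (t : R) : t `^ p * t `^ p = t `^ (5 / 3).
Proof.
rewrite -powRD; first by congr (_ `^ _); rewrite /p; field.
by apply/implyP => /eqP; rewrite /p; lra.
Qed.

Let U i : R3meas R -> R[i] := fun_of (fracLap (5 / 6 / 2) (cmp_distr u i)).

(** Each half of the Laplacian has symbol |xi|^p with p = 5/6. The Parseval identity for a = |xi|^p
    v and the second symbol on h give |xi|^(5/3). *)
Lemma dissipation_pairing i h : tf h ->
  cigr m (fun x => U i x * fun_of (fracLap (5 / 6 / 2) (distr_of (of_real h))) x) /\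
  ci m (fun x => U i x * fun_of (fracLap (5 / 6 / 2) (distr_of (of_real h))) x) =
  ci m (fun x => v i x * ((enorm x `^ (5 / 3))%:C * ift h x)).
Proof.
move=> th; have [isf fin] := fe; have [mU HU] := fun_of_represents (isf i).
have [mv iv] := Hv i; pose a xi : R[i] := (enorm xi `^ p)%:C * v i xi.
have ma : cmeas a by apply: cmeasM => //; apply: cmeas_real; exact: measurable_enorm_powR.
have ia : igr m (fun x => cabs (a x) ^+ 2).
  apply: (igr_ext _ iv) => x; rewrite /a cabsM cabs_real ger0_norm ?powR_ge0 //.
  by rewrite exprMn (expr2 (enorm x `^ p)) powpp.
have mUs j : measurable_fun setT (fun x : R3meas R => cabs (U j x) ^+ 2).
  by apply: measurable_sqr; apply: cmeas_cabs; exact: cmeas_fun_of.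
have iU : igr m (fun x => cabs (U i x) ^+ 2).
  have iS : igr m (fun x => \sum_(j < 3) cabs (U j x) ^+ 2).
    apply/igr_ge0P.
    - by apply: measurable_sum => j; exact: mUs.
    - by move=> x; apply: sumr_ge0 => j _; exact: sqr_ge0.
    - exact: fin.
  apply: (igr_le (mUs i) _ iS) => x; rewrite ger0_norm ?sqr_ge0 //.
  by rewrite (bigD1 i) //= lerDl; apply: sumr_ge0 => j _; exact: sqr_ge0.
have Ua g : schwartz g -> cigr m (fun x => U i x * g x) /\
    ci m (fun x => U i x * g x) = ci m (fun xi => a xi * inv_fourier g xi).
  by move=> sg; have [I E] := HU g sg; split; [exact: I|exact: (esym E)].
have I := cigr_UW mU iU p02 th.
have E := parseval_UW mU iU ma ia Ua p02 th.
have s02 : (0 : R) <= 2 * (5 / 6 / 2) <= 2 := p02.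
have mW := cmeas_fun_of (fracLap (5 / 6 / 2) (distr_of (of_real h))).
have ae : {ae m, forall x, U i x * inv_fourier (wft p h) x =
    U i x * fun_of (fracLap (5 / 6 / 2) (distr_of (of_real h))) x}.
  by apply: (ae_imp (fracLap_tf s02 th)) => x ->.
have mUW := cmeasM mU mW.
split; first by refine (@cigr_ae _ _ R m _ _ mUW _ I); exact: ae.
transitivity (ci m (fun x => U i x * inv_fourier (wft p h) x)).
  by apply/esym; apply: ci_ae; [exact: (cigr_meas I)|exact: mUW|exact: ae].
apply: (etrans E); apply: ci_ext => x.
by rewrite /a -powpp realcM; move: (v i x) (ift h x) (_%:C) => r s t; ring.
Qed.

(** Linearity is stated through a f + g; with a = 1 and f = g = 0 it reads P 0 = P 0 + P 0. *)
Lemma tempered_0 (P : distr R) : tempered P -> P (of_real (fun=> 0)) = 0.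
Proof.
move=> [lin _]; have s0 := tf_schwartz (@tf0 R).
have := lin 1 _ _ s0 s0; have -> : (fun x => 1 * of_real (fun=> 0) x + of_real (fun=> 0) x) = of_real (fun=> 0 : R).
  by apply/funext => x; rewrite /of_real mul1r rmorph0 addr0.
rewrite mul1r => /eqP; rewrite -subr_eq0 opprD addrA subrr sub0r oppr_eq0 => /eqP.
exact.
Qed.

Section Curl.
Variables (a b : 'I_3) (psi : R3 R -> R).
Hypothesis tpsi : tf psi.

(** Kronecker deltas treat all index pairs at once, including a = b, where the field is zero. *)
Definition curl_field (i : 'I_3) : R3 R -> R := fun x =>
  (i == a)%:R * partial b psi x + (- (i == b)%:R) * partial a psi x.

Lemma tf_curl i : tf (curl_field i).
Proof. by apply: tfD; apply: tf_scale; exact: tf_partial. Qed.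

Lemma tf_partialZD (c d : R) f g i : tf f -> tf g ->
  partial i (fun x => c * f x + d * g x) = fun x => c * partial i f x + d * partial i g x.
Proof.
move=> [rf _] [rg _]; have rc (k : R) := ralg_cst (@bump_base R) k.
rewrite (ralg_partialD (@bump_baseP R)) //; [|exact: ralg_mul|exact: ralg_mul].
rewrite (ralg_partialM (@bump_baseP R) i (rc c) rf) (ralg_partialM (@bump_baseP R) i (rc d) rg).
by rewrite !partial_cst; apply/funext => x; rewrite !mulr0 !addr0.
Qed.

Lemma divergence_curl : divergence curl_field = fun=> 0.
Proof.
have ta := tf_partial a tpsi; have tb := tf_partial b tpsi.
apply/funext => x; rewrite /divergence.
transitivity (\sum_(i < 3) ((i == a)%:R * partial i (partial b psi) x +
    - (i == b)%:R * partial i (partial a psi) x)).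
  by apply: eq_bigr => i _; rewrite /curl_field tf_partialZD.
apply: (etrans (sum_curl a b (fun i => partial i (partial b psi) x) (fun i => partial i (partial a psi) x))).
by rewrite (tf_partialC a b tpsi) subrr.
Qed.

Lemma ift_curl i x : ift (curl_field i) x =
  mI * ((i == a)%:R%:C * (coord3 b x)%:C - (i == b)%:R%:C * (coord3 a x)%:C) * ift psi x.
Proof.
have ta := tf_partial a tpsi; have tb := tf_partial b tpsi.
rewrite iftD; [|exact: tf_scale|exact: tf_scale].
rewrite !ift_scale // !ift_partialE // (_ : (- (i == b)%:R)%:C = - (i == b)%:R%:C); last by rewrite rmorphN.
by move: (_%:R%:C) (_%:R%:C) (ift psi x) => r s t; ring.
Qed.

Let C i j x : R[i] := ift (partial j (curl_field i)) x.

Let convC i j : cigr m (fun x => conv (v i) (v j) x * C i j x) /\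
  (\int[m]_x (u i x * u j x * partial j (curl_field i) x))%:C =
  (cF R)%:C * ci m (fun x => conv (v i) (v j) x * C i j x).
Proof.
have tc := tf_partial j (tf_curl i); have mC := cmeas_ift tc.
have [K hK] := ift_bound tc.
have [I E] := conv_pairing (Hv i) (Hv j) mC (igr_sing_bound mC hK).
have [_ _ F] := product_formula (ftpair_u i) (ftpair_u j) tc.
by split; [exact: I|rewrite F E].
Qed.

Let dis i := dissipation_pairing i (tf_curl i).

Let mpow : cmeas (fun x : R3meas R => (enorm x `^ (5 / 3))%:C : R[i]).
Proof. by apply: cmeas_real; exact: measurable_enorm_powR. Qed.

Let pow_poly x : cabs ((enorm x `^ (5 / 3))%:C : R[i]) <= (1 + dot x x) ^+ 2.
Proof.
rewrite cabs_real ger0_norm ?powR_ge0 //; apply: le_trans (dot_wt_le2 x).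
by apply: powR_le_wt; apply/andP; split; lra.
Qed.

(** The pressure sees a zero divergence, and both other terms are moved to the frequency side. There
    d_j becomes - i xi_j, and bringing the convection to the left turns this into the + i of
    [ell]. *)
Lemma ell_curl : cigr m (fun x => \sum_(i < 3) ell v i x * ift (curl_field i) x) /\
  ci m (fun x => \sum_(i < 3) ell v i x * ift (curl_field i) x) = 0.
Proof.
have I1 i := cigr_v_poly i (tf_curl i) mpow pow_poly.
have I2 i j := (convC i j).1.
have E i x : v i x * ((enorm x `^ (5 / 3))%:C * ift (curl_field i) x) +
    \sum_(j < 3) (- (cF R)%:C) * (conv (v i) (v j) x * C i j x) = ell v i x * ift (curl_field i) x.
  have e0 : (0 +i* cF R) = - (cF R)%:C * mI.
    by apply: complex_ext; rewrite ?ReM ?ImM ?ReN ?ImN /=; ring.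
  have e1 : (enorm x `^ (5 / 3))%:C * v i x * ift (curl_field i) x =
      v i x * ((enorm x `^ (5 / 3))%:C * ift (curl_field i) x) by rewrite mulrAC mulrC.
  have e2 : (0 +i* cF R) * (\sum_(j < 3) (coord3 j x)%:C * conv (v i) (v j) x) * ift (curl_field i) x =
      \sum_(j < 3) (- (cF R)%:C) * (conv (v i) (v j) x * C i j x).
    rewrite -mulrA mulr_suml mulr_sumr; apply: eq_bigr => j _.
    rewrite /C (ift_partialE _ _ (tf_curl i)) e0; move: (conv _ _ _) (ift _ _) => r s.
    by move: (coord3 j x)%:C (cF R)%:C mI => t w y; ring.
  by rewrite /ell [RHS]mulrDl e1 e2.
have I3 i : cigr m (fun x => \sum_(j < 3) (- (cF R)%:C) * (conv (v i) (v j) x * C i j x)).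
  by apply: cigr_sum => j; apply: cigrZ; exact: I2.
have I4 i : cigr m (fun x => ell v i x * ift (curl_field i) x).
  by apply: (cigr_ext _ (cigrD (I1 i) (I3 i))) => x; exact: E.
split; first exact: cigr_sum.
rewrite ci_sum //.
have E5 i : ci m (fun x => ell v i x * ift (curl_field i) x) =
   ci m (fun x => v i x * ((enorm x `^ (5 / 3))%:C * ift (curl_field i) x)) -
   \sum_(j < 3) (\int[m]_x (u i x * u j x * partial j (curl_field i) x))%:C.
  rewrite -(ci_ext m (E i)) ciD // ci_sum; last by move=> j; apply: cigrZ; exact: I2.
  congr (_ + _); rewrite -sumrN; apply: eq_bigr => j _.
  by rewrite (ciZ _ (I2 i j)) (convC i j).2 mulNr.
under eq_bigr do rewrite E5; rewrite sumrB; apply/eqP; rewrite subr_eq0; apply/eqP.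
have [_ _ [P tP wm]] := ws.
have := wm curl_field (fun i => tf_test_function (tf_curl i)).
rewrite divergence_curl (tempered_0 tP) addr0.
rewrite -[LHS]/(ci m (fun x => \sum_(i < 3) U i x * fun_of (fracLap (5 / 6 / 2) (distr_of (of_real (curl_field i)))) x)).
rewrite ci_sum; last by move=> i; exact: (dis i).1.
under eq_bigr do rewrite (dis _).2.
move=> ->.
have i5 i j : igr m (fun x => u i x * u j x * partial j (curl_field i) x).
  by have [] := product_formula (ftpair_u i) (ftpair_u j) (tf_partial j (tf_curl i)).
have i6 i j := cigr_real (i5 i j).
rewrite -[LHS]/((\int[m]_x (\sum_(i < 3) \sum_(j < 3) u i x * u j x * partial j (curl_field i) x))%:C) -ci_real.
transitivity (ci m (fun x => \sum_(i < 3) \sum_(j < 3) (u i x * u j x * partial j (curl_field i) x)%:C)).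
  apply: ci_ext => x; rewrite (rmorph_sum (real_complex R)); apply: eq_bigr => i _.
  by rewrite (rmorph_sum (real_complex R)).
rewrite ci_sum; last by move=> i; apply: cigr_sum => j; exact: i6.
apply: eq_bigr => i _; rewrite ci_sum; last by move=> j; exact: i6.
by apply: eq_bigr => j _; rewrite ci_real.
Qed.

End Curl.

Lemma cmeas_ell i : cmeas (ell v i).
Proof.
apply: cmeasD.
  by apply: cmeasM; [apply: cmeas_real; exact: measurable_enorm_powR|exact: (Hv i).1].
apply: cmeasM; first exact: cmeas_cst.
apply: cmeas_sum => j.
by apply: cmeasM; [exact: cmeas_coord3|exact: cmeas_conv (Hv i).1 (Hv j).1].
Qed.

Lemma v_momentum a b : {ae m, forall x,
  (coord3 b x)%:C * ell v a x = (coord3 a x)%:C * ell v b x}.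
Proof.
suff : {ae m, forall x, (coord3 b x)%:C * ell v a x - (coord3 a x)%:C * ell v b x = 0}.
  by move=> /ae_imp; apply => x /eqP; rewrite subr_eq0 => /eqP.
apply: ift_tests_eq0.
  by apply: cmeasB; apply: cmeasM; [exact: cmeas_coord3|exact: cmeas_ell|exact: cmeas_coord3|exact: cmeas_ell].
move=> psi tpsi; have [I I0] := ell_curl a b tpsi.
have E x : mI^-1 * (\sum_(i < 3) ell v i x * ift (curl_field a b psi i) x) =
    ((coord3 b x)%:C * ell v a x - (coord3 a x)%:C * ell v b x) * ift psi x.
  under eq_bigr do rewrite ift_curl //.
  have -> : \sum_(i < 3) ell v i x * (mI * ((i == a)%:R%:C * (coord3 b x)%:C -
      (i == b)%:R%:C * (coord3 a x)%:C) * ift psi x) =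
    \sum_(i < 3) (i == a)%:R%:C * (mI * ift psi x * (coord3 b x)%:C * ell v i x) -
    \sum_(i < 3) (i == b)%:R%:C * (mI * ift psi x * (coord3 a x)%:C * ell v i x).
    rewrite -sumrB; apply: eq_bigr => i _.
    move: (((i == a)%:R)%:C) (((i == b)%:R)%:C) (coord3 b x)%:C (coord3 a x)%:C => r s y z.
    by move: (ift psi x) (ell v i x) mI => t w k; ring.
  rewrite !sum_delta; have := mulVf mI_neq0; move: (ift psi x) (ell v a x) (ell v b x) => t ea eb.
  move: (coord3 b x)%:C (coord3 a x)%:C => c d k.
  rewrite (_ : mI^-1 * _ = (mI^-1 * mI) * ((c * ea - d * eb) * t)); first by rewrite k mul1r.
  by move: (mI^-1) mI => n l; ring.
split; first by apply: (cigr_ext _ (cigrZ mI^-1 I)) => x; exact: E.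
by apply: (etrans (esym (ci_ext m E))); rewrite (ciZ _ I) I0 mulr0.
Qed.

Lemma weak_solution_eq0 i : {ae m, forall x, u i x = 0}.
Proof.
have v0 := energy_zero Hv v_hermitian v_divergence v_momentum i.
have : {ae m, forall x, (u i x)%:C = 0 :> R[i]}.
  apply: (tame_ae_eq (tu i) (tame0 R)) => h th.
  have [I ->] := u_pairing i th.
  have E : {ae m, forall x, v i x * ift h x = 0} by apply: (ae_imp v0) => x ->; rewrite mul0r.
  have mz : cmeas (fun _ : R3meas R => 0 : R[i]) by exact: cmeas_cst.
  transitivity (ci m (fun _ : R3meas R => 0 : R[i])).
    by apply: ci_ae; [exact: cigr_meas I|exact: mz|exact: E].
  by apply: ci_ext => x; rewrite mul0r.
by move=> /ae_imp; apply => x /(congr1 (@complex.Re R)).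
Qed.

End WeakSolution.

Theorem corollary1p3 (R : realType) (u : 'I_3 -> R3 R -> R) :
  weak_solution (5 / 6) u ->
  finite_energy (5 / 6) u ->
  forall i : 'I_3, {ae @leb3 R, forall x, u i x = 0}.
Proof. by move=> ws fe i; exact: weak_solution_eq0. Qed.
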